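(* Let $v\in(-1,1)\setminus\{0\}$ and let $V:\mathbf{R}\to\mathbf{R}$ be a smooth function decaying exponentially fast at infinity. Let $s_0\in\mathbf{R}$ be a simple root of $$M'(s)=\int_{\mathbf{R}}V'(x)\,[1-|\phi_{0,v}|^2(x-s)]\,dx,\qquad s\in\mathbf{R},$$ namely $M'(s_0)=0$ and $M''(s_0)\neq 0$, where $\phi_{0,v}(x)=\sqrt{1-v^2}\tanh(\sqrt{1-v^2}\,x)+iv$. Then there exist $\varepsilon_0>0$ and a unique family $\phi_{\varepsilon,v}(x-s_\varepsilon)$ of gray modes, defined for $\varepsilon\in(-\varepsilon_0,\varepsilon_0)$, for which $$\lim_{\varepsilon\to0}\bigl(\|\phi_{\varepsilon,v}-\phi_{0,v}\|_{L^\infty(\mathbf{R})}+|s_\varepsilon-s_0|\bigr)=0,$$ and such that, for any fixed $x\in\mathbf{R}$, the map $\varepsilon\mapsto\phi_{\varepsilon,v}(x-s_\varepsilon)$ is smooth in $(-\varepsilon_0,\varepsilon_0)$.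
   Context: Consider the Gross-Pitaevskii equation with external potential, in the co-moving frame, $$i\partial_tu-\tfrac12\partial_x^2u+iv\partial_xu-(1-|u|^2)u+\varepsilon V(x)u=0,\qquad |u(x)|^2\to1\ \text{as}\ |x|\to\infty, \tag{GP-V}$$ where $\varepsilon\in\mathbf{R}$ is the strength of the potential. Time-independent solutions satisfy $-\frac12u''+ivu'-(1-|u|^2)u+\varepsilon V(x)u=0$. Definition (gray mode). Let $\varepsilon\in\mathbf{R}$, $v\ne0$. A gray mode is a time-independent solution $u:\mathbf{R}\to\mathbf{C}$ of (GP-V) which is nowhere vanishing. It can be written as $u(x)=\rho(x)e^{i\theta(x)}e^{i\phi}$, $\phi\in\mathbf{R}$, with $\rho:\mathbf{R}\to\mathbf{R}_+$ and $\theta:\mathbf{R}\to\mathbf{R}$ smooth functions converging exponentially fast to the limits $\lim_{|x|\to\infty}\rho(x)=1$ and $\lim_{x\to\pm\infty}\theta(x)=\theta_\pm$, where $\theta_\pm\in\mathbf{R}$ are parameters of the solution. The function $M'$ is the derivative of the effective potential $M(s)=\int_{\mathbf{R}}V(x)[1-|\phi_{0,v}|^2(x-s)]\,dx$. The gray mode with strength $\varepsilon$ in the family is the function $x\mapsto\phi_{\varepsilon,v}(x-s_\varepsilon)$, $s_\varepsilon\in\mathbf{R}$.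
   Formalization: Uniqueness is proved for the gray modes x ↦ φ_{ε,v}(x−s_ε) up to a constant phase factor for each ε; literal uniqueness fails, since multiplying the family by e^{iε} gives another family of gray modes with the same limit and smoothness. *)

(* Defs.v *)
From Stdlib Require Import Reals.
From Coquelicot Require Import Coquelicot.
Open Scope R_scope.

Definition smooth (f : R -> R) : Prop :=
  forall (n : nat) (x : R), ex_derive_n f n x.

(* Complex-valued functions of a real variable are smooth when their real and
   imaginary parts are. *)
Definition Csmooth_on (a b : R) (f : R -> C) : Prop :=
  forall (n : nat) (x : R), a < x < b ->
    ex_derive_n (fun y => fst (f y)) n x /\
    ex_derive_n (fun y => snd (f y)) n x.

Definition exp_decay (f : R -> R) : Prop :=
  exists K a : R, 0 < a /\ forall x : R, Rabs (f x) <= K * exp (- a * Rabs x).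

Definition exp_cvg_pinfty (f : R -> R) (l : R) : Prop :=
  exists K a : R, 0 < a /\
    forall x : R, 0 <= x -> Rabs (f x - l) <= K * exp (- a * x).

Definition exp_cvg_minfty (f : R -> R) (l : R) : Prop :=
  exp_cvg_pinfty (fun x => f (- x)) l.

(* e^{it} *)
Definition cis (t : R) : C := (cos t, sin t).

(* The supremum norm, with values in [0, +oo]; it is the L^oo norm on
   continuous functions, and gray modes are continuous. *)
Definition Linf_norm (f : R -> C) : Rbar :=
  Lub_Rbar (fun y => exists x : R, y = Cmod (f x)).

Definition soliton (v : R) (x : R) : C :=
  (sqrt (1 - v ^ 2) * tanh (sqrt (1 - v ^ 2) * x), v).

(* M'(s).  The integral over R is the improper Riemann integral: when only V
   itself is known to decay, V' times the (exponentially localized) second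
   factor need not be absolutely integrable, but the improper integral
   converges, as one integration by parts shows. *)
Definition dM (v : R) (V : R -> R) (s : R) : R :=
  RInt_gen (fun x => Derive V x * (1 - Cmod (soliton v (x - s)) ^ 2))
    (Rbar_locally m_infty) (Rbar_locally p_infty).

(* The derivatives of u : R -> C are taken in C as a real normed space. *)
Definition stationary_solution (eps v : R) (V : R -> R) (u : R -> C) : Prop :=
  (exists du ddu : R -> C,
     (forall x : R, is_derive (K := R_AbsRing) (V := C_R_NormedModule)
                      u x (du x)) /\
     (forall x : R, is_derive (K := R_AbsRing) (V := C_R_NormedModule)
                      du x (ddu x)) /\
     (forall x : R,
        (- (RtoC (1 / 2) * ddu x) + Ci * RtoC v * du x
         - RtoC (1 - Cmod (u x) ^ 2) * u x
         + RtoC (eps * V x) * u x)%C = RtoC 0)) /\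
  is_lim (fun x => Cmod (u x) ^ 2) p_infty 1 /\
  is_lim (fun x => Cmod (u x) ^ 2) m_infty 1.

Definition gray_mode (eps v : R) (V : R -> R) (u : R -> C) : Prop :=
  stationary_solution eps v V u /\
  (forall x : R, u x <> RtoC 0) /\
  exists (rho theta : R -> R) (theta_m theta_p phase : R),
    smooth rho /\ smooth theta /\
    (forall x : R, 0 < rho x) /\
    exp_cvg_minfty rho 1 /\ exp_cvg_pinfty rho 1 /\
    exp_cvg_minfty theta theta_m /\ exp_cvg_pinfty theta theta_p /\
    forall x : R, u x = (RtoC (rho x) * cis (theta x) * cis phase)%C.

(* The members of the family are the functions x |-> phi eps (x - s eps) for
   eps in (-eps0, eps0); the values of phi and s at other eps are irrelevant.
   The limit is that of a [0, +oo]-valued function of eps, written out. *)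
Definition gray_family (v : R) (V : R -> R) (s0 eps0 : R)
    (phi : R -> R -> C) (s : R -> R) : Prop :=
  (forall eps : R, - eps0 < eps < eps0 ->
     gray_mode eps v V (fun x => phi eps (x - s eps))) /\
  (forall eta : R, 0 < eta ->
     locally' (T := R_UniformSpace) 0 (fun eps =>
       Rbar_lt
         (Rbar_plus (Linf_norm (fun x => (phi eps x - soliton v x)%C))
                    (Finite (Rabs (s eps - s0))))
         (Finite eta))) /\
  (forall x : R,
     Csmooth_on (- eps0) eps0 (fun eps => phi eps (x - s eps))).

(* Equality of gray modes up to a constant phase, under which the equation is
   invariant. *)
Definition same_up_to_phase (u w : R -> C) : Prop :=
  exists alpha : R, forall x : R, w x = (cis alpha * u x)%C.

(* Main.v *)
(* Write a gray mode as u = r e^(i t).  The phase is determined up to a constant by the amplitude,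
   t' = v (1 - 1 / r^2), and r is a positive solution of r'' = famp r + 2 eps V r that tends to 1 at
   both ends, where famp r0 = r0'' for the amplitude r0 of the soliton.

   Existence.  Put r = sum_n eps^n a_n.  Each a_n solves the linearization at r0, which can be
   inverted on exponentially localized functions whose integral against the translation mode r0'
   vanishes.  The multiple of r0' that is free in a_n is chosen so that this condition holds at the
   next order; its coefficient there is M''(s0) <> 0.  Majorants B^n / (n + 1)^2 make the series
   converge, so the mode is analytic in eps.

   Uniqueness.  Close to r0 the same nondegeneracy gives uniqueness for each eps <> 0.  A competing
   family is only known to be close to the soliton as eps tends to 0, so one has to exclude that its
   amplitude acquires a second dip (a critical point at a low level).  By energy estimates every dip
   looks like a soliton.  At a dip at X the amplitude exceeds the solution that has the same critical
   point and converges to 1 at one of the ends by an amount comparable to e^(-2 k d), where d is the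
   distance to the next dip on that side, and by 0 if there is none.  Dips move continuously with
   eps, so a new one must come in from infinity; by Baire's theorem, if this happens at all, then
   there is an eps near which every large X is the position of a dip.  This makes the difference of
   the two one-sided reference values at X at most O(e^(-2 k X)) near this eps.  Up to that order the
   difference is a polynomial in eps whose coefficients depend on X, so if there are such eps
   arbitrarily close to 0, interpolation gives the bound O(|eps| e^(-2 k X)) for all small eps.  But
   then a second dip needs a third one further out that it feels as much as the first, and so on,
   although the dips of one amplitude are bounded. *)

Require Import Defs.
From Stdlib Require Import Reals Lra Lia Psatz Classical ClassicalEpsilon Arith FunctionalExtensionality.
From Coquelicot Require Import Coquelicot.
Open Scope R_scope.

(** * Elementary estimates *)

(** The solvability condition is not imposed literally. Each source is projected orthogonally to
    [zs], and the free multiple of [zs] is fixed by requiring that [V (r^2)'] integrates to 0 at the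
    same order, a condition linear in it with coefficient [Mdd]. The sum then solves the equation up
    to a term [L rho0'], and integrating the energy identity over the line gives [L intR (rho0' r')
    = eps intR (V (r^2)') = 0], so [L = 0]. The obstacle to uniqueness is that a family is
    continuous in [eps] only at each fixed [x], so near a given nonzero [eps] nothing is controlled
    far away. Moreover [V] decays at some rate [a] that may be far below [2 k], so a priori the
    difference of the one-sided references at [X] is much larger than the interaction [e^(-2 k X)]
    of a dip at [X] with one near the origin. Its coefficient of order [n] is [O(e^(-n a X))] until
    [n a] passes [2 k], which is why only finitely many coefficients count. *)

Lemma exp_le (x y : R) : x <= y -> exp x <= exp y.
Proof. intros [H| ->]; [left; now apply exp_increasing|lra]. Qed.

Lemma exp_ge0_1 (t : R) : t <= 0 -> exp t <= 1.
Proof. rewrite <- exp_0. apply exp_le. Qed.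

Lemma Rabs_mult_le (a b A B : R) : Rabs a <= A -> Rabs b <= B -> Rabs (a * b) <= A * B.
Proof. intros. rewrite Rabs_mult. apply Rmult_le_compat; auto using Rabs_pos. Qed.

Lemma Rabs_add_le (a b A B : R) : Rabs a <= A -> Rabs b <= B -> Rabs (a + b) <= A + B.
Proof. intros. eapply Rle_trans; [apply Rabs_triang|now apply Rplus_le_compat]. Qed.

Lemma Rabs_sub_le (a b A B : R) : Rabs a <= A -> Rabs b <= B -> Rabs (a - b) <= A + B.
Proof. intros. apply Rabs_add_le; [|rewrite Rabs_Ropp]; easy. Qed.

Lemma le_div (a b x : R) : 0 < b -> x <= a / b -> x * b <= a.
Proof.
  intros Hb H. apply (Rmult_le_compat_r b) in H; [|lra]. unfold Rdiv in H.
  rewrite Rmult_assoc, Rinv_l in H; lra.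
Qed.

Lemma le_inv (b x : R) : 0 < b -> x <= / b -> x * b <= 1.
Proof. intros Hb H. apply le_div; [easy|]. unfold Rdiv. lra. Qed.

Lemma Rle_le_0_compat_div (a b : R) : 0 <= a -> 0 < b -> 0 <= a / b.
Proof. intros. apply Rmult_le_pos; [easy|]. left. now apply Rinv_0_lt_compat. Qed.

Create HintDb pos discriminated.

Ltac pos :=
  match goal with
  | |- _ => lra
  | |- 0 < _ * _ => apply Rmult_lt_0_compat; pos
  | |- 0 < _ / _ => apply Rdiv_lt_0_compat; pos
  | |- 0 < / _ => apply Rinv_0_lt_compat; pos
  | |- 0 < exp _ => apply exp_pos
  | |- 0 < _ ^ _ => apply pow_lt; pos
  | |- 0 < PI => apply PI_RGT_0
  | |- 0 < Rmin _ _ => apply Rmin_glb_lt; pos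
  | |- 0 < Rabs _ => apply Rabs_pos_lt; pos
  | |- 0 < _ + _ => apply Rplus_lt_0_compat; pos
  | |- 0 < _ + _ => apply Rplus_le_lt_0_compat; pos
  | |- 0 < _ + _ => apply Rplus_lt_le_0_compat; pos
  | |- 0 <= Rabs _ => apply Rabs_pos
  | |- 0 <= INR _ => apply pos_INR
  | |- 0 <= exp _ => left; apply exp_pos
  | |- 0 <= _ * _ => apply Rmult_le_pos; pos
  | |- 0 <= _ / _ => apply Rle_le_0_compat_div; pos
  | |- 0 <= _ ^ 2 => apply pow2_ge_0
  | |- 0 <= _ ^ _ => apply pow_le; pos
  | |- 0 <= _ + _ => apply Rplus_le_le_0_compat; pos
  | |- 0 <= _ => left; pos
  | |- _ >= 0 => apply Rle_ge; pos
  | |- _ <> 0 => apply Rgt_not_eq; pos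
  | |- _ /\ _ => split; pos
  | |- _ => solve [auto with pos]
  end.

Ltac mono :=
  match goal with
  | |- _ => lra
  | |- _ => assumption
  | |- 0 <= _ => pos
  | |- 0 < _ => pos
  | |- ?x * _ <= ?x * _ => apply Rmult_le_compat_l; [pos|mono]
  | |- _ * ?x <= _ * ?x => apply Rmult_le_compat_r; [pos|mono]
  | |- Rabs (_ * _) <= _ * _ => apply Rabs_mult_le; mono
  | |- Rabs (_ + _) <= _ + _ => apply Rabs_add_le; mono
  | |- Rabs (_ - _) <= _ + _ => apply Rabs_sub_le; mono
  | |- Rabs (- _) <= _ => rewrite Rabs_Ropp; mono
  | |- Rabs _ <= _ => apply Rabs_le; mono
  | |- Rabs _ <= _ => rewrite Rabs_right by pos; mono
  | |- _ * _ <= _ * _ => apply Rmult_le_compat; [pos|pos|mono|mono]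
  | |- _ + _ <= _ + _ => apply Rplus_le_compat; mono
  | |- exp _ <= exp _ => apply exp_le; mono
  | |- exp _ <= 1 => apply exp_ge0_1; mono
  | |- / _ <= / _ => apply Rinv_le_contravar; [pos|mono]
  | |- _ ^ _ <= _ ^ _ => apply pow_incr; split; [pos|mono]
  | |- - _ <= - _ => apply Ropp_le_contravar; mono
  | |- _ /\ _ => split; mono
  | |- _ => solve [auto with pos]
  | |- _ => solve [auto]
  end.

Ltac clear_divs := repeat match goal with
  | H : ?x <= ?a / ?b |- _ => apply le_div in H; [|pos]
  | H : ?x <= / ?b |- _ => apply le_inv in H; [|pos]
  end.

(* Replaces minima and maxima by fresh variables together with the inequalities they satisfy. *)
Ltac minmax := repeat match goal with
  | x := Rmin _ _ |- _ => subst x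
  | x := Rmax _ _ |- _ => subst x
  end; repeat match goal with
  | |- context [Rmin ?a ?b] => let H := fresh in
      try assert (H : 0 < Rmin a b) by pos;
      pose proof (Rmin_l a b); pose proof (Rmin_r a b); generalize dependent (Rmin a b); intros
  | _ : context [Rmin ?a ?b] |- _ => let H := fresh in
      try assert (H : 0 < Rmin a b) by pos;
      pose proof (Rmin_l a b); pose proof (Rmin_r a b); generalize dependent (Rmin a b); intros
  | |- context [Rmax ?a ?b] =>
      pose proof (Rmax_l a b); pose proof (Rmax_r a b); generalize dependent (Rmax a b); intros
  | _ : context [Rmax ?a ?b] |- _ =>
      pose proof (Rmax_l a b); pose proof (Rmax_r a b); generalize dependent (Rmax a b); intros
  end; clear_divs.

Ltac absolute :=
  match goal with
  | |- Rabs _ <= _ => apply Rabs_le; split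
  | |- Rabs _ < _ => apply Rabs_def1
  | |- _ => idtac
  end;
  repeat match goal with
  | |- context [Rabs ?a] =>
      pose proof (Rle_abs a); pose proof (Rabs_maj2 a); generalize dependent (Rabs a); intros
  | _ : context [Rabs ?a] |- _ =>
      pose proof (Rle_abs a); pose proof (Rabs_maj2 a); generalize dependent (Rabs a); intros
  end; lra.

Ltac bound := intros;
  repeat match goal with |- _ /\ _ => split | H : _ /\ _ |- _ => destruct H end;
  solve [minmax; first [mono | absolute | nra]].

Ltac splits := repeat (split; [solve [easy | pos | mono]|]).

Ltac triangle := eapply Rle_trans; [apply Rabs_triang|].

Lemma is_derive_shift (f : R -> R) (X y l : R) :
  is_derive f (X + y) l -> is_derive (fun y => f (X + y)) y l.
Proof.
  intros H. evar_last; [apply (is_derive_comp f (fun y => X + y)); [exact H|auto_derive; easy]|].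
  eauto with real.
Qed.

Lemma is_derive_Rmult (f g : R -> R) (x f' g' : R) : is_derive f x f' -> is_derive g x g' ->
  is_derive (fun y => f y * g y) x (f' * g x + f x * g').
Proof.
  intros. now apply (is_derive_mult f g x f' g' ltac:(assumption) ltac:(assumption) Rmult_comm).
Qed.

Create HintDb derive discriminated.
#[global] Hint Constants Opaque : derive.

Ltac derive_rec :=
  lazymatch goal with
  | |- is_derive (fun _ => ?c) _ _ => apply (is_derive_const c)
  | |- is_derive (fun x => x) _ _ => apply is_derive_id
  | |- is_derive (fun x => @?f x + @?g x) _ _ => apply (is_derive_plus f g); derive_rec
  | |- is_derive (fun x => @?f x - @?g x) _ _ => apply (is_derive_minus f g); derive_rec
  | |- is_derive (fun x => - @?f x) _ _ => apply (is_derive_opp f); derive_rec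
  | |- is_derive (fun x => @?f x * @?g x) _ _ => apply (is_derive_Rmult f g); derive_rec
  | |- is_derive (fun x => @?f x ^ ?n) _ _ => apply (is_derive_pow f n); derive_rec
  | |- is_derive (fun x => ?f (?X + x)) _ _ => apply (is_derive_shift f X); derive_rec
  | |- _ => first
      [ assumption
      | match goal with
        | H : context [is_derive ?f _ _] |- is_derive ?f _ _ => apply H; lra
        | H : context [is_derive ?f _ _] |- is_derive (fun x => ?f x) _ _ => apply H; lra
        end
      | solve [eauto 3 with derive]
      | match goal with H : _ |- _ => apply H; lra end ]
  end.

Ltac algebra := first [ring | lra | now field | field; pos].

(** The derivative is first built as an existential variable by following the syntax of the
    function, and only then compared with the stated value. *)
Ltac derive := intros; lazymatch goal with |- is_derive _ _ _ => idtac end;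
  evar_last; [solve [derive_rec]|unfold plus, minus, opp, scal, zero, one, mult; cbn -[pow]; algebra].

(** * Calculus on the line *)

(** Continuous induction: the supremum of the points up to which [P] holds throughout has the same
    property by the third hypothesis, and cannot lie below [b] by the second. *)
Lemma real_induction (P : R -> Prop) (a b : R) :
  P a ->
  (forall x, a <= x < b -> (forall y, a <= y <= x -> P y) ->
     exists d, 0 < d /\ forall y, x < y < x + d -> y <= b -> P y) ->
  (forall x, a < x <= b -> (forall y, a <= y < x -> P y) -> P x) ->
  forall x, a <= x <= b -> P x.
Proof.
  intros Pa Hopen Hclosed x0 Hx0. pose (S := fun x => a <= x <= b /\ forall y, a <= y <= x -> P y).
  assert (S a). { splits. intros y Hy. replace y with a by lra. exact Pa. }
  destruct (completeness S) as [s [Hub Hlub]]. { exists b. intros x [Hx _]. lra. } { eauto. }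
  assert (a <= s) by auto. assert (s <= b) by (apply Hlub; intros x [Hx _]; lra).
  assert (forall y, a <= y < s -> P y).
  { intros y Hy. apply NNPP. intros Hn. assert (s <= y); [|lra]. apply Hlub. intros x [Hx HP].
    destruct (Rle_dec x y) as [|Hxy]; [easy|]. exfalso. apply Hn, HP. lra. }
  assert (Hle : forall y, a <= y <= s -> P y).
  { intros y Hy. destruct (Rlt_dec y s); [bound|]. replace y with s by lra.
    destruct (Req_dec a s) as [<-|]; [exact Pa|]. apply Hclosed; [lra|easy]. }
  destruct (Rlt_dec s b) as [Hs|Hs]; [|apply Hle; lra].
  destruct (Hopen s) as [d [Hd HP]]; [lra|exact Hle|]. pose (z := Rmin b (s + d / 2)).
  assert (s < z /\ z <= b /\ z <= s + d / 2). { split; [apply Rmin_glb_lt; lra|]. bound. }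
  assert (z <= s); [|lra]. apply Hub. splits. intros y Hy. destruct (Rle_dec y s); [bound|].
  apply HP; lra.
Qed.

Lemma is_derive_continuity_pt (f : R -> R) (x l : R) :
  is_derive f x l -> continuity_pt f x.
Proof. intros H. apply derivable_continuous_pt. exists l. now apply is_derive_Reals. Qed.

Lemma is_derive_near (f : R -> R) (x l : R) :
  is_derive f x l -> forall e, 0 < e ->
  exists d, 0 < d /\ forall y, Rabs (y - x) < d -> Rabs (f y - f x) < e.
Proof.
  intros H e He. destruct (is_derive_continuity_pt f x l H e He) as [d [Hd Hc]]. exists d. splits.
  intros y Hy. destruct (Req_dec x y) as [<-|Hne]. { bound. } apply (Hc y). easy.
Qed.

Lemma Derive_eta {f : R -> R} {x l : R} :
  is_derive f x l -> Derive (fun y : R => f y) x = l.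
Proof. intros H. now apply is_derive_unique. Qed.

Lemma mvt (f f' : R -> R) (a b : R) :
  a <= b -> (forall x, a <= x <= b -> is_derive f x (f' x)) ->
  exists c, a <= c <= b /\ f b - f a = f' c * (b - a).
Proof.
  intros Hab H. destruct (MVT_gen f a b f') as [c [Hc Heq]].
  - intros x Hx. rewrite Rmin_left, Rmax_right in Hx by lra. derive.
  - intros x Hx. rewrite Rmin_left, Rmax_right in Hx by lra. eapply is_derive_continuity_pt, H, Hx.
  - exists c. rewrite Rmin_left, Rmax_right in Hc by lra. auto.
Qed.

Lemma derive_0_const (f : R -> R) (x : R) : (forall y, is_derive f y 0) -> f x = f 0.
Proof.
  intros H. destruct (Rle_dec 0 x) as [Hx|Hx].
  - destruct (mvt f (fun _ => 0) 0 x Hx) as [c [_ E]]; [auto|]. lra.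
  - destruct (mvt f (fun _ => 0) x 0) as [c [_ E]]; [lra|auto|]. lra.
Qed.

Lemma derive_ge0_le (f f' : R -> R) (a b : R) :
  a <= b -> (forall x, a <= x <= b -> is_derive f x (f' x)) ->
  (forall x, a <= x <= b -> 0 <= f' x) -> f a <= f b.
Proof. intros Hab H H0. destruct (mvt f f' a b Hab H) as [c [Hc E]]. specialize (H0 c Hc). nra. Qed.

Lemma derive_le0_ge (f f' : R -> R) (a b : R) :
  a <= b -> (forall x, a <= x <= b -> is_derive f x (f' x)) ->
  (forall x, a <= x <= b -> f' x <= 0) -> f b <= f a.
Proof. intros Hab H H0. destruct (mvt f f' a b Hab H) as [c [Hc E]]. specialize (H0 c Hc). nra. Qed.

Lemma derive_abs_le (f f' : R -> R) (a b M : R) :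
  a <= b -> (forall x, a <= x <= b -> is_derive f x (f' x)) ->
  (forall x, a <= x <= b -> Rabs (f' x) <= M) -> Rabs (f b - f a) <= M * (b - a).
Proof. intros Hab H H0. destruct (mvt f f' a b Hab H) as [c [Hc ->]]. mono. Qed.

(** The product [y exp (- phi)] is nonincreasing. The rate is given through a primitive [phi], so
    that rates of which only the integral is controlled can be used later. *)
Lemma gronwall_le (y y' phi phi' : R -> R) (a b : R) :
  a <= b ->
  (forall x, a <= x <= b -> is_derive y x (y' x)) ->
  (forall x, a <= x <= b -> is_derive phi x (phi' x)) ->
  (forall x, a <= x <= b -> y' x <= phi' x * y x) ->
  y b <= y a * exp (phi b - phi a).
Proof.
  intros Hab Hy Hp H. assert (Hd : y b * exp (- phi b) <= y a * exp (- phi a)).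
  { apply (derive_le0_ge (fun x => y x * exp (- phi x)) (fun x => (y' x - phi' x * y x) * exp (- phi
      x))); [easy| |].
    - intros x Hx. specialize (Hy x Hx). specialize (Hp x Hx).
      auto_derive; [split; [now exists (y' x)|split; [now exists (phi' x)|easy]]|].
      rewrite (Derive_eta Hy), (Derive_eta Hp). ring.
    - intros x Hx. specialize (H x Hx). pose proof (exp_pos (- phi x)). nra. }
  replace (phi b - phi a) with (- phi a + phi b) by ring. rewrite exp_plus.
  apply (Rmult_le_compat_r (exp (phi b))) in Hd; [|pos].
  rewrite !Rmult_assoc, <- (exp_plus (- phi b)), Rplus_opp_l, exp_0 in Hd. lra.
Qed.

Lemma gronwall_ge (y y' phi phi' : R -> R) (a b : R) :
  a <= b ->
  (forall x, a <= x <= b -> is_derive y x (y' x)) ->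
  (forall x, a <= x <= b -> is_derive phi x (phi' x)) ->
  (forall x, a <= x <= b -> phi' x * y x <= y' x) ->
  y a * exp (phi b - phi a) <= y b.
Proof.
  intros Hab Hy Hp H.
  pose proof (gronwall_le (fun x => - y x) (fun x => - y' x) phi phi' a b Hab) as G.
  assert (- y b <= - y a * exp (phi b - phi a)); [|lra]. apply G; [|easy|].
  - derive.
  - intros x Hx. specialize (H x Hx). lra.
Qed.

(** The functions [e + (K / a) exp (- a x)] and [e - (K / a) exp (- a x)] are monotone in opposite
    directions and both vanish at infinity. *)
Lemma decay_of_derive (e e' : R -> R) (x0 K a : R) :
  0 < a -> (forall x, x0 <= x -> is_derive e x (e' x)) ->
  (forall x, x0 <= x -> Rabs (e' x) <= K * exp (- a * x)) ->
  is_lim e p_infty 0 ->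
  forall x, x0 <= x -> Rabs (e x) <= K / a * exp (- a * x).
Proof.
  intros Ha Hd Hb Hl x Hx. assert (0 <= K).
  { specialize (Hb x0 (Rle_refl _)). pose proof (Rabs_pos (e' x0)). pose proof (exp_pos (- a * x0)).
    nra. }
  assert (key : forall z d, x0 <= z -> 0 < d -> Rabs (e z) <= K / a * exp (- a * z) + d).
  { intros z d Hz Hdp. apply is_lim_spec in Hl. destruct (Hl (mkposreal d Hdp)) as [M HM].
    set (b := Rmax z (M + 1)). assert (z <= b) by bound. assert (Hb2 : M < b) by bound.
    specialize (HM b Hb2). cbn in HM. apply Rabs_def2 in HM.
    assert (forall x, is_derive (fun x => K / a * exp (- a * x)) x (- K * exp (- a * x))).
    { intros t. auto_derive; [easy|]. field. lra. }
    assert (0 <= K / a * exp (- a * b)) by pos.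
    assert (e b + K / a * exp (- a * b) <= e z + K / a * exp (- a * z)).
    { apply (derive_le0_ge (fun x => e x + K / a * exp (- a * x)) (fun x => e' x + - K * exp (- a *
        x))); [easy| |].
      - intros t Ht. apply (is_derive_plus e); [derive|easy].
      - intros t Ht. specialize (Hb t ltac:(lra)). bound. }
    assert (e z - K / a * exp (- a * z) <= e b - K / a * exp (- a * b)).
    { apply (derive_ge0_le (fun x => e x - K / a * exp (- a * x)) (fun x => e' x - - K * exp (- a *
        x))); [easy| |].
      - intros t Ht. apply (is_derive_minus e); [derive|easy].
      - intros t Ht. specialize (Hb t ltac:(lra)). bound. }
    mono. }
  specialize (key x ((Rabs (e x) - K / a * exp (- a * x)) / 2) Hx). lra.
Qed.

Lemma interior_min (f f' : R -> R) (a b x : R) :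
  (forall y, a <= y <= b -> is_derive f y (f' y)) -> a < x < b ->
  f x < f a -> f x < f b ->
  exists c, a < c < b /\ f' c = 0 /\ f c <= f x /\ forall y, a <= y <= b -> f c <= f y.
Proof.
  intros H Hx Ha Hb. destruct (continuity_ab_min f a b) as [c [Hmin Hc]]; [lra| |].
  { intros y Hy. eapply is_derive_continuity_pt, H, Hy. }
  assert (f c <= f x) by (apply Hmin; lra). assert (a < c < b).
  { split.
    - destruct (Req_dec a c) as [<-|]; [lra|lra].
    - destruct (Req_dec c b) as [->|]; [lra|lra]. }
  exists c. splits. split; [|split; [easy|easy]].
  assert (Hd : derivable_pt_lim f c (f' c)) by (apply is_derive_Reals, H; lra).
  pose (pr := exist _ (f' c) Hd : derivable_pt f c). apply (deriv_minimum f a b c pr); try lra.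
  eauto with real.
Qed.

(** While [D] is positive it is convex, so it stays above its tangent at [t0] and therefore
    positive; [real_induction] makes this circle a proof. *)
Lemma convex_escape (D D1 D2 : R -> R) (t0 b : R) :
  (forall x, t0 <= x <= b -> is_derive D x (D1 x)) ->
  (forall x, t0 <= x <= b -> is_derive D1 x (D2 x)) ->
  0 < D t0 -> 0 <= D1 t0 ->
  (forall x, t0 <= x <= b -> 0 < D x -> 0 <= D2 x) ->
  forall x, t0 <= x <= b ->
    D1 t0 <= D1 x /\ D t0 + D1 t0 * (x - t0) <= D x.
Proof.
  intros H1 H2 HD HD1 Hc.
  assert (step : forall x, t0 <= x <= b -> (forall y, t0 <= y < x -> 0 < D y) -> D1 t0 <= D1 x /\ D
    t0 + D1 t0 * (x - t0) <= D x).
  { assert (step1 : forall x, t0 <= x <= b -> (forall y, t0 <= y <= x -> 0 < D y) -> D1 t0 <= D1 x).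
    { intros x Hx Hy. apply (derive_ge0_le D1 D2); [lra| |].
      - derive.
      - intros y Hy'. apply Hc; [lra|]. auto. }
    intros x Hx Hy. assert (D t0 + D1 t0 * (x - t0) <= D x).
    { destruct (Req_dec t0 x) as [<-|Hne]; [lra|].
      destruct (MVT_gen (fun y => D y - D1 t0 * y) t0 x (fun y => D1 y - D1 t0)) as [c [Hcc Heq]].
      - intros y Hy'. rewrite Rmin_left, Rmax_right in Hy' by lra. derive.
      - intros y Hy'. rewrite Rmin_left, Rmax_right in Hy' by lra.
        apply (is_derive_continuity_pt _ _ (D1 y - D1 t0)). derive.
      - rewrite Rmin_left, Rmax_right in Hcc by lra. destruct (Req_dec c x) as [->|Hne2].
        + (* the mean value point may be x itself; use the left limit of the inequality *)
          destruct (Rle_dec (D t0 + D1 t0 * (x - t0)) (D x)) as [|Hlt]; [easy|exfalso].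
          assert (D1 x - D1 t0 < 0) by nra.
          destruct (is_derive_near D1 x (D2 x) (H2 x ltac:(lra)) (D1 t0 - D1 x) ltac:(lra)) as [d
            [Hd Hnear]].
          pose (y := Rmax t0 (x - d / 2)). assert (t0 <= y /\ x - d / 2 <= y) by bound.
          assert (y < x) by (apply Rmax_lub_lt; lra).
          specialize (Hnear y ltac:(apply Rabs_def1; lra)).
          pose proof (step1 y ltac:(lra) ltac:(intros; apply Hy; lra)). bound.
        + pose proof (step1 c ltac:(lra) ltac:(intros; apply Hy; lra)). nra. }
    split; [|easy]. apply step1; [easy|]. intros y Hy'. destruct (Rlt_dec y x); [bound|].
    replace y with x by lra. nra. }
  assert (pos : forall x, t0 <= x <= b -> 0 < D x).
  { apply real_induction; [easy| |].
    - intros x Hx Hy.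
      destruct (is_derive_near D x (D1 x) (H1 x ltac:(lra)) (D x) (Hy x ltac:(lra))) as [d [Hd Hn]].
      exists d. splits. intros y Hy' _. specialize (Hn y ltac:(apply Rabs_def1; lra)). bound.
    - intros x Hx Hy. destruct (step x ltac:(lra) Hy). nra. }
  intros x Hx. apply step; [easy|]. intros; apply pos; lra.
Qed.

(** * Repeated differentiability *)

(** The derivatives are existential witnesses, so closure under products, inverses, sine and cosine
    is a plain induction. The passage to [ex_derive_n] is made once, on open sets. *)
Fixpoint Cn (n : nat) (I : R -> Prop) (f : R -> R) : Prop :=
  match n with
  | O => True
  | S m => exists f', (forall x, I x -> is_derive f x (f' x)) /\ Cn m I f'
  end.

Lemma Cn_S (n : nat) (I : R -> Prop) (f : R -> R) : Cn (S n) I f -> Cn n I f.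
Proof.
  revert f. induction n as [|n IH]; intros f; [easy|]. intros [f' [H1 H2]]. exists f'. auto.
Qed.

Lemma Cn_const (n : nat) (I : R -> Prop) (c : R) : Cn n I (fun _ => c).
Proof.
  revert c. induction n as [|n IH]; intros c; [easy|]. exists (fun _ => 0). split; [|easy]. derive.
Qed.

Lemma Cn_plus (n : nat) (I : R -> Prop) (f g : R -> R) :
  Cn n I f -> Cn n I g -> Cn n I (fun x => f x + g x).
Proof.
  revert f g. induction n as [|n IH]; intros f g; [easy|]. intros [f' [Hf Hf']] [g' [Hg Hg']].
  exists (fun x => f' x + g' x). split.
  - derive.
  - auto.
Qed.

Lemma Cn_mult (n : nat) (I : R -> Prop) (f g : R -> R) :
  Cn n I f -> Cn n I g -> Cn n I (fun x => f x * g x).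
Proof.
  revert f g. induction n as [|n IH]; intros f g; [easy|]. intros Hf Hg. pose proof (Cn_S _ _ _ Hf).
  pose proof (Cn_S _ _ _ Hg). destruct Hf as [f' [Hf Hf']]. destruct Hg as [g' [Hg Hg']].
  exists (fun x => f' x * g x + f x * g' x). split.
  - derive.
  - apply Cn_plus; apply IH; auto.
Qed.

Lemma Cn_inv (n : nat) (I : R -> Prop) (f : R -> R) :
  (forall x, I x -> f x <> 0) -> Cn n I f -> Cn n I (fun x => / f x).
Proof.
  intros H0. induction n as [|n IH]; [easy|]. intros Hf. pose proof (IH (Cn_S _ _ _ Hf)).
  destruct Hf as [f' [Hf Hf']]. exists (fun x => (-1 * f' x) * (/ f x * / f x)). split.
  - intros x Hx. evar_last; [apply (is_derive_inv f x _ (Hf x Hx)), H0, Hx|]. field; pos.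
  - apply Cn_mult; [apply Cn_mult; [apply Cn_const|easy]|now apply Cn_mult].
Qed.

Lemma Cn_cos_sin (n : nat) (I : R -> Prop) (f : R -> R) :
  Cn n I f -> Cn n I (fun x => cos (f x)) /\ Cn n I (fun x => sin (f x)).
Proof.
  induction n as [|n IH]; [easy|]. intros Hf. destruct (IH (Cn_S _ _ _ Hf)) as [Hc Hs].
  destruct Hf as [f' [Hf Hf']]. split.
  - exists (fun x => (-1 * f' x) * sin (f x)). split.
    + intros x Hx. specialize (Hf x Hx). auto_derive; [now exists (f' x)|]. rewrite (Derive_eta Hf).
      ring.
    + apply Cn_mult; [apply Cn_mult; [apply Cn_const|easy]|easy].
  - exists (fun x => f' x * cos (f x)). split.
    + intros x Hx. specialize (Hf x Hx). auto_derive; [now exists (f' x)|]. rewrite (Derive_eta Hf).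
      ring.
    + now apply Cn_mult.
Qed.

Lemma ex_derive_n_of_Cn (n : nat) (I : R -> Prop) (f : R -> R) :
  open I -> Cn n I f -> forall x, I x -> ex_derive_n f n x.
Proof.
  intros HI. revert f. induction n as [|[|n] IH]; intros f; [easy| |].
  { intros [f' [Hf _]] x Hx. exists (f' x). auto. }
  intros [f' [Hf Hf']] x Hx. assert (H : ex_derive_n f' (S n) x) by auto.
  apply (ex_derive_n_ext_loc f' (Derive f)) in H.
  - apply (ex_derive_ext (Derive_n (Derive f) n)); [|exact H]. intros t.
    rewrite (Derive_n_comp f n 1). f_equal; ring.
  - generalize (HI x Hx). apply filter_imp. intros y Hy. symmetry. now apply is_derive_unique, Hf.
Qed.

Lemma Cn_of_ex_derive_n (n : nat) (I : R -> Prop) (f : R -> R) :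
  (forall k x, ex_derive_n f k x) -> Cn n I f.
Proof.
  revert f. induction n as [|n IH]; intros f Hf; [easy|]. exists (Derive f). split.
  - intros x _. apply Derive_correct, (Hf 1%nat).
  - apply IH. intros [|k] x; [easy|].
    apply (ex_derive_ext (Derive_n f (S k))); [|apply (Hf (S (S k)))]. intros t.
    rewrite (Derive_n_comp f k 1). f_equal; ring.
Qed.

(** * Series of functions *)

Lemma ex_series_dom (a b : nat -> R) :
  (forall n, Rabs (a n) <= b n) -> ex_series b -> ex_series a.
Proof. exact (@ex_series_le R_AbsRing R_CompleteNormedModule a b). Qed.

(** The derived series converges uniformly by the Weierstrass test with [M], which is what
    [CVU_derivable] asks for; the series itself needs pointwise convergence only. *)
Lemma is_derive_Series (f f' : nat -> R -> R) (M : nat -> R) (c : R) (r : posreal) :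
  ex_series M ->
  (forall n y, Rabs (y - c) < r -> is_derive (f n) y (f' n y)) ->
  (forall n y, Rabs (y - c) < r -> Rabs (f' n y) <= M n) ->
  (forall y, Rabs (y - c) < r -> ex_series (fun n => f n y)) ->
  forall x, Rabs (x - c) < r ->
  is_derive (fun y => Series (fun n => f n y)) x (Series (fun n => f' n x)).
Proof.
  intros HM Hd Hb Hs x Hx. apply is_derive_Reals.
  assert (Hs' : forall y, Rabs (y - c) < r -> ex_series (fun n => f' n y)).
  { intros y Hy. apply (ex_series_dom (fun n => f' n y) M); [|easy]. auto. }
  apply (CVU_derivable (fun n y => sum_n (fun k => f k y) n) (fun n y => sum_n (fun k => f' k y) n)
    (fun y => Series (fun n => f n y)) (fun y => Series (fun n => f' n y)) c r).
  - intros e He. destruct HM as [l Hl]. assert (Hl' : is_series M l) by easy.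
    apply (is_lim_seq_spec (sum_n M) l) in Hl. destruct (Hl (mkposreal e He)) as [N HN].
    change (pos (mkposreal e He)) with e in HN. exists N. intros n y Hn Hy. specialize (Hs' y Hy).
    rewrite (Series_incr_n (fun k => f' k y) (S n)); [|lia|easy]. cbn [pred]. rewrite sum_n_Reals.
    replace (_ + _ - _) with (Series (fun k => f' (S n + k)%nat y)) by ring.
    assert (ex_series (fun k => M (S n + k)%nat)).
    { apply (ex_series_incr_n M (S n)). now exists l. }
    apply Rle_lt_trans with (Series (fun k => M (S n + k)%nat)).
    + apply Rle_trans with (Series (fun k => Rabs (f' (S n + k)%nat y))).
      * apply Series_Rabs. apply (ex_series_dom _ (fun k => M (S n + k)%nat)); [|easy]. bound.
      * apply Series_le; [|easy]. bound.
    + specialize (HN n Hn). assert (HE : Series M = sum_n M n + Series (fun k => M (S n + k)%nat)).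
      { rewrite (Series_incr_n M (S n)); [|lia|now exists l]. now rewrite sum_n_Reals. }
      rewrite (is_series_unique M l) in HE. 2: exact Hl'. apply Rabs_def2 in HN. lra.
  - intros y Hy. apply is_lim_seq_Reals. apply Series_correct. auto.
  - intros n y Hy. apply is_derive_Reals.
    apply (is_derive_sum_n (V := R_NormedModule) (fun k y => f k y) n y (fun k => f' k y)). auto.
  - exact Hx.
Qed.

(** * Improper integrals *)

Definition tail (f : R -> R) (x : R) : R := real (Lim (fun b => RInt f x b) p_infty).

Definition cont (f : R -> R) : Prop := forall x, continuous f x.

Lemma ex_RInt_cont (f : R -> R) (a b : R) : cont f -> ex_RInt f a b.
Proof. intros H. apply (ex_RInt_continuous (V := R_CompleteNormedModule)). easy. Qed.

Lemma is_derive_RInt_cont (f : R -> R) (a b : R) :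
  cont f -> is_derive (fun x => RInt f a x) b (f b).
Proof.
  intros H. apply (is_derive_RInt (V := R_NormedModule) f (fun x => RInt f a x) a b); [|apply H].
  apply filter_forall. intros x. apply (RInt_correct (V := R_CompleteNormedModule)).
  now apply ex_RInt_cont.
Qed.

Lemma RInt_cont_chasles (f : R -> R) (a b c : R) :
  cont f -> RInt f a c = RInt f a b + RInt f b c.
Proof.
  intros H. symmetry.
  apply (RInt_Chasles (V := R_CompleteNormedModule) f a b c); now apply ex_RInt_cont.
Qed.

Lemma RInt_dom (f h H : R -> R) (a b K : R) :
  cont f -> a <= b -> (forall z, a <= z <= b -> is_derive H z (h z)) ->
  (forall z, a <= z <= b -> Rabs (f z) <= K * h z) ->
  Rabs (RInt f a b) <= K * (H b - H a).
Proof.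
  intros Hf Hab HH Hb. assert (H1 : RInt f a b - K * H b <= RInt f a a - K * H a).
  { apply (derive_le0_ge (fun x => RInt f a x - K * H x) (fun x => f x - K * h x)); [easy| |].
    - intros x Hx. apply (is_derive_minus (fun x => RInt f a x)).
      + now apply is_derive_RInt_cont.
      + derive.
    - intros x Hx. specialize (Hb x Hx). bound. }
  assert (H2 : RInt f a a + K * H a <= RInt f a b + K * H b).
  { apply (derive_ge0_le (fun x => RInt f a x + K * H x) (fun x => f x + K * h x)); [easy| |].
    - intros x Hx. apply (is_derive_plus (fun x => RInt f a x)).
      + now apply is_derive_RInt_cont.
      + derive.
    - intros x Hx. specialize (Hb x Hx). bound. }
  rewrite RInt_point in H1, H2. change zero with 0 in H1, H2. mono.
Qed.

(* [exp (- g * |z|)] is dominated by [1 / cosh (g z)], which has the bounded primitive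
   [2 / g * atan (exp (g z))]. *)
Definition bump (g c z : R) : R := 2 / (exp (g * (z - c)) + exp (- (g * (z - c)))).
Definition bump_int (g c z : R) : R := 2 / g * atan (exp (g * (z - c))).

Lemma is_derive_bump_int (g c z : R) : 0 < g -> is_derive (bump_int g c) z (bump g c z).
Proof.
  intros Hg. unfold bump_int, bump. auto_derive; [easy|]. set (E := exp (g * (z - c))).
  assert (0 < E) by apply exp_pos.
  assert (HE : exp (- (g * (z - c))) = / E) by (unfold E; now rewrite <- exp_Ropp).
  unfold Rminus in E. fold E. rewrite HE. field. nra.
Qed.

Lemma bump_ge (g c z : R) : 0 < g -> exp (- g * Rabs (z - c)) <= bump g c z.
Proof.
  intros Hg. unfold bump. set (y := z - c). pose proof (exp_pos (g * y)).
  pose proof (exp_pos (- (g * y))). apply (Rmult_le_reg_r (exp (g * y) + exp (- (g * y)))); [lra|].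
  unfold Rdiv. rewrite Rmult_assoc, Rinv_l by lra. rewrite Rmult_plus_distr_l, <- !exp_plus.
  assert (Hle : forall t, t <= 0 -> exp t <= 1) by bound. pose proof (Rle_abs y).
  pose proof (Rle_abs (- y)). rewrite Rabs_Ropp in *.
  pose proof (Hle (- g * Rabs y + g * y) ltac:(nra)).
  pose proof (Hle (- g * Rabs y + - (g * y)) ltac:(nra)). lra.
Qed.

Lemma bump_int_bounds (g c z : R) : 0 < g -> 0 < bump_int g c z < PI / g.
Proof.
  intros Hg. unfold bump_int. pose proof (atan_bound (exp (g * (z - c)))).
  assert (0 < atan (exp (g * (z - c)))). { rewrite <- atan_0. apply atan_increasing, exp_pos. }
  assert (0 < 2 / g) by pos. nra.
Qed.

(** The point is that the bound depends neither on the interval nor on the centre [c]: the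
    exponential lies below [bump], whose integral over the whole line is [PI / g]. *)
Lemma RInt_exp_bound (f : R -> R) (a b K g c : R) :
  cont f -> 0 < g -> a <= b -> 0 <= K ->
  (forall z, a <= z <= b -> Rabs (f z) <= K * exp (- g * Rabs (z - c))) ->
  Rabs (RInt f a b) <= K * (PI / g).
Proof.
  intros Hf Hg Hab HK Hb. apply Rle_trans with (K * (bump_int g c b - bump_int g c a)).
  - apply (RInt_dom f (bump g c)); [easy|easy| |].
    + intros; now apply is_derive_bump_int.
    + intros z Hz. specialize (Hb z Hz). pose proof (bump_ge g c z Hg). nra.
  - pose proof (bump_int_bounds g c a Hg). pose proof (bump_int_bounds g c b Hg). nra.
Qed.

Lemma is_lim_incr (F F' : R -> R) (x0 M : R) :
  (forall x, x0 <= x -> is_derive F x (F' x)) -> (forall x, x0 <= x -> 0 <= F' x) ->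
  (forall x, x0 <= x -> F x <= M) -> exists l : R, is_lim F p_infty l.
Proof.
  intros Hd H0 HM.
  destruct (completeness (fun y => exists x, x0 <= x /\ y = F x)) as [l [Hub Hlub]].
  { exists M. intros y [x [Hx ->]]. auto. }
  { eauto with real. } exists l. apply is_lim_spec. intros [e He]. cbn.
  destruct (classic (exists x, x0 <= x /\ l - e < F x)) as [[x [Hx Hl]]|Hn].
  - exists x. intros y Hy. assert (F x <= F y).
    { apply (derive_ge0_le F F'); [lra| |]; intros; [apply Hd|apply H0]; lra. }
    assert (F y <= l) by (apply Hub; exists y; split; [lra|easy]). bound.
  - assert (l <= l - e); [|lra]. apply Hlub. intros y [x [Hx ->]].
    destruct (Rle_dec (F x) (l - e)) as [|Hc]; [easy|]. exfalso. eauto with real.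
Qed.

(** Adding [K bump_int] to the integral makes it nondecreasing and keeps it bounded, and
    [K bump_int] is itself nondecreasing and bounded; the integral is the difference of two
    convergent functions. *)
Lemma tail_correct (f : R -> R) (x0 K g c : R) :
  cont f -> 0 < g -> 0 <= K ->
  (forall z, x0 <= z -> Rabs (f z) <= K * exp (- g * Rabs (z - c))) ->
  is_lim (fun b => RInt f x0 b) p_infty (tail f x0).
Proof.
  intros Hf Hg HK Hb. assert (HH : exists l : R, is_lim (fun b => K * bump_int g c b) p_infty l).
  { apply (is_lim_incr _ (fun z => K * bump g c z) x0 (K * (PI / g))).
    - intros. apply is_derive_scal. now apply is_derive_bump_int.
    - intros x _. pose proof (bump_ge g c x Hg). pose proof (exp_pos (- g * Rabs (x - c))). nra.
    - intros x _. pose proof (bump_int_bounds g c x Hg). nra. }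
  assert (HF : exists l : R, is_lim (fun b => RInt f x0 b + K * bump_int g c b) p_infty l).
  { apply (is_lim_incr _ (fun z => f z + K * bump g c z) x0 (2 * K * (PI / g))).
    - intros. apply (is_derive_plus (fun b => RInt f x0 b)).
      + now apply is_derive_RInt_cont.
      + apply is_derive_scal. now apply is_derive_bump_int.
    - intros x Hx. specialize (Hb x Hx). pose proof (bump_ge g c x Hg). apply Rabs_le_between in Hb.
      nra.
    - intros x Hx.
      pose proof (RInt_exp_bound f x0 x K g c Hf Hg Hx HK (fun z Hz => Hb z (proj1 Hz))) as Hi.
      apply Rabs_le_between in Hi. pose proof (bump_int_bounds g c x Hg). nra. }
  destruct HH as [l1 H1]. destruct HF as [l2 H2].
  assert (H3 : is_lim (fun b => RInt f x0 b) p_infty (l2 - l1)).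
  { apply (is_lim_ext (fun b => RInt f x0 b + K * bump_int g c b - K * bump_int g c b)); [bound|].
    now apply (is_lim_minus _ _ _ (Finite l2) (Finite l1)). }
  unfold tail. rewrite (is_lim_unique _ _ _ H3). exact H3.
Qed.

Lemma is_lim_le_abs (F : R -> R) (x0 l B : R) :
  is_lim F p_infty l -> (forall x, x0 <= x -> Rabs (F x) <= B) -> Rabs l <= B.
Proof.
  intros Hl HB. destruct (Rle_dec (Rabs l) B) as [|Hn]; [easy|exfalso]. apply is_lim_spec in Hl.
  assert (He : 0 < Rabs l - B) by lra. destruct (Hl (mkposreal _ He)) as [M HM]. cbn in HM.
  pose (x := Rmax x0 (M + 1)). assert (x0 <= x) by bound. assert (M + 1 <= x) by bound.
  specialize (HM x ltac:(lra)). specialize (HB x ltac:(lra)). pose proof (Rabs_triang_inv l (F x)).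
  rewrite Rabs_minus_sym in HM. lra.
Qed.

Lemma tail_bound (f : R -> R) (x0 K g c : R) :
  cont f -> 0 < g -> 0 <= K ->
  (forall z, x0 <= z -> Rabs (f z) <= K * exp (- g * Rabs (z - c))) ->
  Rabs (tail f x0) <= K * (PI / g).
Proof.
  intros Hf Hg HK Hb. apply (is_lim_le_abs (fun b => RInt f x0 b) x0).
  - now apply (tail_correct f x0 K g c).
  - intros x Hx. apply (RInt_exp_bound f x0 x K g c); auto. bound.
Qed.

Lemma tail_shift (f : R -> R) (x0 x l : R) :
  cont f -> is_lim (fun b => RInt f x0 b) p_infty l ->
  is_lim (fun b => RInt f x b) p_infty (l - RInt f x0 x).
Proof.
  intros Hf Hl. apply (is_lim_ext (fun b => RInt f x0 b - RInt f x0 x)).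
  - intros b. rewrite (RInt_cont_chasles f x0 x b Hf). ring.
  - apply (is_lim_minus _ _ _ (Finite l) (Finite (RInt f x0 x))); [easy|apply is_lim_const|easy].
Qed.

Lemma is_derive_tail (f : R -> R) (x0 l x : R) :
  cont f -> is_lim (fun b => RInt f x0 b) p_infty (Finite l) -> is_derive (tail f) x (- f x).
Proof.
  intros Hf Hl. apply (is_derive_ext (fun y => l - RInt f x0 y)).
  - intros y. unfold tail. now rewrite (is_lim_unique _ _ _ (tail_shift f x0 y l Hf Hl)).
  - replace (- f x) with (0 - f x) by ring.
    apply (is_derive_minus (fun _ => l)); [apply (is_derive_const l)|].
    now apply is_derive_RInt_cont.
Qed.

(** * The amplitude equation and the soliton amplitude *)

(* A gray mode has modulus [r] with [r'' = famp r + 2 eps V r]. *)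
Definition famp (v r : R) : R := - (v ^ 2 + 2) * r + 2 * r ^ 3 + v ^ 2 / r ^ 3.
Definition dfamp (v r : R) : R := - (v ^ 2 + 2) + 6 * r ^ 2 - 3 * v ^ 2 / r ^ 4.

Definition kap (v : R) : R := sqrt (1 - v ^ 2).
Definition th (v x : R) : R := tanh (kap v * x).
Definition sch (v x : R) : R := 1 - th v x ^ 2.
Definition rho0 (v x : R) : R := sqrt (v ^ 2 + kap v ^ 2 * th v x ^ 2).

(* Two solutions of the linearized equation [z'' = dfamp rho0 z]: the translation mode
   [zs = rho0'], and the growing mode [zu], obtained from it by reduction of order. *)
Definition zs (v x : R) : R := kap v ^ 3 * th v x * sch v x / rho0 v x.
Definition yu (v x : R) : R :=
  - v ^ 2 * sch v x + th v x ^ 2 / (4 * sch v x) + (3 / 8 + v ^ 2 / 2) * th v x ^ 2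
  + (3 / 8 + 3 * v ^ 2 / 2) * (kap v * x * th v x * sch v x).
Definition yu' (v x : R) : R :=
  kap v * (2 * v ^ 2 * th v x * sch v x + th v x / (2 * sch v x)
  + (3 / 4 + v ^ 2) * th v x * sch v x
  + (3 / 8 + 3 * v ^ 2 / 2) * (th v x * sch v x + kap v * x * (sch v x * (1 - 3 * th v x ^ 2)))).
Definition zu (v x : R) : R := yu v x / rho0 v x.
Definition zu' (v x : R) : R := yu' v x / rho0 v x - yu v x * zs v x / rho0 v x ^ 2.

Lemma is_derive_tanh (x : R) : is_derive tanh x (1 - tanh x ^ 2).
Proof.
  assert (Hc : cosh x <> 0).
  { unfold cosh. pose proof (exp_pos x). pose proof (exp_pos (- x)). lra. }
  replace (1 - tanh x ^ 2) with ((cosh x * cosh x - sinh x * sinh x) / Rsqr (cosh x)).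
  - apply is_derive_Reals. apply (derivable_pt_lim_div sinh cosh x (cosh x) (sinh x)).
    + apply derivable_pt_lim_sinh.
    + apply derivable_pt_lim_cosh.
    + exact Hc.
  - unfold tanh, Rsqr. now field.
Qed.

Ltac solve_ex_derive :=
  repeat match goal with
  | |- _ /\ _ => split
  | |- True => exact I
  | H : is_derive ?f ?x ?l |- ex_derive (fun y => ?f y) ?x => exists l; exact H
  end.

Class speed := Speed { vel : R; vel_lt1 : -1 < vel < 1; vel_neq0 : vel <> 0 }.

Section Soliton.

Context {sp : speed}.
Notation v := (@vel sp).

Notation k := (kap v).
Notation t := (th v).
Notation s := (sch v).
Notation r0 := (rho0 v).

Lemma v2_bounds : 0 < v ^ 2 < 1.
Proof. pose proof vel_lt1. pose proof vel_neq0. nra. Qed.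

Lemma kap_sq : k ^ 2 = 1 - v ^ 2.
Proof. unfold kap. rewrite pow2_sqrt; [easy|]. pose proof v2_bounds; lra. Qed.

Lemma kap_pos : 0 < k.
Proof. apply sqrt_lt_R0. pose proof v2_bounds; lra. Qed.

Lemma kap_lt1 : k < 1.
Proof. pose proof kap_sq. pose proof v2_bounds. nra. Qed.

Lemma is_derive_th (x : R) : is_derive t x (k * s x).
Proof.
  unfold th, sch, th. evar_last.
  - apply (is_derive_comp tanh (fun y => k * y)); [apply is_derive_tanh|]. auto_derive; easy.
  - cbn. lra.
Qed.

Lemma cosh_bounds (x : R) : exp (Rabs x) / 2 <= cosh x <= exp (Rabs x).
Proof.
  unfold cosh. pose proof (exp_pos x). pose proof (exp_pos (- x)). unfold Rabs.
  destruct (Rcase_abs x).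
  - pose proof (exp_le x (- x) ltac:(lra)). lra.
  - pose proof (exp_le (- x) x ltac:(lra)). lra.
Qed.

Lemma sch_cosh (x : R) : s x = / cosh (k * x) ^ 2.
Proof.
  unfold sch, th, tanh. assert (E : sinh (k * x) ^ 2 = cosh (k * x) ^ 2 - 1).
  { unfold sinh, cosh. pose proof (exp_plus (k * x) (- (k * x))) as Hp.
    rewrite Rplus_opp_r, exp_0 in Hp. nra. }
  assert (cosh (k * x) <> 0) by nra.
  replace ((sinh (k * x) / cosh (k * x)) ^ 2) with (sinh (k * x) ^ 2 / cosh (k * x) ^ 2) by algebra.
  rewrite E. now field.
Qed.

Lemma sch_pos (x : R) : 0 < s x.
Proof.
  rewrite sch_cosh. pose proof (cosh_bounds (k * x)). pose proof (exp_pos (Rabs (k * x))). bound.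
Qed.

Lemma th2_bounds (x : R) : 0 <= t x ^ 2 < 1.
Proof. pose proof (sch_pos x). unfold sch in *. pos. Qed.

Lemma th_bounds (x : R) : Rabs (t x) < 1.
Proof. pose proof (th2_bounds x). apply Rabs_def1; nra. Qed.

Lemma sch_le1 (x : R) : s x <= 1.
Proof. unfold sch. nra. Qed.

Lemma Rabs_kx (x : R) : Rabs (k * x) = k * Rabs x.
Proof. rewrite Rabs_mult, (Rabs_right k); [easy|]. pose proof kap_pos; lra. Qed.

Lemma sch_le (x : R) : s x <= 4 * exp (- (2 * k) * Rabs x).
Proof.
  rewrite sch_cosh. pose proof (cosh_bounds (k * x)) as [H1 _]. rewrite Rabs_kx in H1.
  pose proof (exp_pos (k * Rabs x)).
  replace (- (2 * k) * Rabs x) with (- (k * Rabs x) + - (k * Rabs x)) by ring.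
  rewrite exp_plus, exp_Ropp.
  replace (4 * (/ exp (k * Rabs x) * / exp (k * Rabs x))) with (/ (exp (k * Rabs x) / 2) ^ 2) by
    algebra.
  mono.
Qed.

Lemma inv_sch_le (x : R) : / s x <= exp (2 * k * Rabs x).
Proof.
  rewrite sch_cosh, Rinv_inv. pose proof (cosh_bounds (k * x)) as H. rewrite Rabs_kx in H.
  replace (2 * k * Rabs x) with (k * Rabs x + k * Rabs x) by ring. rewrite exp_plus. nra.
Qed.

Lemma rho0_sq (x : R) : r0 x ^ 2 = v ^ 2 + k ^ 2 * t x ^ 2.
Proof. apply pow2_sqrt. pos. Qed.

Lemma rho0_sq_sch (x : R) : 1 - r0 x ^ 2 = k ^ 2 * s x.
Proof. rewrite rho0_sq. unfold sch. rewrite kap_sq. ring. Qed.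

Lemma rho0_pos (x : R) : 0 < r0 x.
Proof. apply sqrt_lt_R0. pose proof v2_bounds. pos. Qed.

Lemma rho0_lt1 (x : R) : r0 x < 1.
Proof.
  pose proof (rho0_sq_sch x). pose proof (sch_pos x). pose proof (pow_lt k 2 kap_pos). nra.
Qed.

Lemma rho0_ge (x : R) : Rabs v <= r0 x.
Proof. rewrite <- sqrt_Rsqr_abs. apply sqrt_le_1_alt. unfold Rsqr. nra. Qed.

Lemma rho0_0 : r0 0 = Rabs v.
Proof.
  unfold rho0, th, tanh. rewrite Rmult_0_r, sinh_0, Rdiv_0_l.
  replace (v ^ 2 + k ^ 2 * 0 ^ 2) with (Rsqr v).
  - apply sqrt_Rsqr_abs.
  - unfold Rsqr. ring.
Qed.

Lemma rho0_near1 (x : R) : 0 < 1 - r0 x <= 4 * exp (- (2 * k) * Rabs x).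
Proof.
  pose proof (rho0_lt1 x). pose proof (rho0_sq_sch x). pose proof (rho0_pos x).
  pose proof (sch_le x). pose proof kap_pos. pose proof kap_lt1. assert (k ^ 2 <= 1) by nra. nra.
Qed.

Lemma is_derive_rho0 (x : R) : is_derive r0 x (zs v x).
Proof.
  pose proof (rho0_pos x). pose proof (rho0_sq x). unfold rho0. auto_derive.
  { split; [eexists; apply is_derive_th|]. nra. }
  rewrite (Derive_eta (is_derive_th x)). unfold zs. replace (sqrt _) with (r0 x) by easy. algebra.
Qed.

Lemma is_derive_sch (x : R) : is_derive s x (- 2 * t x * (k * s x)).
Proof.
  unfold sch. auto_derive; [eexists; apply is_derive_th|]. rewrite (Derive_eta (is_derive_th x)).
  unfold sch. ring.
Qed.

Lemma is_derive_zs (x : R) : is_derive (zs v) x (famp v (r0 x)).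
Proof.
  pose proof (rho0_pos x). pose proof (rho0_sq x) as Hsq. unfold zs. auto_derive.
  { pose proof (is_derive_th x). pose proof (is_derive_sch x). pose proof (is_derive_rho0 x).
    solve_ex_derive. lra. }
  rewrite (Derive_eta (is_derive_th x)), (Derive_eta (is_derive_sch x)), (Derive_eta (is_derive_rho0
    x)).
  unfold famp, zs. apply (Rmult_eq_reg_r (r0 x ^ 3)); [|eauto with real].
  field_simplify; [|lra|lra]. replace (r0 x ^ 6) with ((r0 x ^ 2) ^ 3) by ring.
  replace (r0 x ^ 4) with ((r0 x ^ 2) ^ 2) by ring. replace (k ^ 6) with ((k ^ 2) ^ 3) by ring.
  replace (k ^ 4) with ((k ^ 2) ^ 2) by ring. rewrite Hsq, kap_sq. unfold sch. ring.
Qed.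

Lemma is_derive_famp (g : R -> R) (x g' : R) :
  g x <> 0 -> is_derive g x g' -> is_derive (fun y => famp v (g y)) x (dfamp v (g x) * g').
Proof.
  intros Hg H. unfold famp, dfamp. auto_derive.
  { repeat split; try (now exists g'). apply Rmult_integral_contrapositive_currified; [easy|]. auto. }
  rewrite (Derive_eta H). field. easy.
Qed.

Lemma is_derive_yu (x : R) : is_derive (yu v) x (yu' v x).
Proof.
  pose proof (sch_pos x). unfold yu. auto_derive.
  { pose proof (is_derive_th x). pose proof (is_derive_sch x). solve_ex_derive; lra. }
  rewrite (Derive_eta (is_derive_th x)), (Derive_eta (is_derive_sch x)). unfold yu'. unfold sch.
  field. pos.
Qed.

Lemma is_derive_zu (x : R) : is_derive (zu v) x (zu' v x).
Proof.
  pose proof (rho0_pos x). unfold zu. auto_derive.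
  { pose proof (is_derive_yu x). pose proof (is_derive_rho0 x). solve_ex_derive. lra. }
  rewrite (Derive_eta (is_derive_yu x)), (Derive_eta (is_derive_rho0 x)). unfold zu'. field. lra.
Qed.

Lemma famp_rho0 (x : R) :
  famp v (r0 x) = k ^ 4 * s x * (1 - 3 * t x ^ 2) / r0 x - zs v x ^ 2 / r0 x.
Proof.
  pose proof (rho0_pos x). pose proof (rho0_sq x) as Hsq. unfold famp, zs.
  apply (Rmult_eq_reg_r (r0 x ^ 3)); [|eauto with real]. field_simplify; [|lra|lra].
  replace (r0 x ^ 6) with ((r0 x ^ 2) ^ 3) by ring.
  replace (r0 x ^ 4) with ((r0 x ^ 2) ^ 2) by ring. replace (k ^ 6) with ((k ^ 2) ^ 3) by ring.
  replace (k ^ 4) with ((k ^ 2) ^ 2) by ring. rewrite Hsq, kap_sq. unfold sch. ring.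
Qed.

(** Since [famp v (r0 x)] is the derivative of [zs], this is the Wronskian of the two modes, and its
    nonzero value is the divisor in [solve]. *)
Lemma wronskian (x : R) : zs v x * zu' v x - famp v (r0 x) * zu v x = k ^ 4.
Proof.
  pose proof (rho0_pos x). pose proof (rho0_sq x) as Hsq. pose proof (sch_pos x). rewrite famp_rho0.
  unfold zu', zu.
  replace (_ - _) with ((k ^ 3 * t x * s x * yu' v x - k ^ 4 * s x * (1 - 3 * t x ^ 2) * yu v x) /
    r0 x ^ 2) by (unfold zs; field; lra).
  rewrite Hsq, kap_sq. apply (Rmult_eq_reg_r (v ^ 2 + (1 - v ^ 2) * t x ^ 2)).
  2:{ rewrite <- kap_sq, <- Hsq. nra. }
  unfold Rdiv. rewrite Rmult_assoc, Rinv_l. 2:{ rewrite <- kap_sq, <- Hsq. nra. }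
  unfold yu, yu', sch in *. field. lra.
Qed.

Definition yu'' (x : R) : R :=
  k ^ 2 * (2 * v ^ 2 * s x * (1 - 3 * t x ^ 2) + (1 + t x ^ 2) / (2 * s x)
  + (3 / 4 + v ^ 2) * s x * (1 - 3 * t x ^ 2)
  + (3 / 8 + 3 * v ^ 2 / 2) * (2 * s x * (1 - 3 * t x ^ 2)
     + k * x * (s x * (- 8 * t x + 12 * t x ^ 3)))).

Lemma is_derive_yu' (x : R) : is_derive (yu' v) x (yu'' x).
Proof.
  pose proof (sch_pos x). unfold yu'. auto_derive.
  { pose proof (is_derive_th x). pose proof (is_derive_sch x). solve_ex_derive; lra. }
  rewrite (Derive_eta (is_derive_th x)), (Derive_eta (is_derive_sch x)). unfold yu''.
  unfold sch in *. field. lra.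
Qed.

Lemma is_derive_zu' (x : R) : is_derive (zu' v) x (dfamp v (r0 x) * zu v x).
Proof.
  pose proof (rho0_pos x). pose proof (rho0_sq x) as Hsq. pose proof (sch_pos x). unfold zu'.
  auto_derive.
  { pose proof (is_derive_yu x). pose proof (is_derive_yu' x). pose proof (is_derive_rho0 x).
    pose proof (is_derive_zs x). solve_ex_derive; try lra. nra. }
  rewrite (Derive_eta (is_derive_yu x)), (Derive_eta (is_derive_yu' x)), (Derive_eta (is_derive_rho0
    x)), (Derive_eta (is_derive_zs x)).
  (* After multiplication by [rho0^5] both sides are polynomials in [rho0^2], which is then replaced
     by its expression in [th]. *)
  rewrite famp_rho0. unfold dfamp, zu, zs. apply (Rmult_eq_reg_r (r0 x ^ 5)); [|eauto with real].
  match goal with |- ?l = ?r => replace l with (yu'' x * (r0 x ^ 2) ^ 2 - 2 * yu' v x * (k ^ 3 * t x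
    * s x) * r0 x ^ 2 - yu v x * (k ^ 4 * s x * (1 - 3 * t x ^ 2)) * r0 x ^ 2 + 3 * yu v x * (k ^ 3
    * t x * s x) ^ 2) by algebra; replace r with ((- (v ^ 2 + 2) * (r0 x ^ 2) ^ 2 + 6 * (r0 x ^ 2) ^
    3 - 3 * v ^ 2) * yu v x) by algebra end.
  (* Both [yu'] and [zs] carry an odd power of [k]. Extracting one factor from [yu'] leaves only
     even powers, which [kap_sq] eliminates. *)
  rewrite Hsq. assert (E : exists q, yu' v x = k * q /\ q = yu' v x / k).
  { exists (yu' v x / k). split; [field; pose proof kap_pos; lra|easy]. }
  destruct E as [q [Eq Hq]]. unfold yu' in Hq.
  replace (2 * yu' v x * (k ^ 3 * t x * s x)) with (2 * q * ((k ^ 2) ^ 2 * t x * s x)) by nra.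
  replace ((k ^ 3 * t x * s x) ^ 2) with ((k ^ 2) ^ 3 * (t x * s x) ^ 2) by ring.
  replace (k ^ 4) with ((k ^ 2) ^ 2) by ring. rewrite Hq. unfold yu, yu''. rewrite kap_sq.
  unfold sch in *. field. pose proof kap_pos. lra.
Qed.

End Soliton.

#[global] Hint Resolve kap_pos sch_pos rho0_pos : pos.
#[global] Hint Resolve is_derive_th is_derive_sch is_derive_rho0 is_derive_zs is_derive_zu is_derive_zu' : derive.

Section Modes.

Context {sp : speed}.
Notation v := (@vel sp).

Notation k := (kap v).
Notation t := (th v).
Notation s := (sch v).
Notation r0 := (rho0 v).

Lemma vabs_bounds : 0 < Rabs v < 1.
Proof. pose proof vel_lt1. pose proof vel_neq0. bound. Qed.

Lemma th_opp (x : R) : t (- x) = - t x.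
Proof.
  unfold th, tanh, sinh, cosh. replace (k * - x) with (- (k * x)) by ring. rewrite Ropp_involutive.
  field. pose proof (exp_pos (k * x)). pose proof (exp_pos (- (k * x))). lra.
Qed.

Lemma sch_opp (x : R) : s (- x) = s x.
Proof. unfold sch. rewrite th_opp. ring. Qed.

Lemma rho0_opp (x : R) : r0 (- x) = r0 x.
Proof. unfold rho0. rewrite th_opp. f_equal. ring. Qed.

Lemma zs_opp (x : R) : zs v (- x) = - zs v x.
Proof. unfold zs. rewrite th_opp, sch_opp, rho0_opp. lra. Qed.

Lemma zu_opp (x : R) : zu v (- x) = zu v x.
Proof. unfold zu, yu. rewrite th_opp, sch_opp, rho0_opp. lra. Qed.

Lemma th_0 : t 0 = 0.
Proof. unfold th, tanh. rewrite Rmult_0_r, sinh_0. lra. Qed.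

Lemma sch_0 : s 0 = 1.
Proof. unfold sch. rewrite th_0. ring. Qed.

Lemma zs_0 : zs v 0 = 0.
Proof. unfold zs. rewrite th_0. lra. Qed.

Lemma zu_0 : zu v 0 = - Rabs v.
Proof.
  unfold zu, yu. rewrite th_0, sch_0, rho0_0 by auto. pose proof vabs_bounds.
  apply (Rmult_eq_reg_r (Rabs v)); [|lra]. field_simplify; [|lra].
  replace (v ^ 2) with (Rabs v ^ 2) by apply pow2_abs. field.
Qed.

Lemma zu'_0 : zu' v 0 = 0.
Proof. unfold zu'. rewrite zs_0. unfold yu'. rewrite th_0, sch_0, Rmult_0_r. lra. Qed.

(** The value is [k^4 / |v|], the curvature of the soliton amplitude at its bottom. *)
Lemma famp_rho0_0 : 0 < famp v (r0 0).
Proof.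
  rewrite famp_rho0 by auto. rewrite zs_0, th_0, sch_0. replace (_ - _) with (k ^ 4 / r0 0) by lra.
  pos.
Qed.

Lemma th_pos (x : R) : 0 < x -> 0 < t x.
Proof.
  intros Hx. apply Rdiv_lt_0_compat.
  - unfold sinh. assert (0 < k * x) by pos.
    pose proof (exp_increasing (- (k * x)) (k * x) ltac:(lra)). lra.
  - unfold cosh. pos.
Qed.

Lemma zs_pos (x : R) : 0 < x -> 0 < zs v x.
Proof. intros Hx. pose proof (th_pos x Hx). unfold zs. pos. Qed.

Lemma x_exp_le (y : R) : 0 <= y -> y * exp (- (2 * y)) <= 1.
Proof.
  intros Hy. pose proof (exp_ineq1_le y). pose proof (exp_pos (- (2 * y))).
  apply Rle_trans with (exp y * exp (- (2 * y))); [nra|]. rewrite <- exp_plus. mono.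
Qed.

Lemma exp_2k_ge1 (x : R) : 1 <= exp (2 * k * Rabs x).
Proof. rewrite <- exp_0. mono. Qed.

Lemma kxs_le (x : R) : k * Rabs x * s x <= 4.
Proof.
  pose proof (sch_le x). pose proof (Rabs_pos x). pose proof kap_pos.
  assert (0 <= k * Rabs x) by nra. pose proof (x_exp_le (k * Rabs x) ltac:(easy)) as Hx.
  replace (- (2 * (k * Rabs x))) with (- (2 * k) * Rabs x) in Hx by ring. nra.
Qed.

Lemma Rabs_le4 (a b c d A B C D : R) :
  Rabs a <= A -> Rabs b <= B -> Rabs c <= C -> Rabs d <= D ->
  Rabs (a + b + c + d) <= A + B + C + D.
Proof. bound. Qed.

Lemma yu_bound (x : R) : Rabs (yu v x) <= 16 * exp (2 * k * Rabs x).
Proof.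
  pose proof v2_bounds. pose proof (th2_bounds x). pose proof (sch_pos x). pose proof (sch_le1 x).
  pose proof (inv_sch_le x). pose proof (exp_2k_ge1 x). pose proof (kxs_le x).
  pose proof (th_bounds x). set (E := exp (2 * k * Rabs x)) in *.
  apply Rle_trans with (1 + E + 1 + 2 * (4 * 1)); [|lra]. apply Rabs_le4.
  - apply Rabs_le. nra.
  - replace (t x ^ 2 / (4 * s x)) with (t x ^ 2 * (/ 4 * / s x)) by algebra.
    assert (0 < / s x) by pos. rewrite Rabs_right; nra.
  - apply Rabs_le. nra.
  - apply Rabs_mult_le; [mono|]. replace (k * x * t x * s x) with (k * x * s x * t x) by ring.
    apply Rabs_mult_le; [|lra]. rewrite Rabs_mult, Rabs_kx by auto.
    rewrite (Rabs_right (s x)) by lra. easy.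
Qed.

Lemma yu'_bound (x : R) : Rabs (yu' v x) <= 40 * exp (2 * k * Rabs x).
Proof.
  pose proof v2_bounds. pose proof (th2_bounds x). pose proof (sch_pos x). pose proof (sch_le1 x).
  pose proof (inv_sch_le x). pose proof (exp_2k_ge1 x). pose proof (kxs_le x).
  pose proof (th_bounds x). pose proof kap_lt1. set (E := exp (2 * k * Rabs x)) in *.
  assert (Rabs (t x * s x) <= 1). { replace 1 with (1 * 1) by ring. mono. }
  apply Rle_trans with (1 * (2 * 1 + E + 2 * 1 + 2 * (1 + 4 * 2))); [|lra].
  apply Rabs_mult_le; [mono|]. apply Rabs_le4.
  - rewrite Rmult_assoc. mono.
  - replace (t x / (2 * s x)) with (t x * (/ 2 * / s x)) by algebra. replace E with (1 * E) by ring.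
    mono.
  - rewrite Rmult_assoc. mono.
  - apply Rabs_mult_le; [mono|]. triangle. apply Rplus_le_compat; [easy|]. rewrite <- Rmult_assoc.
    apply Rabs_mult_le; [|mono]. rewrite Rabs_mult, Rabs_kx by auto.
    rewrite (Rabs_right (s x)) by lra. easy.
Qed.

Lemma modes_bound : exists C, 1 <= C /\ forall x,
  Rabs (zs v x) <= C * exp (- (2 * k) * Rabs x) /\
  Rabs (famp v (r0 x)) <= C * exp (- (2 * k) * Rabs x) /\
  Rabs (zu v x) <= C * exp (2 * k * Rabs x) /\
  Rabs (zu' v x) <= C * exp (2 * k * Rabs x).
Proof.
  pose proof vabs_bounds. pose proof kap_pos. pose proof kap_lt1. pose (i := / Rabs v).
  assert (1 < i). { rewrite <- Rinv_1. apply Rinv_lt_contravar; lra. }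
  assert (Hzs : forall x, Rabs (zs v x) <= 4 * i * exp (- (2 * k) * Rabs x)).
  { intros x. pose proof (sch_le x). pose proof (th_bounds x). pose proof (rho0_ge x).
    assert (Hir : 0 < / r0 x <= i). { splits. apply Rinv_le_contravar; lra. }
    replace (4 * i * exp (- (2 * k) * Rabs x)) with (1 * 1 * (4 * exp (- (2 * k) * Rabs x)) * i) by
      ring.
    apply Rabs_mult_le; [|mono]. apply Rabs_mult_le; [|mono]. apply Rabs_mult_le; [|lra].
    rewrite Rabs_right by nra. nra. }
  assert (Hir : forall x, 0 < / r0 x <= i).
  { intros x. pose proof (rho0_ge x). splits. apply Rinv_le_contravar; lra. }
  assert (He : forall x, 0 < exp (- (2 * k) * Rabs x) <= 1).
  { intros x. splits. apply exp_ge0_1. pose proof (Rabs_pos x). nra. }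
  assert (forall x, Rabs (zs v x) <= 4 * i).
  { intros x. specialize (Hzs x). specialize (He x). nra. }
  exists (1000 * i ^ 4). assert (1 <= i ^ 4) by (apply pow_R1_Rle; lra).
  assert (i <= i ^ 3 /\ i ^ 3 <= i ^ 4 /\ i ^ 2 <= i ^ 4) by nra. splits. intros x.
  specialize (He x). pose proof (Hzs x). specialize (Hir x). pose proof (exp_2k_ge1 x).
  split; [|split; [|split]].
  - nra.
  - rewrite famp_rho0 by auto. pose proof (sch_le x). pose proof (th2_bounds x). triangle.
    apply Rle_trans with (1 * (4 * exp (- (2 * k) * Rabs x)) * 2 * i + (4 * i * exp (- (2 * k) *
      Rabs x)) * (4 * i) * i).
    + apply Rplus_le_compat.
      * apply Rabs_mult_le; [apply Rabs_mult_le; [apply Rabs_mult_le|]|].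
        -- assert (k ^ 4 <= 1 ^ 4) by mono. bound.
        -- mono.
        -- mono.
        -- mono.
      * unfold Rdiv. replace (zs v x ^ 2) with (zs v x * zs v x) by ring. mono.
    + nra.
  - apply Rle_trans with (16 * exp (2 * k * Rabs x) * i).
    + apply Rabs_mult_le; [apply yu_bound|mono].
    + nra.
  - triangle.
    apply Rle_trans with (40 * exp (2 * k * Rabs x) * i + 16 * exp (2 * k * Rabs x) * (4 * i) * (i *
      i)).
    + apply Rplus_le_compat.
      * apply Rabs_mult_le; [apply yu'_bound|mono].
      * rewrite Rabs_Ropp. apply Rabs_mult_le.
        -- apply Rabs_mult_le; [apply yu_bound|easy].
        -- rewrite <- (Rabs_right (i * i)) by nra. replace (/ r0 x ^ 2) with (/ r0 x * / r0 x).
          ++ rewrite !Rabs_mult. rewrite (Rabs_right i), (Rabs_right (/ r0 x)) by lra. nra.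
          ++ pose proof (rho0_pos x). field. lra.
    + nra.
Qed.

Lemma dfamp_1 : dfamp v 1 = 4 * k ^ 2.
Proof. unfold dfamp. rewrite kap_sq by auto. field. Qed.

(** Beyond [T1] the equation makes [zu'] increase at a rate of at least [k^2], so it exceeds 1 after
    a time that depends on its value at [T1]. *)
Lemma zu_growth : exists T, 0 < T /\ forall x, T <= x -> 1 <= zu v x /\ 1 <= zu' v x.
Proof.
  pose proof kap_pos. pose proof v2_bounds. pose proof kap_sq.
  (* at [x >= T1]: [s <= k^2 / 40], hence [dfamp rho0 >= k^2] and [yu >= 1] *)
  pose (T1 := ln (200 / k ^ 2) / (2 * k)). assert (0 < k ^ 2) by lra. assert (0 < ln (200 / k ^ 2)).
  { rewrite <- ln_1. apply ln_increasing; [lra|]. apply (Rmult_lt_reg_r (k ^ 2)); [easy|].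
    unfold Rdiv. rewrite Rmult_assoc, Rinv_l; nra. }
  assert (0 < T1) by (apply Rdiv_lt_0_compat; lra).
  assert (Hs : forall x, T1 <= x -> 0 < s x <= k ^ 2 / 40).
  { intros x Hx. splits. eapply Rle_trans; [apply (sch_le)|]. rewrite Rabs_right by lra.
    apply Rle_trans with (4 * (k ^ 2 / 200)); [|lra]. apply Rmult_le_compat_l; [lra|].
    replace (k ^ 2 / 200) with (/ (200 / k ^ 2)) by algebra.
    rewrite <- (exp_ln (200 / k ^ 2)) by pos. rewrite <- exp_Ropp. apply exp_le.
    assert (T1 * (2 * k) = ln (200 / k ^ 2)) by (unfold T1; field; lra). nra. }
  assert (Hz1 : forall x, T1 <= x -> 1 <= zu v x).
  { intros x Hx. specialize (Hs x Hx). pose proof (rho0_pos x) as Hr. pose proof (rho0_lt1 x).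
    assert (1 <= yu v x).
    { unfold yu. assert (39 / 40 <= t x ^ 2) by (unfold sch in Hs; lra).
      assert (9 <= t x ^ 2 / (4 * s x)).
      { apply (Rmult_le_reg_r (4 * s x)); [lra|]. unfold Rdiv. rewrite Rmult_assoc, Rinv_l by lra.
        nra. }
      assert (0 <= k * x * t x * s x). { pose proof (th_pos x ltac:(lra)). pos. } nra. }
    unfold zu. apply (Rmult_le_reg_r (r0 x)); [easy|]. unfold Rdiv.
    rewrite Rmult_assoc, Rinv_l; lra. }
  assert (Hdf : forall x, T1 <= x -> k ^ 2 <= dfamp v (r0 x)).
  { intros x Hx. specialize (Hs x Hx). pose proof (rho0_sq_sch x). pose proof (rho0_pos x) as Hr.
    unfold dfamp. set (q := r0 x ^ 2) in *. assert (1 - k ^ 2 / 40 <= q) by nra.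
    replace (3 * v ^ 2 / r0 x ^ 4) with (3 * v ^ 2 / q ^ 2) by (unfold q; field; lra).
    assert (v ^ 2 / q ^ 2 <= v ^ 2 + v ^ 2 * (k ^ 2 / 10)).
    { apply (Rmult_le_reg_r (q ^ 2)); [nra|]. unfold Rdiv. rewrite Rmult_assoc, Rinv_l by nra.
      rewrite Rmult_1_r. rewrite <- (Rmult_1_r (v ^ 2)) at 1.
      replace ((v ^ 2 + v ^ 2 * (k ^ 2 * / 10)) * q ^ 2) with (v ^ 2 * ((1 + k ^ 2 / 10) * q ^ 2))
        by field.
      apply Rmult_le_compat_l; [lra|]. nra. }
    nra. }
  pose (d := Rabs (zu' v T1)). exists (T1 + (1 + d) / k ^ 2). assert (0 <= d) by apply Rabs_pos.
  assert (0 < (1 + d) / k ^ 2) by pos. splits. intros x Hx. split; [apply Hz1; lra|].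
  destruct (mvt (zu' v) (fun x => dfamp v (r0 x) * zu v x) T1 x) as [c [Hc E]]; [lra| |].
  { derive. }
  assert (k ^ 2 <= dfamp v (r0 c) * zu v c).
  { specialize (Hz1 c ltac:(lra)). specialize (Hdf c ltac:(lra)). nra. }
  assert (- d <= zu' v T1) by (unfold d; pose proof (Rle_abs (- zu' v T1)); rewrite Rabs_Ropp in *;
    lra).
  assert (1 + d <= k ^ 2 * (x - T1)); [|nra].
  replace (1 + d) with (k ^ 2 * ((1 + d) / k ^ 2)) by algebra. mono.
Qed.

End Modes.

(** * Inverting the linearized operator *)

Lemma cont_of_derive (f f' : R -> R) : (forall x, is_derive f x (f' x)) -> cont f.
Proof. intros H x. apply (ex_derive_continuous (V := R_NormedModule)). now exists (f' x). Qed.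

Lemma cont_mult (f g : R -> R) : cont f -> cont g -> cont (fun x => f x * g x).
Proof. intros Hf Hg x. apply (continuous_mult f g); auto. Qed.

Lemma cont_plus (f g : R -> R) : cont f -> cont g -> cont (fun x => f x + g x).
Proof. intros Hf Hg x. apply (continuous_plus f g); auto. Qed.

Lemma cont_const (c : R) : cont (fun _ => c).
Proof. intros x. apply continuous_const. Qed.

Lemma cont_minus (f g : R -> R) : cont f -> cont g -> cont (fun x => f x - g x).
Proof. intros Hf Hg x. apply (continuous_minus f g); auto. Qed.

Lemma cont_opp (f : R -> R) : cont f -> cont (fun x => - f x).
Proof. intros Hf x. apply (continuous_opp (V := R_NormedModule) f); auto. Qed.

Lemma cont_Rabs (f : R -> R) : cont f -> cont (fun x => Rabs (f x)).
Proof. intros Hf x. apply (continuous_comp f Rabs); [easy|apply (continuous_Rabs (f x))]. Qed.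

Lemma cont_pow (f : R -> R) (n : nat) : cont f -> cont (fun x => f x ^ n).
Proof.
  intros Hf. induction n as [|n IH]; [apply (cont_const 1)|].
  apply (cont_mult f (fun x => f x ^ n)); assumption.
Qed.

Lemma cont_id : cont (fun x => x).
Proof. easy. Qed.

Lemma cont_ext (f g : R -> R) : (forall x, f x = g x) -> cont f -> cont g.
Proof. intros He Hf x. apply (continuous_ext f); [easy|easy]. Qed.

Lemma cont_comp (f g : R -> R) : cont f -> cont g -> cont (fun x => f (g x)).
Proof. intros Hf Hg x. apply continuous_comp; auto. Qed.

Create HintDb cont discriminated.
#[global] Hint Constants Opaque : cont.

Ltac solve_cont := intros;
  match goal with
  | |- cont (fun _ => ?c) => apply (cont_const c)
  | |- cont (fun x => x) => apply cont_id
  | |- cont (fun x => @?f x + @?g x) => apply (cont_plus f g); solve_cont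
  | |- cont (fun x => @?f x - @?g x) => apply (cont_minus f g); solve_cont
  | |- cont (fun x => @?f x * @?g x) => apply (cont_mult f g); solve_cont
  | |- cont (fun x => - @?f x) => apply (cont_opp f); solve_cont
  | |- cont (fun x => @?f x ^ ?n) => apply (cont_pow f n); solve_cont
  | |- cont (fun x => Rabs (@?f x)) => apply (cont_Rabs f); solve_cont
  | H : _ |- _ => apply H; solve [easy | lia]
  | |- _ => solve [auto with cont]
  | |- cont (fun x => ?f (@?g x)) => apply (cont_comp f g); solve_cont
  | H : forall x, is_derive ?f x _ |- cont ?f => apply (cont_of_derive _ _ H)
  | H : forall x, is_derive ?f x _ |- cont (fun x => ?f x) => apply (cont_of_derive _ _ H)
  end.

(* [|x - z| + |z - Z| >= |x - Z|] is used with the smaller of the two rates, and the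
   rest of the larger rate makes the bound integrable in [z]. *)
Lemma exp_conv (a b x z Z : R) : 0 <= a -> 0 <= b -> a <> b ->
  exp (- a * Rabs (x - z)) * exp (- b * Rabs (z - Z)) <=
  exp (- Rmin a b * Rabs (x - Z)) *
  exp (- Rabs (a - b) * Rabs (z - (if Rlt_dec a b then Z else x))).
Proof.
  intros Ha Hb Hne. rewrite <- !exp_plus. apply exp_le.
  pose proof (Rabs_triang (x - z) (z - Z)) as Ht.
  replace (x - z + (z - Z)) with (x - Z) in Ht by ring. destruct (Rlt_dec a b).
  - rewrite Rmin_left, (Rabs_left (a - b)) by lra. nra.
  - rewrite Rmin_right, (Rabs_right (a - b)) by lra. rewrite (Rabs_minus_sym z x). nra.
Qed.

Section Solve.

Context {sp : speed}.
Notation v := (@vel sp).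
Notation k := (kap v).
Notation r0 := (rho0 v).

Definition zsI (S : R -> R) (x : R) : R := tail (fun z => zs v z * S z) x.
Definition zuI (S : R -> R) (x : R) : R := RInt (fun z => zu v z * S z) 0 x.
(** Variation of parameters. The integral against [zs] runs to [+oo], which suppresses the growing
    mode there; the integral against [zu] starts at 0, which makes the derivative of the solution
    vanish at 0 because [zu' v 0 = 0]. *)
Definition solve (S : R -> R) (x : R) : R :=
  - / k ^ 4 * (zu v x * zsI S x + zs v x * zuI S x).
Definition solve' (S : R -> R) (x : R) : R :=
  - / k ^ 4 * (zu' v x * zsI S x + famp v (r0 x) * zuI S x).

Lemma cont_zs : cont (zs v).
Proof. apply (cont_of_derive _ _ is_derive_zs). Qed.

Lemma cont_zu : cont (zu v).
Proof. apply (cont_of_derive _ _ is_derive_zu). Qed.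

Lemma cont_rho0 : cont r0.
Proof. apply (cont_of_derive _ _ is_derive_rho0). Qed.

Lemma kap4_pos : 0 < k ^ 4.
Proof. pos. Qed.

Lemma zsI_lim (S : R -> R) (x K : R) : cont S -> (forall z, x <= z -> Rabs (S z) <= K) ->
  is_lim (fun b => RInt (fun z => zs v z * S z) x b) p_infty (zsI S x).
Proof.
  intros HS HK. destruct modes_bound as [C [HC Hm]].
  assert (0 <= K) by (specialize (HK x (Rle_refl _)); pose proof (Rabs_pos (S x)); lra).
  pose proof kap_pos. apply (tail_correct _ x (C * K) (2 * k) 0); [|lra|nra|].
  - apply cont_mult; [apply cont_zs|easy].
  - intros z Hz. destruct (Hm z) as [Hz1 _]. rewrite Rminus_0_r.
    replace (C * K * _) with (C * exp (- (2 * k) * Rabs z) * K) by ring. mono.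
Qed.

Lemma solve_derive (S : R -> R) (x0 K : R) : cont S -> (forall z, x0 <= z -> Rabs (S z) <= K) ->
  forall x, is_derive (solve S) x (solve' S x) /\
    is_derive (solve' S) x (dfamp v (r0 x) * solve S x + S x).
Proof.
  intros HS HK x. assert (H1 : is_derive (zsI S) x (- (zs v x * S x))).
  { apply (is_derive_tail (fun z => zs v z * S z) x0 (zsI S x0)).
    - apply cont_mult; [apply cont_zs|easy].
    - now apply (zsI_lim S x0 K). }
  assert (H2 : is_derive (zuI S) x (zu v x * S x)).
  { apply (is_derive_RInt_cont (fun z => zu v z * S z)). apply cont_mult; [apply cont_zu|easy]. }
  pose proof (is_derive_zs x) as Hzs. pose proof (is_derive_zu x) as Hzu.
  pose proof (is_derive_zu' x) as Hzu'. pose proof (is_derive_rho0 x) as Hr.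
  pose proof (rho0_pos x). pose proof kap4_pos.
  pose proof (is_derive_famp r0 x (zs v x) ltac:(lra) Hr). split.
  - unfold solve. set (c := - / k ^ 4). auto_derive; [solve_ex_derive|].
    rewrite (Derive_eta H1), (Derive_eta H2), (Derive_eta Hzs), (Derive_eta Hzu). unfold solve'.
    unfold c. ring.
  - assert (Hg : exists g : R -> R, (forall y, g y = famp v (r0 y)) /\ is_derive g x (dfamp v (r0 x)
      * zs v x)) by (eexists; split; [reflexivity|easy]).
    destruct Hg as [g [Eg Hg]].
    apply (is_derive_ext (fun x : R => - / k ^ 4 * (zu' v x * zsI S x + g x * zuI S x))).
    { intros y. now rewrite Eg. }
    set (c := - / k ^ 4). auto_derive; [solve_ex_derive|].
    rewrite (Derive_eta H1), (Derive_eta H2), (Derive_eta Hzu'), (Derive_eta Hg), Eg.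
    pose proof (wronskian x) as W.
    transitivity (dfamp v (r0 x) * solve S x + / k ^ 4 * (zs v x * zu' v x - famp v (r0 x) * zu v x)
      * S x).
    + unfold solve, c. ring.
    + rewrite W, Rinv_l; lra.
Qed.

Lemma solve'_0 (S : R -> R) : solve' S 0 = 0.
Proof. unfold solve', zuI. rewrite zu'_0, RInt_point. cbn; lra. Qed.

(* For [x >= -1] the estimate sees only the values of [S] on [[-1, oo)]. *)
Lemma solve_bound : exists C, 0 < C /\
  forall (S : R -> R) (K b Z x : R), cont S -> 0 <= b -> b <> 2 * k -> 0 <= K -> - 1 <= x ->
  (forall z, - 1 <= z -> Rabs (S z) <= K * exp (- b * Rabs (z - Z))) ->
  Rabs (solve S x) <= C / Rabs (2 * k - b) * K * exp (- Rmin (2 * k) b * Rabs (x - Z)) /\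
  Rabs (solve' S x) <= C / Rabs (2 * k - b) * K * exp (- Rmin (2 * k) b * Rabs (x - Z)).
Proof.
  destruct modes_bound as [C [HC Hm]]. pose proof kap_pos.
  exists (/ k ^ 4 * (2 * (C * (C * exp (4 * k) * PI)))). split. { pos. }
  intros S K b Z x HS Hb Hne HK Hx HSb. set (m := Rmin (2 * k) b). set (g := Rabs (2 * k - b)).
  assert (0 < g) by (apply Rabs_pos_lt; lra). set (M := exp (- m * Rabs (x - Z))).
  assert (0 < M) by apply exp_pos. set (c := if Rlt_dec (2 * k) b then Z else x).
  set (A := C * exp (4 * k) * PI) in *.
  assert (forall z, exp (- (2 * k) * Rabs (x - z)) * exp (- b * Rabs (z - Z)) <= M * exp (- g * Rabs
    (z - c))).
  { intros z. apply exp_conv; lra. }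
  assert (Rabs (zsI S x) <= A / g * K * M * exp (- (2 * k) * Rabs x)).
  { apply Rle_trans with (C * exp (4 * k) * K * M * exp (- (2 * k) * Rabs x) * (PI / g)).
    - apply (tail_bound _ x _ g c).
      + apply cont_mult; [apply cont_zs|easy].
      + easy.
      + pos.
      + intros z Hz. destruct (Hm z) as [Hz1 _]. specialize (HSb z ltac:(lra)).
        eapply Rle_trans; [apply Rabs_mult_le; [exact Hz1|exact HSb]|].
        (* For [x >= 0] this holds without the factor; [exp (4 k)] pays for [- 1 <= x < 0], where
           [|x| + |x - z|] exceeds [|z|] by at most 2. *)
        assert (exp (- (2 * k) * Rabs z) <= exp (4 * k) * exp (- (2 * k) * Rabs x) * exp (- (2 * k)
          * Rabs (x - z))).
        { rewrite <- !exp_plus. apply exp_le. rewrite (Rabs_left1 (x - z)) by lra. unfold Rabs.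
          destruct (Rcase_abs x), (Rcase_abs z); nra. }
        apply Rle_trans with (C * K * (exp (4 * k) * exp (- (2 * k) * Rabs x)) * (exp (- (2 * k) *
          Rabs (x - z)) * exp (- b * Rabs (z - Z)))).
        * replace (C * exp (- (2 * k) * Rabs z) * (K * exp (- b * Rabs (z - Z)))) with (C * K * exp
            (- b * Rabs (z - Z)) * exp (- (2 * k) * Rabs z)) by ring.
          replace (C * K * (exp (4 * k) * exp (- (2 * k) * Rabs x)) * (exp (- (2 * k) * Rabs (x -
            z)) * exp (- b * Rabs (z - Z)))) with (C * K * exp (- b * Rabs (z - Z)) * (exp (4 * k) *
            exp (- (2 * k) * Rabs x) * exp (- (2 * k) * Rabs (x - z)))) by ring.
          mono.
        * replace (C * exp (4 * k) * K * M * exp (- (2 * k) * Rabs x) * exp (- g * Rabs (z - c)))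
            with (C * K * (exp (4 * k) * exp (- (2 * k) * Rabs x)) * (M * exp (- g * Rabs (z - c))))
            by ring.
          mono.
    - unfold A. lra. }
  (* The interval [[p, q]] is the one between 0 and [x], in either order; on it
     [|x - z| = |x| - |z|], so the growth of [zu] at [z] is the growth at [x] damped by
     [exp (- 2 k |x - z|)]. *)
  assert (Hfin : forall p q, p <= q -> (forall z, p <= z <= q -> - 1 <= z /\ Rabs z <= Rabs x /\
    Rabs (x - z) = Rabs x - Rabs z) -> Rabs (RInt (fun z => zu v z * S z) p q) <= A / g * K * M *
    exp (2 * k * Rabs x)).
  { intros p q Hpq Hz. apply Rle_trans with (C * K * M * exp (2 * k * Rabs x) * (PI / g)).
    - apply (RInt_exp_bound _ p q _ g c).
      + apply cont_mult; [apply cont_zu|easy].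
      + easy.
      + easy.
      + pos.
      + intros z Hz'. destruct (Hz z Hz') as [Hz1 [Hz2 Hz3]]. destruct (Hm z) as [_ [_ [Hzu _]]].
        specialize (HSb z Hz1). eapply Rle_trans; [apply Rabs_mult_le; [exact Hzu|exact HSb]|].
        replace (exp (2 * k * Rabs z)) with (exp (2 * k * Rabs x) * exp (- (2 * k) * Rabs (x - z))).
        2:{ rewrite <- exp_plus. f_equal. nra. }
        replace (C * (exp (2 * k * Rabs x) * exp (- (2 * k) * Rabs (x - z))) * (K * exp (- b * Rabs
          (z - Z)))) with (C * K * exp (2 * k * Rabs x) * (exp (- (2 * k) * Rabs (x - z)) * exp (- b
          * Rabs (z - Z)))) by ring.
        replace (C * K * M * exp (2 * k * Rabs x) * exp (- g * Rabs (z - c))) with (C * K * exp (2 *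
          k * Rabs x) * (M * exp (- g * Rabs (z - c)))) by ring.
        mono.
    - assert (1 <= exp (4 * k)) by (rewrite <- exp_0; apply exp_le; lra).
      assert (0 <= C * K * M * exp (2 * k * Rabs x) * (PI / g)) by pos.
      replace (A / g * K * M * exp (2 * k * Rabs x)) with (C * K * M * exp (2 * k * Rabs x) * (PI /
        g) * exp (4 * k)) by (unfold A; field; lra).
      nra. }
  assert (Rabs (zuI S x) <= A / g * K * M * exp (2 * k * Rabs x)).
  { unfold zuI. destruct (Rle_dec 0 x) as [Hx0|Hx0].
    - apply Hfin; [easy|]. intros z Hz. rewrite !Rabs_right by lra. lra.
    - rewrite <- (opp_RInt_swap (V := R_CompleteNormedModule)).
      + rewrite Rabs_Ropp. apply Hfin; [lra|]. intros z Hz.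
        rewrite (Rabs_left1 x), (Rabs_left1 z), (Rabs_left1 (x - z)) by lra. lra.
      + apply ex_RInt_cont. apply cont_mult; [apply cont_zu|easy]. }
  assert (forall p q, Rabs p <= C * exp (2 * k * Rabs x) -> Rabs q <= C * exp (- (2 * k) * Rabs x)
    -> Rabs (- / k ^ 4 * (p * zsI S x + q * zuI S x)) <= / k ^ 4 * (2 * (C * A)) / g * K * M).
  { intros p q Hp Hq. rewrite Rabs_mult, Rabs_Ropp, Rabs_right. 2:{ pos. }
    replace (/ k ^ 4 * (2 * (C * A)) / g * K * M) with (/ k ^ 4 * (C * (A / g * K * M) + C * (A / g
      * K * M))) by lra.
    apply Rmult_le_compat_l; [pos|]. triangle.
    assert (HE : exp (2 * k * Rabs x) * exp (- (2 * k) * Rabs x) = 1).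
    { rewrite <- exp_plus, <- exp_0. f_equal. ring. }
    apply Rplus_le_compat; (eapply Rle_trans; [apply Rabs_mult_le; eassumption|]); right.
    - replace (C * exp (2 * k * Rabs x) * (A / g * K * M * exp (- (2 * k) * Rabs x))) with (C * (A /
        g * K * M) * (exp (2 * k * Rabs x) * exp (- (2 * k) * Rabs x))) by ring.
      rewrite HE. ring.
    - replace (C * exp (- (2 * k) * Rabs x) * (A / g * K * M * exp (2 * k * Rabs x))) with (C * (A /
        g * K * M) * (exp (2 * k * Rabs x) * exp (- (2 * k) * Rabs x))) by ring.
      rewrite HE. ring. }
  destruct (Hm x) as [Ha [Hb' [Hc Hd]]]. eauto.
Qed.

End Solve.

#[global] Hint Resolve cont_zs cont_zu cont_rho0 : cont.

(** * Formal power series in the potential strength *)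

Fixpoint sumn (n : nat) (f : nat -> R) : R :=
  match n with O => 0 | S m => sumn m f + f m end.

Lemma sumn_ext (n : nat) (f g : nat -> R) :
  (forall i, (i < n)%nat -> f i = g i) -> sumn n f = sumn n g.
Proof. induction n as [|n IH]; intros H; [easy|]. cbn. rewrite IH, H; auto. Qed.

Lemma sumn_abs_le (n : nat) (f g : nat -> R) :
  (forall i, (i < n)%nat -> Rabs (f i) <= g i) -> Rabs (sumn n f) <= sumn n g.
Proof. induction n as [|n IH]; intros H; cbn; [rewrite Rabs_R0; lra|]. mono. Qed.

Lemma sumn_scal (n : nat) (c : R) (f : nat -> R) : sumn n (fun i => c * f i) = c * sumn n f.
Proof. induction n as [|n IH]; cbn; [ring|]. lra. Qed.

Lemma sumn_plus (n : nat) (f g : nat -> R) :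
  sumn n (fun i => f i + g i) = sumn n f + sumn n g.
Proof. induction n as [|n IH]; cbn; [ring|]. lra. Qed.

Lemma sumn_shift (n : nat) (f : nat -> R) : sumn (S n) f = f O + sumn n (fun i => f (S i)).
Proof.
  induction n as [|n IH]; [cbn; ring|].
  change (sumn (S n) f + f (S n) = f O + (sumn n (fun i => f (S i)) + f (S n))). lra.
Qed.

Lemma sumn_rev (n : nat) (f : nat -> R) : sumn n (fun i => f (n - 1 - i)%nat) = sumn n f.
Proof.
  induction n as [|n IH]; [easy|]. rewrite sumn_shift. cbn [sumn]. rewrite <- IH.
  replace (S n - 1 - 0)%nat with n by lia. rewrite Rplus_comm. f_equal. apply sumn_ext. intros i Hi.
  f_equal. lia.
Qed.

Lemma sumn_sum_f_R0 (n : nat) (f : nat -> R) : sum_f_R0 f n = sumn (S n) f.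
Proof. induction n as [|n IH]; [cbn; ring|]. cbn [sum_f_R0]. rewrite IH. easy. Qed.

(* The part of the coefficient [S m] of the product of two power series that involves no
   coefficient of index [0] or [S m]. *)
Definition mid (a c : nat -> R) (m : nat) : R := sumn m (fun i => a (S i) * c (m - i)%nat).

Lemma mid_ext (a a' c c' : nat -> R) (m : nat) :
  (forall i, (i <= m)%nat -> a i = a' i) -> (forall i, (i <= m)%nat -> c i = c' i) ->
  mid a c m = mid a' c' m.
Proof. intros H1 H2. apply sumn_ext. intros i Hi. rewrite H1, H2 by lia. easy. Qed.

Lemma PS_mult_S (a c : nat -> R) (m : nat) :
  PS_mult a c (S m) = a O * c (S m) + mid a c m + a (S m) * c O.
Proof.
  unfold PS_mult. rewrite sumn_sum_f_R0. rewrite sumn_shift. cbn [sumn].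
  rewrite Nat.sub_0_r, Nat.sub_diag. eauto with real.
Qed.

Lemma PS_mult_0 (a c : nat -> R) : PS_mult a c O = a O * c O.
Proof. reflexivity. Qed.

Definition sq (a : nat -> R) : nat -> R := PS_mult a a.
Definition cube (a : nat -> R) : nat -> R := PS_mult a (PS_mult a a).

(* The coefficient [S m] of the cube when the coefficient [S m] of [a] is replaced by [0]. *)
Definition cubelow (a : nat -> R) (m : nat) : R := a O * mid a a m + mid a (sq a) m.

Lemma cube_S (a : nat -> R) (m : nat) :
  cube a (S m) = 3 * a O ^ 2 * a (S m) + cubelow a m.
Proof. unfold cube, cubelow. rewrite PS_mult_S, PS_mult_S, PS_mult_0. unfold sq. ring. Qed.

(** Geometric growth damped by [1 / (n + 1)^2]: up to a constant factor this sequence reproduces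
    itself under Cauchy products, which a purely geometric one does not. *)
Definition maj (B : R) (n : nat) : R := B ^ n / (INR n + 1) ^ 2.

Lemma maj_pos (B : R) (n : nat) : 0 < B -> 0 < maj B n.
Proof. intros HB. apply Rdiv_lt_0_compat; [pos|]. pos. Qed.

Lemma maj_le (B : R) (n : nat) : 0 < B -> maj B n <= B ^ n.
Proof.
  intros HB. unfold maj. pose proof (pow_lt B n HB). pose proof (pos_INR n).
  apply (Rmult_le_reg_r ((INR n + 1) ^ 2)); [pos|]. unfold Rdiv. rewrite Rmult_assoc, Rinv_l by nra.
  nra.
Qed.

(** One order gains a factor [4 / B]; this is how a large [B] makes the linear term with the
    potential small. *)
Lemma maj_step (B : R) (n : nat) : 0 < B -> maj B n <= 4 / B * maj B (S n).
Proof.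
  intros HB. unfold maj. rewrite S_INR. pose proof (pos_INR n). pose proof (pow_lt B n HB).
  cbn [pow].
  replace (4 / B * (B * B ^ n / ((INR n + 1 + 1) * ((INR n + 1 + 1) * 1)))) with (B ^ n * (4 / (INR
    n + 2) ^ 2)) by algebra.
  apply (Rmult_le_reg_r ((INR n + 1) ^ 2 * (INR n + 2) ^ 2)); [pos|]. field_simplify; [|lra|lra].
  nra.
Qed.

Lemma sum_inv_sq (m : nat) : sumn m (fun i => / (INR i + 2) ^ 2) <= 1.
Proof.
  assert (sumn m (fun i => / (INR i + 2) ^ 2) <= 1 - / (INR m + 1)).
  { induction m as [|m IH]; [cbn; rewrite Rplus_0_l, Rinv_1; lra|]. cbn [sumn]. rewrite S_INR.
    pose proof (pos_INR m). assert (/ (INR m + 2) ^ 2 <= / (INR m + 1) - / (INR m + 1 + 1)); [|lra].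
    replace (/ (INR m + 1) - / (INR m + 1 + 1)) with (/ ((INR m + 1) * (INR m + 2))) by algebra.
    mono. }
  assert (0 < / (INR m + 1)) by pos. lra.
Qed.

Lemma maj_conv (B : R) (m : nat) : 0 < B ->
  sumn m (fun i => maj B (S i) * maj B (m - i)%nat) <= 4 * maj B (S m).
Proof.
  intros HB.
  (* [1 / (p q)^2 <= 2 (1 / p^2 + 1 / q^2) / (p + q)^2] *)
  pose (c := B ^ S m / (INR m + 2) ^ 2). assert (0 < c). { apply Rdiv_lt_0_compat; [pos|]. pos. }
  apply Rle_trans with (sumn m (fun i => 2 * c * (/ (INR i + 2) ^ 2 + / (INR (m - 1 - i) + 2) ^
    2))).
  - assert (Rabs (sumn m (fun i => maj B (S i) * maj B (m - i))) <= sumn m (fun i => 2 * c * (/ (INR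
      i + 2) ^ 2 + / (INR (m - 1 - i) + 2) ^ 2))).
    2:{ bound. } apply sumn_abs_le. intros i Hi.
    rewrite Rabs_right by (apply Rle_ge; left; apply Rmult_lt_0_compat; now apply maj_pos).
    unfold maj, c. replace (m - i)%nat with (S (m - 1 - i)) by lia. set (j := (m - 1 - i)%nat).
    rewrite !S_INR.
    replace (INR m) with (INR i + INR j + 1) by (replace m with (S (i + j)) by lia; rewrite S_INR,
      plus_INR; ring).
    replace (S m) with (S i + S j)%nat by lia. rewrite pow_add. pose proof (pos_INR i).
    pose proof (pos_INR j). set (p := INR i) in *. set (q := INR j) in *.
    set (E := B ^ S i * B ^ S j). assert (0 < E) by (apply Rmult_lt_0_compat; now apply pow_lt).
    replace (B ^ S i / (p + 1 + 1) ^ 2 * (B ^ S j / (q + 1 + 1) ^ 2)) with (E * (/ (p + 2) ^ 2 * /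
      (q + 2) ^ 2)) by (unfold E; field; lra).
    replace (2 * (E / (p + q + 1 + 2) ^ 2) * (/ (p + 2) ^ 2 + / (q + 2) ^ 2)) with (E * (2 / (p + q
      + 3) ^ 2 * (/ (p + 2) ^ 2 + / (q + 2) ^ 2))) by algebra.
    apply Rmult_le_compat_l; [lra|].
    apply (Rmult_le_reg_r ((p + 2) ^ 2 * (q + 2) ^ 2 * (p + q + 3) ^ 2)). { pos. }
    replace (/ (p + 2) ^ 2 * / (q + 2) ^ 2 * ((p + 2) ^ 2 * (q + 2) ^ 2 * (p + q + 3) ^ 2)) with ((p
      + q + 3) ^ 2) by algebra.
    replace (2 / (p + q + 3) ^ 2 * (/ (p + 2) ^ 2 + / (q + 2) ^ 2) * ((p + 2) ^ 2 * (q + 2) ^ 2 * (p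
      + q + 3) ^ 2)) with (2 * ((p + 2) ^ 2 + (q + 2) ^ 2)) by algebra.
    pose proof (pow2_ge_0 (p - q)). lra.
  - rewrite sumn_scal, sumn_plus, (sumn_rev m (fun i => / (INR i + 2) ^ 2)).
    pose proof (sum_inv_sq m). unfold maj. rewrite S_INR.
    replace (INR m + 1 + 1) with (INR m + 2) by ring. fold c. nra.
Qed.

Lemma mid_bound (a c : nat -> R) (om : nat -> R) (A C B sg : R) (m : nat) :
  0 < B -> 0 <= A -> 0 <= C ->
  (forall i, (1 <= i <= m)%nat -> Rabs (a i) <= A * maj B i * om i) ->
  (forall i, (1 <= i <= m)%nat -> Rabs (c i) <= C * maj B i * om i) ->
  (forall i j, (1 <= i)%nat -> (1 <= j)%nat -> (i + j = S m)%nat -> om i * om j <= sg) ->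
  0 <= sg ->
  Rabs (mid a c m) <= 4 * A * C * maj B (S m) * sg.
Proof.
  intros HB HA HC Ha Hc Ho Hsg.
  apply Rle_trans with (sumn m (fun i => (A * C * sg) * (maj B (S i) * maj B (m - i)%nat))).
  - apply sumn_abs_le. intros i Hi.
    eapply Rle_trans; [apply Rabs_mult_le; [apply Ha|apply Hc]; lia|].
    specialize (Ho (S i) (m - i)%nat ltac:(lia) ltac:(lia) ltac:(lia)).
    pose proof (maj_pos B (S i) HB). pose proof (maj_pos B (m - i) HB).
    replace (A * maj B (S i) * om (S i) * (C * maj B (m - i) * om (m - i)%nat)) with (A * C * (maj B
      (S i) * maj B (m - i)) * (om (S i) * om (m - i)%nat)) by ring.
    replace (A * C * sg * (maj B (S i) * maj B (m - i))) with (A * C * (maj B (S i) * maj B (m - i))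
      * sg) by ring.
    mono.
  - rewrite sumn_scal. pose proof (maj_conv B m HB).
    replace (4 * A * C * maj B (S m) * sg) with (A * C * sg * (4 * maj B (S m))) by ring. mono.
Qed.

Lemma sq_ext (a a' : nat -> R) (m : nat) :
  (forall i, (i <= m)%nat -> a i = a' i) -> sq a m = sq a' m.
Proof.
  intros H. unfold sq, PS_mult. rewrite !sumn_sum_f_R0. apply sumn_ext. intros i Hi.
  rewrite !H by lia. easy.
Qed.

Lemma cubelow_ext (a a' : nat -> R) (m : nat) :
  (forall i, (i <= m)%nat -> a i = a' i) -> cubelow a m = cubelow a' m.
Proof.
  intros H. unfold cubelow. rewrite (H O) by lia.
  rewrite (mid_ext a a' a a' m), (mid_ext a a' (sq a) (sq a') m); auto. intros i Hi. apply sq_ext.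
  solve_cont.
Qed.

Lemma cubelow_bound (a : nat -> R) (om : nat -> R) (A B a0 sg : R) (m : nat) :
  0 < B -> 0 <= A -> 0 <= a0 -> Rabs (a O) <= a0 ->
  (forall i, (1 <= i <= m)%nat -> Rabs (a i) <= A * maj B i * om i) ->
  (forall i j, (1 <= i)%nat -> (1 <= j)%nat -> (i + j = S m)%nat -> om i * om j <= sg) ->
  (forall i j, (1 <= i)%nat -> (1 <= j)%nat -> (i + j <= m)%nat -> om i * om j <= om (i + j)%nat) ->
  (forall i, (1 <= i <= m)%nat -> 0 <= om i) ->
  0 <= sg ->
  Rabs (cubelow a m) <= (12 * a0 * A ^ 2 + 16 * A ^ 3) * maj B (S m) * sg.
Proof.
  intros HB HA Ha0 Ha00 Ha Ho1 Ho2 Hom Hsg. unfold cubelow.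
  assert (Rabs (mid a a m) <= 4 * A * A * maj B (S m) * sg) by now apply (mid_bound _ _ om).
  assert (forall i, (1 <= i <= m)%nat -> Rabs (sq a i) <= (2 * a0 * A + 4 * A * A) * maj B i * om
    i).
  { intros [|i] Hi; [lia|]. unfold sq. rewrite PS_mult_S.
    assert (Rabs (mid a a i) <= 4 * A * A * maj B (S i) * om (S i)).
    { apply (mid_bound _ _ om); auto.
      - solve_cont.
      - solve_cont.
      - intros p q Hp Hq Hpq. rewrite <- Hpq. solve_cont. }
    replace (a O * a (S i) + mid a a i + a (S i) * a O) with (2 * (a O * a (S i)) + mid a a i) by
      ring.
    replace ((2 * a0 * A + 4 * A * A) * maj B (S i) * om (S i)) with (2 * (a0 * (A * maj B (S i) *
      om (S i))) + 4 * A * A * maj B (S i) * om (S i)) by ring.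
    mono. }
  assert (Rabs (mid a (sq a) m) <= 4 * A * (2 * a0 * A + 4 * A * A) * maj B (S m) * sg).
  { apply (mid_bound _ _ om); auto. nra. }
  apply Rle_trans with (a0 * (4 * A * A * maj B (S m) * sg) + 4 * A * (2 * a0 * A + 4 * A * A) * maj
    B (S m) * sg).
  - mono.
  - right. ring.
Qed.

(** * The recursion for the coefficients and its majorant *)

Section Recursion.

Context {sp : speed}.
Notation v := (@vel sp).
Notation k := (kap v).
Notation r0 := (rho0 v).

(* With [r = sum eps^n a_n] and [1 / r = sum eps^n g_n], the order [n + 1] of the amplitude
   equation reads [a_(n+1)'' = dfamp r0 a_(n+1) + src_n]. *)
Definition src (w : R -> R) (a g : nat -> R -> R) (n : nat) (x : R) : R :=
  2 * cubelow (fun i => a i x) n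
  + v ^ 2 * (cubelow (fun i => g i x) n
             - 3 * (/ r0 x) ^ 3 * mid (fun i => a i x) (fun i => g i x) n)
  + 2 * w x * a n x.

(** Order [n + 1] of the identity [r (1 / r) = 1], solved for the coefficient of [1 / r]; [y] stands
    for the coefficient [a_(n+1)]. *)
Definition gnext (a g : nat -> R -> R) (n : nat) (x y : R) : R :=
  - / r0 x * mid (fun i => a i x) (fun i => g i x) n - (/ r0 x) ^ 2 * y.

(** The part of the coefficient [n + 1] of [(r^2)' = 2 r r'] that contains neither [a_(n+1)] nor its
    derivative. *)
Definition dsq (a a1 : nat -> R -> R) (n : nat) (x : R) : R :=
  2 * mid (fun i => a i x) (fun i => a1 i x) n.

(** One induction serves the half-line and the whole line. The weights [om] are those of the
    coefficients and [sg] those of the sources; the last hypothesis is the linear estimate, which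
    may pass from [sg] to the weaker weight [om] at the cost of a constant [CL]. The induction
    closes because the nonlinear part of a source is quadratic in [A], while the part with the
    potential carries a factor [1 / B]: [A] is small against [CL], and then [B] is large against
    [A]. *)
Lemma majorant (Kw CL : R) : 0 <= Kw -> 0 <= CL ->
  exists A B G, 0 < A /\ 0 < B /\ 0 < G /\
  forall (D : R -> Prop) (om sg : nat -> R -> R) (w : R -> R) (a a1 g : nat -> R -> R),
  (forall x i j, D x -> (1 <= i)%nat -> (1 <= j)%nat -> om i x * om j x <= sg (i + j)%nat x) ->
  (forall x i, D x -> (1 <= i)%nat -> 0 <= sg i x <= om i x) ->
  (forall x, D x -> Rabs (w x) <= Kw * sg 1%nat x) ->
  (forall x i, D x -> (1 <= i)%nat -> Rabs (w x) * om i x <= Kw * sg (S i) x) ->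
  (forall x, a O x = r0 x) -> (forall x, g O x = / r0 x) ->
  (forall n x, g (S n) x = gnext a g n x (a (S n) x)) ->
  (forall n M, 0 <= M ->
     (forall x j, D x -> (1 <= j <= n)%nat -> Rabs (a j x) <= A * maj B j * om j x /\
       Rabs (a1 j x) <= A * maj B j * om j x /\ Rabs (g j x) <= G * maj B j * om j x) ->
     (forall j x, (j < n)%nat -> D x -> Rabs (src w a g j x) <= B * maj B (S j) * sg (S j) x) ->
     (forall x, D x -> Rabs (src w a g n x) <= M * sg (S n) x) ->
     (forall x, D x -> Rabs (dsq a a1 n x) <= M * sg (S n) x) ->
     forall x, D x -> Rabs (a (S n) x) <= CL * M * om (S n) x /\
       Rabs (a1 (S n) x) <= CL * M * om (S n) x) ->
  forall n x, D x ->
    (Rabs (a (S n) x) <= A * maj B (S n) * om (S n) x /\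
     Rabs (a1 (S n) x) <= A * maj B (S n) * om (S n) x /\
     Rabs (g (S n) x) <= G * maj B (S n) * om (S n) x) /\
    Rabs (src w a g n x) <= B * maj B (S n) * sg (S n) x.
Proof.
  intros HKw HCL. pose proof vabs_bounds as Hv. pose proof v2_bounds as Hv2. pose (i := / Rabs v).
  assert (Hi : 1 < i). { rewrite <- Rinv_1. apply Rinv_lt_contravar; lra. }
  assert (Hi6 : i <= i ^ 6 /\ 1 <= i ^ 6 /\ i ^ 5 <= i ^ 6).
  { assert (H : 1 <= i ^ 5) by (apply pow_R1_Rle; lra). nra. }
  pose (A := / (512 * i ^ 6 * (CL + 1))). assert (HAd : 0 < 512 * i ^ 6 * (CL + 1)) by nra.
  assert (HA : 0 < A) by now apply Rinv_0_lt_compat.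
  assert (HAe : A * (512 * i ^ 6 * (CL + 1)) = 1) by (unfold A; apply Rinv_l; lra).
  assert (HAi : 8 * i * A <= 1) by nra. pose (B := 16 * Kw * CL / A + 8 * Kw + 1).
  assert (HBp : 0 <= 16 * Kw * CL / A) by pos. assert (HB : 1 <= B) by (unfold B; lra).
  (* In [gnext] the term with [a_(n+1)] takes [i^2 A = G / 2], and the product term takes the other
     half because [8 i A <= 1]. *)
  pose (G := 2 * i ^ 2 * A). assert (HG : 0 < G) by (unfold G; nra).
  pose (M := 256 * i ^ 6 * A ^ 2 + 8 * Kw / B). assert (HKB : 0 <= 8 * Kw / B) by pos.
  assert (HM0 : 0 <= M) by (unfold M; nra). assert (HMA : CL * M <= A).
  { unfold M. assert (CL * (256 * i ^ 6 * A ^ 2) <= A / 2) by nra.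
    assert (CL * (8 * Kw / B) <= A / 2); [|lra]. apply (Rmult_le_reg_r B); [lra|].
    apply Rle_trans with (A / 2 * (16 * Kw * CL / A)); [right; field; lra|]. unfold B. nra. }
  assert (HMB : M <= B).
  { unfold M. assert (8 * Kw / B <= 8 * Kw).
    { apply (Rmult_le_reg_r B); [lra|]. replace (8 * Kw / B * B) with (8 * Kw) by algebra. nra. }
    assert (8 * Kw + 1 <= B) by (unfold B; lra). nra. }
  exists A, B, G. splits. intros D om sg w a a1 g Hos Hso Hw1 Hw2 Ha0 Hg0 Hg HL.
  assert (Hom : forall x j, D x -> (1 <= j)%nat -> 0 <= om j x).
  { intros x j Hx Hj. pose proof (Hso x j Hx Hj). lra. }
  assert (HB0 : 0 < B) by lra. assert (Hr : forall x, 0 < / r0 x <= i).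
  { intros x. pose proof (rho0_ge x). splits. apply Rinv_le_contravar; lra. }
  assert (step : forall n, (forall x j, D x -> (1 <= j <= n)%nat -> Rabs (a j x) <= A * maj B j * om
    j x /\ Rabs (a1 j x) <= A * maj B j * om j x /\ Rabs (g j x) <= G * maj B j * om j x) -> (forall
    j x, (j < n)%nat -> D x -> Rabs (src w a g j x) <= B * maj B (S j) * sg (S j) x) -> forall x, D
    x -> (Rabs (a (S n) x) <= A * maj B (S n) * om (S n) x /\ Rabs (a1 (S n) x) <= A * maj B (S n) *
    om (S n) x /\ Rabs (g (S n) x) <= G * maj B (S n) * om (S n) x) /\ Rabs (src w a g n x) <= B *
    maj B (S n) * sg (S n) x).
  { intros n IH IHs. pose proof (maj_pos B (S n) HB0) as Hu. set (u := maj B (S n)) in *.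
    assert (Hmag : forall x, D x -> Rabs (mid (fun j => a j x) (fun j => g j x) n) <= 4 * A * G * u
      * sg (S n) x).
    { intros x Hx. apply (mid_bound _ _ (fun j => om j x)); try lra.
      - solve_cont.
      - solve_cont.
      - intros p q Hp Hq <-. auto.
      - solve_cont. }
    assert (Hsrc : forall x, D x -> Rabs (src w a g n x) <= M * u * sg (S n) x).
    { intros x Hx. pose proof (Hso x (S n) Hx ltac:(lia)) as Hsg.
      assert (Hca : Rabs (cubelow (fun j => a j x) n) <= (12 * 1 * A ^ 2 + 16 * A ^ 3) * u * sg (S
        n) x).
      { apply (cubelow_bound _ (fun j => om j x)); try lra.
        - rewrite Ha0. pose proof (rho0_lt1 x). mono.
        - solve_cont.
        - intros p q Hp Hq <-. auto.
        - intros p q Hp Hq Hpq. eapply Rle_trans; [now apply Hos|]. solve_cont.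
        - bound. }
      assert (Hcg : Rabs (cubelow (fun j => g j x) n) <= (12 * i * G ^ 2 + 16 * G ^ 3) * u * sg (S
        n) x).
      { apply (cubelow_bound _ (fun j => om j x)); try lra.
        - rewrite Hg0. specialize (Hr x). mono.
        - solve_cont.
        - intros p q Hp Hq <-. auto.
        - intros p q Hp Hq Hpq. eapply Rle_trans; [now apply Hos|]. solve_cont.
        - bound. }
      (* At order 0 the factor [a_0 = rho0] does not decay, so the weight comes from [w] alone; at
         later orders [w] and [a_n] contribute together and [maj_step] supplies the factor
         [1 / B]. *)
      assert (Hwa : Rabs (2 * w x * a n x) <= 8 * Kw / B * u * sg (S n) x).
      { rewrite Rmult_assoc. destruct n as [|n].
        - replace (8 * Kw / B * u * sg 1%nat x) with (2 * (Kw * sg 1%nat x * 1)).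
          2:{ unfold u, maj. cbn. field. lra. }
          rewrite Ha0. pose proof (rho0_lt1 x). mono.
        - replace (8 * Kw / B * u * sg (S (S n)) x) with (2 * (4 / B * u * (Kw * sg (S (S n)) x)))
            by lra.
          apply Rabs_mult_le; [mono|]. destruct (IH x (S n) Hx ltac:(lia)) as [IHa _].
          apply Rle_trans with (Rabs (w x) * (A * maj B (S n) * om (S n) x)). { mono. }
          pose proof (maj_step B (S n) HB0) as Hst. fold u in Hst.
          pose proof (maj_pos B (S n) HB0) as Hun. pose proof (Hw2 x (S n) Hx ltac:(lia)) as Hw'.
          pose proof (Rabs_pos (w x)). pose proof (Hom x (S n) Hx ltac:(lia)).
          replace (Rabs (w x) * (A * maj B (S n) * om (S n) x)) with (A * maj B (S n) * (Rabs (w x)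
            * om (S n) x)) by ring.
          apply Rmult_le_compat; [nra|nra| |easy]. nra. }
      apply Rle_trans with (2 * ((12 * 1 * A ^ 2 + 16 * A ^ 3) * u * sg (S n) x) + 1 * ((12 * i * G
        ^ 2 + 16 * G ^ 3) * u * sg (S n) x + 3 * i ^ 3 * (4 * A * G * u * sg (S n) x)) + 8 * Kw / B
        * u * sg (S n) x).
      + triangle. apply Rplus_le_compat; [|easy]. triangle. apply Rplus_le_compat.
        * mono.
        * specialize (Hr x). mono.
      + replace (_ + _) with ((24 * A ^ 2 + 32 * A ^ 3 + 12 * i * G ^ 2 + 16 * G ^ 3 + 12 * i ^ 3 *
          A * G + 8 * Kw / B) * u * sg (S n) x) by ring.
        apply Rmult_le_compat_r; [lra|]. apply Rmult_le_compat_r; [lra|]. unfold M. unfold G. nra. }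
    assert (Hdsq : forall x, D x -> Rabs (dsq a a1 n x) <= M * u * sg (S n) x).
    { intros x Hx. pose proof (Hso x (S n) Hx ltac:(lia)) as Hsg.
      apply Rle_trans with (2 * (4 * A * A * u * sg (S n) x)).
      - apply Rabs_mult_le; [mono|]. apply (mid_bound _ _ (fun j => om j x)); try lra.
        + solve_cont.
        + solve_cont.
        + intros p q Hp Hq <-. auto.
      - replace (2 * (4 * A * A * u * sg (S n) x)) with ((8 * A ^ 2) * u * sg (S n) x) by ring.
        apply Rmult_le_compat_r; [lra|]. apply Rmult_le_compat_r; [lra|]. unfold M. nra. }
    intros x Hx. pose proof (Hso x (S n) Hx ltac:(lia)) as Hsg.
    destruct (HL n (M * u) ltac:(nra) IH IHs Hsrc Hdsq x Hx) as [H1 H2].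
    assert (CL * (M * u) * om (S n) x <= A * u * om (S n) x). { rewrite <- Rmult_assoc. mono. }
    split; [split; [lra|split; [lra|]]|].
    - rewrite Hg. unfold gnext, Rminus. specialize (Hr x).
      apply Rle_trans with (i * (4 * A * G * u * sg (S n) x) + i ^ 2 * (A * u * om (S n) x)).
      + mono.
      + apply Rle_trans with (i * (4 * A * G * u * om (S n) x) + i ^ 2 * (A * u * om (S n) x)).
        * mono.
        * replace (_ + _) with ((4 * (i * A) * G + i ^ 2 * A) * u * om (S n) x) by ring.
          apply Rmult_le_compat_r; [lra|]. apply Rmult_le_compat_r; [lra|].
          assert (i ^ 2 * A = G / 2) by (unfold G; field). nra.
    - eapply Rle_trans; [now apply Hsrc|]. mono. }
  assert (all : forall n, (forall x j, D x -> (1 <= j <= n)%nat -> Rabs (a j x) <= A * maj B j * om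
    j x /\ Rabs (a1 j x) <= A * maj B j * om j x /\ Rabs (g j x) <= G * maj B j * om j x) /\ (forall
    j x, (j < n)%nat -> D x -> Rabs (src w a g j x) <= B * maj B (S j) * sg (S j) x)).
  { induction n as [|n [IH IHs]]; [split; intros; lia|]. split.
    - intros x j Hx Hj. destruct (Nat.eq_dec j (S n)) as [->|Hne]; [|apply IH; [easy|lia]].
      solve_cont.
    - intros j x Hj Hx. destruct (Nat.eq_dec j n) as [->|Hne]; [|apply IHs; [lia|easy]]. solve_cont. }
  intros n x Hx. destruct (all n) as [H1 H2]. auto.
Qed.

End Recursion.

Definition pbound (K B : R) (c : nat -> R) : Prop := forall n, Rabs (c n) <= K * B ^ n.

Lemma pbound_ge0 (K B : R) (c : nat -> R) : pbound K B c -> 0 <= K.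
Proof. intros H. specialize (H O). bound. Qed.

Lemma pbound_cv (K B : R) (c : nat -> R) (e : R) : 0 < B -> pbound K B c -> Rabs e < / B ->
  Rbar_lt (Rabs e) (CV_radius c).
Proof.
  intros HB H He. apply (Rbar_lt_le_trans _ (/ B)); [easy|]. apply (CV_radius_bounded c). exists K.
  intros n. rewrite Rabs_mult. pose proof (pow_lt (/ B) n (Rinv_0_lt_compat _ HB)).
  rewrite (Rabs_right ((/ B) ^ n)) by lra.
  apply Rle_trans with (K * B ^ n * (/ B) ^ n); [apply Rmult_le_compat_r; [lra|apply H]|].
  rewrite Rmult_assoc, <- Rpow_mult_distr, Rinv_r, pow1 by lra. lra.
Qed.

Lemma pbound_ex (K B : R) (c : nat -> R) (e : R) : 0 < B -> pbound K B c -> Rabs e < / B ->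
  ex_series (fun n => c n * e ^ n).
Proof. intros HB H He. apply ex_series_Rabs, CV_disk_inside. now apply (pbound_cv K B). Qed.

Lemma pbound_exp (K B : R) (c : nat -> R) (e : R) : 0 < B -> pbound K B c -> Rabs e < / B ->
  ex_pseries c e.
Proof. intros HB H He. apply CV_radius_inside. now apply (pbound_cv K B). Qed.

(** The coefficient [n] of the product has [n + 1 <= 2^n] terms; this is where the doubled rate
    comes from. *)
Lemma pbound_mult (K L B : R) (a b : nat -> R) : 0 < B -> pbound K B a -> pbound L B b ->
  pbound (K * L) (2 * B) (PS_mult a b).
Proof.
  intros HB Ha Hb n. pose proof (pbound_ge0 _ _ _ Ha). pose proof (pbound_ge0 _ _ _ Hb).
  unfold PS_mult. rewrite sumn_sum_f_R0. apply Rle_trans with (sumn (S n) (fun _ => K * L * B ^ n)).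
  - apply sumn_abs_le. intros i Hi. eapply Rle_trans; [apply Rabs_mult_le; [apply Ha|apply Hb]|].
    right. replace n with (i + (n - i))%nat at 2 by lia. rewrite pow_add. ring.
  - rewrite Rpow_mult_distr. assert (Hs : forall m c, sumn m (fun _ => c) = INR m * c).
    { intros m c. induction m as [|m IH]; [cbn; ring|]. cbn [sumn]. rewrite IH, S_INR. ring. }
    rewrite Hs. assert (INR (S n) <= 2 ^ n).
    { induction n as [|n IH]; [cbn; lra|]. rewrite S_INR. cbn [pow].
      assert (1 <= 2 ^ n) by (apply pow_R1_Rle; lra). lra. }
    replace (K * L * (2 ^ n * B ^ n)) with (2 ^ n * (K * L * B ^ n)) by ring. mono.
Qed.

Lemma pbound_weaken (K B B' : R) (c : nat -> R) : 0 < B -> B <= B' -> pbound K B c -> pbound K B' c.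
Proof.
  intros HB Hle H n. eapply Rle_trans; [apply H|]. apply Rmult_le_compat_l.
  - now apply (pbound_ge0 K B c).
  - mono.
Qed.

Lemma series_half (u : nat -> R) (M : R) : (forall n, Rabs (u n) <= M * (/ 2) ^ n) ->
  ex_series u /\ Rabs (Series u) <= 2 * M.
Proof.
  intros H. assert (Hg : is_series (fun n => M * (/ 2) ^ n) (M * / (1 - / 2))).
  { apply (is_series_scal M (fun n => (/ 2) ^ n)). apply is_series_geom. bound. }
  assert (ex_series (fun n => M * (/ 2) ^ n)) by (eexists; exact Hg).
  split; [now apply (ex_series_dom u (fun n => M * (/ 2) ^ n))|].
  eapply Rle_trans; [apply Series_Rabs; apply (ex_series_dom _ (fun n => M * (/ 2) ^ n)); [|easy]|].
  { bound. }
  eapply Rle_trans; [apply (Series_le _ (fun n => M * (/ 2) ^ n)); [|easy]|]. { bound. }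
  rewrite (is_series_unique _ _ Hg). lra.
Qed.

Lemma PSeries_tail (N : nat) (K B W e : R) (c : nat -> R) : 0 < B -> Rabs e <= / (2 * B) -> 0 <= K * W ->
  (forall n, (N <= n)%nat -> Rabs (c n) <= K * B ^ n * W) ->
  Rabs (PSeries c e - sumn N (fun n => c n * e ^ n)) <= 2 * (K * W * (B * Rabs e) ^ N).
Proof.
  intros HB He HKW Hc.
  assert (Ht : forall n, Rabs (c (N + n)%nat * e ^ (N + n)) <= K * W * (B * Rabs e) ^ N * (/ 2) ^
    n).
  { intros n. rewrite Rabs_mult, <- RPow_abs.
    eapply Rle_trans; [apply Rmult_le_compat_r; [pos|apply Hc; lia]|].
    replace (K * B ^ (N + n) * W * Rabs e ^ (N + n)) with (K * W * (B * Rabs e) ^ (N + n)) by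
      (rewrite Rpow_mult_distr; ring).
    rewrite pow_add, <- Rmult_assoc. bound. }
  destruct (series_half _ _ Ht) as [Hex Hb]. unfold PSeries. destruct N as [|N].
  - rewrite Rminus_0_r. exact Hb.
  - rewrite (Series_incr_n (fun k => c k * e ^ k) (S N)); [|lia|].
    + cbn [pred]. rewrite sumn_sum_f_R0. bound.
    + now apply (ex_series_incr_n (V := R_NormedModule) (fun k => c k * e ^ k) (S N)).
Qed.

(** * From the recursion to the differential equation *)

Section Sum.

Context {sp : speed}.
Notation v := (@vel sp).
Notation r0 := (rho0 v).

(** The second derivative prescribed for the coefficient of order [n]. The sequence [lm] collects
    the multiples of [zs] subtracted from the sources. *)
Definition coef2 (w : R -> R) (lm : nat -> R) (a g : nat -> R -> R) (n : nat) (x : R) : R :=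
  match n with
  | O => famp v (r0 x)
  | S m => dfamp v (r0 x) * a (S m) x + (src w a g m x - lm (S m) * zs v x)
  end.

Lemma coef2_eq (w : R -> R) (lm : nat -> R) (a g : nat -> R -> R) (x : R) :
  lm O = 0 -> a O x = r0 x -> g O x = / r0 x -> (forall n, g (S n) x = gnext a g n x (a (S n) x)) ->
  forall n, coef2 w lm a g n x = - (v ^ 2 + 2) * a n x + 2 * cube (fun i => a i x) n
    + v ^ 2 * cube (fun i => g i x) n + 2 * w x * PS_incr_1 (fun i => a i x) n - zs v x * lm n.
Proof.
  intros Hlm Ha Hg Hgn n. pose proof (rho0_pos x). destruct n as [|n].
  - cbn [coef2 PS_incr_1]. unfold cube. rewrite !PS_mult_0, Ha, Hg, Hlm. unfold famp.
    change zero with 0. field. lra.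
  - cbn [coef2 PS_incr_1]. rewrite !cube_S, Ha, Hg, Hgn. unfold src, gnext, dfamp. field. lra.
Qed.

Lemma mult_inverse (a g : nat -> R -> R) (x : R) :
  a O x = r0 x -> g O x = / r0 x -> (forall n, g (S n) x = gnext a g n x (a (S n) x)) ->
  forall n, PS_mult (fun i => a i x) (fun i => g i x) n = (match n with O => 1 | _ => 0 end).
Proof.
  intros Ha Hg Hgn n. pose proof (rho0_pos x). destruct n as [|n].
  - rewrite PS_mult_0, Ha, Hg. field. lra.
  - rewrite PS_mult_S, Ha, Hg, Hgn. unfold gnext. field. lra.
Qed.

(** Two products turn the rate [B] into [4 B] for the cubes, which limits [e] to [1 / (8 B)]. The
    conclusion keeps the defect [zs * PSeries lm e]: it is 0 for the reference solutions, where
    nothing is subtracted, and has to be shown to vanish on the whole line. *)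
Lemma sum_solution (w : R -> R) (lm : nat -> R) (a a1 g : nat -> R -> R) (K B x : R) (d : posreal) (e : R) :
  0 < B -> Rabs e <= / (8 * B) ->
  (forall y n, Rabs (y - x) < d ->
     Rabs (a n y) <= K * B ^ n /\ Rabs (a1 n y) <= K * B ^ n /\ Rabs (g n y) <= K * B ^ n /\
     Rabs (coef2 w lm a g n y) <= K * B ^ n) ->
  lm O = 0 -> pbound K B lm ->
  (forall y, a O y = r0 y) -> (forall y, g O y = / r0 y) ->
  (forall n y, g (S n) y = gnext a g n y (a (S n) y)) ->
  (forall n y, is_derive (a n) y (a1 n y) /\ is_derive (a1 n) y (coef2 w lm a g n y)) ->
  let rho y := PSeries (fun n => a n y) e in
  let rho1 y := PSeries (fun n => a1 n y) e in
  rho x * PSeries (fun n => g n x) e = 1 /\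
  is_derive rho x (rho1 x) /\
  is_derive rho1 x (famp v (rho x) + 2 * e * w x * rho x - zs v x * PSeries lm e).
Proof.
  intros HB He Hb Hlm0 Hlm Ha0 Hg0 Hgn Hd rho rho1. assert (He' : Rabs e < / (4 * B)).
  { eapply Rle_lt_trans; [exact He|]. apply Rinv_lt_contravar; nra. }
  assert (HeB : Rabs e < / B). { eapply Rle_lt_trans; [exact He|]. apply Rinv_lt_contravar; nra. }
  assert (He2 : Rabs e < / (2 * B)).
  { eapply Rle_lt_trans; [exact He|]. apply Rinv_lt_contravar; nra. }
  assert (Hx : Rabs (x - x) < d) by (rewrite Rminus_diag, Rabs_R0; apply cond_pos).
  assert (Hpa : pbound K B (fun n => a n x)) by (intros n; now apply Hb).
  assert (Hpg : pbound K B (fun n => g n x)) by (intros n; now apply Hb).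
  assert (Hinv : rho x * PSeries (fun n => g n x) e = 1).
  { unfold rho. rewrite <- PSeries_mult; try now apply (pbound_cv K B).
    rewrite (PSeries_ext _ (fun n => match n with O => 1 | _ => 0 end)).
    2:{ now apply mult_inverse. }
    pose proof (PSeries_tail 1 0 B 1 e (fun n => match n with O => 1 | _ => 0 end) HB ltac:(lra)
      ltac:(lra)) as Ht.
    cbn [sumn pow] in Ht. rewrite !Rmult_0_l, Rmult_0_r, Rplus_0_l, Rmult_1_r in Ht.
    apply Rminus_diag_uniq. apply Rabs_eq_0. apply Rle_antisym; [|pos]. apply Ht.
    intros [|n] Hn; [lia|]. mono. }
  splits. assert (HMser : ex_series (fun n => K * (/ 2) ^ n)).
  { exists (K * / (1 - / 2)). apply (is_series_scal K (fun n => (/ 2) ^ n)). apply is_series_geom.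
    bound. }
  assert (Hterm : forall c n, Rabs c <= K * B ^ n -> Rabs (c * e ^ n) <= K * (/ 2) ^ n).
  { intros c n Hc. pose proof (pbound_ge0 _ _ _ Hpa). rewrite Rabs_mult, <- RPow_abs.
    apply Rle_trans with (K * B ^ n * Rabs e ^ n).
    - mono.
    - rewrite Rmult_assoc, <- Rpow_mult_distr. bound. }
  assert (Hexs : forall c, (forall n, Rabs (c n) <= K * B ^ n) -> ex_series (fun n => c n * e ^ n)).
  { intros c Hc. apply (ex_series_dom _ (fun n => K * (/ 2) ^ n)); [|easy]. auto. }
  split.
  - apply (is_derive_Series (fun n y => a n y * e ^ n) (fun n y => a1 n y * e ^ n) (fun n => K * (/
      2) ^ n) x d); auto.
    + intros n y Hy. destruct (Hd n y) as [H1 _]. derive.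
    + intros n y Hy. apply Hterm. now apply Hb.
    + intros y Hy. apply (Hexs (fun n => a n y)). solve_cont.
  - replace (famp v (rho x) + 2 * e * w x * rho x - zs v x * PSeries lm e) with (Series (fun n =>
      coef2 w lm a g n x * e ^ n)).
    + apply (is_derive_Series (fun n y => a1 n y * e ^ n) (fun n y => coef2 w lm a g n y * e ^ n)
        (fun n => K * (/ 2) ^ n) x d); auto.
      * derive.
      * intros n y Hy. apply Hterm. now apply Hb.
      * intros y Hy. apply (Hexs (fun n => a1 n y)). solve_cont.
    + change (PSeries (fun n => coef2 w lm a g n x) e = famp v (rho x) + 2 * e * w x * rho x - zs v
        x * PSeries lm e).
      set (an := fun n => a n x) in *. set (gn := fun n => g n x) in *.
      rewrite (PSeries_ext _ (PS_plus (PS_plus (PS_plus (PS_plus (PS_scal (- (v ^ 2 + 2)) an)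
        (PS_scal 2 (cube an))) (PS_scal (v ^ 2) (cube gn))) (PS_scal (2 * w x) (PS_incr_1 an)))
        (PS_scal (- zs v x) lm))).
      2:{ intros n. rewrite coef2_eq by auto.
        unfold PS_plus, PS_scal, plus, scal; cbn; unfold mult; cbn. unfold an, gn. ring. }
      assert (Hcub : forall c, pbound K B c -> pbound (K * (K * K)) (4 * B) (cube c) /\ PSeries
        (cube c) e = PSeries c e ^ 3).
      { intros c Hc. pose proof (pbound_mult K K B c c HB Hc Hc).
        assert (pbound K (2 * B) c) by (apply (pbound_weaken K B); [lra|lra|easy]). split.
        - replace (4 * B) with (2 * (2 * B)) by ring. apply pbound_mult; [lra|easy|easy].
        - unfold cube. rewrite PSeries_mult; [rewrite PSeries_mult|..].
          + ring.
          + now apply (pbound_cv K B).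
          + now apply (pbound_cv K B).
          + now apply (pbound_cv K B).
          + apply (pbound_cv (K * K) (2 * B)); [lra|easy|easy]. }
      destruct (Hcub an Hpa) as [Hca Hca']. destruct (Hcub gn Hpg) as [Hcg Hcg'].
      assert (ex_pseries (PS_scal (- (v ^ 2 + 2)) an) e).
      { apply ex_pseries_scal; [apply Rmult_comm|]. now apply (pbound_exp K B). }
      assert (ex_pseries (PS_scal 2 (cube an)) e).
      { apply ex_pseries_scal; [apply Rmult_comm|].
        apply (pbound_exp (K * (K * K)) (4 * B)); [lra|easy|easy]. }
      assert (ex_pseries (PS_scal (v ^ 2) (cube gn)) e).
      { apply ex_pseries_scal; [apply Rmult_comm|].
        apply (pbound_exp (K * (K * K)) (4 * B)); [lra|easy|easy]. }
      assert (ex_pseries (PS_scal (2 * w x) (PS_incr_1 an)) e).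
      { apply ex_pseries_scal; [apply Rmult_comm|]. apply ex_pseries_incr_1.
        now apply (pbound_exp K B). }
      assert (ex_pseries (PS_scal (- zs v x) lm) e).
      { apply ex_pseries_scal; [apply Rmult_comm|]. now apply (pbound_exp K B). }
      rewrite PSeries_plus; [|apply ex_pseries_plus; [apply ex_pseries_plus; [apply
        ex_pseries_plus|]|]|]; auto.
      rewrite PSeries_plus; [|apply ex_pseries_plus; [apply ex_pseries_plus|]|]; auto.
      rewrite PSeries_plus; [|apply ex_pseries_plus|]; auto. rewrite PSeries_plus; auto.
      rewrite !PSeries_scal, Hca', Hcg', PSeries_incr_1. change (PSeries an e) with (rho x).
      assert (rho x <> 0) by nra. replace (PSeries gn e) with (/ rho x).
      2:{ apply (Rmult_eq_reg_l (rho x)); [|easy]. rewrite Rinv_r; [symmetry|]; easy. }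
      unfold famp. field. easy.
Qed.

End Sum.

(** * The sequence of coefficients *)

Section Coefficients.

Context {sp : speed}.
Notation v := (@vel sp).
Notation k := (kap v).
Notation r0 := (rho0 v).

Variable w : R -> R.
(* The multiple of the translation mode added to [solve S], as a function of the source [S]
   and of the derivative [q] of the lower-order part of the coefficient of [r^2]. *)
Variable kc : (R -> R) -> (R -> R) -> R.
(* The multiple of the translation mode subtracted from the source. *)
Variable lam : (R -> R) -> R.

(** Course-of-values recursion: every source involves all earlier orders, so [prefix n] returns, as
    a function of the index, the triples (coefficient of [r], its derivative, coefficient of
    [1 / r]) up to order [n]. *)
Fixpoint prefix (n : nat) : nat -> (R -> R) * (R -> R) * (R -> R) :=
  match n with
  | O => fun _ => (r0, zs v, fun x => / r0 x)
  | S m =>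
      let p := prefix m in
      let a i := fst (fst (p i)) in
      let a1 i := snd (fst (p i)) in
      let g i := snd (p i) in
      let s0 := src w a g m in
      let s x := s0 x - lam s0 * zs v x in
      let c := kc s (dsq a a1 m) in
      let an x := solve s x + c * zs v x in
      fun i => if Nat.eqb i (S m)
               then (an, fun x => solve' s x + c * famp v (r0 x), fun x => gnext a g m x (an x))
               else p i
  end.

Definition ca (n : nat) : R -> R := fst (fst (prefix n n)).
Definition ca1 (n : nat) : R -> R := snd (fst (prefix n n)).
Definition cg (n : nat) : R -> R := snd (prefix n n).
Definition clam (n : nat) : R := match n with O => 0 | S m => lam (src w ca cg m) end.
Definition csrc (n : nat) : R -> R := fun x => src w ca cg n x - clam (S n) * zs v x.
Definition ckc (n : nat) : R := kc (csrc n) (dsq ca ca1 n).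

Lemma prefix_stable (n i : nat) : (i <= n)%nat -> prefix n i = prefix i i.
Proof.
  induction n as [|n IH]; intros Hi; [now replace i with O by lia|].
  destruct (Nat.eq_dec i (S n)) as [->|Hne]; [easy|]. rewrite <- IH by lia. cbn [prefix].
  now rewrite (proj2 (Nat.eqb_neq i (S n)) Hne).
Qed.

Lemma prefix_S (n : nat) : prefix (S n) (S n) =
  (fun x => solve (csrc n) x + ckc n * zs v x,
   fun x => solve' (csrc n) x + ckc n * famp v (r0 x),
   fun x => gnext ca cg n x (solve (csrc n) x + ckc n * zs v x)).
Proof.
  assert (E1 : src w (fun i => fst (fst (prefix n i))) (fun i => snd (prefix n i)) n = src w ca cg
    n).
  { apply functional_extensionality. intros x. unfold src, ca, cg.
    rewrite (cubelow_ext _ (fun i => fst (fst (prefix i i)) x) n).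
    2:{ intros i Hi. now rewrite prefix_stable. }
    rewrite (cubelow_ext (fun i => snd (prefix n i) x) (fun i => snd (prefix i i) x) n).
    2:{ intros i Hi. now rewrite prefix_stable. }
    rewrite (mid_ext (fun i => fst (fst (prefix n i)) x) (fun i => fst (fst (prefix i i)) x) (fun i
      => snd (prefix n i) x) (fun i => snd (prefix i i) x) n); [easy|..]; intros i Hi; now rewrite
      prefix_stable. }
  assert (E2 : dsq (fun i => fst (fst (prefix n i))) (fun i => snd (fst (prefix n i))) n = dsq ca
    ca1 n).
  { apply functional_extensionality. intros x. unfold dsq, ca, ca1. f_equal.
    apply mid_ext; intros i Hi; now rewrite prefix_stable. }
  cbn [prefix]. rewrite Nat.eqb_refl, E1, E2. f_equal. apply functional_extensionality. intros x.
  unfold gnext, ca, cg. f_equal. f_equal. apply mid_ext; intros i Hi; now rewrite prefix_stable.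
Qed.

Lemma ca_0 : ca O = r0.
Proof. reflexivity. Qed.

Lemma cg_0 : cg O = fun x => / r0 x.
Proof. reflexivity. Qed.

Lemma ca_S (n : nat) (x : R) : ca (S n) x = solve (csrc n) x + ckc n * zs v x.
Proof. unfold ca at 1. now rewrite prefix_S. Qed.

Lemma ca1_S (n : nat) (x : R) : ca1 (S n) x = solve' (csrc n) x + ckc n * famp v (r0 x).
Proof. unfold ca1 at 1. now rewrite prefix_S. Qed.

Lemma cg_S (n : nat) (x : R) : cg (S n) x = gnext ca cg n x (ca (S n) x).
Proof. rewrite ca_S. unfold cg at 1. now rewrite prefix_S. Qed.

Lemma cont_sumn (n : nat) (f : nat -> R -> R) : (forall i, (i < n)%nat -> cont (f i)) ->
  cont (fun x => sumn n (fun i => f i x)).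
Proof.
  induction n as [|n IH]; intros H; [exact (cont_const 0)|].
  apply (cont_plus (fun x => sumn n (fun i => f i x)) (f n)); [auto|apply H]; auto.
Qed.

Lemma cont_mid (a b : nat -> R -> R) (n : nat) : (forall i, (i <= n)%nat -> cont (a i)) ->
  (forall i, (i <= n)%nat -> cont (b i)) -> cont (fun x => mid (fun i => a i x) (fun i => b i x) n).
Proof. intros Ha Hb. apply (cont_sumn n (fun i x => a (S i) x * b (n - i)%nat x)). solve_cont. Qed.

Lemma cont_cubelow (a : nat -> R -> R) (n : nat) : (forall i, (i <= n)%nat -> cont (a i)) ->
  cont (fun x => cubelow (fun i => a i x) n).
Proof.
  intros Ha. apply cont_plus.
  - apply cont_mult; [apply Ha; lia|]. now apply cont_mid.
  - apply (cont_mid a (fun i x => sq (fun i => a i x) i)); [easy|]. intros i Hi.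
    apply (cont_ext (fun x => sumn (S i) (fun j => a j x * a (i - j)%nat x))).
    + intros x. unfold sq, PS_mult. now rewrite sumn_sum_f_R0.
    + apply (cont_sumn (S i) (fun j x => a j x * a (i - j)%nat x)). solve_cont.
Qed.

Lemma cont_inv_rho0 : cont (fun x => / r0 x).
Proof.
  apply (cont_of_derive _ (fun x => - zs v x / r0 x ^ 2)). intros x. apply is_derive_inv; [derive|].
  pose proof (rho0_pos x). lra.
Qed.

Hypothesis Hw : cont w.

Lemma cont_csrc (n : nat) : (forall i, (i <= n)%nat -> cont (ca i)) ->
  (forall i, (i <= n)%nat -> cont (cg i)) -> cont (csrc n).
Proof.
  intros Ha Hg.
  apply (cont_ext (fun x => 2 * cubelow (fun i => ca i x) n + v ^ 2 * (cubelow (fun i => cg i x) n +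
    - 3 * (/ r0 x * / r0 x * / r0 x) * mid (fun i => ca i x) (fun i => cg i x) n) + 2 * w x * ca n x
    + - clam (S n) * zs v x)).
  { intros x. unfold csrc, src. lra. } assert (Hi := cont_inv_rho0).
  apply cont_plus; [apply cont_plus; [apply cont_plus|]| apply cont_mult; [solve_cont|solve_cont]].
  - apply cont_mult; [solve_cont|]. now apply cont_cubelow.
  - apply cont_mult; [solve_cont|]. apply cont_plus; [now apply cont_cubelow|].
    apply cont_mult; [|now apply cont_mid]. solve_cont.
  - apply cont_mult; [|auto]. apply cont_mult; [solve_cont|easy].
Qed.

(** Order by order, continuity of the coefficients gives continuity of the next source, and a bound
    on that source to the right of [x0] makes its integral against [zs] up to [+oo] converge, so
    that [solve] can be differentiated everywhere. *)
Lemma ca_derive (x0 : R) (K : nat -> R) (n : nat) :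
  (forall j x, (j < n)%nat -> x0 <= x -> Rabs (csrc j x) <= K j) ->
  forall i, (i <= n)%nat -> cont (ca i) /\ cont (ca1 i) /\ cont (cg i) /\
    forall x, is_derive (ca i) x (ca1 i x) /\ is_derive (ca1 i) x (coef2 w clam ca cg i x).
Proof.
  induction n as [|n IH]; intros HK i Hi.
  - replace i with O by lia. split; [exact cont_rho0|]. split; [exact cont_zs|].
    split; [exact cont_inv_rho0|]. intros x. split; [apply is_derive_rho0|apply is_derive_zs].
  - specialize (IH ltac:(intros; apply HK; [lia|easy])).
    destruct (Nat.eq_dec i (S n)) as [->|Hne]; [|apply IH; lia].
    assert (Hc : cont (csrc n)) by (apply cont_csrc; intros; now apply IH).
    pose proof (solve_derive (csrc n) x0 (K n) Hc ltac:(intros; apply HK; [lia|easy])) as Hs.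
    assert (H1 : forall x, is_derive (ca (S n)) x (ca1 (S n) x)).
    { intros x. rewrite ca1_S. apply (is_derive_ext (fun y => solve (csrc n) y + ckc n * zs v y)).
      { intros y. now rewrite ca_S. }
      apply (is_derive_plus (solve (csrc n))); [apply Hs|]. derive. }
    assert (H2 : forall x, is_derive (ca1 (S n)) x (coef2 w clam ca cg (S n) x)).
    { intros x. apply (is_derive_ext (fun y => solve' (csrc n) y + ckc n * famp v (r0 y))).
      { intros y. now rewrite ca1_S. }
      unfold coef2. rewrite ca_S.
      replace (_ + _) with ((dfamp v (r0 x) * solve (csrc n) x + csrc n x) + ckc n * (dfamp v (r0 x)
        * zs v x)) by (unfold csrc; ring).
      apply (is_derive_plus (solve' (csrc n))); [apply Hs|]. apply is_derive_scal.
      apply (is_derive_famp r0); [|derive]. pose proof (rho0_pos x). lra. }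
    split; [exact (cont_of_derive _ _ H1)|]. split; [exact (cont_of_derive _ _ H2)|].
    split; [|easy]. assert (Hi' := cont_inv_rho0).
    apply (cont_ext (fun x => -1 * / r0 x * mid (fun i => ca i x) (fun i => cg i x) n + -1 * (/ r0 x
      * / r0 x) * ca (S n) x)).
    { intros x. rewrite cg_S. unfold gnext. ring. } apply cont_plus.
    + apply cont_mult; [apply cont_mult; [solve_cont|easy]|]. apply cont_mid; intros; now apply IH.
    + apply cont_mult; [|exact (cont_of_derive _ _ H1)]. solve_cont.
Qed.

End Coefficients.

#[global] Hint Resolve cont_inv_rho0 : cont.

(** * Reference solutions on a half-line *)

Section Reference.

Context {sp : speed}.
Notation v := (@vel sp).
Notation k := (kap v).
Notation r0 := (rho0 v).

(** On a half-line there is no solvability condition: no multiple of the translation mode is added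
    and none is subtracted. Together with [solve'_0] this keeps the critical point at 0. *)
Definition hcoef (w : R -> R) : nat -> R -> R := ca w (fun _ _ => 0) (fun _ => 0).
Definition hcoef1 (w : R -> R) : nat -> R -> R := ca1 w (fun _ _ => 0) (fun _ => 0).

(* The solution with [href' = 0] at [0] that decays to [1] at [+oo] and is close to the soliton. *)
Definition href (w : R -> R) (e y : R) : R := PSeries (fun n => hcoef w n y) e.
Definition href1 (w : R -> R) (e y : R) : R := PSeries (fun n => hcoef1 w n y) e.

(* [a = 2 k / (N - 1/2)], so that no multiple of the rate [a] resonates with [2 k]. *)
Variables (a : R) (N : nat).
Hypothesis Ha : 0 < a.
Hypothesis HN : (2 <= N)%nat.
Hypothesis HaN : (INR N - / 2) * a = 2 * k.

(** The decay rates, away from the centre [Z] of the potential, of the coefficient of order [n]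
    ([al]) and of its source ([be]). Below [N] both are [n a < 2 k]. From [N] on the source decays
    faster than the modes, and the coefficient at the rate [2 k], the best that [solve] provides. *)
Definition al (n : nat) : R := if le_lt_dec N n then 2 * k else INR n * a.
Definition be (n : nat) : R := if le_lt_dec N n then 2 * k + a / 2 else INR n * a.

Lemma lt_N (n : nat) : (n < N)%nat -> INR n * a <= 2 * k - a / 2.
Proof. intros H. apply le_INR in H. rewrite S_INR in H. nra. Qed.

Lemma ge_N (n : nat) : (N <= n)%nat -> 2 * k + a / 2 <= INR n * a.
Proof. intros H. apply le_INR in H. nra. Qed.

(** The critical case is [i, j < N <= i + j], where [(i + j) a >= N a = 2 k + a / 2]. *)
Lemma al_add (i j : nat) : (1 <= i)%nat -> (1 <= j)%nat -> be (i + j) <= al i + al j.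
Proof.
  intros Hi Hj. apply le_INR in Hi. apply le_INR in Hj. cbn in Hi, Hj. unfold al, be.
  pose proof (lt_N 1 HN) as H1. cbn in H1.
  destruct (le_lt_dec N i) as [Hi'|Hi'], (le_lt_dec N j) as [Hj'|Hj'], (le_lt_dec N (i + j)) as
    [Hij|Hij]; try lia; try (apply ge_N in Hij); rewrite plus_INR in *; nra.
Qed.

Lemma al_le_be (i : nat) : al i <= be i.
Proof. unfold al, be. destruct (le_lt_dec N i); lra. Qed.

Lemma al_1 : al 1 = a.
Proof. unfold al. destruct (le_lt_dec N 1); [lia|cbn; ring]. Qed.

Lemma al_ge (i : nat) : (1 <= i)%nat -> a <= al i.
Proof.
  intros H. unfold al. destruct (le_lt_dec N i) as [Hi|Hi].
  - pose proof (lt_N 1 HN) as H1. cbn in H1. lra.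
  - apply le_INR in H. cbn in H. nra.
Qed.

Lemma be_gap (i : nat) : (1 <= i)%nat -> 0 <= be i /\ be i <> 2 * k /\
  a / 2 <= Rabs (2 * k - be i) /\ Rmin (2 * k) (be i) = al i.
Proof.
  intros Hi. pose proof kap_pos. unfold al, be. destruct (le_lt_dec N i) as [H1|H1].
  - rewrite Rabs_left, Rmin_left by lra. lra.
  - apply lt_N in H1. rewrite Rabs_right, Rmin_right by lra. pos.
Qed.

Lemma exp_neg_le (p q t : R) : p <= q -> 0 <= t -> exp (- q * t) <= exp (- p * t).
Proof. bound. Qed.

Lemma dfamp_rho0_bound : exists C, 0 < C /\ forall x, Rabs (dfamp v (r0 x)) <= C.
Proof.
  pose proof vabs_bounds. pose (i := / Rabs v). assert (1 < i).
  { rewrite <- Rinv_1. apply Rinv_lt_contravar; lra. }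
  exists (9 + 3 * i ^ 4). splits. intros x. pose proof (rho0_ge x). pose proof (rho0_lt1 x).
  pose proof v2_bounds. assert (0 < / r0 x <= i). { splits. apply Rinv_le_contravar; lra. }
  unfold dfamp. replace (3 * v ^ 2 / r0 x ^ 4) with (3 * v ^ 2 * (/ r0 x) ^ 4) by algebra.
  assert (0 <= r0 x ^ 2 <= 1) by nra. mono.
Qed.

(** [Z] is the centre of the potential as seen from the dip at 0. From order [N] on, the
    coefficients at 0 are bounded by [e^(- 2 k |Z|)] times a geometric factor, so up to that
    precision the value at the dip is a polynomial in [e]; this is the last conclusion. Starting the
    half-line at [- 1] makes 0 an interior point, with two-sided derivatives. *)
Lemma href_spec (Kw : R) : 0 <= Kw ->
  exists e0 Cb, 0 < e0 /\ 0 < Cb /\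
  forall (Z : R) (w : R -> R), cont w ->
  (forall y, -1 <= y -> Rabs (w y) <= Kw * exp (- a * Rabs (y - Z))) ->
  forall e, Rabs e <= e0 ->
  (forall y, -1 < y -> is_derive (href w e) y (href1 w e y) /\
     is_derive (href1 w e) y (famp v (href w e y) + 2 * e * w y * href w e y)) /\
  href1 w e 0 = 0 /\
  (forall y, -1 <= y -> Rabs (href w e y - r0 y) <= Cb * Rabs e * exp (- a * Rabs (y - Z)) /\
     Rabs (href1 w e y - zs v y) <= Cb * Rabs e * exp (- a * Rabs (y - Z))) /\
  Rabs (href w e 0 - sumn N (fun n => hcoef w n 0 * e ^ n)) <= Cb * Rabs e * exp (- (2 * k) * Rabs Z).
Proof.
  intros HKw. destruct solve_bound as [Cs [HCs Hsolve]].
  destruct (majorant Kw (Cs / (a / 2))) as [A [B [G [HA [HB [HG Hmaj]]]]]]; [easy| |]. { pos. }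
  destruct dfamp_rho0_bound as [Cd [HCd Hd]]. pose proof vabs_bounds as Hv.
  assert (Hiv : 0 < / Rabs v) by pos. destruct modes_bound as [Cm [HCm Hm]].
  pose (K := A + G + B + Cd * A + 1 + / Rabs v + Cm). assert (HCdA : 0 < Cd * A) by pos.
  assert (HK : 0 < K) by (unfold K; lra). pose (Cb := 2 * (K * B) + 2 * (K * B ^ N)).
  assert (HKB : 0 < K * B) by pos. assert (HKBN : 0 < K * B ^ N) by pos.
  exists (Rmin 1 (/ (8 * B))), Cb. splits. split; [unfold Cb; lra|]. intros Z w Hw Hwb e He.
  assert (He2 : Rabs e <= / (8 * B)) by (eapply Rle_trans; [exact He|apply Rmin_r]).
  pose (kc := fun _ _ : R -> R => 0). pose (lm := fun _ : R -> R => 0). pose (a_ := ca w kc lm).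
  pose (a1_ := ca1 w kc lm). pose (g_ := cg w kc lm).
  assert (Hlm : forall n, clam w kc lm n = 0) by now intros [|n].
  assert (Hcsrc : forall n, csrc w kc lm n = src w a_ g_ n).
  { intros n. apply functional_extensionality. intros x. unfold csrc. rewrite Hlm. unfold a_, g_.
    ring. }
  pose (D := fun y : R => -1 <= y). pose (om := fun n y => exp (- al n * Rabs (y - Z))).
  pose (sg := fun n y => exp (- be n * Rabs (y - Z))).
  assert (Hom1 : forall n y, (1 <= n)%nat -> 0 < om n y <= 1).
  { intros n y Hn. split; [apply exp_pos|]. apply exp_ge0_1. pose proof (al_ge n Hn).
    pose proof (Rabs_pos (y - Z)). nra. }
  assert (Hsg1 : forall n y, (1 <= n)%nat -> 0 < sg n y <= 1).
  { intros n y Hn. split; [apply exp_pos|]. apply exp_ge0_1. pose proof (be_gap n Hn).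
    pose proof (Rabs_pos (y - Z)). nra. }
  assert (Hsgle : forall c n y, 0 < c -> (1 <= n)%nat -> c * sg n y <= c).
  { intros c n y Hc Hn. pose proof (Hsg1 n y Hn). nra. }
  assert (Hmajle : forall n, maj B n <= B ^ n) by (intros; now apply maj_le).
  assert (main : forall n x, D x -> (Rabs (a_ (S n) x) <= A * maj B (S n) * om (S n) x /\ Rabs (a1_
    (S n) x) <= A * maj B (S n) * om (S n) x /\ Rabs (g_ (S n) x) <= G * maj B (S n) * om (S n) x)
    /\ Rabs (src w a_ g_ n x) <= B * maj B (S n) * sg (S n) x).
  { apply Hmaj.
    - intros x i j _ Hi Hj. unfold om, sg. rewrite <- exp_plus. apply exp_le.
      pose proof (al_add i j Hi Hj). pose proof (Rabs_pos (x - Z)). nra.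
    - intros x i _ Hi. split; [left; apply exp_pos|]. apply exp_neg_le; [apply al_le_be|pos].
    - intros x Hx. eapply Rle_trans; [now apply Hwb|]. apply Rmult_le_compat_l; [easy|].
      apply exp_neg_le; [|pos]. unfold be. destruct (le_lt_dec N 1); [lia|cbn; lra].
    - intros x i Hx Hi. apply Rle_trans with (Kw * exp (- a * Rabs (x - Z)) * om i x).
      { apply Rmult_le_compat_r; [left; apply exp_pos|]. auto. }
      rewrite Rmult_assoc. apply Rmult_le_compat_l; [easy|]. unfold om, sg. rewrite <- exp_plus.
      apply exp_le. pose proof (al_add 1 i ltac:(lia) Hi) as H. rewrite al_1 in H.
      change (1 + i)%nat with (S i) in H. pose proof (Rabs_pos (x - Z)). nra.
    - easy.
    - easy.
    - intros n x. apply (cg_S w kc lm).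
    - intros n M HM _ IHs HS _ x Hx. assert (Hc : cont (src w a_ g_ n)).
      { rewrite <- Hcsrc.
        assert (HK' : forall j y, (j < n)%nat -> -1 <= y -> Rabs (csrc w kc lm j y) <= B * maj B (S
          j)).
        { intros j y Hj Hy. rewrite Hcsrc. eapply Rle_trans; [apply (IHs j y Hj Hy)|].
          apply Hsgle; [apply Rmult_lt_0_compat; [easy|now apply maj_pos]|lia]. }
        apply (cont_csrc w kc lm Hw); intros i Hi; now apply (ca_derive w kc lm Hw (-1) (fun j => B
          * maj B (S j)) n HK'). }
      destruct (be_gap (S n) ltac:(lia)) as [Hb0 [Hb1 [Hb2 Hb3]]].
      destruct (Hsolve (src w a_ g_ n) M (be (S n)) Z x Hc Hb0 Hb1 HM Hx) as [H1 H2]. { easy. }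
      rewrite Hb3 in H1, H2. fold (om (S n) x) in H1, H2.
      assert (Hle : Cs / Rabs (2 * k - be (S n)) * M * om (S n) x <= Cs / (a / 2) * M * om (S n) x).
      { apply Rmult_le_compat_r; [left; apply exp_pos|]. apply Rmult_le_compat_r; [easy|].
        apply Rmult_le_compat_l; [lra|]. mono. }
      unfold a_, a1_. rewrite ca_S, ca1_S, Hcsrc. rewrite !Rmult_0_l, !Rplus_0_r. lra. }
  assert (Hsrcb : forall j y, -1 <= y -> Rabs (csrc w kc lm j y) <= B * maj B (S j)).
  { intros j y Hy. rewrite Hcsrc. destruct (main j y Hy) as [_ H]. eapply Rle_trans; [exact H|].
    apply Hsgle; [apply Rmult_lt_0_compat; [easy|now apply maj_pos]|lia]. }
  assert (Hder : forall n, cont (a_ n) /\ cont (a1_ n) /\ cont (g_ n) /\ forall x, is_derive (a_ n)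
    x (a1_ n x) /\ is_derive (a1_ n) x (coef2 w (clam w kc lm) a_ g_ n x)).
  { intros n. apply (ca_derive w kc lm Hw (-1) (fun j => B * maj B (S j)) n); [|lia]. auto. }
  assert (Hal : forall n y, -1 <= y -> (1 <= n)%nat -> Rabs (a_ n y) <= K * B ^ n * om n y /\ Rabs
    (a1_ n y) <= K * B ^ n * om n y).
  { intros [|n] y Hy Hn; [lia|]. destruct (main n y Hy) as [[H1 [H2 H3]] H4].
    pose proof (maj_pos B (S n) HB). pose proof (Hom1 (S n) y Hn).
    assert (A * maj B (S n) * om (S n) y <= K * B ^ (S n) * om (S n) y); [|lra]. unfold K; bound. }
  assert (Hball : forall y n, -1 <= y -> Rabs (a_ n y) <= K * B ^ n /\ Rabs (a1_ n y) <= K * B ^ n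
    /\ Rabs (g_ n y) <= K * B ^ n /\ Rabs (coef2 w (clam w kc lm) a_ g_ n y) <= K * B ^ n).
  { intros y [|n] Hy.
    - pose proof (rho0_lt1 y). pose proof (rho0_ge y). destruct (Hm y) as [Hm1 [Hm2 _]].
      assert (He' : exp (- (2 * k) * Rabs y) <= 1).
      { apply exp_ge0_1. pose proof (Rabs_pos y). pose proof kap_pos. nra. }
      change (a_ O y) with (r0 y). change (a1_ O y) with (zs v y). change (g_ O y) with (/ r0 y).
      change (coef2 w (clam w kc lm) a_ g_ O y) with (famp v (r0 y)).
      assert (0 < / r0 y <= / Rabs v) by mono.
      rewrite (Rabs_right (r0 y)), (Rabs_right (/ r0 y)) by lra. unfold K.
      repeat split; try lra; nra.
    - destruct (main n y Hy) as [[H1 [H2 H3]] H4]. specialize (Hmajle (S n)).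
      pose proof (maj_pos B (S n) HB). pose proof (Hom1 (S n) y ltac:(lia)).
      pose proof (Hsg1 (S n) y ltac:(lia)).
      assert (Hgen : forall c s, 0 <= c -> 0 < s <= 1 -> c * maj B (S n) * s <= c * B ^ S n).
      { intros c s Hc Hs. assert (0 <= c * maj B (S n)) by pos. nra. }
      pose proof (Hgen A (om (S n) y) ltac:(lra) ltac:(lra)).
      pose proof (Hgen G (om (S n) y) ltac:(lra) ltac:(lra)).
      pose proof (Hgen B (sg (S n) y) ltac:(lra) ltac:(lra)).
      assert (HKe : forall c, c <= K -> c * B ^ S n <= K * B ^ S n) by bound.
      pose proof (HKe A ltac:(unfold K; lra)). pose proof (HKe G ltac:(unfold K; lra)). splits.
      unfold coef2. rewrite Hlm, Rmult_0_l, Rminus_0_r.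
      apply Rle_trans with (Cd * (A * B ^ S n) + B * B ^ S n).
      + mono.
      + replace (_ + _) with ((Cd * A + B) * B ^ S n) by ring. apply HKe. unfold K. lra. }
  split; [|split; [|split]].
  - intros y Hy.
    destruct (sum_solution w (clam w kc lm) a_ a1_ g_ K B y (mkposreal (y + 1) ltac:(lra)) e HB He2)
      as [_ [H1 H2]].
    + intros z n Hz. cbn in Hz. apply Hball. bound.
    + easy.
    + intros n. rewrite Hlm, Rabs_R0. pos.
    + easy.
    + easy.
    + intros n z. apply (cg_S w kc lm).
    + solve_cont.
    + splits. rewrite (PSeries_ext (clam w kc lm) (fun _ => 0)) in H2 by easy.
      rewrite PSeries_const_0, Rmult_0_r, Rminus_0_r in H2. exact H2.
  - unfold href1. rewrite (PSeries_ext _ (fun _ => 0)).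
    + apply PSeries_const_0.
    + intros [|n]; [apply zs_0|]. unfold hcoef1. rewrite ca1_S. unfold ckc. rewrite solve'_0. ring.
  - intros y Hy. assert (Hw1 : forall n, (1 <= n)%nat -> om n y <= exp (- a * Rabs (y - Z))).
    { intros n Hn. apply exp_neg_le; [now apply al_ge|pos]. }
    pose proof (exp_pos (- a * Rabs (y - Z))) as Hep. assert (He3 : Rabs e <= / (2 * B)).
    { eapply Rle_trans; [exact He2|]. mono. }
    assert (Hfin : forall c : nat -> R, (forall n, (1 <= n)%nat -> Rabs (c n) <= K * B ^ n * om n y)
      -> Rabs (PSeries c e - c O) <= Cb * Rabs e * exp (- a * Rabs (y - Z))).
    { intros c Hc.
      pose proof (PSeries_tail 1 K B (exp (- a * Rabs (y - Z))) e c HB He3 ltac:(nra)) as Ht.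
      cbn [sumn pow] in Ht. rewrite Rplus_0_l, !Rmult_1_r in Ht. eapply Rle_trans; [apply Ht|].
      - intros n Hn. eapply Rle_trans; [now apply Hc|]. mono.
      - replace (2 * (K * exp (- a * Rabs (y - Z)) * (B * Rabs e))) with (2 * (K * B) * (Rabs e *
          exp (- a * Rabs (y - Z)))) by ring.
        rewrite (Rmult_assoc (2 * (K * B) + 2 * (K * B ^ N))). mono. }
    split.
    + apply (Hfin (fun n => hcoef w n y)). solve_cont.
    + apply (Hfin (fun n => hcoef1 w n y)). solve_cont.
  - assert (He3 : Rabs e <= / (2 * B)). { eapply Rle_trans; [exact He2|]. mono. }
    pose proof (exp_pos (- (2 * k) * Rabs Z)) as Hep.
    eapply Rle_trans; [apply (PSeries_tail N K B (exp (- (2 * k) * Rabs Z)) e _ HB He3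
      ltac:(nra))|].
    + intros n Hn. destruct (Hal n 0 ltac:(lra) ltac:(lia)) as [H _]. unfold om, al in H.
      destruct (le_lt_dec N n); [|lia]. rewrite Rminus_0_l, Rabs_Ropp in H. exact H.
    + rewrite Rpow_mult_distr. assert (Rabs e ^ N <= Rabs e).
      { destruct N as [|n]; [lia|]. cbn [pow]. pose proof (Rabs_pos e).
        assert (Rabs e ^ n <= 1 ^ n) by bound. rewrite pow1 in *. nra. }
      unfold Cb.
      replace (2 * (K * exp (- (2 * k) * Rabs Z) * (B ^ N * Rabs e ^ N))) with (2 * (K * B ^ N) *
        exp (- (2 * k) * Rabs Z) * Rabs e ^ N) by ring.
      replace ((2 * (K * B) + 2 * (K * B ^ N)) * Rabs e * exp (- (2 * k) * Rabs Z)) with ((2 * (K *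
        B) + 2 * (K * B ^ N)) * exp (- (2 * k) * Rabs Z) * Rabs e) by ring.
      mono.
Qed.

End Reference.

(** * The integral over the line *)

(** Two one-sided integrals, so that each half is a [tail]. For [expdom] functions the value is also
    the limit over symmetric intervals, and linearity and the fundamental theorem are proved through
    that limit. *)
Definition intR (f : R -> R) : R := tail f 0 + tail (fun z => f (- z)) 0.

Definition expdom (K g : R) (f : R -> R) : Prop :=
  cont f /\ forall z, Rabs (f z) <= K * exp (- g * Rabs z).

Lemma expdom_ge0 (K g : R) (f : R -> R) : expdom K g f -> 0 <= K.
Proof. intros [_ H]. specialize (H 0). rewrite Rabs_R0, Rmult_0_r, exp_0 in H. bound. Qed.

Arguments expdom_ge0 {K g f}.

Lemma cont_opp_arg (f : R -> R) : cont f -> cont (fun z => f (- z)).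
Proof. solve_cont. Qed.

Lemma expdom_opp (K g : R) (f : R -> R) : expdom K g f -> expdom K g (fun z => f (- z)).
Proof. intros [H1 H2]. split; [solve_cont|]. intros z. rewrite <- (Rabs_Ropp z). apply H2. Qed.

Lemma expdom_plus (K L g : R) (f h : R -> R) : expdom K g f -> expdom L g h ->
  expdom (K + L) g (fun x => f x + h x).
Proof.
  intros [Hf1 Hf2] [Hh1 Hh2]. split; [solve_cont|]. intros z. triangle. specialize (Hf2 z).
  specialize (Hh2 z). lra.
Qed.

Lemma expdom_mult (K L g : R) (f h : R -> R) : expdom K g f -> cont h -> (forall x, Rabs (h x) <= L) ->
  expdom (K * L) g (fun x => f x * h x).
Proof.
  intros [Hf1 Hf2] Hh1 Hh2. split; [solve_cont|]. intros z.
  replace (K * L * exp (- g * Rabs z)) with (K * exp (- g * Rabs z) * L) by ring. mono.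
Qed.

Lemma expdom_ext (K g : R) (f h : R -> R) : (forall x, f x = h x) -> expdom K g f -> expdom K g h.
Proof. intros He [H1 H2]. split; [now apply (cont_ext f)|]. intros z. rewrite <- He. apply H2. Qed.

Lemma expdom_weaken (K K' g g' : R) (f : R -> R) : K <= K' -> g' <= g -> expdom K g f -> expdom K' g' f.
Proof.
  intros HK Hg Hf. pose proof (expdom_ge0 Hf). destruct Hf as [H1 H2]. splits. intros z.
  eapply Rle_trans; [apply H2|]. mono.
Qed.

Lemma RInt_opp_arg (f : R -> R) (T : R) : cont f -> RInt (fun z => f (- z)) 0 T = RInt f (- T) 0.
Proof.
  intros Hf. pose proof (RInt_comp_lin (V := R_CompleteNormedModule) f (-1) 0 0 T) as H.
  replace (-1 * 0 + 0) with 0 in H by ring. replace (-1 * T + 0) with (- T) in H by ring.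
  specialize (H ltac:(now apply ex_RInt_cont)).
  rewrite <- (opp_RInt_swap (V := R_CompleteNormedModule) f 0 (- T)) by now apply ex_RInt_cont.
  rewrite <- H. rewrite <- (RInt_opp (V := R_CompleteNormedModule)).
  - apply RInt_ext. intros z _. unfold opp, scal; cbn; unfold mult; cbn.
    replace (-1 * z + 0) with (- z) by ring. ring.
  - apply ex_RInt_cont. apply (cont_ext (fun y => -1 * f (- y))).
    + intros y. unfold scal; cbn; unfold mult; cbn. do 2 f_equal. ring.
    + solve_cont.
Qed.

Lemma intR_lim (K g : R) (f : R -> R) : 0 < g -> expdom K g f ->
  is_lim (fun T => RInt f (- T) T) p_infty (intR f).
Proof.
  intros Hg Hf. pose proof (expdom_ge0 Hf). pose proof (expdom_opp _ _ _ Hf) as Hf'.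
  apply (is_lim_ext (fun T => RInt f 0 T + RInt (fun z => f (- z)) 0 T)).
  - intros T. rewrite RInt_opp_arg by apply Hf. rewrite (RInt_cont_chasles f (- T) 0 T) by apply Hf.
    ring.
  - apply (is_lim_plus _ _ _ (Finite (tail f 0)) (Finite (tail (fun z => f (- z)) 0))).
    + apply (tail_correct f 0 K g 0); [apply Hf|easy|easy|]. intros z _. rewrite Rminus_0_r.
      apply Hf.
    + apply (tail_correct _ 0 K g 0); [apply Hf'|easy|easy|]. intros z _. rewrite Rminus_0_r.
      apply Hf'.
    + easy.
Qed.

Lemma intR_bound (K g : R) (f : R -> R) : 0 < g -> expdom K g f -> Rabs (intR f) <= 2 * PI / g * K.
Proof.
  intros Hg Hf. pose proof (expdom_ge0 Hf). pose proof (expdom_opp _ _ _ Hf) as Hf'. triangle.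
  replace (2 * PI / g * K) with (K * (PI / g) + K * (PI / g)) by lra. apply Rplus_le_compat.
  - apply (tail_bound f 0 K g 0); [apply Hf|easy|easy|]. intros z _. rewrite Rminus_0_r. apply Hf.
  - apply (tail_bound _ 0 K g 0); [apply Hf'|easy|easy|]. intros z _. rewrite Rminus_0_r. apply Hf'.
Qed.

Lemma intR_unique (f : R -> R) (K g l : R) : 0 < g -> expdom K g f ->
  is_lim (fun T => RInt f (- T) T) p_infty (Finite l) -> intR f = l.
Proof.
  intros Hg Hf Hl. pose proof (intR_lim K g f Hg Hf) as H. apply is_lim_unique in H.
  apply is_lim_unique in Hl. rewrite H in Hl. now injection Hl.
Qed.

Lemma expdom_0 (g : R) : expdom 0 g (fun _ => 0).
Proof. split; [solve_cont|]. bound. Qed.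

Lemma intR_0 : intR (fun _ => 0) = 0.
Proof.
  apply (intR_unique _ 0 1); [lra|apply expdom_0|].
  apply (is_lim_ext (fun _ => 0)); [|apply is_lim_const]. intros T. rewrite RInt_const.
  eauto with real.
Qed.

Lemma intR_lin (K L g : R) (f h : R -> R) (c : R) : 0 < g -> expdom K g f -> expdom L g h ->
  intR (fun x => f x + c * h x) = intR f + c * intR h.
Proof.
  intros Hg Hf Hh. apply (intR_unique _ (K + L * Rabs c) g); [easy| |].
  - apply expdom_plus; [easy|]. apply (expdom_ext _ _ (fun x => h x * c)); [bound|].
    apply expdom_mult; [easy|solve_cont|]. intros; lra.
  - apply (is_lim_ext (fun T => RInt f (- T) T + c * RInt h (- T) T)).
    + intros T. symmetry.
      rewrite <- (RInt_scal (V := R_CompleteNormedModule) h) by apply ex_RInt_cont, Hh.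
      apply (RInt_plus (V := R_CompleteNormedModule) f (fun x => c * h x)).
      * apply ex_RInt_cont, Hf.
      * apply ex_RInt_cont. solve_cont.
    + apply (is_lim_plus _ _ _ (Finite (intR f)) (Finite (c * intR h))).
      * now apply (intR_lim K g).
      * apply (is_lim_scal_l (fun T => RInt h (- T) T) c p_infty (Finite (intR h))).
        now apply (intR_lim L g).
      * easy.
Qed.

Lemma intR_ext (f h : R -> R) : (forall x, f x = h x) -> intR f = intR h.
Proof. intros H. f_equal. now apply functional_extensionality. Qed.

Lemma RInt_derive (F f : R -> R) (a b : R) : cont f -> (forall x, is_derive F x (f x)) ->
  RInt f a b = F b - F a.
Proof. intros Hc Hd. apply is_RInt_unique. apply (is_RInt_derive F f); intros; [easy|easy]. Qed.

Lemma intR_derive (K g : R) (F f : R -> R) (lp lm : R) : 0 < g -> expdom K g f ->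
  (forall x, is_derive F x (f x)) -> is_lim F p_infty (Finite lp) -> is_lim F m_infty (Finite lm) ->
  intR f = lp - lm.
Proof.
  intros Hg Hf Hd Hp Hm. apply (intR_unique f K g); [easy|easy|].
  apply (is_lim_ext (fun T => F T - F (- T))).
  - intros T. symmetry. apply RInt_derive; [apply Hf|easy].
  - apply (is_lim_minus F (fun T => F (- T)) _ (Finite lp) (Finite lm)); [easy| |easy].
    apply (is_lim_comp F (fun T => - T) p_infty (Finite lm) m_infty); [easy| |].
    + apply (is_lim_opp (fun x => x) p_infty p_infty). easy.
    + exists 0. easy.
Qed.

Lemma tail_unique (f : R -> R) (x l : R) :
  is_lim (fun b => RInt f x b) p_infty (Finite l) -> tail f x = l.
Proof. intros H. unfold tail. now rewrite (is_lim_unique _ _ _ H). Qed.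

(** * The linearized operator on the whole line *)

Section WholeLine.

Context {sp : speed}.
Notation v := (@vel sp).
Notation k := (kap v).
Notation r0 := (rho0 v).

(** Orthogonality makes the integral from [- x] to [+oo] the negative of the integral from [-oo] to
    [- x], which the oddness of [zs] turns into the reflected tail. *)
Lemma zsI_opp (S : R -> R) (K x : R) : cont S -> (forall z, Rabs (S z) <= K) ->
  intR (fun z => zs v z * S z) = 0 -> zsI S (- x) = zsI (fun z => S (- z)) x.
Proof.
  intros HS HK H0. pose proof (cont_opp_arg S HS) as HS'.
  assert (Hc : cont (fun z => zs v z * S z)) by solve_cont.
  assert (Hc' : cont (fun z => zs v z * S (- z))) by solve_cont.
  pose proof (tail_shift _ 0 (- x) _ Hc (zsI_lim S 0 K HS (fun z _ => HK z))) as H1.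
  pose proof (tail_shift _ 0 x _ Hc' (zsI_lim (fun z => S (- z)) 0 K HS' (fun z _ => HK (- z)))) as
    H2.
  apply tail_unique in H1. apply tail_unique in H2.
  transitivity (zsI S 0 - RInt (fun z => zs v z * S z) 0 (- x)); [easy|].
  transitivity (zsI (fun z => S (- z)) 0 - RInt (fun z => zs v z * S (- z)) 0 x); [|easy].
  assert (E1 : zsI S 0 = zsI (fun z => S (- z)) 0).
  { unfold intR in H0. unfold zsI.
    replace (tail (fun z => zs v (- z) * S (- z)) 0) with (- tail (fun z => zs v z * S (- z)) 0) in
      H0.
    - lra.
    - assert (Hl : is_lim (fun b => RInt (fun z => zs v (- z) * S (- z)) 0 b) p_infty (- zsI (fun z
        => S (- z)) 0)).
      { apply (is_lim_ext (fun b => - RInt (fun z => zs v z * S (- z)) 0 b)).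
        - intros b. symmetry. rewrite (RInt_ext _ (fun z => opp (zs v z * S (- z)))).
          + apply (RInt_opp (V := R_CompleteNormedModule) (fun z => zs v z * S (- z))).
            now apply ex_RInt_cont.
          + intros z _. rewrite zs_opp. eauto with real.
        - apply (is_lim_opp _ _ (Finite (zsI (fun z => S (- z)) 0))).
          apply (zsI_lim (fun z => S (- z)) 0 K HS'). easy. }
      apply tail_unique in Hl. easy. }
  rewrite E1. f_equal.
  assert (RInt (fun z => zs v z * S z) 0 (- x) = RInt (fun z => zs v z * S (- z)) 0 x).
  { rewrite <- (opp_RInt_swap (V := R_CompleteNormedModule)) by now apply ex_RInt_cont.
    rewrite <- (RInt_opp_arg (fun z => zs v z * S z)) by easy.
    rewrite <- (RInt_opp (V := R_CompleteNormedModule)).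
    - apply RInt_ext. intros z _. rewrite zs_opp. cbn; lra.
    - apply ex_RInt_cont. solve_cont. }
  easy.
Qed.

Lemma zuI_opp (S : R -> R) (x : R) : cont S -> zuI S (- x) = - zuI (fun z => S (- z)) x.
Proof.
  intros HS. assert (cont (fun z => zu v z * S z)) by solve_cont. unfold zuI.
  rewrite <- (opp_RInt_swap (V := R_CompleteNormedModule)) by now apply ex_RInt_cont.
  rewrite <- (RInt_opp_arg (fun z => zu v z * S z)) by easy.
  change (- RInt (fun z => zu v (- z) * S (- z)) 0 x = - RInt (fun z => zu v z * S (- z)) 0 x).
  f_equal. apply RInt_ext. intros z _. now rewrite zu_opp.
Qed.

Lemma zu'_opp (x : R) : zu' v (- x) = - zu' v x.
Proof.
  assert (H : is_derive (fun y => zu v (- y)) x (- zu' v (- x))).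
  { evar_last.
    - apply (is_derive_comp (zu v) Ropp); [apply is_derive_zu|]. auto_derive; easy.
    - cbn; lra. }
  apply (is_derive_ext (fun y => zu v (- y)) (zu v)) in H; [|intros; apply zu_opp].
  apply is_derive_unique in H. pose proof (is_derive_unique _ _ _ (is_derive_zu x)). lra.
Qed.

Lemma solve_opp (S : R -> R) (K x : R) : cont S -> (forall z, Rabs (S z) <= K) ->
  intR (fun z => zs v z * S z) = 0 ->
  solve S (- x) = solve (fun z => S (- z)) x /\ solve' S (- x) = - solve' (fun z => S (- z)) x.
Proof.
  intros HS HK H0. unfold solve, solve'. rewrite (zsI_opp S K) by auto.
  rewrite zuI_opp, zu_opp, zs_opp, zu'_opp, rho0_opp by auto. split; ring.
Qed.

(** For [x < 0] the half-line estimate is applied to the reflected source: under the orthogonality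
    condition [solve] commutes with reflection, so decay at [+oo] gives decay at [-oo]. *)
Lemma solve_bound_line (b : R) : 0 < b -> b < 2 * k -> exists C, 0 < C /\
  forall (S : R -> R) (K : R), expdom K b S -> intR (fun z => zs v z * S z) = 0 ->
  forall x, Rabs (solve S x) <= C * K * exp (- b * Rabs x) /\
    Rabs (solve' S x) <= C * K * exp (- b * Rabs x).
Proof.
  intros Hb Hb2. destruct solve_bound as [C [HC H]]. exists (C / Rabs (2 * k - b)). split. { pos. }
  assert (pos : forall (S : R -> R) (K : R), expdom K b S -> forall x, 0 <= x -> Rabs (solve S x) <=
    C / Rabs (2 * k - b) * K * exp (- b * Rabs x) /\ Rabs (solve' S x) <= C / Rabs (2 * k - b) * K *
    exp (- b * Rabs x)).
  { intros S K HS x Hx. pose proof (expdom_ge0 HS). destruct HS as [HS1 HS2].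
    specialize (H S K b 0 x HS1 ltac:(lra) ltac:(lra) ltac:(lra) ltac:(lra)).
    rewrite (Rmin_right (2 * k) b), Rminus_0_r in H by lra. apply H. intros z _. rewrite Rminus_0_r.
    apply HS2. }
  intros S K HS H0 x. destruct (Rle_dec 0 x) as [Hx|Hx]; [now apply pos|].
  pose proof (expdom_ge0 HS). assert (HSb : forall z, Rabs (S z) <= K).
  { intros z. eapply Rle_trans; [apply HS|]. assert (exp (- b * Rabs z) <= 1); [|nra].
    apply exp_ge0_1. pose proof (Rabs_pos z). nra. }
  destruct (solve_opp S K (- x) (proj1 HS) HSb H0) as [E1 E2]. rewrite Ropp_involutive in E1, E2.
  rewrite E1, E2, Rabs_Ropp, <- (Rabs_Ropp x). apply pos; [now apply expdom_opp|lra].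
Qed.

Definition I0 : R := intR (fun z => zs v z * zs v z).

Lemma expdom_zs : exists C, 0 < C /\ expdom C (2 * k) (zs v) /\ expdom C (2 * k) (fun x => famp v (r0 x))
  /\ forall x, Rabs (zs v x) <= C /\ Rabs (famp v (r0 x)) <= C.
Proof.
  destruct modes_bound as [C [HC Hm]]. exists C. splits. split; [|split].
  - split; [apply cont_zs|]. solve_cont.
  - split; [|solve_cont]. apply (cont_of_derive _ (fun x => dfamp v (r0 x) * zs v x)). intros x.
    apply (is_derive_famp r0); [|derive]. pose proof (rho0_pos x). lra.
  - intros x. destruct (Hm x) as [H1 [H2 _]]. assert (exp (- (2 * k) * Rabs x) <= 1).
    { apply exp_ge0_1. pose proof (Rabs_pos x). pose proof kap_pos. nra. }
    split; nra.
Qed.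

Lemma I0_pos : 0 < I0.
Proof.
  destruct expdom_zs as [C [HC [Hz [_ Hb]]]]. pose proof kap_pos.
  assert (Hdom : expdom (C * C) (2 * k) (fun z => zs v z * zs v z)).
  { apply expdom_mult; [easy|apply Hz|]. solve_cont. }
  assert (Hc : cont (fun z => zs v z * zs v z)) by apply Hdom.
  pose proof (intR_lim (C * C) (2 * k) _ ltac:(lra) Hdom) as Hl.
  assert (Hp : 0 < RInt (fun z => zs v z * zs v z) 0 1).
  { apply RInt_gt_0; [lra| |].
    - intros x Hx. pose proof (zs_pos x ltac:(lra)). nra.
    - easy. }
  apply is_lim_spec in Hl. destruct (Hl (mkposreal _ Hp)) as [M HM].
  change (forall x, M < x -> Rabs (RInt (fun z => zs v z * zs v z) (- x) x - I0) < RInt (fun z => zs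
    v z * zs v z) 0 1) in HM.
  pose (T := Rmax 1 (M + 1)). assert (1 <= T) by bound. assert (M + 1 <= T) by bound.
  specialize (HM T ltac:(lra)). apply Rabs_def2 in HM.
  rewrite (RInt_cont_chasles _ (- T) 0 T Hc), (RInt_cont_chasles _ 0 1 T Hc) in HM.
  assert (0 <= RInt (fun z => zs v z * zs v z) (- T) 0).
  { apply RInt_ge_0; [lra|now apply ex_RInt_cont|]. bound. }
  assert (0 <= RInt (fun z => zs v z * zs v z) 1 T).
  { apply RInt_ge_0; [lra|now apply ex_RInt_cont|]. bound. }
  lra.
Qed.

End WholeLine.

(** * Existence of the family *)

(** A primitive of [famp] in [r], so that [r'^2 / 2 - Wpot r] is constant when there is no
    potential. Its positive zeros are the background 1, a double zero, and the bottom [|v|] of the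
    soliton. *)
Definition Wpot (v r : R) : R := (1 - r ^ 2) ^ 2 * (1 - v ^ 2 / r ^ 2) / 2.

Lemma is_derive_Wpot (v : R) (g : R -> R) (x g' : R) : g x <> 0 -> is_derive g x g' ->
  is_derive (fun y => Wpot v (g y)) x (famp v (g x) * g').
Proof.
  intros Hg H. unfold Wpot, famp. auto_derive. { repeat split; try (now exists g'). auto. }
  rewrite (Derive_eta H). field. easy.
Qed.

Section Existence.

Context {sp : speed}.
Notation v := (@vel sp).
Notation k := (kap v).
Notation r0 := (rho0 v).

Variables (V : R -> R) (a Kv : R).
Hypothesis Ha : 0 < a.
Hypothesis Ha2 : a < 2 * k.
Hypothesis HV : expdom Kv a V.

(* the derivative of [2 r0 f], where [f1 = f'] *)
Definition dr2 (f f1 : R -> R) (x : R) : R := 2 * (zs v x * f x + r0 x * f1 x).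
(** The integral of [V (rho0^2)'']. For the potential centred at the root it is [- M''(s0)]. *)
Definition Mdd : R := intR (fun x => V x * dr2 (zs v) (fun y => famp v (r0 y)) x).
(** The multiple of [zs] for which the next coefficient of [V (r^2)'] integrates to 0. The division
    by [Mdd] is where the simplicity of the root enters. *)
Definition kcV (S q : R -> R) : R :=
  - intR (fun x => V x * (dr2 (solve S) (solve' S) x + q x)) / Mdd.
Definition lamV (s : R -> R) : R := intR (fun x => zs v x * s x) / I0.

Hypothesis HMdd : Mdd <> 0.
Hypothesis HM1 : intR (fun x => V x * (2 * (r0 x * zs v x))) = 0.

Notation ac := (ca V kcV lamV).
Notation ac1 := (ca1 V kcV lamV).
Notation gc := (cg V kcV lamV).
Notation lc := (clam V kcV lamV).

Lemma expdom_V_mult (h : R -> R) (L : R) : cont h -> (forall x, Rabs (h x) <= L) ->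
  expdom (Kv * L) a (fun x => V x * h x).
Proof. intros. now apply expdom_mult. Qed.

Lemma exp_a_le1 (x : R) : 0 < exp (- a * Rabs x) <= 1.
Proof. splits. apply exp_ge0_1. pose proof (Rabs_pos x). nra. Qed.

Lemma le_drop_exp (p c x : R) : 0 <= c -> p <= c * exp (- a * Rabs x) -> p <= c.
Proof. intros Hc Hp. pose proof (exp_a_le1 x). nra. Qed.

Lemma cont_dr2 (f f1 : R -> R) : cont f -> cont f1 -> cont (dr2 f f1).
Proof. intros. apply cont_mult; [solve_cont|]. solve_cont. Qed.

Lemma dr2_bound (f f1 : R -> R) (Cz F x : R) : Rabs (zs v x) <= Cz -> Rabs (f x) <= F ->
  Rabs (f1 x) <= F -> Rabs (dr2 f f1 x) <= 2 * (Cz * F + F).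
Proof. intros Hz Hf Hf1. unfold dr2. rewrite <- (Rmult_1_l F). pose proof (rho0_lt1 x). mono. Qed.

Lemma lam_bound : exists C, 0 < C /\ forall S M, expdom M a S -> Rabs (lamV S) <= C * M.
Proof.
  destruct expdom_zs as [Cz [HCz [Hz [_ Hzb]]]]. pose proof I0_pos. exists (2 * PI / a * Cz / I0).
  split. { pos. } intros S M HS. unfold lamV, Rdiv. rewrite Rabs_mult, (Rabs_right (/ I0)).
  2:{ pos. }
  replace (2 * PI * / a * Cz * / I0 * M) with (2 * PI / a * (M * Cz) * / I0) by lra.
  apply Rmult_le_compat_r; [pos|]. apply intR_bound; [easy|].
  apply (expdom_ext _ _ (fun x => S x * zs v x)); [bound|].
  apply expdom_mult; [easy|apply cont_zs|]. solve_cont.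
Qed.

(** The linear estimate required by [majorant], for the whole line: projection of the source,
    solution, and multiple of [zs] are all bounded linearly by [M]. The last conclusion is the
    normalization of the new coefficient, in the form that sums to [V (r^2)']. *)
Lemma step_bound : exists CL, 0 <= CL /\ forall S q M, expdom M a S -> expdom M a q ->
  let S' x := S x - lamV S * zs v x in
  (forall x, Rabs (S' x) <= CL * M) /\
  (forall x, Rabs (solve S' x + kcV S' q * zs v x) <= CL * M * exp (- a * Rabs x) /\
     Rabs (solve' S' x + kcV S' q * famp v (r0 x)) <= CL * M * exp (- a * Rabs x)) /\
  intR (fun x => V x * (dr2 (fun y => solve S' y + kcV S' q * zs v y)
     (fun y => solve' S' y + kcV S' q * famp v (r0 y)) x + q x)) = 0.
Proof.
  destruct expdom_zs as [Cz [HCz [Hz [Hf Hzb]]]]. pose proof I0_pos as HI.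
  destruct lam_bound as [Cl [HCl Hlam]]. destruct (solve_bound_line a Ha Ha2) as [Cs [HCs Hs]].
  pose proof (expdom_ge0 HV) as HKv. assert (HM0 : 0 < Rabs Mdd) by pos. pose (C1 := 1 + Cl * Cz).
  assert (HC1 : 1 <= C1) by (unfold C1; nra). pose (C2 := Cs * C1).
  assert (HC2 : 0 < C2) by (unfold C2; nra). pose (L := 2 * (Cz * C2 + C2) + 1).
  assert (HL : 0 < L) by (unfold L; nra). pose (C3 := 2 * PI / a * (Kv * L) / Rabs Mdd).
  assert (HC3 : 0 <= C3). { apply Rmult_le_pos; [|pos]. pos. } exists (C1 + C2 + C3 * Cz). splits.
  intros S q M HS Hq S'. pose proof (expdom_ge0 HS) as HM.
  assert (HzC : expdom Cz a (zs v)) by (apply (expdom_weaken Cz Cz (2 * k) a); [lra|lra|easy]).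
  assert (HfC : expdom Cz a (fun x => famp v (r0 x))) by (apply (expdom_weaken Cz Cz (2 * k) a);
    [lra|lra|easy]).
  assert (HS' : expdom (C1 * M) a S').
  { apply (expdom_weaken (M + Cz * (Cl * M)) (C1 * M) a a); [unfold C1; lra|lra|].
    apply (expdom_ext _ _ (fun x => S x + zs v x * - lamV S)); [intros; unfold S'; ring|].
    apply expdom_plus; [easy|]. apply expdom_mult; [easy|solve_cont|]. bound. }
  assert (H0 : intR (fun z => zs v z * S' z) = 0).
  { rewrite (intR_ext _ (fun z => zs v z * S z + - lamV S * (zs v z * zs v z))) by (intros; unfold
      S'; ring).
    rewrite (intR_lin (Cz * M) (Cz * Cz) a); [|easy| |].
    - fold I0. unfold lamV. field. lra.
    - apply expdom_mult; [easy|apply HS|]. intros x. eapply Rle_trans; [apply HS|].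
      pose proof (exp_a_le1 x). nra.
    - apply expdom_mult; [easy|apply cont_zs|]. solve_cont. }
  pose proof (Hs S' (C1 * M) HS' H0) as Hsol.
  assert (Hsol' : forall x, Rabs (solve S' x) <= C2 * M * exp (- a * Rabs x) /\ Rabs (solve' S' x)
    <= C2 * M * exp (- a * Rabs x)).
  { intros x. replace (C2 * M) with (Cs * (C1 * M)) by (unfold C2; ring). apply Hsol. }
  assert (HS'b : forall x, Rabs (S' x) <= C1 * M).
  { intros x. destruct HS' as [_ HS'']. eapply Rle_trans; [apply HS''|]. pose proof (exp_a_le1 x).
    assert (0 <= C1 * M) by nra. nra. }
  assert (cont (solve S') /\ cont (solve' S')).
  { pose proof (solve_derive S' 0 (C1 * M) (proj1 HS') ltac:(auto)) as Hd. split.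
    - apply (cont_of_derive _ (solve' S')). solve_cont.
    - eapply cont_of_derive. intros; apply Hd. }
  assert (Hdom1 : expdom (Kv * (L * M)) a (fun x => V x * (dr2 (solve S') (solve' S') x + q x))).
  { apply expdom_V_mult.
    - apply cont_plus; [now apply cont_dr2|apply Hq].
    - intros x. triangle. destruct (Hsol' x) as [Hx1 Hx2]. assert (HC2M : 0 <= C2 * M) by nra.
      pose proof (dr2_bound (solve S') (solve' S') Cz (C2 * M) x (proj1 (Hzb x)) (le_drop_exp _ _ _
        HC2M Hx1) (le_drop_exp _ _ _ HC2M Hx2)).
      destruct Hq as [_ Hq]. specialize (Hq x). apply le_drop_exp in Hq; [|easy]. unfold L. lra. }
  assert (Hdom2 : expdom (Kv * (2 * (Cz * Cz + Cz))) a (fun x => V x * dr2 (zs v) (fun y => famp v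
    (r0 y)) x)).
  { apply expdom_V_mult.
    - apply cont_dr2; [apply cont_zs|apply Hf].
    - intros x. apply (dr2_bound _ _ Cz Cz); apply Hzb. }
  assert (Rabs (kcV S' q) <= C3 * M).
  { unfold kcV, Rdiv. rewrite Rabs_mult, Rabs_Ropp, Rabs_inv.
    replace (C3 * M) with (2 * PI / a * (Kv * (L * M)) * / Rabs Mdd) by (unfold C3; field; lra).
    apply Rmult_le_compat_r; [pos|]. now apply intR_bound. }
  split; [intros x; specialize (HS'b x); assert (0 <= C2 * M) by nra; assert (0 <= C3 * Cz * M) by
    pos; lra|].
  split.
  - intros x. destruct (Hsol' x) as [Hx1 Hx2].
    assert (Hgen : forall p r, Rabs p <= C2 * M * exp (- a * Rabs x) -> Rabs r <= Cz * exp (- a *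
      Rabs x) -> Rabs (p + kcV S' q * r) <= (C1 + C2 + C3 * Cz) * M * exp (- a * Rabs x)).
    { intros p r Hp Hr. triangle.
      apply Rle_trans with (C2 * M * exp (- a * Rabs x) + C3 * M * (Cz * exp (- a * Rabs x))).
      - mono.
      - assert (0 <= C1 * M * exp (- a * Rabs x)) by bound. lra. }
    split; apply Hgen; try easy; [apply HzC|apply HfC].
  - rewrite (intR_ext _ (fun x => V x * (dr2 (solve S') (solve' S') x + q x) + kcV S' q * (V x * dr2
      (zs v) (fun y => famp v (r0 y)) x))).
    2:{ intros x. unfold dr2. ring. } rewrite (intR_lin _ _ a _ _ _ Ha Hdom1 Hdom2). fold Mdd.
    unfold kcV. now field.
Qed.

Lemma coefficients_bound : exists A B, 0 < A /\ 0 < B /\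
  (forall n, cont (ac n) /\ cont (ac1 n) /\ cont (gc n) /\
    forall x, is_derive (ac n) x (ac1 n x) /\ is_derive (ac1 n) x (coef2 V lc ac gc n x)) /\
  (forall n x, (1 <= n)%nat -> Rabs (ac n x) <= A * B ^ n * exp (- a * Rabs x) /\
    Rabs (ac1 n x) <= A * B ^ n * exp (- a * Rabs x) /\
    Rabs (gc n x) <= A * B ^ n * exp (- a * Rabs x)) /\
  (forall n x, Rabs (ac n x) <= A * B ^ n /\ Rabs (ac1 n x) <= A * B ^ n /\
    Rabs (gc n x) <= A * B ^ n /\ Rabs (coef2 V lc ac gc n x) <= A * B ^ n) /\
  pbound A B lc /\
  (forall n, intR (fun x => V x * (2 * PS_mult (fun i => ac i x) (fun i => ac1 i x) n)) = 0).
Proof.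
  destruct step_bound as [CL [HCL Hstep]]. pose proof (expdom_ge0 HV) as HKv.
  destruct (majorant Kv CL HKv HCL) as [A [B [G [HA [HB [HG Hmaj]]]]]].
  (* As [a < 2 k], inverting the linearized operator loses no decay, and one weight serves both
     coefficients and sources. *)
  pose (om := fun (_ : nat) x => exp (- a * Rabs x)).
  assert (Hmajle : forall n, 0 < maj B n <= B ^ n) by (intros; split; [now apply maj_pos|now apply
    maj_le]).
  assert (Hcontdsq : forall n, (forall i, (i <= n)%nat -> cont (ac i) /\ cont (ac1 i)) -> cont (dsq
    ac ac1 n)).
  { intros n Hn. apply cont_mult; [solve_cont|]. apply cont_mid; intros; now apply Hn. }
  (* [step_bound] applies to a continuous source only, so regularity is obtained by an induction of
     its own from pointwise bounds on the sources already reached. *)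
  assert (Hder : forall n, (forall j x, (j < n)%nat -> True -> Rabs (src V ac gc j x) <= B * maj B
    (S j) * exp (- a * Rabs x)) -> (forall i, (i <= n)%nat -> cont (ac i) /\ cont (ac1 i) /\ cont
    (gc i) /\ forall x, is_derive (ac i) x (ac1 i x) /\ is_derive (ac1 i) x (coef2 V lc ac gc i x))
    /\ (forall j, (j < n)%nat -> expdom (B * maj B (S j)) a (src V ac gc j))).
  { induction n as [|n IHn]; intros Hsrc.
    - split; [|easy]. intros i Hi.
      apply (ca_derive V kcV lamV (proj1 HV) 0 (fun _ => 0) 0); [easy|easy].
    - destruct IHn as [IH1 IH2]; [intros; apply Hsrc; [lia|easy]|].
      assert (Hdom : forall j, (j < S n)%nat -> expdom (B * maj B (S j)) a (src V ac gc j)).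
      { intros j Hj. split; [|solve_cont].
        apply (cont_ext (fun x => csrc V kcV lamV j x + lc (S j) * zs v x)).
        { intros x. unfold csrc. ring. }
        apply cont_plus; [|apply cont_mult; [solve_cont|apply cont_zs]].
        apply (cont_csrc V kcV lamV (proj1 HV)); intros i Hi; apply IH1; lia. }
      split; [|easy].
      apply (ca_derive V kcV lamV (proj1 HV) 0 (fun j => CL * (B * maj B (S j))) (S n)).
      intros j x Hj _. assert (Hz : expdom (B * maj B (S j)) a (fun _ => 0)).
      { split; [solve_cont|]. intros z. pose proof (Hmajle (S j)). bound. }
      destruct (Hstep (src V ac gc j) (fun _ => 0) _ (Hdom j Hj) Hz) as [H1 _]. apply H1. }
  assert (main : forall n x, True -> (Rabs (ac (S n) x) <= A * maj B (S n) * om (S n) x /\ Rabs (ac1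
    (S n) x) <= A * maj B (S n) * om (S n) x /\ Rabs (gc (S n) x) <= G * maj B (S n) * om (S n) x)
    /\ Rabs (src V ac gc n x) <= B * maj B (S n) * om (S n) x).
  { apply (Hmaj (fun _ => True) om om V ac ac1 gc).
    - intros x i j _ _ _. unfold om. pose proof (exp_a_le1 x). nra.
    - intros x i _ _. unfold om. bound.
    - solve_cont.
    - intros x i _ _. unfold om. pose proof (exp_a_le1 x). destruct HV as [_ HV'].
      specialize (HV' x). pose proof (Rabs_pos (V x)). nra.
    - easy.
    - easy.
    - intros n x. apply cg_S.
    - intros n M HM IH IHs HS Hq x _. destruct (Hder n IHs) as [Hd1 Hd2].
      assert (HSd : expdom M a (src V ac gc n)).
      { split; [|solve_cont]. apply (cont_ext (fun x => csrc V kcV lamV n x + lc (S n) * zs v x)).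
        { intros y. unfold csrc. ring. }
        apply cont_plus; [|apply cont_mult; [solve_cont|apply cont_zs]].
        apply (cont_csrc V kcV lamV (proj1 HV)); intros i Hi; now apply Hd1. }
      assert (Hqd : expdom M a (dsq ac ac1 n)).
      { split; [|solve_cont]. apply Hcontdsq. intros i Hi. split; now apply Hd1. }
      destruct (Hstep _ _ M HSd Hqd) as [_ [H2 _]]. rewrite ca_S, ca1_S. apply H2. }
  assert (Hsrcall : forall n, forall j x, (j < n)%nat -> True -> Rabs (src V ac gc j x) <= B * maj B
    (S j) * exp (- a * Rabs x)) by solve_cont.
  assert (Hd : forall n, cont (ac n) /\ cont (ac1 n) /\ cont (gc n) /\ forall x, is_derive (ac n) x
    (ac1 n x) /\ is_derive (ac1 n) x (coef2 V lc ac gc n x)).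
  { intros n. now apply (Hder n (Hsrcall n)). }
  assert (Hsd : forall n, expdom (B * maj B (S n)) a (src V ac gc n)).
  { intros n. apply (Hder (S n) (Hsrcall (S n))). lia. }
  destruct lam_bound as [Cl [HCl Hlam]]. destruct dfamp_rho0_bound as [Cd [HCd Hdb]].
  destruct expdom_zs as [Cz [HCz [_ [_ Hzb]]]]. pose proof vabs_bounds as Hv.
  assert (Hiv : 0 < / Rabs v) by pos.
  pose (K := A + G + Cd * A + B + Cl * B * Cz + Cl * B + 1 + / Rabs v + Cz).
  assert (HCdA : 0 < Cd * A) by pos. assert (HClB : 0 < Cl * B) by pos.
  assert (HClBz : 0 < Cl * B * Cz) by pos.
  assert (HlcS : forall n, Rabs (lc (S n)) <= Cl * B * B ^ S n).
  { intros n. eapply Rle_trans; [apply (Hlam _ _ (Hsd n))|]. rewrite Rmult_assoc.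
    apply Rmult_le_compat_l; [lra|]. apply Rmult_le_compat_l; [lra|]. apply Hmajle. }
  exists K, B. split; [unfold K; lra|]. split; [easy|]. split; [easy|].
  assert (HBn : forall n, 0 < B ^ n) by bound.
  assert (HKe : forall c n, c <= K -> c * B ^ n <= K * B ^ n) by bound.
  assert (Hdec : forall n x, (1 <= n)%nat -> Rabs (ac n x) <= A * B ^ n * exp (- a * Rabs x) /\ Rabs
    (ac1 n x) <= A * B ^ n * exp (- a * Rabs x) /\ Rabs (gc n x) <= G * B ^ n * exp (- a * Rabs x)).
  { intros [|n] x Hn; [lia|]. destruct (main n x I) as [[H1 [H2 H3]] _]. unfold om in *.
    pose proof (exp_a_le1 x) as He. pose proof (Hmajle (S n)) as Hm.
    assert (Hgen : forall c, 0 < c -> c * maj B (S n) * exp (- a * Rabs x) <= c * B ^ S n * exp (- a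
      * Rabs x)) by bound.
    pose proof (Hgen A HA). pose proof (Hgen G HG). lra. }
  split; [|split; [|split]].
  - intros n x Hn. destruct (Hdec n x Hn) as [H1 [H2 H3]]. pose proof (exp_a_le1 x) as He.
    assert (Hgen : forall c, c <= K -> c * B ^ n * exp (- a * Rabs x) <= K * B ^ n * exp (- a * Rabs
      x)) by bound.
    pose proof (Hgen A ltac:(unfold K; lra)). pose proof (Hgen G ltac:(unfold K; lra)). lra.
  - intros [|n] x.
    + pose proof (rho0_pos x). pose proof (rho0_lt1 x). pose proof (rho0_ge x).
      destruct (Hzb x) as [Hz1 Hz2]. change (ac O x) with (r0 x). change (ac1 O x) with (zs v x).
      change (gc O x) with (/ r0 x). change (coef2 V lc ac gc O x) with (famp v (r0 x)).
      assert (0 < / r0 x <= / Rabs v) by mono.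
      rewrite (Rabs_right (r0 x)), (Rabs_right (/ r0 x)) by lra. unfold K. algebra.
    + destruct (Hdec (S n) x ltac:(lia)) as [H1 [H2 H3]]. pose proof (exp_a_le1 x) as He.
      assert (Hgen : forall c, 0 < c -> c <= K -> c * B ^ S n * exp (- a * Rabs x) <= K * B ^ S n).
      { intros c Hc HcK. pose proof (HBn (S n)). assert (0 <= c * B ^ S n) by nra. nra. }
      pose proof (Hgen A HA ltac:(unfold K; lra)). pose proof (Hgen G HG ltac:(unfold K; lra)).
      splits. triangle.
      apply Rle_trans with (Cd * (A * B ^ S n) + (B * B ^ S n + Cl * B * B ^ S n * Cz)).
      * apply Rplus_le_compat.
        -- apply Rabs_mult_le; [easy|]. pose proof (HBn (S n)). assert (0 <= A * B ^ S n) by nra.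
          nra.
        -- triangle. apply Rplus_le_compat.
          ++ destruct (main n x I) as [_ H4]. eapply Rle_trans; [exact H4|]. unfold om.
            pose proof (Hmajle (S n)). assert (0 <= B * maj B (S n)) by nra. nra.
          ++ rewrite Rabs_Ropp. apply Rabs_mult_le; [easy|apply Hzb].
      * replace (_ + _) with ((Cd * A + B + Cl * B * Cz) * B ^ S n) by ring. apply HKe. unfold K.
        lra.
  - intros [|n].
    + change (lc O) with 0. rewrite Rabs_R0. unfold K. nra.
    + eapply Rle_trans; [apply HlcS|]. apply HKe. unfold K. lra.
  - intros [|n].
    + easy.
    + set (M := B * maj B (S n) + 8 * (A * A) * maj B (S n)). pose proof (Hmajle (S n)) as Hm.
      assert (HS1 : expdom M a (src V ac gc n)).
      { apply (expdom_weaken (B * maj B (S n)) M a a); [unfold M; nra|lra|easy]. }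
      assert (Hq1 : expdom M a (dsq ac ac1 n)).
      { apply (expdom_weaken (8 * (A * A) * maj B (S n)) M a a); [unfold M; nra|lra|].
        split; [apply Hcontdsq; intros; split; apply Hd|]. intros x.
        replace (8 * (A * A) * maj B (S n) * exp (- a * Rabs x)) with (2 * (4 * A * A * maj B (S n)
          * exp (- a * Rabs x))) by ring.
        apply Rabs_mult_le; [mono|]. pose proof (exp_a_le1 x).
        apply (mid_bound _ _ (fun _ => exp (- a * Rabs x))); try lra.
        - intros [|i] Hi; [lia|]. solve_cont.
        - intros [|i] Hi; [lia|]. solve_cont.
        - bound. }
      destruct (Hstep _ _ M HS1 Hq1) as [_ [_ H3]].
      assert (H3' : intR (fun x => V x * (dr2 (fun y => solve (csrc V kcV lamV n) y + ckc V kcV lamV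
        n * zs v y) (fun y => solve' (csrc V kcV lamV n) y + ckc V kcV lamV n * famp v (r0 y)) x +
        dsq ac ac1 n x)) = 0) by easy.
      rewrite <- H3'. apply intR_ext. intros x. rewrite PS_mult_S. unfold dr2, dsq.
      rewrite !ca_S, !ca1_S. cbn; lra.
Qed.

End Existence.

Lemma exp_decay_lim (f : R -> R) (K a : R) : 0 < a ->
  (forall x, Rabs (f x) <= K * exp (- a * Rabs x)) -> is_lim f p_infty 0 /\ is_lim f m_infty 0.
Proof.
  intros Ha Hf. assert (Hsmall : forall e x, 0 < e -> K / (a * e) < Rabs x -> Rabs (f x) < e).
  { intros e x He Hx. eapply Rle_lt_trans; [apply Hf|]. assert (K < a * e * Rabs x).
    { apply (Rmult_lt_compat_l (a * e)) in Hx; [|nra].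
      replace (a * e * (K / (a * e))) with K in Hx by algebra. easy. }
    pose proof (exp_ineq1_le (a * Rabs x)). pose proof (exp_pos (a * Rabs x)).
    replace (- a * Rabs x) with (- (a * Rabs x)) by ring. rewrite exp_Ropp.
    apply (Rmult_lt_reg_r (exp (a * Rabs x))); [easy|]. rewrite Rmult_assoc, Rinv_l by lra. nra. }
  split; apply is_lim_spec; intros [e He]; cbn.
  - exists (Rabs (K / (a * e))). intros x Hx. rewrite Rminus_0_r. apply Hsmall; [easy|]. bound.
  - exists (- Rabs (K / (a * e))). intros x Hx. rewrite Rminus_0_r. apply Hsmall; [easy|]. bound.
Qed.

Lemma le_geom_0 (x C : R) : (forall N : nat, Rabs x <= C * (/ 2) ^ N) -> x = 0.
Proof.
  intros H. destruct (Req_dec x 0) as [|Hx]; [easy|exfalso]. assert (0 < Rabs x) by pos.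
  assert (0 < C) by (specialize (H O); cbn in H; lra).
  destruct (pow_lt_1_zero (/ 2) ltac:(rewrite Rabs_right; lra) (Rabs x / C)) as [N HN]. { pos. }
  specialize (HN N (Nat.le_refl N)). specialize (H N). rewrite Rabs_right in HN by pos.
  apply (Rmult_lt_compat_l C) in HN; [|easy].
  replace (C * (Rabs x / C)) with (Rabs x) in HN by algebra. lra.
Qed.

(** * Summation and vanishing of the multipliers *)

Section Family.

Context {sp : speed}.
Notation v := (@vel sp).
Notation k := (kap v).
Notation r0 := (rho0 v).

Lemma Wpot_bound (r : R) : Rabs v / 2 <= r <= 2 -> Rabs (Wpot v r) <= 25 * (1 - r) ^ 2.
Proof.
  intros Hr. pose proof vabs_bounds.
  assert (E : Wpot v r = ((1 + r) ^ 2 * (1 - v ^ 2 / r ^ 2) / 2) * (1 - r) ^ 2).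
  { unfold Wpot. lra. }
  rewrite E. apply Rabs_mult_le; [|rewrite Rabs_right; [lra|pos]]. assert (0 <= v ^ 2 / r ^ 2 <= 4).
  { split.
    - pos.
    - apply (Rmult_le_reg_r (r ^ 2)); [pos|].
      replace (v ^ 2 / r ^ 2 * r ^ 2) with (v ^ 2) by algebra. rewrite <- (pow2_abs v). nra. }
  apply Rabs_le. nra.
Qed.

Variables (V : R -> R) (a Kv : R).
Hypothesis Ha : 0 < a.
Hypothesis Ha2 : a < 2 * k.
Hypothesis HV : expdom Kv a V.
Hypothesis HMdd : Mdd V <> 0.
Hypothesis HM1 : intR (fun x => V x * (2 * (r0 x * zs v x))) = 0.

Notation ac := (ca V (kcV V) lamV).
Notation ac1 := (ca1 V (kcV V) lamV).
Notation gc := (cg V (kcV V) lamV).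
Notation lc := (clam V (kcV V) lamV).

Definition rhoE (e y : R) : R := PSeries (fun n => ac n y) e.
Definition rhoE1 (e y : R) : R := PSeries (fun n => ac1 n y) e.
Definition gE (e y : R) : R := PSeries (fun n => gc n y) e.

Lemma family : exists e0 K B, 0 < e0 /\ 0 < K /\ 0 < B /\ e0 <= / (8 * B) /\
  (forall n, cont (gc n)) /\
  (forall n x, Rabs (ac n x) <= K * B ^ n /\ Rabs (gc n x) <= K * B ^ n) /\
  (forall n x, (1 <= n)%nat -> Rabs (gc n x) <= K * B ^ n * exp (- a * Rabs x)) /\
  forall e, Rabs e <= e0 -> forall y,
    Rabs v / 2 <= rhoE e y <= 2 /\ rhoE e y * gE e y = 1 /\
    is_derive (rhoE e) y (rhoE1 e y) /\
    is_derive (rhoE1 e) y (famp v (rhoE e y) + 2 * e * V y * rhoE e y) /\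
    Rabs (rhoE e y - r0 y) <= K * Rabs e * exp (- a * Rabs y) /\
    Rabs (rhoE1 e y - zs v y) <= K * Rabs e * exp (- a * Rabs y).
Proof.
  destruct (coefficients_bound V a Kv Ha Ha2 HV HMdd HM1) as [A [B [HA [HB [Hder [Hdec [Hb [Hlc
    HJ]]]]]]]].
  destruct expdom_zs as [Cz [HCz [Hz [_ Hzb]]]]. pose proof I0_pos as HI.
  pose proof vabs_bounds as Hv. set (K := A + 2 * (A * B)). assert (HAB : 0 < A * B) by pos.
  pose (q := 2 * PI / a * (2 * (A * B) * Cz)). assert (Hq : 0 < q).
  { apply Rmult_lt_0_compat; [pos|]. pos. }
  (* The three bounds provide convergence of the series, the range [[|v| / 2, 2]] of the amplitude,
     and a distance of at most [I0 / 2] between [intR (zs r')] and [I0]. *)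
  pose (e0 := Rmin (/ (8 * B)) (Rmin (Rabs v / (4 * (A * B))) (I0 / (2 * q)))).
  assert (He0 : 0 < e0) by bound. exists e0, K, B. splits. split; [unfold K; lra|]. splits.
  split; [apply Rmin_l|]. assert (HKle : forall n, A * B ^ n <= K * B ^ n).
  { intros n. unfold K. bound. }
  split; [solve_cont|]. split.
  { intros n x. pose proof (HKle n). destruct (Hb n x) as [H1 [_ [H2 _]]]. lra. }
  split.
  { intros n x Hn. destruct (Hdec n x Hn) as [_ [_ H1]]. eapply Rle_trans; [exact H1|]. mono. }
  intros e He. assert (He1 : Rabs e <= / (8 * B)) by (eapply Rle_trans; [exact He|apply Rmin_l]).
  assert (He2 : 2 * (A * B) * Rabs e <= Rabs v / 2) by bound.
  assert (He3 : q * Rabs e <= I0 / 2) by bound. assert (He4 : Rabs e <= / (2 * B)).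
  { eapply Rle_trans; [exact He1|]. mono. }
  set (r := rhoE e). set (r1 := rhoE1 e).
  assert (HE : forall y, 0 < exp (- a * Rabs y) <= 1) by (intros; now apply exp_a_le1).
  assert (Hclose : forall y, Rabs (r y - r0 y) <= 2 * (A * B) * Rabs e * exp (- a * Rabs y) /\ Rabs
    (r1 y - zs v y) <= 2 * (A * B) * Rabs e * exp (- a * Rabs y)).
  { intros y. specialize (HE y).
    assert (Hfin : forall c : nat -> R, (forall n, (1 <= n)%nat -> Rabs (c n) <= A * B ^ n * exp (-
      a * Rabs y)) -> Rabs (PSeries c e - c O) <= 2 * (A * B) * Rabs e * exp (- a * Rabs y)).
    { intros c Hc.
      pose proof (PSeries_tail 1 A B (exp (- a * Rabs y)) e c HB He4 ltac:(nra) Hc) as Ht.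
      cbn [sumn pow] in Ht. bound. }
    assert (H1 := Hfin (fun n => ac n y) ltac:(intros; now apply Hdec)).
    assert (H2 := Hfin (fun n => ac1 n y) ltac:(intros; now apply Hdec)). easy. }
  assert (Hrange : forall y, Rabs v / 2 <= r y <= 2).
  { intros y. destruct (Hclose y) as [H _]. specialize (HE y).
    assert (Hd : 2 * (A * B) * Rabs e * exp (- a * Rabs y) <= Rabs v / 2) by nra.
    pose proof (rho0_ge y). pose proof (rho0_lt1 y). bound. }
  assert (Hsum : forall y, r y * gE e y = 1 /\ is_derive r y (r1 y) /\ is_derive r1 y (famp v (r y)
    + 2 * e * V y * r y - zs v y * PSeries lc e)).
  { intros y.
    pose proof (sum_solution V lc ac ac1 gc A B y (mkposreal 1 Rlt_0_1) e HB He1 (fun z n _ => Hb n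
      z) eq_refl Hlc ltac:(intros; now rewrite ca_0) ltac:(intros; now rewrite cg_0) ltac:(intros;
      apply cg_S) (fun n => proj2 (proj2 (proj2 (Hder n))))) as H.
    easy. }
  assert (HLam : PSeries lc e = 0).
  { set (L := PSeries lc e) in *.
    assert (Hr1b : forall y, Rabs (r1 y) <= (Cz + 1) * exp (- a * Rabs y)).
    { intros y. destruct (Hclose y) as [_ H].
      assert (Hzy : Rabs (zs v y) <= Cz * exp (- a * Rabs y)).
      { eapply Rle_trans; [apply Hz|]. mono. }
      replace (r1 y) with (r1 y - zs v y + zs v y) by ring. triangle. specialize (HE y). nra. }
    assert (Hcr : cont r) by (apply (cont_of_derive _ r1); intros; apply Hsum).
    assert (Hcr1 : cont r1) by (eapply cont_of_derive; intros; apply Hsum).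
    assert (Hr1B : forall y, Rabs (r1 y) <= Cz + 1).
    { intros y. eapply Rle_trans; [apply Hr1b|]. specialize (HE y). nra. }
    assert (HrB : forall y, Rabs (r y) <= 2). { intros y. specialize (Hrange y). mono. }
    assert (D1 : expdom (Kv * (4 * (Cz + 1))) a (fun y => V y * (2 * (r y * r1 y)))).
    { apply expdom_mult; [easy| |].
      - solve_cont.
      - intros y. replace (4 * (Cz + 1)) with (2 * (2 * (Cz + 1))) by ring. mono. }
    assert (Hzr : expdom (Cz * (Cz + 1)) a (fun y => zs v y * r1 y)).
    { apply expdom_mult; [|easy|easy]. apply (expdom_weaken Cz Cz (2 * k) a); [lra|lra|easy]. }
    assert (Hen : forall y, Rabs (r1 y * r1 y / 2 - Wpot v (r y)) <= ((Cz + 1) * (Cz + 1) / 2 + 25 *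
      25) * exp (- a * Rabs y)).
    { intros y. specialize (HE y). destruct (Hclose y) as [Hc _]. pose proof (rho0_near1 y) as Hn.
      pose proof (exp_neg_le a (2 * k) (Rabs y) ltac:(lra) (Rabs_pos y)) as Hee. triangle.
      rewrite Rabs_Ropp, Rmult_plus_distr_r. apply Rplus_le_compat.
      - assert (Rabs (r1 y * r1 y) <= (Cz + 1) * ((Cz + 1) * exp (- a * Rabs y))) by mono. bound.
      - eapply Rle_trans; [now apply Wpot_bound|].
        assert (Rabs (1 - r y) <= 5 * exp (- a * Rabs y)).
        { replace (1 - r y) with ((1 - r0 y) + - (r y - r0 y)) by ring. triangle.
          rewrite Rabs_Ropp, (Rabs_right (1 - r0 y)) by lra. nra. }
        rewrite <- (pow2_abs (1 - r y)). pose proof (Rabs_pos (1 - r y)). nra. }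
    (* The derivative of the energy is integrated over the line. The energy itself vanishes at both
       ends, because [r'] and [r - 1] decay. *)
    assert (Hid : e * intR (fun y => V y * (2 * (r y * r1 y))) + - L * intR (fun y => zs v y * r1 y)
      = 0).
    { assert (D1' : expdom (Kv * (4 * (Cz + 1)) * Rabs e) a (fun y => V y * (2 * (r y * r1 y)) *
        e)).
      { apply expdom_mult; [easy|solve_cont|]. intros; lra. }
      assert (E1 : intR (fun y => e * (V y * (2 * (r y * r1 y)))) = e * intR (fun y => V y * (2 * (r
        y * r1 y)))).
      { rewrite (intR_ext _ (fun y => 0 + e * (V y * (2 * (r y * r1 y))))) by bound.
        rewrite (intR_lin 0 _ a _ _ e Ha (expdom_0 a) D1), intR_0. ring. }
      rewrite <- E1.
      rewrite <- (intR_lin _ _ a _ _ _ Ha (expdom_ext _ _ _ (fun y => e * (V y * (2 * (r y * r1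
        y)))) (fun y => Rmult_comm _ _) D1') Hzr).
      replace 0 with (0 - 0) by ring.
      apply (intR_derive (Kv * (4 * (Cz + 1)) * Rabs e + Cz * (Cz + 1) * Rabs (- L)) a (fun y => r1
        y * r1 y / 2 - Wpot v (r y))); [easy| | | |].
      - apply expdom_plus.
        + apply (expdom_ext _ _ (fun y => V y * (2 * (r y * r1 y)) * e)); [bound|easy].
        + apply (expdom_ext _ _ (fun y => zs v y * r1 y * - L)); [bound|].
          apply expdom_mult; [easy|solve_cont|]. intros; lra.
      - intros y. destruct (Hsum y) as [_ [H1 H2]].
        assert (Hr0 : r y <> 0) by (specialize (Hrange y); lra).
        pose proof (is_derive_Wpot v r y (r1 y) Hr0 H1) as H3. evar_last.
        + apply (is_derive_minus (fun y => r1 y * r1 y / 2)); [|exact H3].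
          auto_derive; [solve_ex_derive|]. reflexivity.
        + rewrite (Derive_eta H2). cbn; lra.
      - exact (proj1 (exp_decay_lim _ _ a Ha Hen)).
      - exact (proj2 (exp_decay_lim _ _ a Ha Hen)). }
    (* Each partial sum integrates to 0 by the choice of the coefficients, and the remainder after
       [N] terms is [O(2^(- N))]. This replaces an exchange of sum and integral. *)
    assert (intR (fun y => V y * (2 * (r y * r1 y))) = 0).
    { pose (d := fun n y => 2 * PS_mult (fun i => ac i y) (fun i => ac1 i y) n).
      assert (Hdb : forall y, pbound (2 * (A * A)) (2 * B) (fun n => d n y)).
      { intros y n. rewrite Rmult_assoc. apply Rabs_mult_le; [mono|].
        apply pbound_mult; [easy| |]; intros i; apply Hb. }
      assert (forall n, cont (d n)).
      { intros n. apply cont_mult; [solve_cont|]. unfold PS_mult.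
        apply (cont_ext (fun x => sumn (S n) (fun j => ac j x * ac1 (n - j)%nat x))).
        - intros x. now rewrite sumn_sum_f_R0.
        - apply (cont_sumn (S n) (fun j x => ac j x * ac1 (n - j)%nat x)). intros j _.
          apply cont_mult; apply Hder. }
      assert (HPN : forall N, exists L, expdom L a (fun y => V y * sumn N (fun n => d n y * e ^ n))
        /\ intR (fun y => V y * sumn N (fun n => d n y * e ^ n)) = 0).
      { induction N as [|N [L1 [IH1 IH2]]].
        - exists 0. split.
          + apply (expdom_ext _ _ (fun _ => 0)); [intros; cbn; ring|apply expdom_0].
          + rewrite (intR_ext _ (fun y => 0)) by (intros; cbn; ring). apply intR_0.
        - assert (DN : expdom (Kv * (2 * (A * A) * (2 * B) ^ N)) a (fun y => V y * d N y)).
          { apply expdom_mult; [easy|easy|]. solve_cont. }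
          exists (L1 + Kv * (2 * (A * A) * (2 * B) ^ N) * Rabs (e ^ N)). split.
          + apply (expdom_ext _ _ (fun y => V y * sumn N (fun n => d n y * e ^ n) + V y * d N y * e
              ^ N)).
            { intros; cbn; ring. } apply expdom_plus; [easy|].
            apply expdom_mult; [easy|solve_cont|]. intros; lra.
          + rewrite (intR_ext _ (fun y => V y * sumn N (fun n => d n y * e ^ n) + e ^ N * (V y * d N
              y))).
            2:{ intros; cbn; ring. } rewrite (intR_lin _ _ a _ _ _ Ha IH1 DN), IH2. unfold d.
            rewrite HJ. ring. }
      apply (le_geom_0 _ (2 * PI / a * (Kv * (4 * (A * A))))). intros N.
      destruct (HPN N) as [LN [HN1 HN2]].
      replace (intR (fun y => V y * (2 * (r y * r1 y)))) with (intR (fun y => V y * (2 * (r y * r1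
        y)) + -1 * (V y * sumn N (fun n => d n y * e ^ n)))).
      2:{ rewrite (intR_lin _ _ a _ _ _ Ha D1 HN1), HN2. ring. }
      replace (2 * PI / a * (Kv * (4 * (A * A))) * (/ 2) ^ N) with (2 * PI / a * (Kv * (4 * (A * A)
        * (/ 2) ^ N))) by ring.
      apply intR_bound; [easy|].
      apply (expdom_ext _ _ (fun y => V y * (2 * (r y * r1 y) + -1 * sumn N (fun n => d n y * e ^
        n)))); [bound|].
      apply expdom_mult; [easy| |].
      - apply cont_plus; [apply cont_mult; [solve_cont|now apply cont_mult]|].
        apply cont_mult; [solve_cont|]. apply (cont_sumn N (fun n y => d n y * e ^ n)). solve_cont.
      - intros y. assert (Er : 2 * (r y * r1 y) = PSeries (fun n => d n y) e).
        { unfold d.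
          change (fun n => 2 * PS_mult (fun i => ac i y) (fun i => ac1 i y) n) with (PS_scal 2
            (PS_mult (fun i => ac i y) (fun i => ac1 i y))).
          assert (Rabs e < / B).
          { eapply Rle_lt_trans; [exact He1|]. apply Rinv_lt_contravar; nra. }
          rewrite PSeries_scal, PSeries_mult; [reflexivity| |]; apply (pbound_cv A B); try easy;
            intros n; apply Hb. }
        rewrite Er.
        replace (_ + _) with (PSeries (fun n => d n y) e - sumn N (fun n => d n y * e ^ n)) by ring.
        eapply Rle_trans.
        + apply (PSeries_tail N (2 * (A * A)) (2 * B) 1 e); [lra| |nra|].
          * eapply Rle_trans; [exact He1|]. mono.
          * intros n _. rewrite Rmult_1_r. apply Hdb.
        + replace (4 * (A * A) * (/ 2) ^ N) with (2 * (2 * (A * A) * 1 * (/ 2) ^ N)) by ring. bound. }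
    assert (HI2 : Rabs (intR (fun y => zs v y * r1 y) - I0) <= I0 / 2).
    { assert (Dz : expdom (Cz * Cz) a (fun z => zs v z * zs v z)).
      { apply expdom_mult; [|apply cont_zs|apply Hzb].
        apply (expdom_weaken Cz Cz (2 * k) a); [lra|lra|easy]. }
      replace (intR (fun y => zs v y * r1 y) - I0) with (intR (fun y => zs v y * r1 y + -1 * (zs v y
        * zs v y))).
      2:{ rewrite (intR_lin _ _ a _ _ _ Ha Hzr Dz). unfold I0. ring. }
      eapply Rle_trans; [|exact He3]. unfold q.
      replace (2 * PI / a * (2 * (A * B) * Cz) * Rabs e) with (2 * PI / a * (2 * (A * B) * Rabs e *
        Cz)) by ring.
      apply intR_bound; [easy|].
      apply (expdom_ext _ _ (fun y => (r1 y + -1 * zs v y) * zs v y)); [bound|].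
      apply expdom_mult; [|apply cont_zs|apply Hzb]. split.
      - solve_cont.
      - intros y. replace (r1 y + -1 * zs v y) with (r1 y - zs v y) by ring. apply Hclose. }
    apply Rabs_le_between in HI2. nra. }
  intros y. destruct (Hsum y) as [H1 [H2 H3]]. rewrite HLam, Rmult_0_r, Rminus_0_r in H3. splits.
  destruct (Hclose y) as [H4 H5].
  assert (2 * (A * B) * Rabs e * exp (- a * Rabs y) <= K * Rabs e * exp (- a * Rabs y)); [|lra].
  unfold K. bound.
Qed.

End Family.

(** * A priori bounds for gray amplitudes *)

Record gm (v e : R) (V p p1 : R -> R) : Prop := {
  gm_pos : forall x, 0 < p x;
  gm_d : forall x, is_derive p x (p1 x);
  gm_dd : forall x, is_derive p1 x (famp v (p x) + 2 * e * V x * p x);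
  gm_pinf : is_lim p p_infty 1;
  gm_minf : is_lim p m_infty 1 }.

Arguments gm_pos {v e V p p1}.
Arguments gm_d {v e V p p1}.
Arguments gm_dd {v e V p p1}.
Arguments gm_pinf {v e V p p1}.
Arguments gm_minf {v e V p p1}.

#[global] Hint Resolve gm_d gm_dd : derive.

Lemma is_derive_opp_arg (f : R -> R) (x l : R) :
  is_derive f (- x) l -> is_derive (fun y => f (- y)) x (- l).
Proof.
  intros H. evar_last.
  - apply (is_derive_comp f Ropp); [exact H|]. auto_derive; easy.
  - cbn; lra.
Qed.

Lemma is_lim_opp_arg (f : R -> R) (l : R) :
  (is_lim f p_infty l -> is_lim (fun x => f (- x)) m_infty l) /\
  (is_lim f m_infty l -> is_lim (fun x => f (- x)) p_infty l).
Proof.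
  split; intros H.
  - apply (is_lim_comp f (fun T => - T) m_infty (Finite l) p_infty); [easy| |].
    + apply (is_lim_opp (fun x => x) m_infty m_infty). easy.
    + exists 0. easy.
  - apply (is_lim_comp f (fun T => - T) p_infty (Finite l) m_infty); [easy| |].
    + apply (is_lim_opp (fun x => x) p_infty p_infty). easy.
    + exists 0. easy.
Qed.

Lemma gm_opp (v e : R) (V p p1 : R -> R) : gm v e V p p1 ->
  gm v e (fun x => V (- x)) (fun x => p (- x)) (fun x => - p1 (- x)).
Proof.
  intros [H1 H2 H3 H4 H5]. split; auto.
  - intros x. now apply is_derive_opp_arg.
  - intros x.
    replace (famp v (p (- x)) + 2 * e * V (- x) * p (- x)) with (- - (famp v (p (- x)) + 2 * e * V
      (- x) * p (- x))) by ring.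
    apply (is_derive_opp (fun x => p1 (- x))), is_derive_opp_arg, H3.
  - now apply is_lim_opp_arg.
  - now apply is_lim_opp_arg.
Qed.

Arguments gm_opp {v e V p p1}.

Lemma eventually_lt (f : R -> R) (l d : R) : is_lim f p_infty l -> 0 < d ->
  exists M, forall x, M < x -> Rabs (f x - l) < d.
Proof. intros H Hd. apply is_lim_spec in H. apply (H (mkposreal d Hd)). Qed.

(** Close to its limit [f] has a small mean slope over a step of length [h], and within the step the
    slope varies by at most [C h]. *)
Lemma derive_lim_0 (f f1 f2 : R -> R) (l C x0 : R) : is_lim f p_infty (Finite l) ->
  (forall x, is_derive f x (f1 x)) -> (forall x, is_derive f1 x (f2 x)) ->
  (forall x, x0 <= x -> Rabs (f2 x) <= C) -> is_lim f1 p_infty 0.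
Proof.
  intros Hl H1 H2 HC. apply is_lim_spec. intros [d Hd]. cbn. pose (h := d / (2 * (Rabs C + 1))).
  assert (0 < Rabs C + 1) by pos. assert (0 < h) by (apply Rdiv_lt_0_compat; lra).
  assert (Rabs C * h <= d / 2).
  { unfold h. apply (Rmult_le_reg_r (2 * (Rabs C + 1))); [lra|].
    replace (Rabs C * (d / (2 * (Rabs C + 1))) * (2 * (Rabs C + 1))) with (Rabs C * d) by algebra.
    nra. }
  destruct (eventually_lt f l (h * d / 4) Hl) as [M HM]; [nra|]. exists (Rmax M x0). intros x Hx.
  assert (Hx1 : M < x) by bound.
  destruct (mvt f f1 x (x + h)) as [c [Hc E]]; [lra|intros; apply H1|].
  assert (Rabs (f1 c - f1 x) <= C * (c - x)).
  { apply (derive_abs_le f1 f2); [lra|easy|]. intros; apply HC; bound. }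
  pose proof (HM x Hx1) as Ha. pose proof (HM (x + h) ltac:(lra)) as Hb. apply Rabs_def2 in Ha.
  apply Rabs_def2 in Hb. assert (Rabs (f1 c) < d / 2).
  { apply Rabs_def1; [apply (Rmult_lt_reg_r h)|apply (Rmult_lt_reg_r h)]; lra. }
  assert (C * (c - x) <= Rabs C * h). { pose proof (Rle_abs C). pose proof (Rabs_pos C). nra. }
  bound.
Qed.

Lemma bounded_of_lim (f f1 : R -> R) (lp lm : R) : (forall x, is_derive f x (f1 x)) ->
  is_lim f p_infty (Finite lp) -> is_lim f m_infty (Finite lm) ->
  exists M, forall x, f x <= M.
Proof.
  intros Hd Hp Hm. destruct (eventually_lt f lp 1 Hp Rlt_0_1) as [M1 H1].
  destruct (eventually_lt (fun x => f (- x)) lm 1) as [M2 H2]; [now apply is_lim_opp_arg|lra|].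
  pose (T := Rmax 1 (Rmax (M1 + 1) (M2 + 1))).
  assert (HT : 1 <= T /\ M1 + 1 <= T /\ M2 + 1 <= T) by bound.
  destruct (continuity_ab_maj f (- T) T) as [c [Hc _]]; [lra| |].
  { intros x _. eapply is_derive_continuity_pt, Hd. }
  exists (Rmax (f c) (Rmax (lp + 1) (lm + 1))). intros x. destruct (Rlt_dec T x) as [Hx|Hx].
  - pose proof (H1 x ltac:(lra)) as H. bound.
  - destruct (Rlt_dec x (- T)) as [Hx'|Hx'].
    + pose proof (H2 (- x) ltac:(lra)) as H. rewrite Ropp_involutive in H. bound.
    + eapply Rle_trans; [|apply Rmax_l]. apply Hc. lra.
Qed.

Lemma not_max_of_convex (f f1 : R -> R) (c l b : R) : (forall x, is_derive f x (f1 x)) ->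
  is_derive f1 c l -> f1 c = 0 -> 0 < l -> c < b -> exists x, c < x < b /\ f c < f x.
Proof.
  intros Hd Hd1 H0 Hl Hb. apply is_derive_Reals in Hd1.
  destruct (Hd1 (l / 2)) as [[d Hdp] Hdd]; [lra|]. cbn in Hdd.
  pose (h := Rmin (d / 2) ((b - c) / 2)).
  assert (Hh : 0 < h /\ h <= d / 2 /\ h <= (b - c) / 2) by bound.
  assert (Hf1 : forall y, c < y <= c + h -> 0 < f1 y).
  { intros y Hy. specialize (Hdd (y - c) ltac:(lra)). rewrite Rabs_right in Hdd by lra.
    specialize (Hdd ltac:(lra)). replace (c + (y - c)) with y in Hdd by ring. rewrite H0 in Hdd.
    apply Rabs_def2 in Hdd. assert (l / 2 < (f1 y - 0) / (y - c)) by lra.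
    apply (Rmult_lt_compat_r (y - c)) in H; [|lra].
    replace ((f1 y - 0) / (y - c) * (y - c)) with (f1 y) in H by algebra. nra. }
  exists (c + h). destruct (MVT_gen f c (c + h) f1) as [z [Hz E]].
  - easy.
  - intros; eapply is_derive_continuity_pt, Hd.
  - rewrite Rmin_left, Rmax_right in Hz by lra. destruct (Req_dec z c) as [->|Hne].
    + destruct (mvt f f1 (c + h / 2) (c + h)) as [z' [Hz' E']]; [lra|intros; apply Hd|].
      destruct (mvt f f1 c (c + h / 2)) as [z'' [Hz'' E'']]; [lra|intros; apply Hd|].
      pose proof (Hf1 z' ltac:(lra)).
      destruct (Req_dec z'' c) as [->|Hne']; [rewrite H0 in E''; nra|].
      pose proof (Hf1 z'' ltac:(lra)). nra.
    + pose proof (Hf1 z ltac:(lra)). nra.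
Qed.

Section Bounds.

Context {sp : speed}.
Notation v := (@vel sp).
Notation k := (kap v).
Notation r0 := (rho0 v).

Variables (a Kv : R).
Hypothesis Ha : 0 < a.
Hypothesis HKv : 0 <= Kv.

Definition energy (p p1 : R -> R) (x : R) : R := p1 x ^ 2 / 2 - Wpot v (p x).

Lemma energy_derive (e : R) (V p p1 : R -> R) (x : R) : gm v e V p p1 ->
  is_derive (energy p p1) x (e * V x * (2 * p x * p1 x)).
Proof.
  intros [H1 H2 H3 _ _]. specialize (H1 x). specialize (H2 x). specialize (H3 x).
  pose proof (is_derive_Wpot v p x (p1 x) ltac:(lra) H2) as HW. evar_last.
  - apply (is_derive_minus (fun y => p1 y ^ 2 / 2)); [|exact HW]. auto_derive; [solve_ex_derive|].
    reflexivity.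
  - rewrite (Derive_eta H3). cbn; lra.
Qed.

Lemma famp_ge (r : R) : 1 <= r -> 2 * k ^ 2 * (r ^ 2 - 1) * r <= famp v r.
Proof.
  intros Hr. rewrite kap_sq.
  assert (famp v r - 2 * (1 - v ^ 2) * (r ^ 2 - 1) * r = v ^ 2 * (r ^ 2 - 1) ^ 2 * (2 * r ^ 2 + 1) /
    r ^ 3) by (unfold famp; field; lra).
  assert (0 <= v ^ 2 * (r ^ 2 - 1) ^ 2 * (2 * r ^ 2 + 1) / r ^ 3); [|lra]. pos.
Qed.

(** Maximum principle: at a maximum above this level [famp] outweighs the potential term, and the
    amplitude would be strictly convex there. *)
Lemma gm_upper (e : R) (V p p1 : R -> R) : gm v e V p p1 -> (forall x, Rabs (V x) <= Kv) ->
  forall x, p x ^ 2 <= 1 + Rabs e * Kv / k ^ 2.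
Proof.
  intros Hg HV x. destruct (Rle_dec (p x ^ 2) (1 + Rabs e * Kv / k ^ 2)) as [|Hn]; [easy|exfalso].
  pose proof (gm_pos Hg) as Hpos. pose proof (gm_d Hg) as Hd. pose proof (gm_dd Hg) as Hdd.
  pose proof kap_pos as Hk. assert (Hk2 : 0 < k ^ 2) by pos.
  assert (HeK : 0 <= Rabs e * Kv / k ^ 2) by pos.
  assert (Hx1 : 1 < p x) by (specialize (Hpos x); nra).
  destruct (eventually_lt p 1 (p x - 1) (gm_pinf Hg)) as [M1 H1]; [lra|].
  destruct (eventually_lt (fun x => p (- x)) 1 (p x - 1)) as [M2 H2].
  { apply is_lim_opp_arg, (gm_minf Hg). }
  { lra. } pose (T := Rmax (Rabs x + 1) (Rmax (M1 + 1) (M2 + 1))).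
  assert (Rabs x + 1 <= T /\ M1 + 1 <= T /\ M2 + 1 <= T) by bound. pose proof (Rle_abs x).
  pose proof (Rle_abs (- x)). rewrite Rabs_Ropp in *. pose proof (H1 T ltac:(lra)) as HT1.
  apply Rabs_def2 in HT1. pose proof (H2 T ltac:(lra)) as HT2. apply Rabs_def2 in HT2.
  destruct (interior_min (fun y => - p y) (fun y => - p1 y) (- T) T x) as [c [Hc [Hc0 [Hcx Hmin]]]].
  - derive.
  - lra.
  - lra.
  - lra.
  - destruct (not_max_of_convex p p1 c _ T Hd (Hdd c)) as [y [Hy Hcy]]; [lra| |lra|].
    + assert (Hpc1 : 1 <= p c) by lra. pose proof (famp_ge (p c) Hpc1).
      assert (Rabs e * Kv < k ^ 2 * (p c ^ 2 - 1)).
      { assert (Hlt : Rabs e * Kv / k ^ 2 < p c ^ 2 - 1) by nra.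
        apply (Rmult_lt_compat_l (k ^ 2)) in Hlt; [|easy].
        replace (k ^ 2 * (Rabs e * Kv / k ^ 2)) with (Rabs e * Kv) in Hlt by algebra. lra. }
      assert (- (Rabs e * Kv) <= e * V c).
      { assert (Rabs (e * V c) <= Rabs e * Kv) by mono. bound. }
      nra.
    + specialize (Hmin y ltac:(lra)). lra.
Qed.

Lemma gm_p1_lim (e : R) (V p p1 : R -> R) : gm v e V p p1 -> (forall x, Rabs (V x) <= Kv) ->
  is_lim p1 p_infty 0.
Proof.
  intros Hg HV. pose proof v2_bounds.
  destruct (eventually_lt p 1 (/ 2) (gm_pinf Hg)) as [M HM]; [lra|].
  apply (derive_lim_0 p p1 (fun x => famp v (p x) + 2 * e * V x * p x) 1 (100 + 4 * Rabs e * Kv) (M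
    + 1)); [apply Hg|apply Hg|apply Hg|].
  intros x Hx. pose proof (HM x ltac:(lra)) as Hp. apply Rabs_def2 in Hp. triangle.
  apply Rplus_le_compat.
  - unfold famp. assert (0 < / p x < 2).
    { splits. rewrite <- (Rinv_inv 2). apply Rinv_lt_contravar; nra. }
    replace (v ^ 2 / p x ^ 3) with (v ^ 2 * (/ p x) ^ 3) by algebra.
    assert (0 <= (/ p x) ^ 3 <= 8) by nra. apply Rabs_le. nra.
  - replace (4 * Rabs e * Kv) with (2 * Rabs e * Kv * 2) by ring. mono.
Qed.

Lemma energy_lim (e : R) (V p p1 : R -> R) : gm v e V p p1 -> (forall x, Rabs (V x) <= Kv) ->
  is_lim (energy p p1) p_infty 0.
Proof.
  intros Hg HV. pose proof (gm_p1_lim e V p p1 Hg HV) as H1. pose proof (gm_pinf Hg) as H2.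
  pose proof vabs_bounds. apply is_lim_spec. intros [d Hd]. cbn.
  pose (h := Rmin (Rmin (/ 2 * (1 - Rabs v / 2)) 1) (Rmin (d / 60) 1)).
  assert (0 < h /\ h <= / 2 * (1 - Rabs v / 2) /\ h <= 1 /\ h <= d / 60) by bound.
  destruct (eventually_lt p1 0 h H1) as [M1 HM1]; [lra|].
  destruct (eventually_lt p 1 h H2) as [M2 HM2]; [lra|]. exists (Rmax M1 M2). intros x Hx.
  pose proof (HM1 x ltac:(eapply Rle_lt_trans; [apply Rmax_l|exact Hx])) as Hp1.
  pose proof (HM2 x ltac:(eapply Rle_lt_trans; [apply Rmax_r|exact Hx])) as Hp.
  apply Rabs_def2 in Hp. apply Rabs_def2 in Hp1. assert (Hpr : Rabs v / 2 <= p x <= 2) by lra.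
  pose proof (Wpot_bound (p x) Hpr). unfold energy. assert ((1 - p x) ^ 2 <= h) by nra.
  assert (0 <= p1 x ^ 2 <= h) by nra. bound.
Qed.

End Bounds.

(** * Comparison estimates *)

(** Including the constant [h^2] in [D^2 + D1^2 + h^2] absorbs the inhomogeneous term, so that the
    sum grows at a rate of at most [2 + C]. *)
Lemma second_order_gronwall (D D1 F : R -> R) (l b C h : R) : l <= b -> 0 <= C -> 0 <= h ->
  (forall x, l <= x <= b -> is_derive D x (D1 x)) ->
  (forall x, l <= x <= b -> is_derive D1 x (F x)) ->
  (forall x, l <= x <= b -> Rabs (F x) <= C * Rabs (D x) + h) ->
  D b ^ 2 + D1 b ^ 2 <= (D l ^ 2 + D1 l ^ 2 + h ^ 2) * exp ((2 + C) * (b - l)).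
Proof.
  intros Hlb HC Hh HD HD1 HF.
  pose proof (gronwall_le (fun x => D x ^ 2 + D1 x ^ 2 + h ^ 2) (fun x => 2 * D x * D1 x + 2 * D1 x
    * F x) (fun x => (2 + C) * x) (fun _ => 2 + C) l b Hlb) as G.
  cbv beta in G. replace ((2 + C) * b - (2 + C) * l) with ((2 + C) * (b - l)) in G by ring.
  enough (D b ^ 2 + D1 b ^ 2 + h ^ 2 <= (D l ^ 2 + D1 l ^ 2 + h ^ 2) * exp ((2 + C) * (b - l))) by
    nra.
  apply G.
  - derive.
  - derive.
  - intros x Hx. assert (D1 x * F x <= Rabs (D1 x) * (C * Rabs (D x) + h)).
    { eapply Rle_trans; [apply Rle_abs|]. mono. }
    rewrite <- (pow2_abs (D x)), <- (pow2_abs (D1 x)).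
    assert (D x * D1 x <= Rabs (D x) * Rabs (D1 x)). { rewrite <- Rabs_mult. bound. }
    set (u := Rabs (D x)) in *. set (w := Rabs (D1 x)) in *. pose proof (pow2_ge_0 (u - w)).
    pose proof (pow2_ge_0 (w - h)). nra.
Qed.

Lemma sqr_abs_le (x y : R) : 0 <= y -> x ^ 2 <= y ^ 2 -> Rabs x <= y.
Proof. intros Hy H. apply Rabs_le. split; nra. Qed.

(** The divided difference of [famp]. Through it the difference of two amplitudes solves a linear
    equation whose coefficient is close to [dfamp] when both are close to a common profile. *)
Definition fq (v a b : R) : R :=
  - (v ^ 2 + 2) + 2 * (a ^ 2 + a * b + b ^ 2)
  - v ^ 2 * (/ a * (/ b) ^ 3 + (/ a) ^ 2 * (/ b) ^ 2 + (/ a) ^ 3 * / b).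

Lemma famp_sub (v a b : R) : a <> 0 -> b <> 0 -> famp v a - famp v b = fq v a b * (a - b).
Proof. intros. unfold famp, fq. field. easy. Qed.

Lemma fq_diag (v a : R) : a <> 0 -> fq v a a = dfamp v a.
Proof. intros. unfold fq, dfamp. field. easy. Qed.

Lemma Rabs_prod_sub (x y z w M N : R) : Rabs y <= M -> Rabs z <= N ->
  Rabs (x * y - z * w) <= M * Rabs (x - z) + N * Rabs (y - w).
Proof. intros. replace (x * y - z * w) with (y * (x - z) + z * (y - w)) by ring. mono. Qed.

Section Compare.

Context {sp : speed}.
Notation v := (@vel sp).
Notation k := (kap v).
Notation r0 := (rho0 v).

Lemma fq_bound : exists C, 1 <= C /\ forall a b c,
  Rabs v / 2 <= a <= 2 -> Rabs v / 2 <= b <= 2 -> Rabs v / 2 <= c <= 2 ->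
  Rabs (fq v a b) <= C /\ Rabs (fq v a b - dfamp v c) <= C * (Rabs (a - c) + Rabs (b - c)).
Proof.
  pose proof vabs_bounds as Hv. pose proof v2_bounds as Hv2. pose (M := 2 / Rabs v).
  assert (HM : 2 < M).
  { unfold M. apply (Rmult_lt_reg_r (Rabs v)); [lra|].
    replace (2 / Rabs v * Rabs v) with 2 by algebra. lra. }
  assert (Hinv : forall a, Rabs v / 2 <= a <= 2 -> Rabs (/ a) <= M).
  { intros a Ha. unfold M. replace (2 / Rabs v) with (/ (Rabs v / 2)) by algebra. mono. }
  assert (HM5 : 0 < M ^ 5) by pos. assert (HM4 : M ^ 4 <= M ^ 5) by nra. exists (30 + 9 * M ^ 5).
  splits. intros a b c Ha Hb Hc. pose proof (Hinv a Ha) as Hia. pose proof (Hinv b Hb) as Hib.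
  pose proof (Hinv c Hc) as Hic. assert (Hpow : forall x n, Rabs x <= M -> Rabs (x ^ n) <= M ^ n).
  { intros x n Hx. rewrite <- RPow_abs. mono. }
  split.
  - unfold fq.
    assert (HQ : Rabs (/ a * (/ b) ^ 3 + (/ a) ^ 2 * (/ b) ^ 2 + (/ a) ^ 3 * / b) <= 3 * M ^ 4).
    { replace (3 * M ^ 4) with (M * M ^ 3 + M ^ 2 * M ^ 2 + M ^ 3 * M) by ring. mono. }
    apply Rabs_le_between in HQ. apply Rabs_le. nra.
  - rewrite <- fq_diag by lra. unfold fq. set (P := 2 * (a ^ 2 + a * b + b ^ 2)).
    set (P' := 2 * (c ^ 2 + c * c + c ^ 2)). set (x := / a) in *. set (y := / b) in *.
    set (z := / c) in *. assert (HP : Rabs (P - P') <= 20 * (Rabs (a - c) + Rabs (b - c))).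
    { unfold P, P'.
      replace (2 * (a ^ 2 + a * b + b ^ 2) - 2 * (c ^ 2 + c * c + c ^ 2)) with ((2 * (a + c) + 2 *
        b) * (a - c) + (2 * c + 2 * (b + c)) * (b - c)) by ring.
      triangle. rewrite !Rabs_mult.
      rewrite (Rabs_right (2 * (a + c) + 2 * b)), (Rabs_right (2 * c + 2 * (b + c))) by lra.
      pose proof (Rabs_pos (a - c)). pose proof (Rabs_pos (b - c)). nra. }
    assert (Hd : forall p, Rabs v / 2 <= p <= 2 -> Rabs (/ p - z) <= M ^ 2 * Rabs (p - c)).
    { intros p Hp. replace (/ p - z) with (/ p * z * (c - p)) by (unfold z; field; lra).
      rewrite Rabs_mult, (Rabs_minus_sym c p). replace (M ^ 2) with (M * M) by ring. mono. }
    pose proof (Hd a Ha) as Hx. pose proof (Hd b Hb) as Hy. fold x in Hx. fold y in Hy.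
    assert (H2 : forall p, Rabs p <= M -> Rabs (p ^ 2 - z ^ 2) <= 2 * M * Rabs (p - z)).
    { intros p Hp. replace (p ^ 2 - z ^ 2) with (p * p - z * z) by ring.
      eapply Rle_trans; [now apply (Rabs_prod_sub p p z z M M)|]. lra. }
    assert (H3 : forall p, Rabs p <= M -> Rabs (p ^ 3 - z ^ 3) <= 3 * M ^ 2 * Rabs (p - z)).
    { intros p Hp. eapply Rle_trans; [apply (Rabs_prod_sub p (p ^ 2) z (z ^ 2) (M ^ 2) M); auto|].
      specialize (H2 p Hp). nra. }
    set (Q := x * y ^ 3 + x ^ 2 * y ^ 2 + x ^ 3 * y).
    set (Q' := z * z ^ 3 + z ^ 2 * z ^ 2 + z ^ 3 * z).
    assert (HQ : Rabs (Q - Q') <= 9 * M ^ 3 * (Rabs (x - z) + Rabs (y - z))).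
    { unfold Q, Q'.
      replace (x * y ^ 3 + x ^ 2 * y ^ 2 + x ^ 3 * y - (z * z ^ 3 + z ^ 2 * z ^ 2 + z ^ 3 * z)) with
        ((x * y ^ 3 - z * z ^ 3) + (x ^ 2 * y ^ 2 - z ^ 2 * z ^ 2) + (x ^ 3 * y - z ^ 3 * z)) by
        ring.
      pose proof (Rabs_prod_sub x (y ^ 3) z (z ^ 3) (M ^ 3) M (Hpow y 3%nat Hib) Hic).
      pose proof (Rabs_prod_sub (x ^ 2) (y ^ 2) (z ^ 2) (z ^ 2) (M ^ 2) (M ^ 2) (Hpow y 2%nat Hib)
        (Hpow z 2%nat Hic)).
      pose proof (Rabs_prod_sub (x ^ 3) y (z ^ 3) z M (M ^ 3) Hib (Hpow z 3%nat Hic)).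
      pose proof (H2 x Hia). pose proof (H2 y Hib). pose proof (H3 x Hia) as Ex3.
      pose proof (H3 y Hib) as Ey3. triangle.
      eapply Rle_trans; [apply Rplus_le_compat_r, Rabs_triang|]. assert (0 < M ^ 2) by pos.
      apply (Rmult_le_compat_l M) in Ey3; [|lra]. apply (Rmult_le_compat_l M) in Ex3; [|lra].
      pose proof (Rabs_pos (x - z)). pose proof (Rabs_pos (y - z)). nra. }
    replace (- (v ^ 2 + 2) + P - v ^ 2 * Q - (- (v ^ 2 + 2) + P' - v ^ 2 * Q')) with ((P - P') + -
      (v ^ 2 * (Q - Q'))) by ring.
    triangle. rewrite Rabs_Ropp, Rabs_mult, (Rabs_right (v ^ 2)) by lra.
    assert (Rabs (Q - Q') <= 9 * M ^ 5 * (Rabs (a - c) + Rabs (b - c))) by nra.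
    assert (v ^ 2 * Rabs (Q - Q') <= 1 * Rabs (Q - Q')) by mono. bound.
Qed.

End Compare.

Lemma exp_small (g h : R) : 0 < g -> 0 < h -> exists T, 0 < T /\ forall x, T <= x -> exp (- g * x) <= h.
Proof.
  intros Hg Hh. exists (/ (g * h)). splits. intros x Hx. assert (/ h <= g * x).
  { apply (Rmult_le_compat_l g) in Hx; [|lra]. replace (g * / (g * h)) with (/ h) in Hx by algebra.
    lra. }
  assert (0 < / h) by pos. pose proof (exp_ineq1 (g * x) ltac:(lra)).
  replace (- g * x) with (- (g * x)) by ring. rewrite exp_Ropp. rewrite <- (Rinv_inv h). mono.
Qed.

(** For [D'' = c D], the quantity [D1^2 + (K D)^2] grows at a rate of at most [2 K + Z' / K], and
    [D1 + K D] at a rate of at least [K - Z' / K]. Only the integral of the bound on [|c - K^2|]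
    enters, so an integrable error costs a constant factor, however long the interval. *)
Lemma linear_growth (D D1 c Z Z' : R -> R) (K l b : R) : 0 < K -> l <= b ->
  (forall x, l <= x <= b -> is_derive D x (D1 x)) ->
  (forall x, l <= x <= b -> is_derive D1 x (c x * D x)) ->
  (forall x, is_derive Z x (Z' x)) ->
  (forall x, l <= x <= b -> Rabs (c x - K ^ 2) <= Z' x) ->
  (K * D b) ^ 2 <= (D1 l ^ 2 + (K * D l) ^ 2) * exp (2 * K * (b - l) + (Z b - Z l) / K) /\
  ((forall x, l <= x <= b -> 0 < D x /\ 0 < D1 x) ->
   (D1 l + K * D l) * exp (K * (b - l) - (Z b - Z l) / K) <= D1 b + K * D b).
Proof.
  intros HK Hlb HD HD1 HZ Hc. split.
  - apply Rle_trans with (D1 b ^ 2 + (K * D b) ^ 2); [pose proof (pow2_ge_0 (D1 b)); lra|].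
    replace (2 * K * (b - l) + (Z b - Z l) / K) with ((2 * K * b + / K * Z b) - (2 * K * l + / K * Z
      l)) by algebra.
    apply (gronwall_le (fun x => D1 x ^ 2 + (K * D x) ^ 2) (fun x => 2 * D1 x * (c x * D x) + 2 * (K
      * D x) * (K * D1 x)) (fun x => 2 * K * x + / K * Z x) (fun x => 2 * K + / K * Z' x));
      [easy|derive|derive|].
    intros x Hx. set (u := K * D x). set (w := D1 x).
    replace (2 * w * (c x * D x)) with (2 * (w * u) * K + (c x - K ^ 2) * (/ K * (2 * (w * u)))) by
      (unfold u; algebra).
    assert (E : Rabs (2 * (w * u)) <= w ^ 2 + u ^ 2).
    { apply Rabs_le. pose proof (pow2_ge_0 (w + u)). pose proof (pow2_ge_0 (w - u)). lra. }
    assert ((c x - K ^ 2) * (/ K * (2 * (w * u))) <= Z' x * (/ K * (w ^ 2 + u ^ 2))).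
    { eapply Rle_trans; [apply Rle_abs|]. mono. }
    pose proof (Rle_abs (2 * (w * u))). nra.
  - intros Hp.
    replace (K * (b - l) - (Z b - Z l) / K) with ((K * b - / K * Z b) - (K * l - / K * Z l)) by
      algebra.
    apply (gronwall_ge (fun x => D1 x + K * D x) (fun x => c x * D x + K * D1 x) (fun x => K * x - /
      K * Z x) (fun x => K - / K * Z' x)); [easy|derive|derive|].
    intros x Hx. destruct (Hp x Hx). specialize (Hc x Hx). apply Rabs_le_between in Hc.
    assert (0 <= / K * Z' x * D1 x) by pos.
    replace ((K - / K * Z' x) * (D1 x + K * D x)) with (K * D1 x + K ^ 2 * D x - / K * Z' x * D1 x -
      Z' x * D x) by algebra.
    nra.
Qed.

Lemma convex_unbounded (F F1 F2 : R -> R) (t0 M : R) :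
  (forall x, t0 <= x -> is_derive F x (F1 x)) -> (forall x, t0 <= x -> is_derive F1 x (F2 x)) ->
  0 < F t0 -> 0 < F1 t0 -> (forall x, t0 <= x -> 0 < F x -> 0 <= F2 x) ->
  (forall x, t0 <= x -> F x <= M) -> False.
Proof.
  intros H1 H2 HF HF1 Hc HM. pose (b := t0 + (Rabs M + 1) / F1 t0). assert (Hb : t0 <= b).
  { unfold b. assert (0 < (Rabs M + 1) / F1 t0); [|lra]. pos. }
  destruct (convex_escape F F1 F2 t0 b) with (x := b) as [_ H]; try lra.
  - bound.
  - bound.
  - bound.
  - specialize (HM b Hb). replace (b - t0) with ((Rabs M + 1) / F1 t0) in H by (unfold b; ring).
    replace (F1 t0 * ((Rabs M + 1) / F1 t0)) with (Rabs M + 1) in H by algebra. bound.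
Qed.

(* The value at a dip located at [X] of the solution converging to the background at [+oo]. *)
Definition mR {sp : speed} (V : R -> R) (e X : R) : R := href (fun y => V (X + y)) e 0.

(** The coefficients in [e] of [gap] below. *)
Definition gcoef {sp : speed} (V : R -> R) (n : nat) (X : R) : R :=
  hcoef (fun y => V (X + y)) n 0 - hcoef (fun y => V (- (- X + y))) n 0.

Definition gpol {sp : speed} (V : R -> R) (N : nat) (e X : R) : R :=
  sumn N (fun n => gcoef V n X * e ^ n).

(** Reflection exchanges the two ends, so the second term is the value at a dip at [X] of the
    solution that converges to 1 at [-oo]. For small [e], an amplitude whose only dip is at [X]
    forces the gap to vanish there. *)
Definition gap {sp : speed} (V : R -> R) (e X : R) : R := mR V e X - mR (fun x => V (- x)) e (- X).

(** Continuity in the parameter is asked at each fixed [x] only, which is all that a family of gray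
    modes provides away from parameter 0. *)
Record gfam {sp : speed} (lo hi : R) (V : R -> R) (P P1 : R -> R -> R) : Prop := {
  gf_gm : forall e, lo < e < hi -> gm vel e V (P e) (P1 e);
  gf_cont : forall x e d, lo < e < hi -> 0 < d -> exists t, 0 < t /\
    forall e', lo < e' < hi -> Rabs (e' - e) < t -> Rabs (P e' x - P e x) < d }.

Arguments gf_gm {sp lo hi V P P1}.
Arguments gf_cont {sp lo hi V P P1}.

(** * Births of dips *)

(** If no [F n] contained a relatively open part of [B], one could shrink step by step to nested
    intervals centred in [B], the next one missing [F n] at step [n]. Their common point lies in
    [B], which is closed in [(lo, hi)], but in none of the covering sets. *)
Lemma baire (lo hi : R) (B : R -> Prop) (F : nat -> R -> Prop) (e0 : R) : B e0 ->
  (forall e, B e -> lo < e < hi) ->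
  (forall e, lo < e < hi -> ~ B e -> exists t, 0 < t /\ forall e', Rabs (e' - e) < t -> ~ B e') ->
  (forall n e, lo < e < hi -> ~ F n e ->
     exists t, 0 < t /\ forall e', lo < e' < hi -> Rabs (e' - e) < t -> ~ F n e') ->
  (forall e, B e -> exists n, F n e) ->
  exists n e t, 0 < t /\ B e /\ forall e', B e' -> Rabs (e' - e) < t -> F n e'.
Proof.
  intros HB0 Hrange HBc HFc Hcov. apply NNPP. intros Hno.
  assert (Hstep : forall (n : nat) (c : R * R), exists c' : R * R, B (fst c) /\ 0 < snd c -> B (fst
    c') /\ 0 < snd c' /\ snd c' <= snd c / 2 /\ Rabs (fst c' - fst c) + snd c' <= snd c /\ forall x,
    lo < x < hi -> Rabs (x - fst c') <= snd c' -> ~ F n x).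
  { intros n [c r]. destruct (classic (B c /\ 0 < r)) as [[Hc Hr]|Hn]; [|exists (c, r); easy].
    assert (Hex : exists e', B e' /\ Rabs (e' - c) < r /\ ~ F n e').
    { apply NNPP. intros Hne. apply Hno. exists n, c, r. splits. intros e' He' Hee. apply NNPP.
      intros HF. eauto. }
    destruct Hex as [c' [Hc' [Hcc HF]]]. destruct (HFc n c' (Hrange c' Hc') HF) as [t [Ht H]].
    exists (c', Rmin (Rmin (r / 2) (r - Rabs (c' - c))) (t / 2)). cbn. intros _. minmax. splits.
    intros x Hx Hxc. apply H; [easy|lra]. }
  pose (next := fun n c => proj1_sig (constructive_indefinite_description _ (Hstep n c))).
  assert (Hnext : forall n c, B (fst c) /\ 0 < snd c -> B (fst (next n c)) /\ 0 < snd (next n c) /\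
    snd (next n c) <= snd c / 2 /\ Rabs (fst (next n c) - fst c) + snd (next n c) <= snd c /\ forall
    x, lo < x < hi -> Rabs (x - fst (next n c)) <= snd (next n c) -> ~ F n x).
  { intros n c. unfold next.
    destruct (constructive_indefinite_description _ (Hstep n c)) as [c' Hc']. exact Hc'. }
  pose proof (Hrange e0 HB0) as He0. pose (r0 := Rmin ((e0 - lo) / 2) ((hi - e0) / 2)).
  assert (Hr0 : 0 < r0 /\ r0 <= (e0 - lo) / 2 /\ r0 <= (hi - e0) / 2) by bound.
  pose (s := fix s (n : nat) : R * R := match n with O => (e0, r0) | S m => next m (s m) end).
  assert (Hs : forall n, B (fst (s n)) /\ 0 < snd (s n)).
  { induction n as [|n IH]; [easy|]. destruct (Hnext n (s n) IH) as [H1 [H2 _]]. easy. }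
  assert (Hsr : forall n, snd (s n) <= r0 * (/ 2) ^ n).
  { induction n as [|n IH]; [cbn; lra|]. cbn [s pow].
    destruct (Hnext n (s n) (Hs n)) as [_ [_ [H _]]]. lra. }
  assert (Hnest : forall n m x, Rabs (x - fst (s (n + m)%nat)) <= snd (s (n + m)%nat) -> Rabs (x -
    fst (s n)) <= snd (s n)).
  { intros n m x. induction m as [|m IH]; [now rewrite Nat.add_0_r|]. rewrite Nat.add_succ_r.
    intros H. apply IH.
    destruct (Hnext (n + m)%nat (s (n + m)%nat) (Hs (n + m)%nat)) as [_ [_ [_ [H4 _]]]].
    change (Rabs (x - fst (next (n + m)%nat (s (n + m)%nat))) <= snd (next (n + m)%nat (s (n +
      m)%nat))) in H.
    bound. }
  pose (S := fun y => exists n, y = fst (s n) - snd (s n)).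
  assert (Hcomp : forall n m, fst (s n) - snd (s n) <= fst (s m) + snd (s m)).
  { intros n m. destruct (Hs n) as [_ Hn]. destruct (Hs m) as [_ Hm].
    destruct (le_lt_dec n m) as [Hle|Hlt].
    - pose proof (Hnest n (m - n)%nat (fst (s m))) as H.
      replace (n + (m - n))%nat with m in H by lia. rewrite Rminus_diag, Rabs_R0 in H. bound.
    - pose proof (Hnest m (n - m)%nat (fst (s n))) as H.
      replace (m + (n - m))%nat with n in H by lia. rewrite Rminus_diag, Rabs_R0 in H. bound. }
  destruct (completeness S) as [L [HL1 HL2]].
  { exists (fst (s O) + snd (s O)). intros y [n ->]. apply Hcomp. }
  { exists (fst (s O) - snd (s O)). now exists O. }
  assert (HL : forall n, Rabs (L - fst (s n)) <= snd (s n)).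
  { intros n. assert (fst (s n) - snd (s n) <= L) by (apply HL1; now exists n).
    assert (L <= fst (s n) + snd (s n)) by (apply HL2; intros y [m ->]; apply Hcomp). mono. }
  assert (HLr : lo < L < hi). { pose proof (HL O) as H. cbn in H. bound. } assert (HBL : B L).
  { apply NNPP. intros HnB. destruct (HBc L HLr HnB) as [t [Ht H]].
    destruct (pow_lt_1_zero (/ 2) ltac:(rewrite Rabs_right; lra) (t / r0)) as [n Hn]. { pos. }
    specialize (Hn n (le_n _)). rewrite Rabs_right in Hn by pos.
    apply (Rmult_lt_compat_l r0) in Hn; [|lra]. replace (r0 * (t / r0)) with t in Hn by algebra.
    apply (H (fst (s n))); [|apply Hs]. rewrite Rabs_minus_sym. specialize (HL n).
    specialize (Hsr n). lra. }
  destruct (Hcov L HBL) as [n Hn]. destruct (Hnext n (s n) (Hs n)) as [_ [_ [_ [_ H5]]]].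
  apply (H5 L HLr); [|easy]. exact (HL (Datatypes.S n)).
Qed.

(* [D e x] abstracts "the amplitude of parameter [e] has a dip at [x]". *)
Record dip_family (lo hi : R) (D : R -> R -> Prop) : Prop := {
  df_persist : forall e X r, lo < e < hi -> 0 < r -> D e X -> exists t, 0 < t /\
    forall e', lo < e' < hi -> Rabs (e' - e) < t -> exists X', Rabs (X' - X) < r /\ D e' X';
  df_open : forall e A B, lo < e < hi -> (forall x, A <= x <= B -> ~ D e x) -> exists t, 0 < t /\
    forall e', lo < e' < hi -> Rabs (e' - e) < t -> forall x, A <= x <= B -> ~ D e' x;
  df_bounded : forall e, lo < e < hi -> exists n : nat, forall x, INR n < x -> ~ D e x }.

Arguments df_persist {lo hi D}.
Arguments df_open {lo hi D}.
Arguments df_bounded {lo hi D}.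

(** A dip enters from [+oo], or escapes to it, as the parameter approaches [e]. *)
Definition birth (lo hi : R) (D : R -> R -> Prop) (e : R) : Prop :=
  forall M t, 0 < t -> exists e' x, lo < e' < hi /\ Rabs (e' - e) < t /\ M < x /\ D e' x.

(** Near [e] every far point is a dip in two ways: as the first one beyond [m] and as the last one.
    The former limits the influence of dips on the left, the latter excludes any influence from the
    right; together they squeeze the gap from above and from below. *)
Definition sweeps (lo hi : R) (D : R -> R -> Prop) (e m : R) : Prop :=
  (forall x, m < x -> ~ D e x) /\
  forall d, 0 < d -> exists X0, forall X, X0 <= X ->
    (exists e', lo < e' < hi /\ Rabs (e' - e) < d /\ D e' X /\ forall x, m <= x < X -> ~ D e' x) /\
    (exists e', lo < e' < hi /\ Rabs (e' - e) < d /\ D e' X /\ forall x, X < x -> ~ D e' x).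

Lemma not_birth (lo hi : R) (D : R -> R -> Prop) (e : R) : ~ birth lo hi D e ->
  exists M t, 0 < t /\ forall e', lo < e' < hi -> Rabs (e' - e) < t -> forall x, M < x -> ~ D e' x.
Proof.
  intros H. apply NNPP. intros Hn. apply H. intros M t Ht. apply NNPP. intros Hn'. apply Hn.
  exists M, t. splits. intros e' He' Hee x Hx HD. apply Hn'. now exists e', x.
Qed.

Lemma leave_point (U : R -> Prop) (l b : R) : l < b -> (exists c, l < c <= b /\ forall x, l < x <= c -> U x) ->
  ~ U b -> exists t, l < t <= b /\ (forall x, l < x < t -> U x) /\
    forall d, 0 < d -> exists x, t <= x < t + d /\ x <= b /\ ~ U x.
Proof.
  intros Hlb [c [Hc HUc]] HUb. pose (S := fun y => l < y <= b /\ forall x, l < x <= y -> U x).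
  destruct (completeness S) as [t [Ht1 Ht2]]. { exists b. intros y [Hy _]. lra. }
  { exists c. now split. }
  assert (Hct : c <= t) by solve_cont. assert (Htb : t <= b) by (apply Ht2; intros y [Hy _]; lra).
  assert (HUt : forall x, l < x < t -> U x).
  { intros x Hx. apply NNPP. intros HU. assert (t <= x); [|lra]. apply Ht2. intros y [Hy1 Hy2].
    destruct (Rle_dec y x) as [|Hn]; [easy|]. exfalso. apply HU, Hy2. lra. }
  exists t. splits. intros d Hd. apply NNPP. intros Hne.
  assert (HUd : forall x, t <= x < t + d -> x <= b -> U x).
  { intros x Hx Hxb. apply NNPP. intros HU. eauto. }
  destruct (Rlt_dec t b) as [Htb'|Htb'].
  - pose (y := Rmin (t + d / 2) b). pose proof (Rmin_l (t + d / 2) b).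
    pose proof (Rmin_r (t + d / 2) b). fold y in H, H0. assert (t < y) by (apply Rmin_glb_lt; lra).
    assert (y <= t); [|lra]. apply Ht1. splits. intros x Hx.
    destruct (Rlt_dec x t); [bound|apply HUd; lra].
  - apply HUb. apply HUd; lra.
Qed.

Lemma open_closed (U : R -> Prop) (x b : R) : x <= b ->
  (forall t, x <= t <= b -> U t -> exists d, 0 < d /\ forall s, x <= s <= b -> Rabs (s - t) < d -> U s) ->
  (forall t, x <= t <= b -> ~ U t -> exists d, 0 < d /\ forall s, x <= s <= b -> Rabs (s - t) < d -> ~ U s) ->
  U b -> U x.
Proof.
  intros Hxb Ho Hc Hb. apply NNPP. intros Hx. pose (S := fun y => x <= y <= b /\ ~ U y).
  destruct (completeness S) as [t [Ht1 Ht2]]. { exists b. intros y [Hy _]. lra. }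
  { exists x. easy. }
  assert (Hxt : x <= t) by solve_cont. assert (Htb : t <= b) by (apply Ht2; intros y [Hy _]; lra).
  destruct (classic (U t)) as [HU|HU].
  - destruct (Ho t ltac:(lra) HU) as [d [Hd H]]. assert (t <= t - d / 2); [|lra]. apply Ht2.
    intros y [Hy1 Hy2]. destruct (Rle_dec y (t - d / 2)) as [|Hn]; [easy|exfalso].
    assert (y <= t) by solve_cont. apply Hy2, H; [easy|]. bound.
  - destruct (Hc t ltac:(lra) HU) as [d [Hd H]]. destruct (Req_dec t b) as [->|Hne]; [easy|].
    pose (y := Rmin (t + d / 2) b). pose proof (Rmin_l (t + d / 2) b) as Y1.
    pose proof (Rmin_r (t + d / 2) b) as Y2. fold y in Y1, Y2.
    assert (t < y) by (apply Rmin_glb_lt; lra). assert (y <= t); [|lra]. apply Ht1. splits.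
    apply H; [lra|]. bound.
Qed.

(** Without births in [(e, b]] and with the strip [[m + 1, m + 2]] free of dips, having a dip beyond
    the strip is an open and closed condition, so every parameter in [(e, b]] has one. At [e] there
    is none: as the parameter decreases to [e] these dips leave every compact set, and by continuity
    they pass through every far point. *)
Lemma sweeps_right (lo hi : R) (D : R -> R -> Prop) (e b m : R) : dip_family lo hi D -> lo < e -> e < b -> b < hi ->
  (forall x, m < x -> ~ D e x) ->
  (forall x, e < x <= b -> ~ birth lo hi D x) ->
  (forall x y, e <= x <= b -> m + 1 <= y <= m + 2 -> ~ D x y) ->
  (exists X, m + 2 < X /\ D b X) -> sweeps lo hi D e (m + 1).
Proof.
  intros HD Hlo Heb Hhi He Hnb Hgap HbX.
  assert (Hpres : forall x, e < x <= b -> exists X, m + 2 < X /\ D x X).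
  { intros x Hx. apply (open_closed (fun s => exists X, m + 2 < X /\ D s X) x b); [lra| | |easy].
    - intros t Ht [X [HX HDX]].
      destruct (df_persist HD t X (X - (m + 2)) ltac:(lra) ltac:(lra) HDX) as [d [Hd H]]. exists d.
      splits. intros s Hs Hst. destruct (H s ltac:(lra) Hst) as [X' [HX' HDX']]. exists X'. bound.
    - intros t Ht Hn. destruct (not_birth lo hi D t (Hnb t ltac:(lra))) as [M [d1 [Hd1 H1]]].
      destruct (df_open HD t (m + 1) M ltac:(lra)) as [d2 [Hd2 H2]].
      { intros y Hy Hdy. destruct (Rle_dec y (m + 2)) as [Hy2|Hy2].
        - apply (Hgap t y); [lra|lra|easy].
        - eauto with real. }
      exists (Rmin d1 d2). splits. intros s Hs Hst [X [HX HDX]]. minmax.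
      destruct (Rle_dec X M) as [HXM|HXM].
      + apply (H2 s ltac:(lra) ltac:(lra) X); [lra|easy].
      + apply (H1 s ltac:(lra) ltac:(lra) X); [lra|easy]. }
  split; [intros x Hx; apply He; lra|]. intros d Hd. pose (s1 := Rmin b (e + d / 2)).
  pose proof (Rmin_l b (e + d / 2)) as S1. pose proof (Rmin_r b (e + d / 2)) as S2.
  fold s1 in S1, S2. assert (S3 : e < s1) by (apply Rmin_glb_lt; lra).
  destruct (df_bounded HD s1 ltac:(lra)) as [M1 HM1]. exists (Rmax (INR M1 + 1) (m + 3)).
  intros X HX. pose proof (Rmax_l (INR M1 + 1) (m + 3)).
  destruct (df_open HD e (m + 1) X ltac:(lra)) as [t [Ht Hte]]. { intros x Hx. apply He. lra. }
  assert (Hc : exists c, e < c <= s1 /\ forall x, e < x <= c -> forall y, m + 1 <= y <= X -> ~ D x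
    y).
  { exists (Rmin s1 (e + t / 2)). pose proof (Rmin_l s1 (e + t / 2)).
    split; [split; [apply Rmin_glb_lt; lra|easy]|]. intros x Hx. apply Hte; [lra|]. bound. }
  destruct (Hpres s1 ltac:(lra)) as [Y1 [HY1 HDY1]]. assert (Y1 <= INR M1).
  { destruct (Rle_dec Y1 (INR M1)) as [|Hn]; [easy|]. exfalso. apply (HM1 Y1); [lra|easy]. }
  split.
  (* Going up from [e], [s] is the first parameter at which [[m + 1, X]] meets a dip. Persistence
     would make a dip to the left of [X] appear already before [s], so the dip is at [X]. *)
  - destruct (leave_point (fun s => forall y, m + 1 <= y <= X -> ~ D s y) e s1 S3 Hc) as [s [Hs [HU
      HnU]]].
    { intros H'. apply (H' Y1); [lra|easy]. }
    assert (HYX : forall Y, m + 1 <= Y <= X -> D s Y -> Y = X).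
    { intros Y HY HDY. destruct (Req_dec Y X) as [|Hne]; [easy|exfalso]. assert (m + 2 < Y).
      { destruct (Rlt_dec (m + 2) Y) as [|Hn]; [easy|]. exfalso. apply (Hgap s Y); [lra|lra|easy]. }
      destruct (df_persist HD s Y (Rmin 1 (X - Y)) ltac:(lra)) as [d' [Hd' H']]; [apply Rmin_glb_lt;
        lra|easy|].
      pose proof (Rmin_l 1 (X - Y)). pose proof (Rmin_r 1 (X - Y)).
      pose proof (Rmax_l ((e + s) / 2) (s - d' / 2)).
      pose proof (Rmax_r ((e + s) / 2) (s - d' / 2)).
      set (s' := Rmax ((e + s) / 2) (s - d' / 2)) in *. assert (s' < s) by (apply Rmax_lub_lt; lra).
      destruct (H' s') as [Y' [HY' HDY']]; [lra|apply Rabs_def1; lra|]. apply Rabs_def2 in HY'.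
      apply (HU s' ltac:(lra) Y'); [lra|easy]. }
    assert (HsX : exists Y, m + 1 <= Y <= X /\ D s Y).
    { apply NNPP. intros Hne. destruct (df_open HD s (m + 1) X ltac:(lra)) as [d' [Hd' H']].
      { eauto. }
      destruct (HnU d' Hd') as [x [Hx [Hxs HnUx]]]. apply HnUx. apply H'; [lra|]. bound. }
    destruct HsX as [Y [HY HDY]]. rewrite (HYX Y HY HDY) in HDY. exists s. splits. split; [bound|].
    splits. intros x Hx HDx. assert (x = X) by (apply HYX; [lra|easy]). lra.
  - destruct Hc as [c [Hc1 Hc2]].
    (* Now [s] ends the range of parameters, starting from [e], that have a dip at or beyond [X].
       Persistence excludes dips beyond [X] at [s]; openness, and the absence of a birth at [s],
       then leave one at [X]. *)
    destruct (leave_point (fun s => exists y, X <= y /\ D s y) e s1 S3) as [s [Hs [HU HnU]]].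
    { exists c. splits. intros x Hx. destruct (Hpres x ltac:(lra)) as [Y [HY HDY]]. exists Y.
      destruct (Rle_dec X Y) as [|Hn]; [easy|]. exfalso. apply (Hc2 x Hx Y); [lra|easy]. }
    { intros [y [Hy HDy]]. apply (HM1 y); [lra|easy]. } assert (HYX : forall Y, X < Y -> ~ D s Y).
    { intros Y HY HDY.
      destruct (df_persist HD s Y (Y - X) ltac:(lra) ltac:(lra) HDY) as [d' [Hd' H']].
      destruct (HnU d' Hd') as [x [Hx [Hxs HnUx]]]. apply HnUx.
      destruct (H' x) as [Y' [HY' HDY']]; [lra|rewrite Rabs_right; lra|]. exists Y'. bound. }
    assert (HsX : D s X).
    { apply NNPP. intros Hne.
      destruct (not_birth lo hi D s (Hnb s ltac:(lra))) as [M [d1 [Hd1 H1]]].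
      destruct (df_open HD s X M ltac:(lra)) as [d2 [Hd2 H2]].
      { intros y Hy HDy. destruct (Req_dec y X) as [->|Hyx]; [easy|]. apply (HYX y); [lra|easy]. }
      pose proof (Rmin_l d1 d2). pose proof (Rmin_r d1 d2). assert (0 < Rmin d1 d2) by pos.
      pose proof (Rmax_l ((e + s) / 2) (s - Rmin d1 d2 / 2)).
      set (s' := Rmax ((e + s) / 2) (s - Rmin d1 d2 / 2)) in *.
      assert (s' < s) by (apply Rmax_lub_lt; lra). destruct (HU s' ltac:(lra)) as [Y [HY HDY]].
      assert (Rabs (s' - s) < Rmin d1 d2) by bound. destruct (Rle_dec Y M) as [HYM|HYM].
      + apply (H2 s' ltac:(lra) ltac:(lra) Y); [lra|easy].
      + apply (H1 s' ltac:(lra) ltac:(lra) Y); [lra|easy]. }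
    exists s. bound.
Qed.

Lemma dip_family_opp (lo hi : R) (D : R -> R -> Prop) : dip_family lo hi D ->
  dip_family (- hi) (- lo) (fun e => D (- e)).
Proof.
  intros HD. split.
  - intros e X r He Hr HX. destruct (df_persist HD (- e) X r ltac:(lra) Hr HX) as [t [Ht H]].
    exists t. splits. intros e' He' Hee. apply H; [lra|]. bound.
  - intros e A B He Hno. destruct (df_open HD (- e) A B ltac:(lra) Hno) as [t [Ht H]]. exists t.
    splits. intros e' He' Hee. apply H; [lra|]. bound.
  - intros e He. apply (df_bounded HD). lra.
Qed.

Lemma birth_opp (lo hi : R) (D : R -> R -> Prop) (e : R) :
  birth (- hi) (- lo) (fun e => D (- e)) e -> birth lo hi D (- e).
Proof.
  intros H M t Ht. destruct (H M t Ht) as [e' [x [He' [Hee [Hx HD]]]]]. exists (- e'), x. bound.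
Qed.

Lemma sweeps_opp (lo hi : R) (D : R -> R -> Prop) (e m : R) :
  sweeps (- hi) (- lo) (fun e => D (- e)) e m -> sweeps lo hi D (- e) m.
Proof.
  intros [H1 H2]. splits. intros d Hd. destruct (H2 d Hd) as [X0 HX0]. exists X0. intros X HX.
  destruct (HX0 X HX) as [[e1 [A1 [A2 A3]]] [e2 [B1 [B2 B3]]]]. split.
  - exists (- e1). bound.
  - exists (- e2). bound.
Qed.

Lemma last_birth (lo hi : R) (D : R -> R -> Prop) (e b : R) : lo < e < b -> b < hi -> birth lo hi D e ->
  ~ birth lo hi D b -> exists s, e <= s < b /\ birth lo hi D s /\ forall x, s < x <= b -> ~ birth lo hi D x.
Proof.
  intros He Hb HBe HBb.
  assert (Hopen : forall x, lo < x < hi -> ~ birth lo hi D x -> exists t, 0 < t /\ forall y, Rabs (y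
    - x) < t -> ~ birth lo hi D y).
  { intros x Hx HBx. destruct (not_birth lo hi D x HBx) as [M [t [Ht H]]]. exists (t / 2). splits.
    intros y Hy HBy. destruct (HBy M (t / 2) ltac:(lra)) as [z [w [Hz [Hzy [Hw HDw]]]]].
    apply (H z Hz) with (x := w); [|easy|easy]. bound. }
  pose (S := fun y => e <= y <= b /\ birth lo hi D y). destruct (completeness S) as [t [Ht1 Ht2]].
  { exists b. intros y [Hy _]. lra. }
  { exists e. split; [lra|easy]. } assert (Het : e <= t) by (apply Ht1; split; [lra|easy]).
  assert (Htb : t <= b) by (apply Ht2; intros y [Hy _]; lra). assert (HBt : birth lo hi D t).
  { apply NNPP. intros HB. destruct (Hopen t ltac:(lra) HB) as [d [Hd H]].
    assert (t <= t - d / 2); [|lra]. apply Ht2. intros y [Hy1 Hy2].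
    destruct (Rle_dec y (t - d / 2)) as [|Hn]; [easy|exfalso]. assert (y <= t) by solve_cont.
    apply (H y); [bound|easy]. }
  exists t. split; [|split; [easy|]].
  - destruct (Req_dec t b) as [->|]; [easy|lra].
  - intros x Hx HBx. assert (x <= t); [|lra]. apply Ht1. split; [lra|easy].
Qed.

(** Baire's theorem gives a birth [e] near which all births have their own dips below a common [n].
    Arbitrarily near [e] there is a parameter [b] with a dip beyond [n + 2], which therefore is not
    a birth. The birth nearest to [b] on the way from [e] has only birth-free parameters towards
    [b], as [sweeps_right] requires; if [b < e], the parameter is reflected. *)
Lemma birth_sweeps (lo hi : R) (D : R -> R -> Prop) (e0 : R) : dip_family lo hi D -> lo < e0 < hi ->
  birth lo hi D e0 -> exists e m, lo < e < hi /\ sweeps lo hi D e m.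
Proof.
  intros HD He0 HB0.
  destruct (baire lo hi (fun e => lo < e < hi /\ birth lo hi D e) (fun n e => forall x, INR n < x ->
    ~ D e x) e0) as [n [e [t [Ht [[He HBe] HF]]]]].
  - now split.
  - easy.
  - intros e He HB. destruct (not_birth lo hi D e) as [M [t [Ht H]]]; [intros H; now apply HB|].
    exists (t / 2). splits. intros y Hy [Hy' HBy].
    destruct (HBy M (t / 2) ltac:(lra)) as [z [w [Hz [Hzy [Hw HDw]]]]].
    apply (H z Hz) with (x := w); [|easy|easy]. bound.
  - intros n e He HF. assert (Hex : exists x, INR n < x /\ D e x).
    { apply NNPP. intros Hne. apply HF. eauto. }
    destruct Hex as [x [Hx HDx]].
    destruct (df_persist HD e x (x - INR n) He ltac:(lra) HDx) as [t [Ht H]]. exists t. splits.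
    intros e' He' Hee HF'. destruct (H e' He' Hee) as [x' [Hx' HDx']]. apply Rabs_def2 in Hx'.
    apply (HF' x'); [lra|easy].
  - solve_cont.
  - pose proof (HF e (conj He HBe)) as HFe. rewrite Rminus_diag, Rabs_R0 in HFe.
    specialize (HFe Ht). destruct (df_open HD e (INR n + 1) (INR n + 2) He) as [t1 [Ht1 Hgap]].
    { intros x Hx. apply HFe. lra. }
    destruct (HBe (INR n + 2) (Rmin t t1)) as [b [X [Hb [Hbe [HX HDX]]]]]; [now apply Rmin_glb_lt|].
    minmax. assert (HBb : ~ birth lo hi D b).
    { intros HBb. apply (HF b) with (x := X); [easy|lra|lra|easy]. }
    assert (Hside : forall lo' hi' D' e' b', dip_family lo' hi' D' -> lo' < e' -> e' < b' -> b' <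
      hi' -> birth lo' hi' D' e' -> ~ birth lo' hi' D' b' -> (exists X, INR n + 2 < X /\ D' b' X) ->
      (forall y, e' <= y <= b' -> birth lo' hi' D' y -> forall x, INR n < x -> ~ D' y x) -> (forall
      y x, e' <= y <= b' -> INR n + 1 <= x <= INR n + 2 -> ~ D' y x) -> exists s m, lo' < s < hi' /\
      sweeps lo' hi' D' s m).
    { intros lo' hi' D' e' b' HD' Hlo Heb Hhi HBe' HBb' HX' HF' Hgap'.
      destruct (last_birth lo' hi' D' e' b' ltac:(lra) Hhi HBe' HBb') as [s [Hs [HBs Hns]]].
      exists s, (INR n + 1). splits.
      apply (sweeps_right lo' hi' D' s b' (INR n)); try easy; try lra.
      - apply HF'; [lra|easy].
      - intros x y Hx. apply Hgap'. lra. }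
    destruct (Rlt_dec e b) as [Heb|Heb].
    + apply (Hside lo hi D e b); try easy; try lra.
      * eauto.
      * intros y Hy HBy. apply HF; [split; [lra|easy]|]. bound.
      * intros y x Hy. apply Hgap; [lra|]. bound.
    + assert (Hne : b <> e) by (intros ->; easy).
      destruct (Hside (- hi) (- lo) (fun e => D (- e)) (- e) (- b)) as [s [m [Hs Hsw]]]; try lra.
      * now apply dip_family_opp.
      * intros M d Hd. destruct (HBe M d Hd) as [z [w [Hz [Hze Hw]]]]. exists (- z), w.
        rewrite Ropp_involutive. bound.
      * intros HB'. apply birth_opp in HB'. rewrite Ropp_involutive in HB'. easy.
      * exists X. now rewrite Ropp_involutive.
      * intros y Hy HBy. apply birth_opp in HBy. apply HF; [split; [lra|easy]|]. bound.
      * intros y x Hy. apply Hgap; [lra|]. bound.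
      * exists (- s), m. splits. now apply sweeps_opp.
Qed.

(** * Interpolation *)

Lemma continuity_sumn_pow (c : nat -> R) (n : nat) : continuity (fun x => sumn n (fun i => c i * x ^ i)).
Proof.
  induction n as [|n IH]; cbn.
  - apply continuity_const. easy.
  - apply (continuity_plus (fun x => sumn n (fun i => c i * x ^ i)) (fun x => c n * x ^ n));
      [easy|].
    apply (continuity_mult (fun _ => c n) (fun x => x ^ n)); [apply continuity_const; now intros ?
      ?|].
    apply derivable_continuous, derivable_pow.
Qed.

(** Synthetic division by [x - y]. The recursion for the quotient [q] is part of the conclusion
    because it leads back from bounds on [q] to bounds on [c]. *)
Lemma horner_div (c : nat -> R) (y : R) (m : nat) : exists q : nat -> R,
  (forall n, (n < m)%nat -> q n = c (S n) + y * q (S n)) /\ q m = 0 /\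
  forall x, sumn (S m) (fun n => c n * x ^ n) - sumn (S m) (fun n => c n * y ^ n) =
    (x - y) * sumn m (fun n => q n * x ^ n).
Proof.
  pose (q := fun n => sumn (m - n) (fun j => c (S (n + j)) * y ^ j)).
  assert (Hq : forall n, (n < m)%nat -> q n = c (S n) + y * q (S n)).
  { intros n Hn. unfold q. replace (m - n)%nat with (S (m - S n)) by lia. rewrite sumn_shift.
    rewrite Nat.add_0_r, <- sumn_scal. cbn [pow]. f_equal; [ring|]. apply sumn_ext. intros i _.
    replace (n + S i)%nat with (S n + i)%nat by lia. ring. }
  assert (Hqm : q m = 0) by (unfold q; now rewrite Nat.sub_diag). exists q. splits.
  assert (H : forall x j, (j <= m)%nat -> (x - y) * sumn j (fun n => q n * x ^ n) = sumn (S j) (fun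
    n => c n * x ^ n) - c O - y * q O + y * q j * x ^ j).
  { intros x j. induction j as [|j IH]; intros Hj; [cbn; ring|].
    change (sumn (S j) (fun n => q n * x ^ n)) with (sumn j (fun n => q n * x ^ n) + q j * x ^ j).
    change (sumn (S (S j)) (fun n => c n * x ^ n)) with (sumn (S j) (fun n => c n * x ^ n) + c (S j)
      * x ^ (S j)).
    rewrite Rmult_plus_distr_l, IH by lia. cbn [pow]. rewrite (Hq j) by lia. ring. }
  intros x. rewrite (H x m (le_n _)), Hqm. pose proof (H y m (le_n _)). nra.
Qed.

(** Induction by dividing out the last node: the quotient has one node less, with values of size at
    most [2 M / s] at the remaining ones. *)
Lemma interpolation_bound (m : nat) (s : R) : 0 < s -> exists K, 0 < K /\ forall (c x : nat -> R) M, 0 <= M ->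
  (forall i, (i < m)%nat -> Rabs (x i) <= 2) ->
  (forall i j, (i < j < m)%nat -> s <= Rabs (x i - x j)) ->
  (forall i, (i < m)%nat -> Rabs (sumn m (fun n => c n * x i ^ n)) <= M) ->
  forall n, (n < m)%nat -> Rabs (c n) <= K * M.
Proof.
  intros Hs. induction m as [|m [K [HK IH]]]; [exists 1; split; [lra|intros; lia]|].
  pose (K2 := K * (2 / s)). assert (HK2 : 0 < K2) by (apply Rmult_lt_0_compat; [easy|pos]).
  exists (1 + 3 * K2 + 2 * (INR m * K2)). assert (HmK : 0 <= INR m * K2) by pos. splits.
  intros c x M HM Hx Hsep Hp. destruct (horner_div c (x m) m) as [q [Hq [Hqm Hdiv]]].
  assert (Hqb : forall n, (n < m)%nat -> Rabs (q n) <= K2 * M).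
  { replace (K2 * M) with (K * (2 * M / s)) by (unfold K2; field; lra). apply (IH q x (2 * M / s)).
    - pos.
    - auto.
    - bound.
    - intros i Hi. pose proof (Hsep i m ltac:(lia)) as Hsi. pose proof (Hp i ltac:(lia)) as H1.
      pose proof (Hp m ltac:(lia)) as H2.
      assert (H3 : Rabs ((x i - x m) * sumn m (fun n => q n * x i ^ n)) <= 2 * M).
      { rewrite <- Hdiv. bound. }
      rewrite Rabs_mult in H3. apply (Rmult_le_reg_l s); [easy|].
      replace (s * (2 * M / s)) with (2 * M) by algebra. nra. }
  assert (0 <= K2 * M) by pos. assert (Hqb' : forall n, (n <= m)%nat -> Rabs (q n) <= K2 * M).
  { intros n Hn. destruct (Nat.eq_dec n m) as [->|Hne]; [rewrite Hqm, Rabs_R0; lra|apply Hqb; lia]. }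
  intros [|n] Hn.
  - specialize (Hdiv 0). assert (sumn (S m) (fun n => c n * 0 ^ n) = c O).
    { rewrite sumn_shift. rewrite (sumn_ext m _ (fun _ => 0 * 0)).
      - rewrite sumn_scal. ring.
      - intros; cbn; ring. }
    assert (Rabs (sumn m (fun n => q n * 0 ^ n)) <= INR m * (K2 * M)).
    { eapply Rle_trans; [apply (sumn_abs_le m _ (fun _ => K2 * M))|].
      - intros i Hi. rewrite <- (Rmult_1_r (K2 * M)). destruct i; cbn; bound.
      - clear. induction m as [|m IH]; [cbn; lra|].
        change (sumn m (fun _ => K2 * M) + K2 * M <= INR (S m) * (K2 * M)). rewrite S_INR. lra. }
    replace (c O) with (sumn (S m) (fun n => c n * x m ^ n) + - (x m * sumn m (fun n => q n * 0 ^
      n))) by lra.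
    triangle. rewrite Rabs_Ropp, Rabs_mult. pose proof (Hp m ltac:(lia)) as H2.
    assert (Rabs (x m) * Rabs (sumn m (fun n => q n * 0 ^ n)) <= 2 * (INR m * (K2 * M))) by mono.
    lra.
  - specialize (Hq n ltac:(lia)). replace (c (S n)) with (q n + - (x m * q (S n))) by lra. triangle.
    rewrite Rabs_Ropp, Rabs_mult. pose proof (Hqb' n ltac:(lia)) as H1.
    pose proof (Hqb' (S n) ltac:(lia)) as H2.
    assert (Rabs (x m) * Rabs (q (S n)) <= 2 * (K2 * M)) by mono. nra.
Qed.

Lemma finite_choice (m : nat) (P : nat -> R -> Prop) : (forall i, (i < m)%nat -> exists y, P i y) ->
  exists f : nat -> R, forall i, (i < m)%nat -> P i (f i).
Proof.
  induction m as [|m IH]; intros H; [exists (fun _ => 0); intros; lia|].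
  destruct IH as [f Hf]; [intros; apply H; lia|]. destruct (H m ltac:(lia)) as [y Hy].
  exists (fun i => if Nat.eq_dec i m then y else f i). intros i Hi.
  destruct (Nat.eq_dec i m) as [->|Hne]; [easy|]. apply Hf. lia.
Qed.

(** * Energy estimates for gray amplitudes *)

Section GrayAmplitudes.

Context {sp : speed}.
Notation v := (@vel sp).
Notation k := (kap v).
Notation r0 := (rho0 v).

Variables (a Kv : R) (N : nat).
Hypothesis Ha : 0 < a.
Hypothesis HKv : 0 < Kv.
Hypothesis HN : (2 <= N)%nat.
Hypothesis HaN : (INR N - / 2) * a = 2 * k.

Definition decays (V : R -> R) : Prop := forall x, Rabs (V x) <= Kv * exp (- a * Rabs x).

Lemma decays_opp (V : R -> R) : decays V -> decays (fun x => V (- x)).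
Proof. intros H x. rewrite <- (Rabs_Ropp x). apply H. Qed.

Lemma decays_le (V : R -> R) : decays V -> forall x, Rabs (V x) <= Kv.
Proof.
  intros H x. eapply Rle_trans; [apply H|]. assert (exp (- a * Rabs x) <= 1); [|nra].
  apply exp_ge0_1. pose proof (Rabs_pos x). nra.
Qed.

Lemma momentum_bounded (e : R) (V p p1 : R -> R) : gm v e V p p1 -> decays V ->
  exists M, forall x, Rabs (2 * p x * p1 x) <= M.
Proof.
  intros Hg HV. pose proof (gm_p1_lim Kv e V p p1 Hg (decays_le V HV)) as Hp.
  pose proof (gm_p1_lim Kv e _ _ _ (gm_opp Hg) (decays_le _ (decays_opp V HV))) as Hm.
  assert (Hm' : is_lim p1 m_infty 0).
  { apply is_lim_opp_arg in Hm.
    apply (is_lim_ext (fun x => - (- p1 (- - x)))); [intros x; rewrite !Ropp_involutive; easy|].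
    replace 0 with (- 0) by ring. apply (is_lim_opp _ _ (Finite 0)). exact Hm. }
  destruct (bounded_of_lim (fun x => (2 * p x * p1 x) * (2 * p x * p1 x)) (fun x => 2 * (2 * p x *
    p1 x) * (2 * p1 x * p1 x + 2 * p x * (famp v (p x) + 2 * e * V x * p x))) 0 0) as [M HM].
  - derive.
  - replace 0 with ((2 * 1 * 0) * (2 * 1 * 0)) by ring.
    assert (H : is_lim (fun x => 2 * p x * p1 x) p_infty (Finite (2 * 1 * 0))).
    { apply (is_lim_mult _ p1 _ (Finite (2 * 1)) (Finite 0)); [|easy|easy].
      apply (is_lim_mult (fun _ => 2) p _ (Finite 2) (Finite 1)); [apply
        is_lim_const|solve_cont|easy]. }
    now apply (is_lim_mult _ _ _ (Finite (2 * 1 * 0)) (Finite (2 * 1 * 0))).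
  - replace 0 with ((2 * 1 * 0) * (2 * 1 * 0)) by ring.
    assert (H : is_lim (fun x => 2 * p x * p1 x) m_infty (Finite (2 * 1 * 0))).
    { apply (is_lim_mult _ p1 _ (Finite (2 * 1)) (Finite 0)); [|easy|easy].
      apply (is_lim_mult (fun _ => 2) p _ (Finite 2) (Finite 1)); [apply
        is_lim_const|solve_cont|easy]. }
    now apply (is_lim_mult _ _ _ (Finite (2 * 1 * 0)) (Finite (2 * 1 * 0))).
  - exists (1 + M). intros x. assert (Rabs (2 * p x * p1 x) * Rabs (2 * p x * p1 x) <= M).
    { rewrite <- Rabs_mult. rewrite Rabs_right; [easy|]. nra. }
    nra.
Qed.

Lemma energy_bound_right (e M : R) (V p p1 : R -> R) : gm v e V p p1 -> decays V ->
  (forall x, Rabs (2 * p x * p1 x) <= M) ->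
  forall x, 0 <= x -> Rabs (energy p p1 x) <= Rabs e * Kv * M / a.
Proof.
  intros Hg HV HM x Hx.
  assert (0 <= M) by (specialize (HM 0); pose proof (Rabs_pos (2 * p 0 * p1 0)); lra).
  eapply Rle_trans.
  - apply (decay_of_derive (energy p p1) (fun x => e * V x * (2 * p x * p1 x)) 0 (Rabs e * Kv * M) a
      Ha).
    + intros y _. now apply energy_derive.
    + intros y Hy.
      replace (Rabs e * Kv * M * exp (- a * y)) with (Rabs e * (Kv * exp (- a * y)) * M) by ring.
      specialize (HV y). rewrite (Rabs_right y) in HV by lra. bound.
    + apply (energy_lim Kv e V p p1 Hg). now apply decays_le.
    + exact Hx.
  - assert (0 <= Rabs e * Kv * M / a) by pos. assert (exp (- a * x) <= 1) by (apply exp_ge0_1; nra).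
    nra.
Qed.

(** A bootstrap on the supremum [M] of [|2 p p'|], finite by [momentum_bounded]. Integrating its
    derivative, the energy is at most [M |e| Kv / a]; conversely
    [(2 p p')^2 = 8 p^2 (energy + Wpot)]. Together they give [M^2 <= M + 8], independently of the
    amplitude. *)
Lemma energy_bound (e : R) (V p p1 : R -> R) : gm v e V p p1 -> decays V ->
  16 * (Rabs e * Kv / a) <= 1 -> Rabs e * Kv / k ^ 2 <= 1 ->
  forall x, Rabs (energy p p1 x) <= 4 * (Rabs e * Kv / a) /\ Rabs (2 * p x * p1 x) <= 4.
Proof.
  intros Hg HV He1 He2.
  assert (Hall : forall M, (forall x, Rabs (2 * p x * p1 x) <= M) -> forall x, Rabs (energy p p1 x)
    <= Rabs e * Kv / a * M).
  { intros M HM x. replace (Rabs e * Kv / a * M) with (Rabs e * Kv * M / a) by lra.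
    destruct (Rle_dec 0 x) as [Hx|Hx]; [now apply (energy_bound_right e M V)|].
    pose proof (energy_bound_right e M _ _ _ (gm_opp Hg) (decays_opp V HV)) as H.
    assert (HM' : forall y, Rabs (2 * p (- y) * - p1 (- y)) <= M).
    { intros y. rewrite <- Rabs_Ropp.
      replace (- (2 * p (- y) * - p1 (- y))) with (2 * p (- y) * p1 (- y)) by ring. apply HM. }
    specialize (H HM' (- x) ltac:(lra)). unfold energy in H. rewrite !Ropp_involutive in H.
    replace ((- p1 x) ^ 2) with (p1 x ^ 2) in H by ring. exact H. }
  destruct (momentum_bounded e V p p1 Hg HV) as [M0 HM0].
  pose proof (gm_upper Kv ltac:(lra) e V p p1 Hg (decays_le V HV)) as Hup. pose proof v2_bounds.
  destruct (completeness (fun y => exists x, y = Rabs (2 * p x * p1 x))) as [M [Hub Hlub]].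
  { exists M0. intros y [x ->]. apply HM0. }
  { now exists (Rabs (2 * p 0 * p1 0)), 0. }
  assert (HM : forall x, Rabs (2 * p x * p1 x) <= M) by (intros x; apply Hub; now exists x).
  assert (0 <= M) by (specialize (HM 0); pose proof (Rabs_pos (2 * p 0 * p1 0)); lra).
  assert (M <= 4).
  { assert (M <= sqrt (M + 8)).
    { apply Hlub. intros y [x ->]. rewrite <- sqrt_Rsqr_abs. apply sqrt_le_1_alt.
      specialize (Hup x). pose proof (gm_pos Hg x). pose proof (Hall M HM x) as HE.
      unfold energy in HE. set (s := p x ^ 2) in *.
      assert (0 < s <= 2) by (split; [now apply pow_lt|lra]). assert (s * Wpot v (p x) <= 1).
      { replace (s * Wpot v (p x)) with ((1 - s) ^ 2 * (s - v ^ 2) / 2).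
        - assert (0 <= (1 - s) ^ 2) by pos. bound.
        - unfold Wpot, s. field. lra. }
      assert (Rsqr (2 * p x * p1 x) = 8 * (s * (p1 x ^ 2 / 2 - Wpot v (p x))) + 8 * (s * Wpot v (p
        x))).
      { unfold Rsqr, s. field. } apply Rabs_le_between in HE. nra. }
    assert (M * M <= M + 8). { rewrite <- (sqrt_sqrt (M + 8)) by lra. mono. } nra. }
  intros x. split.
  - rewrite (Rmult_comm 4). apply Hall. intros y. specialize (HM y). lra.
  - specialize (HM x). lra.
Qed.

(** The upper bound is the maximum principle. For the lower one, the energy is at least [- Wpot],
    which below [|v| - d] is positive and bounded away from 0, against the smallness of the
    energy. *)
Lemma apriori (d : R) : 0 < d -> exists e1, 0 < e1 /\ forall e V p p1,
  Rabs e <= e1 -> decays V -> gm v e V p p1 -> forall x,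
  Rabs v - d <= p x <= 1 + d /\ Rabs v / 2 <= p x <= 2 /\ Rabs (p1 x) <= 4 / Rabs v /\
  Rabs (energy p p1 x) <= d.
Proof.
  intros Hd. pose proof vabs_bounds as Hv. pose proof kap_pos as Hk. pose proof kap_sq as Hks.
  pose (d' := Rmin d (Rabs v / 2)). assert (Hd' : 0 < d' /\ d' <= d /\ d' <= Rabs v / 2) by bound.
  pose (t := Rmin (Rmin 1 d') (d' * k ^ 4 / 8)).
  assert (Ht : 0 < t /\ t <= 1 /\ t <= d' /\ t <= d' * k ^ 4 / 8) by bound.
  pose (e1 := Rmin (t * a / (16 * Kv)) (t * k ^ 2 / Kv)). exists e1. split. { bound. }
  intros e V p p1 He HV Hg. assert (H1 : 16 * (Rabs e * Kv / a) <= t).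
  { assert (H : Rabs e <= t * a / (16 * Kv)) by (eapply Rle_trans; [exact He|apply Rmin_l]).
    apply (Rmult_le_compat_r (16 * Kv / a)) in H; [|pos].
    replace (t * a / (16 * Kv) * (16 * Kv / a)) with t in H by algebra. lra. }
  assert (Rabs e * Kv / k ^ 2 <= t).
  { assert (H : Rabs e <= t * k ^ 2 / Kv) by (eapply Rle_trans; [exact He|apply Rmin_r]).
    apply (Rmult_le_compat_r (Kv / k ^ 2)) in H; [|pos].
    replace (t * k ^ 2 / Kv * (Kv / k ^ 2)) with t in H by algebra. lra. }
  pose proof (energy_bound e V p p1 Hg HV ltac:(lra) ltac:(lra)) as HE.
  pose proof (gm_upper Kv ltac:(lra) e V p p1 Hg (decays_le V HV)) as Hup. intros x.
  destruct (HE x) as [HEx Hmx]. specialize (Hup x). pose proof (gm_pos Hg x).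
  assert (p x <= 1 + d') by nra. assert (Rabs v - d' <= p x).
  { destruct (Rle_dec (Rabs v - d') (p x)) as [|Hn]; [easy|exfalso]. set (s := p x ^ 2).
    assert (v ^ 2 = Rabs v ^ 2) by (symmetry; apply pow2_abs).
    assert (0 < s /\ s + d' * Rabs v <= v ^ 2). { unfold s. nra. }
    assert ((1 - s) ^ 2 * (v ^ 2 - s) <= 2 * s * (t / 4)).
    { unfold energy in HEx. apply Rabs_le_between in HEx.
      assert (- Wpot v (p x) = (1 - s) ^ 2 * (v ^ 2 - s) / (2 * s)) by (unfold Wpot, s; field; lra).
      assert (HW : (1 - s) ^ 2 * (v ^ 2 - s) / (2 * s) <= t / 4) by nra.
      apply (Rmult_le_compat_r (2 * s)) in HW; [|lra].
      replace ((1 - s) ^ 2 * (v ^ 2 - s) / (2 * s) * (2 * s)) with ((1 - s) ^ 2 * (v ^ 2 - s)) in HW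
        by algebra.
      lra. }
    assert (k ^ 4 <= (1 - s) ^ 2).
    { replace (k ^ 4) with ((k ^ 2) ^ 2) by ring. apply pow_incr. nra. }
    assert (k ^ 4 * (d' * Rabs v) <= (1 - s) ^ 2 * (v ^ 2 - s)) by mono.
    assert (2 * s * (t / 4) <= Rabs v * (d' * k ^ 4 / 8)).
    { assert (Rabs v ^ 2 <= Rabs v) by bound. assert (0 < d' * Rabs v) by pos.
      assert (s * t <= Rabs v * (d' * k ^ 4 / 8)) by mono. bound. }
    bound. }
  splits. split.
  - rewrite !Rabs_mult, (Rabs_right 2), (Rabs_right (p x)) in Hmx by lra.
    apply (Rmult_le_reg_r (Rabs v)); [lra|]. replace (4 / Rabs v * Rabs v) with 4 by algebra. nra.
  - lra.
Qed.

(** * Dips of gray amplitudes *)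

(** For small [e] critical points lie near [|v|] or near 1; the level half-way between separates the
    two kinds. *)
Definition dip (p p1 : R -> R) (x : R) : Prop := p1 x = 0 /\ p x <= (1 + Rabs v) / 2.

(** At a critical point the energy is [- Wpot (p x)]. Its smallness puts [p x] near a zero of
    [Wpot], and 1 is excluded by [p x <= 1 - h]. *)
Lemma crit_small (h z : R) : 0 < h -> 0 < z -> exists e1, 0 < e1 /\ forall e V p p1,
  Rabs e <= e1 -> decays V -> gm v e V p p1 -> forall x,
  p1 x = 0 -> p x <= 1 - h -> Rabs (p x - Rabs v) <= z.
Proof.
  intros Hh Hz. pose proof vabs_bounds as Hv. pose (h' := Rmin h (/ 2)).
  destruct (apriori (h' ^ 2 * (Rabs v * z) / 8)) as [e1 [He1 Hap]]. { bound. } exists e1. splits.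
  intros e V p p1 He HV Hg x Hx Hp. destruct (Hap e V p p1 He HV Hg x) as [_ [Hr [_ HE]]].
  unfold energy in HE. rewrite Hx in HE. set (s := p x ^ 2).
  assert (Hvs : v ^ 2 = Rabs v ^ 2) by (symmetry; apply pow2_abs).
  assert (EW : 0 ^ 2 / 2 - Wpot v (p x) = - ((1 - s) ^ 2 * ((p x - Rabs v) * (p x + Rabs v)) / (2 *
    s))).
  { unfold Wpot, s. rewrite Hvs. field. lra. } rewrite EW, Rabs_Ropp in HE.
  assert (Hs : 0 < s <= 4) by (unfold s; nra). unfold Rdiv in HE. rewrite !Rabs_mult in HE.
  rewrite (Rabs_right (/ (2 * s))), (Rabs_right (p x + Rabs v)), (Rabs_right ((1 - s) ^ 2)) in HE.
  2:{ pos. }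
  2:{ lra. } 2:{ pos. } apply (Rmult_le_compat_r (2 * s)) in HE; [|lra].
  replace ((1 - s) ^ 2 * (Rabs (p x - Rabs v) * (p x + Rabs v)) * / (2 * s) * (2 * s)) with ((1 - s)
    ^ 2 * (Rabs (p x - Rabs v) * (p x + Rabs v))) in HE by algebra.
  assert (H1 : h' ^ 2 <= (1 - s) ^ 2). { apply pow_incr. unfold s. bound. }
  assert (H2 : h' ^ 2 * (Rabs (p x - Rabs v) * Rabs v) <= (1 - s) ^ 2 * (Rabs (p x - Rabs v) * (p x
    + Rabs v))) by mono.
  assert (Hh2 : 0 < h' ^ 2) by bound.
  assert (H3 : h' ^ 2 * (Rabs (p x - Rabs v) * Rabs v) <= h' ^ 2 * (z * Rabs v)).
  { assert (0 <= h' ^ 2 * (Rabs v * z)) by pos. nra. }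
  apply Rmult_le_reg_l in H3; [|easy]. nra.
Qed.

Lemma dip_between (h : R) : 0 < h -> exists e1, 0 < e1 /\ forall e V p p1,
  Rabs e <= e1 -> decays V -> gm v e V p p1 -> forall l b x,
  l < x < b -> p x < p l -> p x < p b -> p x <= 1 - h -> exists c, l < c < b /\ dip p p1 c.
Proof.
  intros Hh. pose proof vabs_bounds.
  destruct (crit_small h ((1 - Rabs v) / 2) Hh ltac:(lra)) as [e1 [He1 Hc]]. exists e1. splits.
  intros e V p p1 He HV Hg l b x Hx Hl Hb Hxh.
  destruct (interior_min p p1 l b x) as [c [Hcx [H0 [Hle _]]]]; try easy. { derive. } exists c.
  splits. specialize (Hc e V p p1 He HV Hg c H0 ltac:(lra)). bound.
Qed.

Lemma dip_after (h : R) : 0 < h -> exists e1, 0 < e1 /\ forall e V p p1,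
  Rabs e <= e1 -> decays V -> gm v e V p p1 -> forall l x,
  l < x -> p x < p l -> p x <= 1 - h -> exists c, l < c /\ dip p p1 c.
Proof.
  intros Hh. destruct (dip_between h Hh) as [e1 [He1 H]]. exists e1. splits.
  intros e V p p1 He HV Hg l x Hx Hl Hxh.
  destruct (eventually_lt p 1 (1 - p x) (gm_pinf Hg)) as [M HM]; [lra|].
  pose (b := Rmax (x + 1) (M + 1)). assert (x + 1 <= b /\ M + 1 <= b) by bound.
  specialize (HM b ltac:(lra)). apply Rabs_def2 in HM.
  destruct (H e V p p1 He HV Hg l b x) as [c [Hc1 Hc2]]; try lra. exists c. easy.
Qed.

Lemma famp_1 : famp v 1 = 0.
Proof. unfold famp. field. Qed.

(** At a dip the value and the slope are close to those of the soliton at its bottom, and Gronwall's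
    inequality carries this over the fixed length [T]. *)
Lemma near_dip (T d : R) : 0 <= T -> 0 < d -> exists e1, 0 < e1 /\ forall e V p p1,
  Rabs e <= e1 -> decays V -> gm v e V p p1 -> forall X, dip p p1 X ->
  forall y, 0 <= y <= T -> Rabs (p (X + y) - r0 y) <= d /\ Rabs (p1 (X + y) - zs v y) <= d.
Proof.
  intros HT Hd. destruct fq_bound as [Cf [HCf Hfq]]. pose proof vabs_bounds.
  pose (E := exp ((2 + Cf) * T)). assert (0 < E) by apply exp_pos. pose (z := d / (2 * E + 2)).
  assert (Hz : 0 < z) by (apply Rdiv_lt_0_compat; lra). assert (HzE : (z ^ 2 + z ^ 2) * E <= d ^ 2).
  { assert (z * (2 * E + 2) = d) by (unfold z; field; lra). nra. }
  destruct (crit_small ((1 - Rabs v) / 2) z ltac:(lra) Hz) as [e1 [He1 Hc]].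
  destruct (apriori 1 Rlt_0_1) as [e2 [He2 Hap]]. exists (Rmin (Rmin e1 e2) (z / (4 * Kv))). split.
  { pos. }
  intros e V p p1 He HV Hg X [HX0 HX] y Hy. assert (He1' : Rabs e <= e1) by bound.
  assert (He2' : Rabs e <= e2) by bound. assert (He3 : 4 * Rabs e * Kv <= z) by bound.
  specialize (Hc e V p p1 He1' HV Hg X HX0 ltac:(lra)). specialize (Hap e V p p1 He2' HV Hg).
  pose proof (second_order_gronwall (fun y => p (X + y) - r0 y) (fun y => p1 (X + y) - zs v y) (fun
    y => famp v (p (X + y)) + 2 * e * V (X + y) * p (X + y) - famp v (r0 y)) 0 y Cf z ltac:(lra)
    ltac:(lra) ltac:(lra)) as G.
  cbv beta in G. rewrite Rplus_0_r, HX0, zs_0, rho0_0, !Rminus_0_r in G.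
  assert ((p (X + y) - r0 y) ^ 2 + (p1 (X + y) - zs v y) ^ 2 <= d ^ 2).
  { eapply Rle_trans; [apply G|].
    - derive.
    - derive.
    - intros t _. destruct (Hap (X + t)) as [_ [Hpr _]]. pose proof (rho0_ge t).
      pose proof (rho0_lt1 t).
      replace (famp v (p (X + t)) + 2 * e * V (X + t) * p (X + t) - famp v (r0 t)) with (fq v (p (X
        + t)) (r0 t) * (p (X + t) - r0 t) + 2 * e * V (X + t) * p (X + t)).
      2:{ rewrite <- famp_sub by lra. ring. } triangle. apply Rplus_le_compat.
      + rewrite Rabs_mult. apply Rmult_le_compat_r; [pos|]. now apply (Hfq _ _ (r0 t)); try lra.
      + eapply Rle_trans; [|exact He3].
        replace (4 * Rabs e * Kv) with (2 * Rabs e * Kv * 2) by ring. apply Rabs_mult_le; [|mono].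
        apply Rabs_mult_le; [rewrite Rabs_mult, (Rabs_right 2); lra|]. now apply (decays_le).
    - eapply Rle_trans; [|exact HzE]. apply Rmult_le_compat.
      + pos.
      + pos.
      + assert ((p X - Rabs v) ^ 2 <= z ^ 2). { rewrite <- (pow2_abs (p X - Rabs v)). mono. } lra.
      + unfold E. mono. }
  pose proof (pow2_ge_0 (p (X + y) - r0 y)). pose proof (pow2_ge_0 (p1 (X + y) - zs v y)).
  split; apply sqr_abs_le; lra.
Qed.

(* The integral of [|p - 1|] over an interval on which [p] stays near [1] does not depend on the
   length of the interval. *)
Lemma near_one_integral : exists h e1 C, 0 < h /\ 0 < e1 /\ 0 < C /\ forall e V p p1,
  Rabs e <= e1 -> decays V -> gm v e V p p1 -> forall l b, l <= b ->
  (forall x, l <= x <= b -> 1 - h <= p x) -> RInt (fun x => Rabs (p x - 1)) l b <= C.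
Proof.
  destruct fq_bound as [Cf [HCf Hfq]]. pose proof vabs_bounds as Hv. pose proof kap_pos as Hk.
  assert (Hk2 : 0 < k ^ 2) by pos. pose (h := Rmin (1 - Rabs v / 2) (k ^ 2 / Cf)).
  assert (Hh : 0 < h /\ h <= 1 - Rabs v / 2 /\ Cf * h <= k ^ 2) by bound.
  destruct (apriori h ltac:(lra)) as [e1 [He1 Hap]].
  pose (C := (8 / Rabs v + 4 * e1 * Kv * (PI / a)) / k ^ 2 + 1). exists h, e1, C. splits. split.
  { unfold C. pos. }
  intros e V p p1 He HV Hg l b Hlb Hnear. specialize (Hap e V p p1 He HV Hg).
  assert (Hc : cont (fun x => Rabs (p x - 1))).
  { intros x. apply (continuous_comp (fun x => p x - 1) Rabs).
    - apply (cont_of_derive (fun x => p x - 1) p1). derive.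
    - apply continuous_Rabs. }
  assert (key : forall d, 0 < d -> k ^ 2 * RInt (fun x => Rabs (p x - 1)) l b <= 8 / Rabs v + 4 * e1
    * Kv * (PI / a) + k ^ 2 * d * (b - l)).
  (* A smooth substitute for [|p - 1|]. Its second derivative is at least [k^2 (|p - 1| - d)] minus
     a multiple of a bump from the potential, so the integral is controlled by the slopes of [w] at
     the two ends. *)
  { intros d Hd. pose (w := fun x => sqrt ((p x - 1) ^ 2 + d ^ 2)). assert (Hd2 : 0 < d ^ 2) by pos.
    assert (Hw2 : forall x, w x ^ 2 = (p x - 1) ^ 2 + d ^ 2). { intros x. apply pow2_sqrt. pos. }
    assert (Hwp : forall x, 0 < w x). { intros x. apply sqrt_lt_R0. pos. }
    assert (Hwz : forall x, Rabs (p x - 1) <= w x).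
    { intros x. pose proof (Hw2 x). pose proof (Hwp x). rewrite <- (pow2_abs (p x - 1)) in *. nra. }
    assert (Hwd : forall x, is_derive w x ((p x - 1) * p1 x / w x)).
    { intros x. pose proof (gm_d Hg x) as H1. unfold w. auto_derive.
      - split; [now exists (p1 x)|]. specialize (Hw2 x). specialize (Hwp x). nra.
      - rewrite (Derive_eta H1). change (d * (d * 1)) with (d ^ 2).
        replace ((p x + - (1)) * ((p x + - (1)) * 1)) with ((p x - 1) ^ 2) by ring. fold (w x).
        specialize (Hwp x). field. lra. }
    assert (Hend : forall x, Rabs ((p x - 1) * p1 x / w x) <= 4 / Rabs v).
    { intros x. destruct (Hap x) as [_ [_ [Hp1 _]]]. unfold Rdiv at 1. rewrite !Rabs_mult.
      rewrite (Rabs_right (/ w x)) by pos. specialize (Hwp x).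
      apply (Rmult_le_reg_r (w x)); [easy|].
      replace (Rabs (p x - 1) * Rabs (p1 x) * / w x * w x) with (Rabs (p x - 1) * Rabs (p1 x)) by
        algebra.
      rewrite (Rmult_comm (4 / Rabs v)). mono. }
    pose proof (derive_ge0_le (fun x => (p x - 1) * p1 x / w x + 4 * e1 * Kv * bump_int a 0 x - k ^
      2 * (RInt (fun x => Rabs (p x - 1)) l x - d * x)) (fun x => (p1 x * p1 x + (p x - 1) * (famp v
      (p x) + 2 * e * V x * p x)) / w x - (p x - 1) * p1 x * ((p x - 1) * p1 x / w x) / w x ^ 2 + 4
      * e1 * Kv * bump a 0 x - k ^ 2 * (Rabs (p x - 1) - d)) l b Hlb) as Hmono.
    cbv beta in Hmono. rewrite RInt_point in Hmono.
    assert ((p l - 1) * p1 l / w l + 4 * e1 * Kv * bump_int a 0 l - k ^ 2 * (0 - d * l) <= (p b - 1)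
      * p1 b / w b + 4 * e1 * Kv * bump_int a 0 b - k ^ 2 * (RInt (fun x => Rabs (p x - 1)) l b - d
      * b)).
    { apply Hmono.
      - intros x _. pose proof (gm_d Hg x) as H1. pose proof (gm_dd Hg x) as H2.
        pose proof (Hwd x) as H3. specialize (Hwp x).
        apply (is_derive_minus (fun x => (p x - 1) * p1 x / w x + 4 * e1 * Kv * bump_int a 0 x)).
        + apply (is_derive_plus (fun x => (p x - 1) * p1 x / w x)).
          * auto_derive; [solve_ex_derive; lra|].
            rewrite (Derive_eta H1), (Derive_eta H2), (Derive_eta H3). field. lra.
          * apply is_derive_scal. now apply is_derive_bump_int.
        + apply is_derive_scal.
          apply (is_derive_minus (fun x0 => RInt (fun x1 => Rabs (p x1 - 1)) l x0)).
          * now apply (is_derive_RInt_cont (fun x1 => Rabs (p x1 - 1))).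
          * auto_derive; [easy|ring].
      - intros x Hx. destruct (Hap x) as [Hr1 [Hr2 _]]. specialize (Hnear x Hx). specialize (Hw2 x).
        specialize (Hwp x). specialize (Hwz x). set (z := p x - 1) in *. set (W := w x) in *.
        assert (Hf : famp v (p x) = fq v (p x) 1 * z).
        { rewrite <- famp_sub by lra. rewrite famp_1. ring. }
        assert (k ^ 2 <= fq v (p x) 1).
        { destruct (Hfq (p x) 1 1) as [_ H]; try lra. rewrite dfamp_1, Rminus_diag, Rabs_R0 in H.
          assert (Rabs (p x - 1) <= h) by mono. assert (Cf * (Rabs (p x - 1) + 0) <= k ^ 2) by nra.
          bound. }
        assert (HVb : Rabs (2 * e * V x * p x) <= 4 * e1 * Kv * exp (- a * Rabs x)).
        { replace (4 * e1 * Kv * exp (- a * Rabs x)) with (2 * e1 * (Kv * exp (- a * Rabs x)) * 2)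
            by ring.
          mono. }
        pose proof (bump_ge a 0 x Ha) as Hbump. rewrite Rminus_0_r in Hbump.
        assert (Rabs (2 * e * V x * p x) <= 4 * e1 * Kv * bump a 0 x).
        { eapply Rle_trans; [exact HVb|]. mono. }
        replace ((p1 x * p1 x + z * (famp v (p x) + 2 * e * V x * p x)) / W - z * p1 x * (z * p1 x /
          W) / W ^ 2) with (p1 x ^ 2 * (W ^ 2 - z ^ 2) / W ^ 3 + fq v (p x) 1 * (z ^ 2 / W) + (2 * e
          * V x * p x) * (z / W)) by (rewrite Hf; field; lra).
        assert (0 <= p1 x ^ 2 * (W ^ 2 - z ^ 2) / W ^ 3) by pos. assert (Rabs z - d <= z ^ 2 / W).
        { apply (Rmult_le_reg_r W); [easy|]. replace (z ^ 2 / W * W) with (z ^ 2) by algebra.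
          rewrite <- (pow2_abs z). rewrite <- (pow2_abs z) in Hw2. pose proof (Rabs_pos z). nra. }
        assert (- Rabs (2 * e * V x * p x) <= (2 * e * V x * p x) * (z / W)).
        { assert (Rabs (z / W) <= 1).
          { unfold Rdiv. rewrite Rabs_mult, (Rabs_right (/ W)) by pos.
            apply (Rmult_le_reg_r W); [easy|]. rewrite Rmult_assoc, Rinv_l by lra. lra. }
          assert (Rabs (2 * e * V x * p x * (z / W)) <= Rabs (2 * e * V x * p x)).
          { rewrite Rabs_mult. pose proof (Rabs_pos (2 * e * V x * p x)). nra. }
          bound. }
        assert (k ^ 2 * (Rabs z - d) <= fq v (p x) 1 * (z ^ 2 / W)).
        { apply Rle_trans with (k ^ 2 * (z ^ 2 / W)).
          - mono.
          - mono. }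
        lra. }
    pose proof (Hend l) as Hl. pose proof (Hend b) as Hb. apply Rabs_le_between in Hl.
    apply Rabs_le_between in Hb. pose proof (bump_int_bounds a 0 l Ha).
    pose proof (bump_int_bounds a 0 b Ha).
    assert (4 * e1 * Kv * bump_int a 0 b <= 4 * e1 * Kv * (PI / a)) by mono. nra. }
  (* This smoothing parameter makes the error [k^2 d (b - l)] at most [k^2], whatever the length. *)
  specialize (key (/ (b - l + 1)) ltac:(apply Rinv_0_lt_compat; lra)).
  assert (k ^ 2 * / (b - l + 1) * (b - l) <= k ^ 2).
  { rewrite Rmult_assoc. rewrite <- (Rmult_1_r (k ^ 2)) at 2. apply Rmult_le_compat_l; [lra|].
    apply (Rmult_le_reg_l (b - l + 1)); [lra|]. rewrite <- Rmult_assoc, Rinv_r by lra. lra. }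
  unfold C. apply (Rmult_le_reg_l (k ^ 2)); [easy|].
  replace (k ^ 2 * ((8 / Rabs v + 4 * e1 * Kv * (PI / a)) / k ^ 2 + 1)) with (8 / Rabs v + 4 * e1 *
    Kv * (PI / a) + k ^ 2) by algebra.
  lra.
Qed.

(** * Dips and one-sided reference solutions *)

(** The deviation from the soliton at [X] is weighted by the distance to the potential, centred at
    0, and not to the dip. The domain extends to the left of [X] so that the derivatives at [X] are
    two-sided. *)
Record refsol (e X d : R) (V q q1 : R -> R) : Prop := {
  ref_d : forall x, X - 1 < x -> is_derive q x (q1 x);
  ref_dd : forall x, X - 1 < x -> is_derive q1 x (famp v (q x) + 2 * e * V x * q x);
  ref_0 : q1 X = 0;
  ref_near : forall x, X <= x -> Rabs (q x - r0 (x - X)) <= d * exp (- a * Rabs x);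
  ref_near1 : forall x, X <= x -> Rabs (q1 x - zs v (x - X)) <= d * exp (- a * Rabs x) }.

Arguments ref_d {e X d V q q1}.
Arguments ref_dd {e X d V q q1}.
Arguments ref_0 {e X d V q q1}.
Arguments ref_near {e X d V q q1}.
Arguments ref_near1 {e X d V q q1}.

Lemma ref_near_le (e X d : R) (V q q1 : R -> R) (x : R) : 0 <= d -> refsol e X d V q q1 -> X <= x ->
  Rabs (q x - r0 (x - X)) <= d /\ Rabs (q1 x - zs v (x - X)) <= d.
Proof.
  intros Hd H Hx. pose proof (ref_near H x Hx). pose proof (ref_near1 H x Hx).
  assert (exp (- a * Rabs x) <= 1) by (apply exp_ge0_1; pose proof (Rabs_pos x); nra). nra.
Qed.

Lemma zs_le (x : R) : Rabs (zs v x) <= / Rabs v.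
Proof.
  pose proof (rho0_ge x). pose proof vabs_bounds. pose proof (sch_pos x). pose proof kap_pos.
  pose proof kap_lt1. assert (th v x ^ 2 + sch v x = 1) by (unfold sch; ring). unfold zs, Rdiv.
  rewrite Rabs_mult. rewrite <- (Rmult_1_l (/ Rabs v)). apply Rmult_le_compat; try apply Rabs_pos.
  - replace 1 with (1 * 1 * 1) by ring. apply Rabs_mult_le; [apply Rabs_mult_le|].
    + rewrite Rabs_right by pos. nra.
    + apply Rabs_le. split; nra.
    + pose proof (pow2_ge_0 (th v x)). mono.
  - mono.
Qed.

(* The deviation of a gray amplitude from the reference solution at the same dip follows the even
   growing mode [zu] of the linearized equation, which changes sign. *)
Lemma dip_start (h Tmin : R) : 0 < h -> exists T d0 e1 M, Tmin <= T /\ 0 < T /\ 0 < d0 /\ 0 < e1 /\ 1 <= M /\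
  forall e V p p1 X q q1,
  Rabs e <= e1 -> decays V -> gm v e V p p1 -> dip p p1 X -> refsol e X d0 V q q1 ->
  1 - h <= p (X + T) /\
  (forall x, X <= x -> Rabs v / 2 <= q x <= 2 /\ Rabs (q1 x) <= M) /\
  (forall x, X + T <= x -> 1 - h <= q x) /\
  exists A B, / 2 <= A <= M /\ / 2 <= B <= M /\
    p (X + T) - q (X + T) = - ((p X - q X) * A) /\ p1 (X + T) - q1 (X + T) = - ((p X - q X) * B).
Proof.
  intros Hh. destruct fq_bound as [Cf [HCf Hfq]]. pose proof vabs_bounds as Hv.
  pose proof kap_pos as Hk. destruct zu_growth as [Tz [HTz Hzu]].
  destruct modes_bound as [Cm [HCm Hmodes]].
  destruct (exp_small (2 * k) (h / 8)) as [Tr [HTr Hr]]; [lra|lra|].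
  pose (T := Rmax Tmin (Rmax Tz Tr)). assert (HT : Tmin <= T /\ Tz <= T /\ Tr <= T) by bound.
  pose (Mz := Cm * exp (2 * k * T)). assert (HMz : 1 <= Mz).
  { unfold Mz. assert (1 <= exp (2 * k * T)); [|nra]. rewrite <- exp_0. mono. }
  pose (Ex := exp ((2 + (Cf + 1)) * T)). assert (HEx : 1 <= Ex).
  { unfold Ex. rewrite <- exp_0 at 1. mono. }
  (* [eta] bounds the deviation of the linear coefficient from [dfamp rho0]. This value makes the
     Gronwall error at [T] at most [|d| / 2], while the multiple of the growing mode has reached at
     least [|d|]. *)
  pose (eta := Rabs v / (2 * Mz * Ex)). assert (HME : 0 < Mz * Ex) by pos.
  assert (Heta : 0 < eta) by (apply Rdiv_lt_0_compat; lra).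
  assert (Heta1 : eta * Mz / Rabs v * Ex = / 2) by (unfold eta; field; lra).
  pose (dl := Rmin (Rmin (eta / (4 * Cf)) (h / 2)) (Rabs v / 2)).
  assert (Hdl : 0 < dl /\ 4 * Cf * dl <= eta /\ dl <= h / 2 /\ dl <= Rabs v / 2) by bound.
  destruct Hdl as [Hdl [Hdl1 [Hdl2 Hdl3]]].
  destruct (near_dip T dl ltac:(lra) Hdl) as [e1 [He1 Hnd]].
  destruct (apriori 1 Rlt_0_1) as [e2 [He2 Hap]]. pose (M := Mz / Rabs v + 2 + / Rabs v).
  assert (HM1 : 0 < / Rabs v) by pos. assert (HM2 : 0 < Mz / Rabs v) by pos.
  exists T, dl, (Rmin (Rmin e1 e2) (Rmin (eta / (4 * Kv)) (/ (2 * Kv)))), M. split; [lra|].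
  split; [lra|]. split; [easy|]. split. { pos. } split; [unfold M; lra|].
  intros e V p p1 X q q1 He HV Hg HX Hq. assert (He1' : Rabs e <= e1) by bound.
  assert (He2' : Rabs e <= e2) by bound.
  assert (He3 : 2 * Rabs e * Kv <= eta / 2 /\ 2 * Rabs e * Kv <= 1) by bound.
  specialize (Hnd e V p p1 He1' HV Hg X HX). specialize (Hap e V p p1 He2' HV Hg).
  assert (Hqn : forall x, X <= x -> Rabs (q x - r0 (x - X)) <= dl /\ Rabs (q1 x - zs v (x - X)) <=
    dl).
  { intros x Hx. apply (ref_near_le e X dl V); [lra|easy|easy]. }
  assert (Hqb : forall x, X <= x -> Rabs v / 2 <= q x <= 2 /\ Rabs (q1 x) <= M).
  { intros x Hx. destruct (Hqn x Hx) as [H1 H2]. apply Rabs_le_between in H1.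
    pose proof (rho0_ge (x - X)). pose proof (rho0_lt1 (x - X)). pose proof (zs_le (x - X)).
    pose proof (Rabs_triang_inv (q1 x) (zs v (x - X))). unfold M. lra. }
  assert (Hr0 : forall y, T <= y -> 1 - h / 2 <= r0 y).
  { intros y Hy. pose proof (rho0_near1 y) as Hn. rewrite (Rabs_right y) in Hn by lra.
    specialize (Hr y ltac:(lra)). lra. }
  split. { destruct (Hnd T ltac:(lra)) as [H _]. specialize (Hr0 T ltac:(lra)). bound. } splits.
  split.
  { intros x Hx. destruct (Hqn x ltac:(lra)) as [H _]. specialize (Hr0 (x - X) ltac:(lra)). bound. }
  set (d := p X - q X). pose (c := fun x => fq v (p x) (q x) + 2 * e * V x).
  (* As [zu v 0 = - |v|] and [zu' v 0 = 0], the compared function and its derivative both start from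
     0. *)
  pose proof (second_order_gronwall (fun y => p (X + y) - q (X + y) + d * / Rabs v * zu v y) (fun y
    => p1 (X + y) - q1 (X + y) + d * / Rabs v * zu' v y) (fun y => c (X + y) * (p (X + y) - q (X +
    y)) + d * / Rabs v * (dfamp v (r0 y) * zu v y)) 0 T (Cf + 1) (Rabs d * (eta * Mz / Rabs v))
    ltac:(lra) ltac:(lra)) as G.
  assert (HdM' : 0 <= Rabs d * (eta * Mz / Rabs v)) by pos. specialize (G HdM').
  assert (Hfact : forall y, 0 <= y <= T -> Rabs (c (X + y)) <= Cf + 1 /\ Rabs (dfamp v (r0 y) - c (X
    + y)) <= eta).
  { intros y Hy. destruct (Hap (X + y)) as [_ [Hpr _]].
    destruct (Hqb (X + y) ltac:(lra)) as [Hqr _]. pose proof (rho0_ge y). pose proof (rho0_lt1 y).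
    destruct (Hfq (p (X + y)) (q (X + y)) (r0 y)) as [F1 F2]; try lra.
    assert (FV : Rabs (2 * e * V (X + y)) <= 2 * Rabs e * Kv).
    { apply Rabs_mult_le; [rewrite Rabs_mult, (Rabs_right 2); lra|now apply (decays_le)]. }
    split; unfold c.
    - mono.
    - replace (dfamp v (r0 y) - (fq v (p (X + y)) (q (X + y)) + 2 * e * V (X + y))) with (- (fq v (p
        (X + y)) (q (X + y)) - dfamp v (r0 y)) + - (2 * e * V (X + y))) by ring.
      triangle. rewrite !Rabs_Ropp. destruct (Hnd y Hy) as [N1 _].
      destruct (Hqn (X + y) ltac:(lra)) as [N2 _]. replace (X + y - X) with y in N2 by ring.
      assert (Cf * (Rabs (p (X + y) - r0 y) + Rabs (q (X + y) - r0 y)) <= Cf * (dl + dl)) by mono.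
      lra. }
  assert (HG : (p (X + T) - q (X + T) + d * / Rabs v * zu v T) ^ 2 + (p1 (X + T) - q1 (X + T) + d *
    / Rabs v * zu' v T) ^ 2 <= (Rabs d / 2) ^ 2).
  { eapply Rle_trans; [apply G|].
    - derive.
    - intros y Hy. apply (is_derive_plus (fun y => p1 (X + y) - q1 (X + y))).
      + destruct (Hap (X + y)) as [_ [Hpr _]]. destruct (Hqb (X + y) ltac:(lra)) as [Hqr _].
        unfold c. evar_last.
        { apply (is_derive_minus (fun y => p1 (X + y))).
          * apply (is_derive_shift p1). apply (gm_dd Hg).
          * apply (is_derive_shift q1). apply (ref_dd Hq). lra. }
        unfold minus, plus, opp; cbn.
        pose proof (famp_sub v (p (X + y)) (q (X + y)) ltac:(lra) ltac:(lra)). lra.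
      + derive.
    - intros y Hy. destruct (Hfact y Hy) as [F1 F2]. destruct (Hmodes y) as [_ [_ [Hz _]]].
      assert (Hz' : Rabs (zu v y) <= Mz). { eapply Rle_trans; [exact Hz|]. unfold Mz. mono. }
      replace (c (X + y) * (p (X + y) - q (X + y)) + d * / Rabs v * (dfamp v (r0 y) * zu v y)) with
        (c (X + y) * (p (X + y) - q (X + y) + d * / Rabs v * zu v y) + (d * / Rabs v) * ((dfamp v
        (r0 y) - c (X + y)) * zu v y)) by ring.
      triangle. apply Rplus_le_compat.
      + mono.
      + replace (Rabs d * (eta * Mz / Rabs v)) with (Rabs d * / Rabs v * (eta * Mz)) by lra. mono.
    - rewrite Rplus_0_r, zu_0, zu'_0, (ref_0 Hq), (proj1 HX). fold d.
      replace (d + d * / Rabs v * - Rabs v) with 0 by algebra.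
      replace ((2 + (Cf + 1)) * (T - 0)) with ((2 + (Cf + 1)) * T) by ring. fold Ex.
      replace (Rabs d / 2) with (Rabs d * (eta * Mz / Rabs v) * Ex) by (rewrite Rmult_assoc, Heta1;
        field).
      nra. }
  destruct (Hmodes T) as [_ [_ [Hz Hz']]]. rewrite (Rabs_right T) in Hz, Hz' by lra.
  fold Mz in Hz, Hz'. destruct (Hzu T ltac:(lra)) as [Hz1 Hz1']. apply Rabs_le_between in Hz.
  apply Rabs_le_between in Hz'.
  assert (Hv1 : 1 <= / Rabs v) by (rewrite <- Rinv_1; apply Rinv_le_contravar; lra).
  assert (key : forall D z, 1 <= z <= Mz -> Rabs (D + d * / Rabs v * z) <= Rabs d / 2 -> exists A, /
    2 <= A <= M /\ D = - (d * A)).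
  { intros D z Hzz HD. assert (Hzv : 1 <= / Rabs v * z <= Mz / Rabs v).
    { unfold Rdiv. split; [nra|]. rewrite Rmult_comm. mono. }
    destruct (Req_dec d 0) as [E0|E0].
    - exists (/ Rabs v * z). split; [unfold M; lra|]. rewrite E0 in HD |- *.
      rewrite !Rmult_0_l, Rplus_0_r, Rabs_R0 in HD. bound.
    - exists (- (D / d)). split; [|algebra]. assert (H : Rabs (D / d + / Rabs v * z) <= / 2).
      { replace (D / d + / Rabs v * z) with ((D + d * / Rabs v * z) / d) by algebra. unfold Rdiv.
        rewrite Rabs_mult, Rabs_inv. apply Rabs_pos_lt in E0.
        apply (Rmult_le_reg_r (Rabs d)); [easy|]. rewrite Rmult_assoc, Rinv_l by lra. lra. }
      apply Rabs_le_between in H. unfold M. lra. }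
  destruct (key (p (X + T) - q (X + T)) (zu v T)) as [A [HA1 HA2]]; [lra| |].
  { pose proof (pow2_ge_0 (p1 (X + T) - q1 (X + T) + d * / Rabs v * zu' v T)).
    pose proof (Rabs_pos d). apply sqr_abs_le; lra. }
  destruct (key (p1 (X + T) - q1 (X + T)) (zu' v T)) as [B [HB1 HB2]]; [lra| |].
  { pose proof (pow2_ge_0 (p (X + T) - q (X + T) + d * / Rabs v * zu v T)). pose proof (Rabs_pos d).
    apply sqr_abs_le; lra. }
  now exists A, B.
Qed.

Lemma refsol_le (e X d d' : R) (V q q1 : R -> R) : d <= d' ->
  refsol e X d V q q1 -> refsol e X d' V q q1.
Proof.
  intros Hd [H1 H2 H3 H4 H5]. split; try easy.
  - intros x Hx. eapply Rle_trans; [now apply H4|]. mono.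
  - intros x Hx. eapply Rle_trans; [now apply H5|]. mono.
Qed.

(** If [p X < q X], then by [dip_start] the difference [p - q] is positive with positive slope at
    [X + T]; from there it is convex as long as it is positive, hence unbounded, a contradiction.
    Otherwise [q - p] grows like [e^(2 k y)] up to constant factors as long as [p] stays near 1, by
    [linear_growth] and the length-independent bound of [near_one_integral]. Since [q - p] and its
    slope remain bounded, [p X - q X] is exponentially small in the length. *)
Lemma dip_ref (Tmin hmax : R) : 0 < hmax -> exists h T d0 e1 C, 0 < h /\ h <= hmax /\
  Tmin <= T /\ 0 < T /\ 0 < d0 /\ 0 < e1 /\ 0 < C /\
  forall e V p p1 X q q1,
  Rabs e <= e1 -> decays V -> gm v e V p p1 -> dip p p1 X -> refsol e X d0 V q q1 ->
  0 <= p X - q X /\ 1 - h <= p (X + T) /\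
  forall Y, X + T <= Y -> (forall x, X + T <= x <= Y -> 1 - h <= p x) ->
    p X - q X <= C * exp (- (2 * k) * (Y - X)) /\
    Rabs (p Y - q Y) <= C * (p X - q X) * exp (2 * k * (Y - X)).
Proof.
  intros Hhmax. destruct fq_bound as [Cf [HCf Hfq]]. pose proof vabs_bounds.
  pose proof kap_pos as Hk. destruct near_one_integral as [h0 [e1 [CI [Hh0 [He1 [HCI HI]]]]]].
  pose (h := Rmin (Rmin h0 hmax) (Rmin (k ^ 2 / (2 * Cf)) (/ 2))).
  assert (Hh : 0 < h /\ h <= h0 /\ h <= hmax /\ 2 * Cf * h <= k ^ 2 /\ h <= / 2) by bound.
  destruct Hh as [Hh [Hhh0 [Hhm [HhC Hh2]]]]. clearbody h.
  destruct (dip_start h Tmin Hh) as [T [d0 [e2 [M [HTm [HT [Hd0 [He2 [HM Hds]]]]]]]]].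
  destruct (apriori h Hh) as [e3 [He3 Hap]].
  pose (CZ := Cf * CI + 4 * Cf * (PI / (2 * k)) + (Cf + 1) * (PI / a)).
  pose (W := CZ / (2 * k) + 2 * k * T). pose (B0 := 4 / Rabs v + M + 4 * k).
  pose (C1 := 2 * B0 * exp W). pose (C2 := (1 + 2 * k) * M / (2 * k) * exp (CZ / (4 * k))).
  assert (HC1 : 0 < C1) by (unfold C1, B0; pos).
  assert (HC2 : 0 < C2) by (apply Rmult_lt_0_compat; pos). pose (dm := Rmin (Rmin d0 h) 1).
  assert (Hdm : 0 < dm /\ dm <= d0 /\ dm <= h /\ dm <= 1) by bound. clearbody dm.
  exists h, T, dm, (Rmin (Rmin e1 e2) (Rmin e3 (Rmin (/ (2 * Kv)) (k ^ 2 / (2 * Kv))))), (C1 + C2).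
  splits. intros e V p p1 X q q1 He HV Hg HX Hq.
  assert (Hee : Rabs e <= e1 /\ Rabs e <= e2 /\ Rabs e <= e3 /\ 2 * Rabs e * Kv <= 1 /\ 2 * Rabs e *
    Kv <= k ^ 2) by bound.
  destruct Hee as [He1' [He2' [He3' [HeV1 HeV2]]]].
  destruct (Hds e V p p1 X q q1 He2' HV Hg HX) as [HpT [Hqb [HqT [A [B [HA [HB [HDA HDB]]]]]]]].
  { now apply (refsol_le e X dm). }
  specialize (Hap e V p p1 He3' HV Hg). assert (Hq1 : forall x, X <= x -> q x <= 1 + h).
  { intros x Hx. destruct (ref_near_le e X dm V q q1 x) as [Hn _]; try easy; [lra|].
    pose proof (rho0_lt1 (x - X)). bound. }
  pose (c := fun x => fq v (p x) (q x) + 2 * e * V x).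
  assert (HVx : forall x, Rabs (2 * e * V x) <= 2 * Rabs e * Kv * exp (- a * Rabs x)).
  { intros x. rewrite (Rmult_assoc (2 * Rabs e)). mono. }
  assert (Hexp : forall x, 0 < exp (- a * Rabs x) <= 1).
  { intros x. splits. apply exp_ge0_1. assert (0 <= a * Rabs x) by pos. lra. }
  assert (Hcpos : forall x, X <= x -> 1 - h <= p x -> 1 - h <= q x -> 0 <= c x).
  { intros x Hx Hp Hqx. specialize (Hq1 x Hx). specialize (HVx x). destruct (Hap x) as [Hr1 _].
    destruct (Hexp x). destruct (Hfq (p x) (q x) 1) as [_ F]; try lra. rewrite dfamp_1 in F.
    assert (Cf * (Rabs (p x - 1) + Rabs (q x - 1)) <= k ^ 2).
    { apply Rle_trans with (Cf * (h + h)); [mono|lra]. }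
    assert (2 * Rabs e * Kv * exp (- a * Rabs x) <= k ^ 2 * 1) by mono. unfold c. bound. }
  set (d := p X - q X) in *.
  assert (HD2 : forall x, X <= x -> famp v (p x) + 2 * e * V x * p x - (famp v (q x) + 2 * e * V x *
    q x) = c x * (p x - q x)).
  { intros x Hx. destruct (Hap x) as [_ [Hr2 _]]. destruct (Hqb x Hx) as [Hr3 _].
    pose proof (famp_sub v (p x) (q x) ltac:(lra) ltac:(lra)). unfold c. lra. }
  assert (Hqd : forall x, X <= x -> is_derive q x (q1 x)) by derive.
  assert (Hqdd : forall x, X <= x -> is_derive q1 x (famp v (q x) + 2 * e * V x * q x)).
  { intros; apply (ref_dd Hq); lra. }
  pose proof (gm_d Hg) as Hpd. assert (Hd : 0 <= d).
  { destruct (Rle_dec 0 d) as [|Hn]; [easy|exfalso].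
    apply (convex_unbounded (fun x => p x - q x) (fun x => p1 x - q1 x) (fun x => c x * (p x - q x))
      (X + T) 2); [derive| |nra|nra| |].
    - intros x Hx. rewrite <- HD2 by lra. derive.
    - intros x Hx HF. apply Rmult_le_pos; [|lra]. specialize (HqT x Hx). apply Hcpos; lra.
    - intros x Hx. destruct (Hap x) as [_ [Hr2 _]]. destruct (Hqb x) as [Hr3 _]; lra. }
  splits. intros Y HY HpY.
  assert (HuD : forall x, X <= x -> is_derive (fun x => q x - p x) x (q1 x - p1 x)) by derive.
  assert (HuD1 : forall x, X <= x -> is_derive (fun x => q1 x - p1 x) x (c x * (q x - p x))).
  { intros x Hx. replace (c x * (q x - p x)) with (- (c x * (p x - q x))) by ring.
    rewrite <- HD2 by lra. derive. }
  (* A primitive of a bound on [|c - (2 k)^2|], with contributions from [p - 1], from the soliton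
     tail in [q - 1], and from the potential together with the correction in [q]. It increases by at
     most [CZ] on [[X + T, Y]]. *)
  pose (Z := fun x => Cf * RInt (fun x => Rabs (p x - 1)) (X + T) x + 4 * Cf * bump_int (2 * k) X x
    + (Cf + 1) * bump_int a 0 x).
  pose (Z' := fun x => Cf * Rabs (p x - 1) + 4 * Cf * bump (2 * k) X x + (Cf + 1) * bump a 0 x).
  assert (HZd : forall x, is_derive Z x (Z' x)).
  { intros x. unfold Z, Z'.
    assert (is_derive (fun y => RInt (fun x => Rabs (p x - 1)) (X + T) y) x (Rabs (p x - 1))).
    { apply (is_derive_RInt_cont (fun x => Rabs (p x - 1))). solve_cont. }
    pose proof (is_derive_bump_int (2 * k) X x ltac:(lra)).
    pose proof (is_derive_bump_int a 0 x Ha). derive. }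
  assert (HZ : Z Y - Z (X + T) <= CZ).
  { unfold Z. rewrite RInt_point. change zero with 0.
    assert (RInt (fun x => Rabs (p x - 1)) (X + T) Y <= CI).
    { apply (HI e V p p1); try easy. intros x Hx. specialize (HpY x Hx). lra. }
    pose proof (bump_int_bounds (2 * k) X Y ltac:(lra)).
    pose proof (bump_int_bounds (2 * k) X (X + T) ltac:(lra)).
    pose proof (bump_int_bounds a 0 Y Ha). pose proof (bump_int_bounds a 0 (X + T) Ha).
    assert (Cf * RInt (fun x => Rabs (p x - 1)) (X + T) Y <= Cf * CI) by mono.
    assert (4 * Cf * (bump_int (2 * k) X Y - bump_int (2 * k) X (X + T)) <= 4 * Cf * (PI / (2 * k)))
      by mono.
    assert ((Cf + 1) * (bump_int a 0 Y - bump_int a 0 (X + T)) <= (Cf + 1) * (PI / a)) by mono.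
    unfold CZ. lra. }
  assert (Hzeta : forall x, X + T <= x <= Y -> Rabs (c x - (2 * k) ^ 2) <= Z' x).
  { intros x Hx. destruct (Hap x) as [_ [Hr2 _]]. destruct (Hqb x ltac:(lra)) as [Hr3 _].
    destruct (Hfq (p x) (q x) 1) as [_ F]; try lra. rewrite dfamp_1 in F. specialize (HVx x).
    pose proof (bump_ge a 0 x Ha) as Hb. rewrite Rminus_0_r in Hb.
    assert (Rabs (q x - 1) <= 4 * bump (2 * k) X x + bump a 0 x).
    { pose proof (ref_near Hq x ltac:(lra)). pose proof (rho0_near1 (x - X)).
      pose proof (bump_ge (2 * k) X x ltac:(lra)).
      assert (dm * exp (- a * Rabs x) <= 1 * exp (- a * Rabs x)) by mono. bound. }
    assert (2 * Rabs e * Kv * exp (- a * Rabs x) <= 1 * exp (- a * Rabs x)) by mono.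
    assert (Cf * (Rabs (p x - 1) + Rabs (q x - 1)) <= Cf * (Rabs (p x - 1) + (4 * bump (2 * k) X x +
      bump a 0 x))) by mono.
    unfold c, Z'. bound. }
  destruct (linear_growth (fun x => q x - p x) (fun x => q1 x - p1 x) c Z Z' (2 * k) (X + T) Y) as
    [G1 G2]; [lra|easy|derive|intros; apply HuD1; lra|easy|easy|].
  replace (q (X + T) - p (X + T)) with (d * A) in G1, G2 by lra.
  replace (q1 (X + T) - p1 (X + T)) with (d * B) in G1, G2 by lra.
  assert (HZ2 : (Z Y - Z (X + T)) / (2 * k) <= CZ / (2 * k)) by (unfold Rdiv; mono). split.
  - destruct (Req_dec d 0) as [E0|E0]. { rewrite E0. pos. } assert (0 < d * A) by pos.
    assert (0 < d * B) by pos.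
    specialize (G2 ltac:( intros x Hx; destruct (convex_escape (fun x => q x - p x) (fun x => q1 x -
      p1 x) (fun x => c x * (q x - p x)) (X + T) Y) with (x := x) as [Hc1 Hc2]; [intros; apply HuD;
      lra|intros; apply HuD1; lra|lra|lra |intros y Hy HFy; apply Rmult_le_pos; [apply Hcpos;
      [lra|now apply HpY|apply HqT; lra]|lra] |easy|assert (0 <= (q1 (X + T) - p1 (X + T)) * (x - (X
      + T))) by pos; lra])).
    assert (Hup : (q1 Y - p1 Y) + 2 * k * (q Y - p Y) <= B0).
    { destruct (Hap Y) as [_ [Hr2 [Hr4 _]]]. destruct (Hqb Y ltac:(lra)) as [Hr3 Hr5].
      assert (2 * k * (q Y - p Y) <= 2 * k * 2) by mono. unfold B0.
      apply Rabs_le_between in Hr4, Hr5. lra. }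
    set (E := exp (2 * k * (Y - X) - W)). set (F := exp W * exp (- (2 * k) * (Y - X))).
    assert (HF : 0 < F) by (unfold F; pos). assert (HEF : E * F = 1).
    { unfold E, F. rewrite <- !exp_plus, <- exp_0. f_equal. ring. }
    assert (d / 2 * E <= B0).
    { eapply Rle_trans; [|exact Hup]. eapply Rle_trans; [|exact G2].
      apply Rmult_le_compat; [lra|left; apply exp_pos| |apply exp_le; unfold W; lra].
      assert (0 <= 2 * k * (d * A)) by pos. assert (d * / 2 <= d * B) by mono. lra. }
    assert (d / 2 * E * F <= B0 * F) by mono.
    replace (d / 2 * E * F) with (d / 2) in * by (rewrite Rmult_assoc, HEF; ring).
    apply Rle_trans with (C1 * exp (- (2 * k) * (Y - X))); [|mono].
    replace (C1 * exp (- (2 * k) * (Y - X))) with (2 * (B0 * F)) by (unfold C1, F; ring). lra.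
  - assert (HS : Rabs (2 * k * (q Y - p Y)) <= 2 * k * (C2 * d * exp (2 * k * (Y - X)))).
    { apply sqr_abs_le; [pos|]. eapply Rle_trans; [exact G1|].
      replace (2 * k * (C2 * d * exp (2 * k * (Y - X)))) with (d * M * (1 + 2 * k) * exp (CZ / (4 *
        k) + 2 * k * (Y - X))) by (unfold C2; rewrite exp_plus; field; lra).
      rewrite (Rpow_mult_distr (d * M * (1 + 2 * k))). apply Rmult_le_compat; [|pos| |].
      - nra.
      - assert ((d * B) ^ 2 <= (d * M) ^ 2) by mono. assert (0 <= d * M * (2 * k * (d * M))) by pos.
        assert ((2 * k * (d * A)) ^ 2 <= (2 * k * (d * M)) ^ 2) by mono. lra.
      - replace (exp (CZ / (4 * k) + 2 * k * (Y - X)) ^ 2) with (exp (CZ / (2 * k) + 4 * k * (Y -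
          X))).
        + apply exp_le. nra.
        + rewrite <- Rsqr_pow2. unfold Rsqr. rewrite <- exp_plus. f_equal. field. lra. }
    rewrite Rabs_mult, (Rabs_right (2 * k)) in HS by lra. apply Rmult_le_reg_l in HS; [|lra].
    rewrite Rabs_minus_sym. eapply Rle_trans; [exact HS|]. mono.
Qed.

Lemma dip_opp (p p1 : R -> R) (X : R) :
  dip p p1 X -> dip (fun x => p (- x)) (fun x => - p1 (- x)) (- X).
Proof. intros [H1 H2]. split; rewrite Ropp_involutive; [lra|easy]. Qed.

Arguments dip_opp {p p1 X}.

Lemma dip_opp_inv (p p1 : R -> R) (X : R) :
  dip (fun x => p (- x)) (fun x => - p1 (- x)) X -> dip p p1 (- X).
Proof. intros [H1 H2]. split; lra. Qed.

(** After a dip the amplitude follows [rho0]: up to [y0] it is strictly convex, because [rho0''] is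
    positive near 0, and on [[y0, L]] its slope stays close to [rho0' > 0]. Neither allows the slope
    to vanish again. *)
Lemma dip_spacing (L : R) : 0 < L -> exists e1, 0 < e1 /\ forall e V p p1,
  Rabs e <= e1 -> decays V -> gm v e V p p1 -> forall X X', dip p p1 X -> dip p p1 X' ->
  X < X' -> L < X' - X.
Proof.
  intros HL. destruct fq_bound as [Cf [HCf Hfq]]. pose proof vabs_bounds. pose (c := famp v (r0 0)).
  assert (0 < c) by apply famp_rho0_0.
  assert (Hnear : exists y0, 0 < y0 /\ forall y, 0 <= y <= y0 -> c / 2 < famp v (r0 y)).
  { assert (Hct : continuity_pt (fun y => famp v (r0 y)) 0).
    { eapply is_derive_continuity_pt. apply (is_derive_famp r0 0 (zs v 0)).
      - pose proof (rho0_pos 0). lra.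
      - derive. }
    destruct (Hct (c / 2)) as [y0 [Hy0 Hy]]; [lra|]. exists (y0 / 2). splits. intros y Hyy.
    destruct (Req_dec y 0) as [->|Hn]; [fold c; lra|]. assert (Rabs (famp v (r0 y) - c) < c / 2).
    { apply (Hy y). split; [split; [exact I|lra]|]. unfold dist; cbn. unfold R_dist. bound. }
    bound. }
  destruct Hnear as [y0 [Hy0 Hnear]].
  assert (Hmin : exists m, 0 < m /\ forall y, y0 <= y <= L -> m <= zs v y).
  { destruct (Rle_dec y0 L) as [Hyl|Hyl].
    - destruct (continuity_ab_min (zs v) y0 L Hyl) as [z [Hz1 Hz2]].
      { intros y _. eapply is_derive_continuity_pt, is_derive_zs. }
      exists (zs v z). split; [apply zs_pos; lra|easy].
    - exists 1; bound. }
  destruct Hmin as [m [Hm Hmin]]. pose (dl := Rmin (c / (8 * Cf)) (m / 2)).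
  assert (Hdl : 0 < dl /\ Cf * dl <= c / 8 /\ dl <= m / 2) by bound.
  destruct Hdl as [Hdl [Hdl1 Hdl2]]. destruct (near_dip L dl ltac:(lra) Hdl) as [e1 [He1 Hnd]].
  destruct (apriori 1 Rlt_0_1) as [e2 [He2 Hap]]. exists (Rmin (Rmin e1 e2) (c / (32 * Kv))).
  splits. intros e V p p1 He HV Hg X X' HX HX' Hlt.
  assert (He' : Rabs e <= e1 /\ Rabs e <= e2 /\ Rabs e <= c / (32 * Kv)).
  { pose proof (Rmin_l (Rmin e1 e2) (c / (32 * Kv))).
    pose proof (Rmin_r (Rmin e1 e2) (c / (32 * Kv))). pose proof (Rmin_l e1 e2).
    pose proof (Rmin_r e1 e2). lra. }
  destruct He' as [He1' [He2' He3]]. destruct (Rlt_dec L (X' - X)) as [|Hn]; [easy|exfalso].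
  specialize (Hnd e V p p1 He1' HV Hg X HX). specialize (Hap e V p p1 He2' HV Hg).
  pose (y := X' - X). assert (HXy : X' = X + y) by (unfold y; ring).
  destruct (Rle_dec y0 y) as [Hy|Hy].
  - specialize (Hmin y ltac:(unfold y in *; lra)).
    destruct (Hnd y ltac:(unfold y in *; lra)) as [_ Hp]. rewrite <- HXy, (proj1 HX') in Hp. bound.
  - destruct (mvt p1 (fun x => famp v (p x) + 2 * e * V x * p x) X X') as [z [Hz E]]; [lra| |].
    { solve_cont. }
    rewrite (proj1 HX), (proj1 HX') in E. assert (0 < famp v (p z) + 2 * e * V z * p z); [|nra].
    pose (yz := z - X). assert (Hzy : z = X + yz) by (unfold yz; ring).
    assert (Hyz : 0 <= yz <= y0) by lra. destruct (Hnd yz ltac:(unfold yz, y in *; lra)) as [Hp _].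
    rewrite <- Hzy in Hp. specialize (Hnear yz Hyz). destruct (Hap z) as [_ [Hpr _]].
    pose proof (rho0_ge yz). pose proof (rho0_lt1 yz).
    pose proof (famp_sub v (p z) (r0 yz) ltac:(lra) ltac:(lra)) as Hs.
    destruct (Hfq (p z) (r0 yz) (r0 yz)) as [F _]; try lra.
    assert (Rabs (famp v (p z) - famp v (r0 yz)) <= Cf * dl). { rewrite Hs. mono. }
    assert (Rabs (2 * e * V z * p z) <= 2 * Rabs e * Kv * 2).
    { apply Rabs_mult_le; [|mono].
      apply Rabs_mult_le; [rewrite Rabs_mult, (Rabs_right 2); lra|now apply (decays_le)]. }
    bound.
Qed.

(** The dip at [X] is moved to 0, so [href_spec] is applied with the potential centred at
    [Z = - X]. *)
Lemma reference_exists : exists e0 Cb, 0 < e0 /\ 0 < Cb /\ forall e V, Rabs e <= e0 ->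
  cont V -> decays V -> forall X, exists q q1, refsol e X (Cb * Rabs e) V q q1 /\ q X = mR V e X.
Proof.
  destruct (href_spec a N Ha HN HaN Kv ltac:(lra)) as [e0 [Cb [He0 [HCb H]]]]. exists e0, Cb.
  splits. intros e V He HcV HV X.
  destruct (H (- X) (fun y => V (X + y))) with (e := e) as [H1 [H2 [H3 _]]]; try easy.
  { solve_cont. }
  { intros y _. replace (y - - X) with (X + y) by ring. apply HV. }
  exists (fun x => href (fun y => V (X + y)) e (- X + x)), (fun x => href1 (fun y => V (X + y)) e (-
    X + x)).
  split; [split|].
  - intros x Hx. apply is_derive_shift. apply H1. lra.
  - intros x Hx. apply is_derive_shift. destruct (H1 (- X + x)) as [_ H1']; [lra|].
    replace (X + (- X + x)) with x in H1' by ring. exact H1'.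
  - now replace (- X + X) with 0 by ring.
  - intros x Hx. destruct (H3 (- X + x)) as [H3' _]; [lra|].
    replace (- X + x - - X) with x in H3' by ring. now replace (x - X) with (- X + x) by ring.
  - intros x Hx. destruct (H3 (- X + x)) as [_ H3']; [lra|].
    replace (- X + x - - X) with x in H3' by ring. now replace (x - X) with (- X + x) by ring.
  - now replace (- X + X) with 0 by ring.
Qed.

(** The upper bounds and the sign come from [dip_ref]. For the lower bound, at [Y = X' - T] the
    amplitude already has nearly the depth of the soliton at distance [T] from its bottom, whereas
    the reference is near 1. Their distance there is of order one, and it cannot have grown from
    less than a multiple of [e^(- 2 k (X' - X))]. *)
Lemma dip_interaction : exists h T e1 C g, 0 < h /\ 0 < T /\ 0 < e1 /\ 0 < C /\ 0 < g /\
  forall e V p p1, Rabs e <= e1 -> cont V -> decays V -> gm v e V p p1 -> forall X, dip p p1 X ->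
  mR V e X <= p X /\
  ((forall x, X < x -> ~ dip p p1 x) -> p X <= mR V e X) /\
  (forall Y, X + T <= Y -> (forall x, X < x < Y -> ~ dip p p1 x) -> 1 - h <= p Y ->
     p X - mR V e X <= C * exp (- (2 * k) * (Y - X))) /\
  (forall X', dip p p1 X' -> X < X' -> (forall x, X < x < X' -> ~ dip p p1 x) ->
     g * exp (- (2 * k) * (X' - X)) <= p X - mR V e X <= C * exp (- (2 * k) * (X' - X))).
Proof.
  pose proof kap_pos as Hk. pose proof vabs_bounds as Hv.
  destruct (dip_ref 0 ((1 - Rabs v) / 2) ltac:(lra)) as [h [T [d0 [e1 [C [Hh [Hhm [_ [HT [Hd0 [He1
    [HC Href]]]]]]]]]]]].
  destruct (dip_between h Hh) as [e2 [He2 Hbet]]. destruct (dip_after h Hh) as [e3 [He3 Haft]].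
  pose (z := 1 - r0 T). assert (Hz : 0 < z) by (unfold z; pose proof (rho0_lt1 T); lra).
  destruct (exp_small (2 * k) (z / 16)) as [T2 [HT2 Hexp]]; [lra|lra|]. pose (L := 2 * T + T2).
  assert (HL : 0 < L) by (unfold L; lra). destruct (dip_spacing L HL) as [e4 [He4 Hsp]].
  destruct reference_exists as [e5 [Cb [He5 [HCb Hrex]]]].
  destruct (near_dip T (z / 4) ltac:(lra) ltac:(lra)) as [e6 [He6 Hnd]].
  pose (dm := Rmin d0 (z / 4)). assert (Hdm : 0 < dm) by bound. pose (E := exp (2 * k * T)).
  assert (HE : 1 <= E). { unfold E. rewrite <- exp_0. mono. } pose (g := z / 4 * / C).
  assert (Hg0 : 0 < g) by (apply Rmult_lt_0_compat; [lra|pos]).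
  exists h, T, (Rmin (Rmin (Rmin e1 e2) (Rmin e3 e4)) (Rmin (Rmin e5 e6) (dm / Cb))), (C * E), g.
  splits. intros e V p p1 He HcV HV Hg X HX.
  assert (Hee : (Rabs e <= e1 /\ Rabs e <= e2 /\ Rabs e <= e3 /\ Rabs e <= e4) /\ Rabs e <= e5 /\
    Rabs e <= e6 /\ Rabs e <= dm / Cb).
  { pose proof (Rmin_l (Rmin (Rmin e1 e2) (Rmin e3 e4)) (Rmin (Rmin e5 e6) (dm / Cb))).
    pose proof (Rmin_r (Rmin (Rmin e1 e2) (Rmin e3 e4)) (Rmin (Rmin e5 e6) (dm / Cb))).
    pose proof (Rmin_l (Rmin e1 e2) (Rmin e3 e4)). pose proof (Rmin_r (Rmin e1 e2) (Rmin e3 e4)).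
    pose proof (Rmin_l e1 e2). pose proof (Rmin_r e1 e2). pose proof (Rmin_l e3 e4).
    pose proof (Rmin_r e3 e4). pose proof (Rmin_l (Rmin e5 e6) (dm / Cb)).
    pose proof (Rmin_r (Rmin e5 e6) (dm / Cb)). pose proof (Rmin_l e5 e6).
    pose proof (Rmin_r e5 e6). lra. }
  destruct Hee as [[E1 [E2 [E3 E4]]] [E5 [E6 E7]]]. assert (E7' : Cb * Rabs e <= dm) by bound.
  destruct (Hrex e V E5 HcV HV X) as [q [q1 [Hq HqX]]]. apply (refsol_le e X _ dm _ _ _ E7') in Hq.
  assert (Hq0 : refsol e X d0 V q q1) by (apply (refsol_le e X dm); [bound|easy]).
  destruct (Href e V p p1 X q q1 E1 HV Hg HX Hq0) as [H1 [H2 H3]]. rewrite HqX in *.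
  set (d := p X - mR V e X) in *.
  assert (Hfar : forall Y, X + T <= Y -> (forall x, X < x < Y -> ~ dip p p1 x) -> 1 - h <= p Y ->
    forall x, X + T <= x <= Y -> 1 - h <= p x).
  { intros Y HY Hno HpY x Hx. destruct (Rle_dec (1 - h) (p x)) as [|Hn]; [easy|exfalso].
    assert (X + T < x < Y).
    { split; [destruct (Req_dec x (X + T)) as [->|]; lra|destruct (Req_dec x Y) as [->|]; lra]. }
    destruct (Hbet e V p p1 E2 HV Hg (X + T) Y x) as [c [Hc1 Hc2]]; try lra.
    apply (Hno c); [lra|easy]. }
  split; [unfold d in H1; lra|]. split; [|split].
  - intros Hno. destruct (Rle_dec d 0) as [|Hn]; [unfold d in *; lra|exfalso].
    destruct (exp_small (2 * k) (d / (2 * C))) as [T3 [HT3 Hexp3]]; [lra|apply Rdiv_lt_0_compat;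
      lra|].
    pose (Y := X + T + T3). destruct (H3 Y) as [H4 _]; [unfold Y; lra| |].
    { intros x Hx. destruct (Rle_dec (1 - h) (p x)) as [|Hn']; [easy|exfalso].
      destruct (Req_dec x (X + T)) as [->|Hne]; [lra|].
      destruct (Haft e V p p1 E3 HV Hg (X + T) x) as [c [Hc1 Hc2]]; try lra.
      apply (Hno c); [lra|easy]. }
    specialize (Hexp3 (Y - X) ltac:(unfold Y; lra)). bound.
  - intros Y HY Hno HpY. destruct (H3 Y HY) as [H4 _]; [now apply Hfar|]. nra.
  - intros X' HX' Hlt Hno. pose proof (Hsp e V p p1 E4 HV Hg X X' HX HX' Hlt). pose (Y := X' - T).
    assert (HY : X + T <= Y) by (unfold Y, L in *; lra).
    destruct (Hrex e (fun x => V (- x)) E5) with (X := - X') as [q' [q1' [Hq' _]]]. { solve_cont. }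
    { now apply decays_opp. }
    apply (refsol_le e (- X') _ d0) in Hq'; [|eapply Rle_trans; [exact E7'|bound]].
    pose proof (gm_opp Hg) as Hg'.
    destruct (Href e _ _ _ (- X') q' q1' E1 (decays_opp V HV) Hg' (dip_opp HX') Hq') as [_ [HpY _]].
    replace (- (- X' + T)) with Y in HpY by (unfold Y; ring).
    assert (forall x, X < x < Y -> ~ dip p p1 x) by (intros x Hx; apply Hno; unfold Y in *; lra).
    destruct (H3 Y HY) as [H4 H5]; [now apply Hfar|].
    assert (HeY : exp (- (2 * k) * (Y - X)) = E * exp (- (2 * k) * (X' - X))).
    { unfold E. rewrite <- exp_plus. f_equal. unfold Y. ring. }
    split.
    + destruct (Hnd e _ _ _ E6 (decays_opp V HV) Hg' (- X') (dip_opp HX') T ltac:(lra)) as [Hn _].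
      replace (- (- X' + T)) with Y in Hn by (unfold Y; ring).
      destruct (ref_near_le e X dm V q q1 Y) as [Hn2 _]; [lra|easy|lra|].
      pose proof (rho0_near1 (Y - X)) as Hr1. rewrite (Rabs_right (Y - X)) in Hr1 by lra.
      specialize (Hexp (Y - X) ltac:(unfold Y, L in *; lra)).
      assert (Hqp : z / 4 <= Rabs (p Y - q Y)). { unfold z in *. bound. }
      assert (z / 4 <= C * d * exp (2 * k * (X' - X))).
      { eapply Rle_trans; [exact Hqp|]. eapply Rle_trans; [exact H5|]. unfold Y. bound. }
      unfold g. replace (- (2 * k) * (X' - X)) with (- (2 * k * (X' - X))) by ring.
      rewrite exp_Ropp. pose proof (exp_pos (2 * k * (X' - X))).
      apply (Rmult_le_reg_r (C * exp (2 * k * (X' - X)))); [pos|].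
      replace (z / 4 * / C * / exp (2 * k * (X' - X)) * (C * exp (2 * k * (X' - X)))) with (z / 4)
        by algebra.
      lra.
    + rewrite HeY in H4. lra.
Qed.

Lemma sumn_minus (n : nat) (f g : nat -> R) : sumn n (fun i => f i - g i) = sumn n f - sumn n g.
Proof. induction n as [|n IH]; cbn; [ring|]. lra. Qed.

Lemma gap_gpol : exists e0 C, 0 < e0 /\ 0 < C /\ forall e V, Rabs e <= e0 -> cont V -> decays V ->
  forall X, Rabs (gap V e X - gpol V N e X) <= C * Rabs e * exp (- (2 * k) * Rabs X).
Proof.
  destruct (href_spec a N Ha HN HaN Kv ltac:(lra)) as [e0 [Cb [He0 [HCb H]]]]. exists e0, (2 * Cb).
  splits. intros e V He HcV HV X.
  assert (key : forall W, cont W -> decays W -> forall Y, Rabs (mR W e Y - sumn N (fun n => hcoef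
    (fun y => W (Y + y)) n 0 * e ^ n)) <= Cb * Rabs e * exp (- (2 * k) * Rabs Y)).
  { intros W HcW HW Y.
    destruct (H (- Y) (fun y => W (Y + y))) with (e := e) as [_ [_ [_ H4]]]; try easy.
    - solve_cont.
    - intros y _. replace (y - - Y) with (Y + y) by ring. apply HW.
    - rewrite Rabs_Ropp in H4. exact H4. }
  pose proof (key V HcV HV X).
  pose proof (key (fun x => V (- x)) (cont_opp_arg V HcV) (decays_opp V HV) (- X)) as K2.
  rewrite Rabs_Ropp in K2.
  assert (gpol V N e X = sumn N (fun n => hcoef (fun y => V (X + y)) n 0 * e ^ n) - sumn N (fun n =>
    hcoef (fun y => V (- (- X + y))) n 0 * e ^ n)).
  { unfold gpol, gcoef. rewrite <- sumn_minus. apply sumn_ext. bound. } unfold gap. bound.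
Qed.

Lemma gcoef_0 (V : R -> R) (X : R) : gcoef V 0 X = 0.
Proof. unfold gcoef, hcoef. eauto with real. Qed.

Lemma dip_isolated_compl (e : R) (V p p1 : R -> R) (m : R) : gm v e V p p1 -> ~ dip p p1 m ->
  exists d, 0 < d /\ forall x, Rabs (x - m) < d -> ~ dip p p1 x.
Proof.
  intros Hg Hm. assert (C1 : continuity_pt p m) by (eapply is_derive_continuity_pt, (gm_d Hg)).
  assert (C2 : continuity_pt p1 m) by (eapply is_derive_continuity_pt, (gm_dd Hg)).
  assert (near : forall f d, continuity_pt f m -> 0 < d -> exists d', 0 < d' /\ forall x, Rabs (x -
    m) < d' -> Rabs (f x - f m) < d).
  { intros f d Hf Hd. destruct (Hf d Hd) as [d' [Hd' H]]. exists d'. splits. intros x Hx.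
    destruct (Req_dec x m) as [->|Hn]; [rewrite Rminus_diag, Rabs_R0; lra|]. solve_cont. }
  destruct (Req_dec (p1 m) 0) as [E|E].
  - assert (Hp : (1 + Rabs v) / 2 < p m).
    { destruct (Rlt_dec ((1 + Rabs v) / 2) (p m)) as [|Hn]; [easy|]. exfalso. apply Hm. split; lra. }
    destruct (near p (p m - (1 + Rabs v) / 2) C1 ltac:(lra)) as [d [Hd H]]. exists d. splits.
    intros x Hx [_ Hx2]. specialize (H x Hx). bound.
  - destruct (near p1 (Rabs (p1 m)) C2 ltac:(now apply Rabs_pos_lt)) as [d [Hd H]]. exists d.
    splits. intros x Hx [Hx1 _]. specialize (H x Hx). rewrite Hx1 in H. unfold Rminus in H.
    rewrite Rplus_0_l, Rabs_Ropp in H. lra.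
Qed.

Lemma first_dip (e : R) (V p p1 : R -> R) (Y c : R) : gm v e V p p1 -> Y <= c -> dip p p1 c ->
  exists X, Y <= X <= c /\ dip p p1 X /\ forall x, Y <= x < X -> ~ dip p p1 x.
Proof.
  intros Hg HYc Hc. destruct (classic (dip p p1 Y)) as [HY|HY]. { exists Y. intuition lra. }
  pose (S := fun x => Y <= x /\ forall y, Y <= y <= x -> ~ dip p p1 y).
  assert (HSc : forall x, S x -> x <= c).
  { intros x [Hx1 Hx2]. destruct (Rle_dec x c) as [|Hn]; [easy|]. exfalso.
    apply (Hx2 c); [lra|easy]. }
  destruct (completeness S) as [m [Hm1 Hm2]].
  - exists c. easy.
  - exists Y. splits. intros y Hy. now replace y with Y by lra.
  - assert (HYm : Y <= m). { apply Hm1. splits. intros y Hy. now replace y with Y by lra. }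
    assert (Hno : forall x, Y <= x < m -> ~ dip p p1 x).
    { intros x Hx Hd. assert (m <= x); [|lra]. apply Hm2. intros y [Hy1 Hy2].
      destruct (Rle_dec y x) as [|Hn]; [easy|]. exfalso. apply (Hy2 x); [lra|easy]. }
    assert (Hmc : m <= c) by auto.
    destruct (classic (dip p p1 m)) as [Hdm|Hdm]; [now exists m|exfalso].
    destruct (dip_isolated_compl e V p p1 m Hg Hdm) as [d [Hd H]]. assert (m + d / 2 <= m); [|lra].
    apply Hm1. splits. intros y Hy. destruct (Rlt_dec y m) as [|Hn]; [apply Hno; lra|]. apply H.
    bound.
Qed.

Lemma dips_bounded (e : R) (V p p1 : R -> R) : gm v e V p p1 -> exists M, forall x, M < x -> ~ dip p p1 x.
Proof.
  intros Hg. pose proof vabs_bounds.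
  destruct (eventually_lt p 1 ((1 - Rabs v) / 2) (gm_pinf Hg)) as [M HM]; [lra|]. exists M.
  intros x Hx [_ Hd]. specialize (HM x Hx). bound.
Qed.

(* If the splitting [gap] between the two one-sided references is at most of the order of the
   interaction of a dip at [X] with a dip near the origin, then a dip next to the one near the
   origin forces infinitely many further dips. *)
Lemma no_escape (Ct : R) : 0 < Ct -> exists e1, 0 < e1 /\ forall V, cont V -> decays V ->
  forall e XA, Rabs e <= e1 ->
  (forall X, XA <= X -> gap V e X <= Ct * Rabs e * exp (- (2 * k) * X)) ->
  forall p p1, gm v e V p p1 -> forall X0 X1, -1 <= X0 <= 1 -> dip p p1 X0 -> dip p p1 X1 ->
  X0 < X1 -> (forall x, X0 < x < X1 -> ~ dip p p1 x) -> X1 < XA.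
Proof.
  intros HCt. pose proof kap_pos.
  destruct (dip_interaction) as [h [T [e1 [C [g [Hh [HT [He1 [HC [Hg0 Hint]]]]]]]]]].
  destruct (exp_small (2 * k) (g / (2 * C))) as [L [HL HexpL]]; [lra|apply Rdiv_lt_0_compat; lra|].
  (* The factor [e^(- 2 k)] accounts for [X0 >= - 1]; half of the interaction is reserved for the
     gap. *)
  destruct (dip_spacing L HL) as [e2 [He2 Hsp]]. pose (c0 := g * exp (- (2 * k)) / 2).
  assert (0 < c0). { unfold c0. pos. } exists (Rmin (Rmin e1 e2) (c0 / Ct)). split. { pos. }
  intros V HcV HV e XA He Hgap p p1 Hg X0 X1 HX0 HdX0 HdX1 Hlt Hno.
  assert (Hee : Rabs e <= e1 /\ Rabs e <= e2 /\ Rabs e <= c0 / Ct).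
  { pose proof (Rmin_l (Rmin e1 e2) (c0 / Ct)). pose proof (Rmin_r (Rmin e1 e2) (c0 / Ct)).
    pose proof (Rmin_l e1 e2). pose proof (Rmin_r e1 e2). lra. }
  destruct Hee as [E1 [E2 E3]]. destruct (Rlt_dec X1 XA) as [|HXA]; [easy|exfalso].
  apply Rnot_lt_le in HXA. pose proof (gm_opp Hg) as Hg'.
  (* The reflected [dip_interaction] bounds the excess of [p X'] over the left reference from below;
     the gap converts it into an excess over the right one. *)
  assert (Hprev : forall X X', dip p p1 X -> dip p p1 X' -> X < X' -> (forall x, X < x < X' -> ~ dip
    p p1 x) -> XA <= X' -> g * exp (- (2 * k) * (X' - X)) - c0 * exp (- (2 * k) * X') <= p X' - mR V
    e X').
  { intros X X' HX HX' HXX Hn HXA'.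
    destruct (Hint e _ _ _ E1 (cont_opp_arg V HcV) (decays_opp V HV) Hg' (- X') (dip_opp HX')) as [_
      [_ [_ H4]]].
    destruct (H4 (- X) (dip_opp HX)) as [H5 _]; [lra| |].
    { intros x Hx Hd. apply (Hn (- x)); [lra|]. now apply dip_opp_inv. }
    rewrite Ropp_involutive in H5. replace (- X - - X') with (X' - X) in H5 by ring.
    specialize (Hgap X' HXA'). unfold gap in Hgap.
    assert (Ct * Rabs e * exp (- (2 * k) * X') <= c0 * exp (- (2 * k) * X')) by bound. lra. }
  (* The invariant handed from dip to dip. At [X] it implies a next dip [X'] with
     [c0 e^(- 2 k X) <= C e^(- 2 k (X' - X))]. As [C e^(- 2 k L) <= g / 2], it follows that [2 c0
     e^(- 2 k X') <= g e^(- 2 k (X' - X))]: the interaction with [X] dominates the gap at [X'], and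
     the invariant holds again. *)
  pose (I := fun X => XA <= X /\ dip p p1 X /\ c0 * exp (- (2 * k) * X) <= p X - mR V e X).
  assert (Hstep : forall X, I X -> exists X', I X' /\ X + L < X').
  { intros X [HX1 [HX2 HX3]]. destruct (Hint e V p p1 E1 HcV HV Hg X HX2) as [_ [H2 [_ H4]]].
    assert (Hex : exists c, X < c /\ dip p p1 c).
    { apply NNPP. intros Hne. assert (p X <= mR V e X). { apply H2. eauto. }
      assert (0 < c0 * exp (- (2 * k) * X)) by pos. lra. }
    destruct Hex as [c [Hc1 Hc2]]. pose proof (Hsp e V p p1 E2 HV Hg X c HX2 Hc2 Hc1).
    destruct (first_dip e V p p1 (X + L) c Hg ltac:(lra) Hc2) as [X' [HX'1 [HX'2 HX'3]]].
    pose proof (Hsp e V p p1 E2 HV Hg X X' HX2 HX'2 ltac:(lra)) as HX'L.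
    assert (Hno' : forall x, X < x < X' -> ~ dip p p1 x).
    { intros x Hx Hd. pose proof (Hsp e V p p1 E2 HV Hg X x HX2 Hd ltac:(lra)).
      apply (HX'3 x); [lra|easy]. }
    exists X'. split; [|lra]. splits.
    pose proof (Hprev X X' HX2 HX'2 ltac:(lra) Hno' ltac:(lra)) as H5.
    destruct (H4 X' HX'2 ltac:(lra) Hno') as [_ H6]. specialize (HexpL (X' - X) ltac:(lra)).
    set (E := exp (- (2 * k) * (X' - X))) in *. set (F := exp (- (2 * k) * X')) in *.
    assert (exp (- (2 * k) * X) * E = F) by (unfold E, F; rewrite <- exp_plus; f_equal; ring).
    assert (0 < E) by apply exp_pos. bound. }
  destruct (dips_bounded e V p p1 Hg) as [M HM]. destruct (completeness I) as [m [Hm1 Hm2]].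
  - exists M. intros x [_ [Hx _]]. destruct (Rle_dec x M) as [|Hn]; [easy|]. exfalso.
    apply (HM x); [lra|easy].
  - exists X1. splits. pose proof (Hprev X0 X1 HdX0 HdX1 Hlt Hno HXA) as H5.
    assert (exp (- (2 * k)) * exp (- (2 * k) * X1) <= exp (- (2 * k) * (X1 - X0))).
    { rewrite <- exp_plus. apply exp_le. nra. }
    set (F := exp (- (2 * k) * X1)) in *.
    assert (2 * c0 * F = g * (exp (- (2 * k)) * F)) by (unfold c0; field). nra.
  - assert (m <= m - L); [|lra]. apply Hm2. intros x Hx. destruct (Hstep x Hx) as [x' [Hx' Hxx]].
    specialize (Hm1 x' Hx'). lra.
Qed.

(** * Continuous families of gray amplitudes *)

Lemma derive_small (f f1 f2 : R -> R) (x h M d : R) : 0 < h ->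
  (forall y, is_derive f y (f1 y)) -> (forall y, is_derive f1 y (f2 y)) ->
  (forall y, Rabs (f2 y) <= M) -> Rabs (f x) <= d -> Rabs (f (x + h)) <= d ->
  Rabs (f1 x) <= 2 * d / h + M * h.
Proof.
  intros Hh H1 H2 HM Hx Hxh. destruct (mvt f f1 x (x + h)) as [c [Hc E]]; [lra|intros; apply H1|].
  pose proof (derive_abs_le f1 f2 x c M). assert (Rabs (f1 c - f1 x) <= M * (c - x)) by bound.
  assert (Rabs (f1 c) <= 2 * d / h).
  { replace (f1 c) with ((f (x + h) - f x) / h) by (rewrite E; field; lra). unfold Rdiv.
    rewrite Rabs_mult, (Rabs_right (/ h)) by pos. apply Rmult_le_compat_r; [pos|]. bound. }
  assert (0 <= M) by (specialize (HM x); pose proof (Rabs_pos (f2 x)); lra).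
  pose proof (Rabs_triang (f1 c) (- (f1 c - f1 x))) as Ht.
  replace (f1 c + - (f1 c - f1 x)) with (f1 x) in Ht by ring. rewrite Rabs_Ropp in Ht. nra.
Qed.

Lemma second_derivative_bound : exists e1 M, 0 < e1 /\ 0 < M /\ forall e V p p1,
  Rabs e <= e1 -> decays V -> gm v e V p p1 -> forall x,
  Rabs (p1 x) <= M /\ Rabs (famp v (p x) + 2 * e * V x * p x) <= M.
Proof.
  destruct fq_bound as [Cf [HCf Hfq]]. pose proof vabs_bounds as Hv.
  destruct (apriori 1 Rlt_0_1) as [e1 [He1 Hap]]. assert (H4 : 0 < 4 / Rabs v) by pos.
  assert (He1K : 0 < e1 * Kv) by pos. exists e1, (4 / Rabs v + 2 * Cf + 4 * (e1 * Kv)). splits.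
  intros e V p p1 He HV Hg x. destruct (Hap e V p p1 He HV Hg x) as [_ [H1 [H2 _]]]. splits.
  triangle. assert (F : Rabs (famp v (p x)) <= Cf * 2).
  { replace (famp v (p x)) with (famp v (p x) - famp v 1) by (rewrite famp_1; ring).
    rewrite famp_sub by lra. destruct (Hfq (p x) 1 1) as [F _]; try lra. mono. }
  assert (Rabs (2 * e * V x * p x) <= 2 * e1 * Kv * 2).
  { apply Rabs_mult_le; [|mono].
    apply Rabs_mult_le; [rewrite Rabs_mult, (Rabs_right 2); lra|now apply (decays_le)]. }
  lra.
Qed.

(** The slopes are bounded uniformly in the parameter, so continuity at finitely many points, [s]
    apart, controls a compact interval. *)
Lemma family_locally_uniform : exists e1, 0 < e1 /\ forall V lo hi P P1, - e1 <= lo -> hi <= e1 ->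
  decays V -> gfam lo hi V P P1 -> forall e A B d, lo < e < hi -> 0 < d ->
  exists t, 0 < t /\ forall e', lo < e' < hi -> Rabs (e' - e) < t -> forall x, A <= x <= B ->
    Rabs (P e' x - P e x) < d.
Proof.
  destruct second_derivative_bound as [e1 [M [He1 [HM Hb]]]]. exists e1. splits.
  intros V lo hi P P1 Hlo Hhi HV Hf e A B d He Hd.
  assert (Hb' : forall e', lo < e' < hi -> forall x, Rabs (P1 e' x) <= M).
  { intros e' He' x. apply (Hb e' V (P e') (P1 e')); [mono|easy|apply Hf; lra]. }
  pose (s := d / (8 * M)). assert (Hs : 0 < s) by (apply Rdiv_lt_0_compat; lra).
  assert (HMs : M * s = d / 8) by (unfold s; field; lra).
  assert (Hlip : forall e', lo < e' < hi -> forall x y, x <= y <= x + s -> Rabs (P e' y - P e' x) <=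
    d / 8).
  { intros e' He' x y Hxy. apply Rle_trans with (M * (y - x)).
    - apply (derive_abs_le (P e') (P1 e')); [lra|derive|auto].
    - nra. }
  assert (Hn : forall n, exists t, 0 < t /\ forall e', lo < e' < hi -> Rabs (e' - e) < t -> forall
    x, A <= x <= A + INR n * s -> Rabs (P e' x - P e x) < d).
  { induction n as [|n [t [Ht IH]]].
    - destruct (gf_cont Hf A e d He Hd) as [t [Ht H]]. exists t. splits. intros e' He' Hee x Hx.
      cbn in Hx. replace x with A by lra. now apply H.
    - destruct (gf_cont Hf (A + INR n * s) e (d / 2) He ltac:(lra)) as [t' [Ht' H]].
      exists (Rmin t t'). splits. intros e' He' Hee x Hx. minmax. rewrite S_INR in Hx.
      destruct (Rle_dec x (A + INR n * s)) as [Hx'|Hx']; [apply IH; lra|].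
      specialize (H e' He' ltac:(lra)). pose proof (Hlip e' He' (A + INR n * s) x ltac:(lra)).
      pose proof (Hlip e He (A + INR n * s) x ltac:(lra)). bound. }
  destruct (nfloor_ex (Rabs (B - A) / s)) as [n [_ Hn2]]. { pos. }
  destruct (Hn (S n)) as [t [Ht H]]. exists t. splits. intros e' He' Hee x Hx. apply H; try easy.
  rewrite S_INR. apply (Rmult_lt_compat_r s) in Hn2; [|easy].
  replace (Rabs (B - A) / s * s) with (Rabs (B - A)) in Hn2 by algebra. bound.
Qed.

(** Second derivatives are bounded uniformly, so closeness of the amplitudes at [x] and [x + s]
    implies closeness of the slopes at [x]. *)
Lemma family_locally_uniform_derive : exists e1, 0 < e1 /\ forall V lo hi P P1, - e1 <= lo -> hi <= e1 ->
  decays V -> gfam lo hi V P P1 -> forall e A B d, lo < e < hi -> 0 < d ->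
  exists t, 0 < t /\ forall e', lo < e' < hi -> Rabs (e' - e) < t -> forall x, A <= x <= B ->
    Rabs (P e' x - P e x) < d /\ Rabs (P1 e' x - P1 e x) < d.
Proof.
  destruct second_derivative_bound as [e1 [M [He1 [HM Hb]]]].
  destruct family_locally_uniform as [e2 [He2 Hu]]. exists (Rmin e1 e2). splits.
  intros V lo hi P P1 Hlo Hhi HV Hf e A B d He Hd. minmax.
  assert (Hb' : forall e', lo < e' < hi -> forall x, Rabs (famp v (P e' x) + 2 * e' * V x * P e' x)
    <= M).
  { intros e' He' x. apply (Hb e' V (P e') (P1 e')); [mono|easy|apply Hf; lra]. }
  pose (s := d / (8 * M)). assert (Hs : 0 < s) by (apply Rdiv_lt_0_compat; lra).
  assert (2 * M * s = d / 4) by (unfold s; field; lra). pose (dl := Rmin d (d * s / 8)).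
  assert (Hdl : 0 < dl /\ dl <= d /\ 2 * dl / s <= d / 4).
  { unfold dl. split; [apply Rmin_glb_lt; [easy|]; assert (0 < d * s) by pos; lra|].
    split; [bound|]. apply (Rmult_le_reg_r s); [easy|].
    replace (2 * Rmin d (d * s / 8) / s * s) with (2 * Rmin d (d * s / 8)) by algebra. bound. }
  destruct (Hu V lo hi P P1 ltac:(lra) ltac:(lra) HV Hf e A (B + s) dl He (proj1 Hdl)) as [t [Ht
    H']].
  exists t. splits. intros e' He' Hee x Hx. pose proof (H' e' He' Hee x ltac:(lra)).
  pose proof (H' e' He' Hee (x + s) ltac:(lra)).
  pose proof (derive_small (fun y => P e' y - P e y) (fun y => P1 e' y - P1 e y) (fun y => (famp v
    (P e' y) + 2 * e' * V y * P e' y) - (famp v (P e y) + 2 * e * V y * P e y)) x s (2 * M) dl Hs)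
    as G.
  assert (Rabs (P1 e' x - P1 e x) <= 2 * dl / s + 2 * M * s); [|lra]. apply G; try lra.
  - derive.
  - intros y.
    apply (is_derive_minus (P1 e') (P1 e)); [apply (gm_dd (gf_gm Hf e' He'))| apply (gm_dd (gf_gm Hf
      e He))].
  - intros y. pose proof (Hb' e' He' y). pose proof (Hb' e He y). bound.
Qed.

Lemma no_dip_open : exists e1, 0 < e1 /\ forall V lo hi P P1, - e1 <= lo -> hi <= e1 ->
  decays V -> gfam lo hi V P P1 -> forall e A B, lo < e < hi ->
  (forall x, A <= x <= B -> ~ dip (P e) (P1 e) x) ->
  exists t, 0 < t /\ forall e', lo < e' < hi -> Rabs (e' - e) < t -> forall x, A <= x <= B ->
    ~ dip (P e') (P1 e') x.
Proof.
  destruct family_locally_uniform_derive as [e1 [He1 Hu]]. exists e1. splits.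
  intros V lo hi P P1 Hlo Hhi HV Hf e A B He Hno.
  destruct (Rle_dec A B) as [HAB|HAB]; [|exists 1; split; [lra|intros; lra]].
  pose proof (gf_gm Hf e He) as Hg.
  (* Nonnegative, and zero exactly at the dips; without dips it is bounded below by a positive
     constant on the compact interval. *)
  pose (f := fun x => Rabs (P1 e x) + Rmax 0 (P e x - (1 + Rabs v) / 2)).
  assert (Hc : forall x, continuity_pt f x).
  { intros x.
    apply (continuity_pt_plus (fun x => Rabs (P1 e x)) (fun x => Rmax 0 (P e x - (1 + Rabs v) /
      2))).
    - apply (continuity_pt_comp (P1 e) Rabs).
      + eapply is_derive_continuity_pt, (gm_dd Hg).
      + apply Rcontinuity_abs.
    - apply (continuity_pt_ext (fun x => (P e x - (1 + Rabs v) / 2 + Rabs (P e x - (1 + Rabs v) /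
        2)) / 2)).
      { intros y. unfold Rmax. destruct (Rle_dec 0 (P e y - (1 + Rabs v) / 2)).
        - rewrite (Rabs_right (P e y - (1 + Rabs v) / 2)); lra.
        - rewrite (Rabs_left (P e y - (1 + Rabs v) / 2)); lra. }
      assert (Hcp : continuity_pt (fun x => P e x - (1 + Rabs v) / 2) x).
      { apply (continuity_pt_minus (P e) (fun _ => (1 + Rabs v) / 2)).
        - eapply is_derive_continuity_pt, (gm_d Hg).
        - apply continuity_pt_const. easy. }
      apply (continuity_pt_mult (fun x => P e x - (1 + Rabs v) / 2 + Rabs (P e x - (1 + Rabs v) /
        2)) (fun _ => / 2)).
      + apply (continuity_pt_plus (fun x => P e x - (1 + Rabs v) / 2) (fun x => Rabs (P e x - (1 +
          Rabs v) / 2))); [easy|].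
        apply (continuity_pt_comp (fun x => P e x - (1 + Rabs v) / 2) Rabs); [easy|apply
          Rcontinuity_abs].
      + apply continuity_pt_const. easy. }
  destruct (continuity_ab_min f A B HAB) as [m [Hm1 Hm2]]; [intros; apply Hc|].
  assert (Hfm : 0 < f m).
  { unfold f. minmax. destruct (Req_dec (P1 e m) 0) as [E|E].
    - destruct (Rlt_dec ((1 + Rabs v) / 2) (P e m)) as [Hl|Hl].
      + bound.
      + exfalso. apply (Hno m Hm2). split; lra.
    - pos. }
  destruct (Hu V lo hi P P1 Hlo Hhi HV Hf e A B (f m / 2) He ltac:(lra)) as [t [Ht H]]. exists t.
  splits. intros e' He' Hee x Hx [Hd1 Hd2]. specialize (Hm1 x Hx).
  destruct (H e' He' Hee x Hx) as [H1 H2]. rewrite Hd1 in H2. unfold Rminus in H2.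
  rewrite Rplus_0_l, Rabs_Ropp in H2. apply Rabs_def2 in H1.
  assert (Rmax 0 (P e x - (1 + Rabs v) / 2) < f m / 2) by (apply Rmax_lub_lt; lra).
  unfold f at 2 in Hm1. lra.
Qed.

Lemma dip_convex : exists e1, 0 < e1 /\ forall e V p p1, Rabs e <= e1 -> decays V -> gm v e V p p1 ->
  forall X, dip p p1 X -> 0 < famp v (p X) + 2 * e * V X * p X.
Proof.
  destruct fq_bound as [Cf [HCf Hfq]]. pose proof vabs_bounds. pose (c := famp v (r0 0)).
  assert (0 < c) by apply famp_rho0_0.
  destruct (crit_small ((1 - Rabs v) / 2) (c / (4 * Cf))) as [e1 [He1 Hcs]]; [lra|apply
    Rdiv_lt_0_compat; lra|].
  destruct (apriori 1 Rlt_0_1) as [e2 [He2 Hap]]. exists (Rmin (Rmin e1 e2) (c / (16 * Kv))).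
  splits. intros e V p p1 He HV Hg X [HX1 HX2]. pose proof (Rmin_l (Rmin e1 e2) (c / (16 * Kv))).
  pose proof (Rmin_r (Rmin e1 e2) (c / (16 * Kv))). pose proof (Rmin_l e1 e2).
  pose proof (Rmin_r e1 e2). assert (Rabs e <= c / (16 * Kv)) by lra.
  specialize (Hcs e V p p1 ltac:(lra) HV Hg X HX1 ltac:(lra)).
  destruct (Hap e V p p1 ltac:(lra) HV Hg X) as [_ [Hpr _]].
  destruct (Hfq (p X) (Rabs v) (Rabs v)) as [F _]; try lra.
  assert (HF : Rabs (famp v (p X) - c) <= Cf * (c / (4 * Cf))).
  { unfold c at 1. rewrite rho0_0, famp_sub by lra. mono. }
  replace (Cf * (c / (4 * Cf))) with (c / 4) in HF by algebra.
  assert (Rabs (2 * e * V X * p X) <= 2 * Rabs e * Kv * 2).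
  { apply Rabs_mult_le; [|mono].
    apply Rabs_mult_le; [rewrite Rabs_mult, (Rabs_right 2); lra|now apply (decays_le)]. }
  bound.
Qed.

(** By [dip_convex] a dip has strictly higher values close by on both sides. Three values suffice:
    they keep their order for nearby parameters, and [dip_between] finds a dip among them. *)
Lemma dip_persists : exists e1, 0 < e1 /\ forall V lo hi P P1, - e1 <= lo -> hi <= e1 ->
  decays V -> gfam lo hi V P P1 -> forall e X r, lo < e < hi -> 0 < r -> dip (P e) (P1 e) X ->
  exists t, 0 < t /\ forall e', lo < e' < hi -> Rabs (e' - e) < t ->
    exists X', Rabs (X' - X) < r /\ dip (P e') (P1 e') X'.
Proof.
  pose proof vabs_bounds. destruct dip_convex as [e1 [He1 Hconv]].
  destruct (dip_between ((1 - Rabs v) / 4) ltac:(lra)) as [e2 [He2 Hbet]]. exists (Rmin e1 e2).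
  splits. intros V lo hi P P1 Hlo Hhi HV Hf e X r He Hr HX. minmax.
  pose proof (gf_gm Hf e He) as Hg. assert (Ee : Rabs e <= e1) by mono.
  pose proof (Hconv e V (P e) (P1 e) Ee HV Hg X HX) as Hcv.
  destruct (not_max_of_convex (P e) (P1 e) X _ (X + r) (gm_d Hg) (gm_dd Hg X) (proj1 HX) Hcv
    ltac:(lra)) as [xr [Hxr1 Hxr2]].
  pose proof (gm_opp Hg) as Hg'.
  destruct (not_max_of_convex (fun x => P e (- x)) (fun x => - P1 e (- x)) (- X) _ (- X + r) (gm_d
    Hg') (gm_dd Hg' (- X)) (proj1 (dip_opp HX))) as [xl [Hxl1 Hxl2]]; [now rewrite
    Ropp_involutive|lra|].
  rewrite Ropp_involutive in Hxl2.
  pose (d := Rmin (Rmin ((P e xr - P e X) / 2) ((P e (- xl) - P e X) / 2)) ((1 - Rabs v) / 4)).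
  assert (Hd : 0 < d /\ d <= (P e xr - P e X) / 2 /\ d <= (P e (- xl) - P e X) / 2 /\ d <= (1 - Rabs
    v) / 4) by bound.
  destruct Hd as [Hd [Hd1 [Hd2 Hd3]]]. destruct (gf_cont Hf xr e d He Hd) as [t1 [Ht1 C1]].
  destruct (gf_cont Hf (- xl) e d He Hd) as [t2 [Ht2 C2]].
  destruct (gf_cont Hf X e d He Hd) as [t3 [Ht3 C3]]. exists (Rmin (Rmin t1 t2) t3). splits.
  intros e' He' Hee. minmax. specialize (C1 e' He' ltac:(lra)). specialize (C2 e' He' ltac:(lra)).
  specialize (C3 e' He' ltac:(lra)). apply Rabs_def2 in C1. apply Rabs_def2 in C2.
  apply Rabs_def2 in C3.
  destruct (Hbet e' V (P e') (P1 e') ltac:(apply Rabs_le; lra) HV (gf_gm Hf e' He') (- xl) xr X) as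
    [c [Hc1 Hc2]]; try lra.
  { destruct HX as [_ HX]. lra. } exists c. bound.
Qed.

(** What a sweep leaves behind, expressed through [gpol] alone: a pinch depends on the potential and
    no longer on the family that produced it. *)
Definition pinch (V : R -> R) (N : nat) (e : R) : Prop :=
  exists C, 0 < C /\ forall d, 0 < d -> exists X0, forall X, X0 <= X ->
    exists e', Rabs (e' - e) < d /\ Rabs (gpol V N e' X) <= C * exp (- (2 * k) * X).

Definition dips (P P1 : R -> R -> R) (e x : R) : Prop := dip (P e) (P1 e) x.

Lemma dips_family : exists e1, 0 < e1 /\ forall V lo hi P P1, - e1 <= lo -> hi <= e1 ->
  decays V -> gfam lo hi V P P1 -> dip_family lo hi (dips P P1).
Proof.
  destruct (no_dip_open) as [e1 [He1 H1]]. destruct (dip_persists) as [e2 [He2 H2]].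
  exists (Rmin e1 e2). splits. intros V lo hi P P1 Hlo Hhi HV Hf. split.
  - intros e X r He Hr HX. apply (H2 V lo hi P P1); try easy; bound.
  - intros e A B He Hno. apply (H1 V lo hi P P1); try easy; bound.
  - intros e He. destruct (dips_bounded e V _ _ (gf_gm Hf e He)) as [M HM].
    destruct (nfloor_ex (Rabs M) (Rabs_pos M)) as [n [_ Hn]]. exists (S n). intros x Hx. apply HM.
    rewrite S_INR in Hx. bound.
Qed.

(** Where [X] is the first dip beyond [m], the left reference is at most [O(e^(- 2 k X))] below
    [p X], and the right one is not above [p X]; this bounds the gap from above. Where [X] is the
    last dip, [p X] equals the right reference and the left one is not above it, so the gap is
    nonnegative. The intermediate value theorem, applied to the polynomial [gpol], gives a parameter
    where the gap is small. *)
Lemma sweeps_pinch : exists e1, 0 < e1 /\ forall V lo hi P P1, - e1 <= lo -> hi <= e1 ->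
  cont V -> decays V -> gfam lo hi V P P1 ->
  forall e m, lo < e < hi -> sweeps lo hi (dips P P1) e m -> pinch V N e.
Proof.
  destruct (dip_interaction) as [h [T [e1 [C [g [Hh [HT [He1 [HC [_ Hint]]]]]]]]]].
  destruct (gap_gpol) as [e2 [C2 [He2 [HC2 Hgp]]]]. exists (Rmin (Rmin e1 e2) 1). splits.
  intros V lo hi P P1 Hlo Hhi HcV HV Hf e m He [_ Hsw]. minmax.
  destruct (eventually_lt (P e) 1 (h / 2) (gm_pinf (gf_gm Hf e He))) as [M HM]; [lra|].
  pose (n := Rmax m (M + 1)). pose proof (Rmax_l m (M + 1)) as Hn1.
  pose proof (Rmax_r m (M + 1)) as Hn2. fold n in Hn1, Hn2. specialize (HM n ltac:(lra)).
  destruct (gf_cont Hf n e (h / 2) He ltac:(lra)) as [t [Ht Hct]].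
  pose (Cp := C * exp (2 * k * n) + C2). assert (0 < C * exp (2 * k * n)) by pos. exists Cp.
  split; [unfold Cp; lra|]. intros d Hd.
  destruct (Hsw (Rmin d t)) as [X0 HX0]; [now apply Rmin_glb_lt|]. pose proof (Rmin_l d t).
  pose proof (Rmin_r d t). exists (Rmax X0 (Rmax (n + T) 0)). intros X HX.
  pose proof (Rmax_l X0 (Rmax (n + T) 0)). pose proof (Rmax_r X0 (Rmax (n + T) 0)).
  pose proof (Rmax_l (n + T) 0).
  destruct (HX0 X ltac:(lra)) as [[x1 [A1 [A2 [A3 A4]]]] [x2 [B1 [B2 [B3 B4]]]]].
  set (w := exp (- (2 * k) * X)) in *. assert (0 < w) by apply exp_pos.
  assert (Hdiff : forall x, lo < x < hi -> Rabs (gap V x X - gpol V N x X) <= C2 * w).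
  { intros x Hx. eapply Rle_trans; [apply (Hgp x V ltac:(apply Rabs_le; lra) HcV HV X)|].
    rewrite (Rabs_right X) by bound. fold w. rewrite <- (Rmult_1_r C2) at 2. mono. }
  assert (gpol V N x1 X <= Cp * w).
  { pose proof (gf_gm Hf x1 A1) as Hg. assert (E1 : Rabs x1 <= e1) by mono.
    destruct (Hint x1 V _ _ E1 HcV HV Hg X A3) as [G1 _].
    destruct (Hint x1 _ _ _ E1 (cont_opp_arg V HcV) (decays_opp V HV) (gm_opp Hg) (- X) (dip_opp
      A3)) as [_ [_ [G2 _]]].
    specialize (G2 (- n) ltac:(lra)). rewrite !Ropp_involutive in G2.
    assert (G3 : P x1 X - mR (fun x => V (- x)) x1 (- X) <= C * exp (- (2 * k) * (- n - - X))).
    { apply G2.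
      - intros x Hx Hdx. apply (A4 (- x)); [lra|]. now apply dip_opp_inv.
      - specialize (Hct x1 A1 ltac:(lra)). bound. }
    replace (exp (- (2 * k) * (- n - - X))) with (exp (2 * k * n) * w) in G3.
    2:{ unfold w. rewrite <- exp_plus. f_equal. ring. }
    specialize (Hdiff x1 A1). unfold gap in Hdiff. unfold Cp. bound. }
  assert (- (Cp * w) <= gpol V N x2 X).
  { pose proof (gf_gm Hf x2 B1) as Hg. assert (E1 : Rabs x2 <= e1) by mono.
    destruct (Hint x2 V _ _ E1 HcV HV Hg X B3) as [_ [G1 _]]. specialize (G1 B4).
    destruct (Hint x2 _ _ _ E1 (cont_opp_arg V HcV) (decays_opp V HV) (gm_opp Hg) (- X) (dip_opp
      B3)) as [G2 _].
    rewrite Ropp_involutive in G2. specialize (Hdiff x2 B1). unfold gap in Hdiff.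
    assert (0 <= C * exp (2 * k * n) * w) by pos. unfold Cp. bound. }
  assert (0 <= Cp * w) by (apply Rmult_le_pos; [unfold Cp|]; lra).
  destruct (Rle_dec (- (Cp * w)) (gpol V N x1 X)) as [Hx1|Hx1]. { exists x1. mono. }
  destruct (Rle_dec (gpol V N x2 X) (Cp * w)) as [Hx2|Hx2]. { exists x2. mono. }
  destruct (IVT_gen (fun x => gpol V N x X) x1 x2 0) as [z [Hz1 Hz2]].
  - apply (continuity_sumn_pow (fun i => gcoef V i X)).
  - bound.
  - exists z. split.
    + assert (A2' : Rabs (x1 - e) < d) by lra. assert (B2' : Rabs (x2 - e) < d) by lra.
      apply Rabs_def2 in A2'. apply Rabs_def2 in B2'. unfold Rmin, Rmax in Hz1.
      destruct (Rle_dec x1 x2); apply Rabs_def1; lra.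
    + mono.
Qed.

Lemma many_pinches (V : R -> R) : (forall d, 0 < d -> exists e, e <> 0 /\ Rabs e < d /\ pinch V N e) ->
  forall m : nat, exists (x : nat -> R) s, 0 < s <= 1 /\
    (forall i, (i < m)%nat -> s <= Rabs (x i) <= 1 /\ pinch V N (x i)) /\
    (forall i j, (i < j < m)%nat -> s <= Rabs (x i - x j)).
Proof.
  intros H m. induction m as [|m [x [s [Hs [Hx Hsep]]]]]. { exists (fun _ => 0), 1. splits. easy. }
  destruct (H (s / 2)) as [e [He0 [He Hpe]]]; [lra|].
  exists (fun i => if Nat.eq_dec i m then e else x i), (Rabs e). splits. split.
  - intros i Hi. destruct (Nat.eq_dec i m) as [->|Hne]; [split; [lra|easy]|].
    destruct (Hx i ltac:(lia)) as [H1 H2]. pos.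
  - intros i j Hij. destruct (Nat.eq_dec i m) as [->|Hi]; [lia|].
    destruct (Nat.eq_dec j m) as [->|Hj]; [|specialize (Hsep i j ltac:(lia)); lra].
    destruct (Hx i ltac:(lia)) as [H1 _]. pose proof (Rabs_triang_inv (x i) e). lra.
Qed.

(** If pinches accumulate at 0, take [N - 1] distinct nonzero ones. Near each of them [gpol] is
    [O(e^(- 2 k X))] for all large [X]. As the constant coefficient is 0, dividing by the node
    leaves a polynomial with [N - 1] coefficients, which these values determine with a uniform
    bound. *)
Lemma pinch_dichotomy (V : R -> R) :
  (exists XA Ct, 0 < Ct /\ forall X, XA <= X -> forall n, (n < N)%nat ->
     Rabs (gcoef V n X) <= Ct * exp (- (2 * k) * X)) \/
  (exists d, 0 < d /\ forall e, e <> 0 -> Rabs e < d -> ~ pinch V N e).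
Proof.
  destruct (classic (exists d, 0 < d /\ forall e, e <> 0 -> Rabs e < d -> ~ pinch V N e)) as [|Hn];
    [now right|left].
  assert (Hmany : forall d, 0 < d -> exists e, e <> 0 /\ Rabs e < d /\ pinch V N e).
  { intros d Hd. apply NNPP. intros H. apply Hn. exists d. splits. intros e He0 He Hp. eauto. }
  destruct (many_pinches V Hmany (N - 1)) as [x [s [Hs [Hx Hsep]]]].
  assert (Hunif : forall m, (m <= N - 1)%nat -> exists C XA, 0 < C /\ forall i, (i < m)%nat ->
    forall X, XA <= X -> exists e', Rabs (e' - x i) < s / 4 /\ Rabs (gpol V N e' X) <= C * exp (- (2
    * k) * X)).
  { induction m as [|m IH]; intros Hm; [exists 1, 0; split; [lra|intros; lia]|].
    destruct IH as [C [XA [HC H1]]]; [lia|]. destruct (Hx m ltac:(lia)) as [_ [C' [HC' H2]]].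
    destruct (H2 (s / 4) ltac:(lra)) as [XB HXB]. exists (C + C'), (Rmax XA XB). splits.
    intros i Hi X HX. minmax. pose proof (exp_pos (- (2 * k) * X)) as Hw.
    destruct (Nat.eq_dec i m) as [->|Hne].
    - destruct (HXB X ltac:(lra)) as [e' [E1 E2]]. exists e'. nra.
    - destruct (H1 i ltac:(lia) X ltac:(lra)) as [e' [E1 E2]]. exists e'. nra. }
  destruct (Hunif (N - 1)%nat (le_n _)) as [C [XA [HC HXA]]].
  destruct (interpolation_bound (N - 1) (s / 2)) as [K [HK HI]]; [lra|].
  exists XA, (K * (2 * C / s)). splits. intros X HX n Hnn.
  pose proof (exp_pos (- (2 * k) * X)) as Hw. set (w := exp (- (2 * k) * X)) in *.
  destruct n as [|n]. { rewrite gcoef_0, Rabs_R0. pos. }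
  destruct (finite_choice (N - 1) (fun i e' => Rabs (e' - x i) < s / 4 /\ Rabs (gpol V N e' X) <= C
    * w)) as [y Hy].
  { auto. } rewrite Rmult_assoc.
  apply (HI (fun n => gcoef V (S n) X) y (2 * C / s * w)); [|intros i Hi|intros i j Hij|intros i
    Hi|lia].
  - pos.
  - destruct (Hy i Hi) as [Y1 _]. destruct (Hx i Hi) as [X1 _]. bound.
  - destruct (Hy i ltac:(lia)) as [Y1 _]. destruct (Hy j ltac:(lia)) as [Y2 _].
    specialize (Hsep i j Hij).
    pose proof (Rabs_triang (y i - y j) (- ((y i - x i) - (y j - x j)))) as Ht.
    replace (y i - y j + - (y i - x i - (y j - x j))) with (x i - x j) in Ht by ring.
    rewrite Rabs_Ropp in Ht. pose proof (Rabs_triang (y i - x i) (- (y j - x j))) as Ht2.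
    rewrite Rabs_Ropp in Ht2. unfold Rminus in *. lra.
  - destruct (Hy i Hi) as [Y1 Y2]. destruct (Hx i Hi) as [X1 _]. assert (s / 2 <= Rabs (y i)).
    { pose proof (Rabs_triang_inv (x i) (y i)). rewrite Rabs_minus_sym in Y1. lra. }
    assert (E : gpol V N (y i) X = y i * sumn (N - 1) (fun n => gcoef V (S n) X * y i ^ n)).
    { unfold gpol. replace N with (S (N - 1)) at 1 by lia.
      rewrite sumn_shift, gcoef_0, <- sumn_scal. rewrite Rmult_0_l, Rplus_0_l. apply sumn_ext.
      intros; cbn; ring. }
    rewrite E, Rabs_mult in Y2.
    set (S0 := Rabs (sumn (N - 1) (fun n => gcoef V (S n) X * y i ^ n))) in *.
    assert (0 <= S0) by apply Rabs_pos. apply (Rmult_le_reg_l (s / 2)); [lra|].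
    replace (s / 2 * (2 * C / s * w)) with (C * w) by algebra. nra.
Qed.

(** In the first case of [pinch_dichotomy] the gap is [O(|e| e^(- 2 k X))] for all small [e]:
    [no_escape] confines the dip next to the central one to a fixed compact set, where openness
    excludes it. In the second case a birth would yield a sweep, hence a pinch, at a small
    parameter, which is nonzero because [(lo, hi)] lies on one side of 0. *)
Lemma right_bound (V : R -> R) : cont V -> decays V -> exists e1, 0 < e1 /\
  forall lo hi P P1, - e1 <= lo -> hi <= e1 -> 0 <= lo \/ hi <= 0 -> gfam lo hi V P P1 ->
  forall e X0, lo < e < hi -> -1 < X0 < 1 -> dips P P1 e X0 -> (forall x, X0 < x -> ~ dips P P1 e x) ->
  exists M t, 0 < t /\ forall e', lo < e' < hi -> Rabs (e' - e) < t -> forall x, M < x -> ~ dips P P1 e' x.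
Proof.
  intros HcV HV. destruct dips_family as [e1 [He1 Hdf]].
  destruct (pinch_dichotomy V) as [[XA [Ct [HCt Htame]]]|[d [Hd Hnp]]].
  - destruct (gap_gpol) as [e2 [C2 [He2 [HC2 Hgp]]]]. pose (Cg := INR N * Ct + C2).
    assert (0 <= INR N * Ct) by pos.
    destruct (no_escape Cg ltac:(unfold Cg; lra)) as [e3 [He3 Hne]].
    destruct (dip_spacing 1 Rlt_0_1) as [e4 [He4 Hsp]].
    exists (Rmin (Rmin (Rmin e1 e2) (Rmin e3 e4)) 1). splits.
    intros lo hi P P1 Hlo Hhi _ Hf e X0 He HX0 HdX0 Hno.
    pose proof (Rmin_l (Rmin (Rmin e1 e2) (Rmin e3 e4)) 1).
    pose proof (Rmin_l (Rmin e1 e2) (Rmin e3 e4)). pose proof (Rmin_l e1 e2).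
    pose proof (Hdf V lo hi P P1 ltac:(lra) ltac:(lra) HV Hf) as HD. pose (XB := Rmax XA 1).
    pose proof (Rmax_l XA 1) as HXB1. pose proof (Rmax_r XA 1) as HXB2. fold XB in HXB1, HXB2.
    pose (r := Rmin (/ 4) (Rmin (1 - X0) (X0 + 1))).
    assert (Hr : 0 < r /\ r <= / 4 /\ r <= 1 - X0 /\ r <= X0 + 1) by bound.
    destruct (df_persist HD e X0 r He (proj1 Hr) HdX0) as [t1 [Ht1 Hper]].
    destruct (df_open HD e (X0 + r) XB He) as [t2 [Ht2 Hopn]]. { intros x Hx. apply Hno. lra. }
    exists XB, (Rmin t1 t2). splits. intros e' He' Hee x Hx Hdx. pose proof (Rmin_l t1 t2).
    pose proof (Rmin_r t1 t2). destruct (Hper e' He' ltac:(lra)) as [X0' [HX0' HdX0']].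
    apply Rabs_def2 in HX0'.
    assert (Ee : Rabs e' <= e1 /\ Rabs e' <= e2 /\ Rabs e' <= e3 /\ Rabs e' <= e4 /\ Rabs e' <= 1)
      by bound.
    destruct Ee as [_ [E2 [E3 [E4 E5]]]]. pose proof (gf_gm Hf e' He') as Hg.
    assert (HX0x : X0' < x) by lra. pose proof (Hsp e' V _ _ E4 HV Hg X0' x HdX0' Hdx HX0x).
    destruct (first_dip e' V _ _ (X0' + / 2) x Hg ltac:(lra) Hdx) as [X1 [HX1 [HdX1 Hno1]]].
    assert (XB < X1).
    { destruct (Rlt_dec XB X1) as [|Hn]; [easy|exfalso].
      apply (Hopn e' He' ltac:(lra) X1); [lra|easy]. }
    assert (X1 < XB); [|lra].
    apply (Hne V HcV HV e' XB E3) with (p := P e') (p1 := P1 e') (X0 := X0'); try easy; try lra.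
    + intros X HX. pose proof (Hgp e' V E2 HcV HV X) as G. rewrite (Rabs_right X) in G by lra.
      assert (Rabs (gpol V N e' X) <= INR N * (Ct * exp (- (2 * k) * X) * Rabs e')).
      { eapply Rle_trans; [apply (sumn_abs_le N _ (fun _ => Ct * exp (- (2 * k) * X) * Rabs e'))|].
        - intros i Hi. destruct i as [|i].
          + rewrite gcoef_0, Rmult_0_l, Rabs_R0. pos.
          + apply Rabs_mult_le; [apply Htame; [lra|easy]|]. rewrite <- (Rmult_1_r (Rabs e')).
            apply Rabs_mult_le; [lra|]. rewrite <- RPow_abs. rewrite <- (pow1 i). mono.
        - clear. generalize (Ct * exp (- (2 * k) * X) * Rabs e'). intros c.
          induction N as [|m IH]; [cbn; lra|]. change (sumn m (fun _ => c) + c <= INR (S m) * c).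
          rewrite S_INR. lra. }
      unfold Cg. bound.
    + intros y Hy Hdy. pose proof (Hsp e' V _ _ E4 HV Hg X0' y HdX0' Hdy ltac:(lra)).
      apply (Hno1 y); [lra|easy].
  - destruct sweeps_pinch as [e2 [He2 Hsp]]. exists (Rmin (Rmin e1 e2) d). splits.
    intros lo hi P P1 Hlo Hhi H0 Hf e X0 He _ _ _. minmax.
    pose proof (Hdf V lo hi P P1 ltac:(lra) ltac:(lra) HV Hf) as HD.
    destruct (classic (birth lo hi (dips P P1) e)) as [HB|HB]; [exfalso|now apply not_birth].
    destruct (birth_sweeps lo hi _ e HD He HB) as [s [m [Hs Hsw]]]. apply (Hnp s); [lra|bound|].
    apply (Hsp V lo hi P P1 ltac:(lra) ltac:(lra) HcV HV Hf s m Hs Hsw).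
Qed.

(** * Local uniqueness *)

(** By uniqueness for the initial value problem, [A' = 0] at 0 makes [A] a multiple of [zu], which
    is unbounded. *)
Lemma bounded_even_mode (A A1 : R -> R) (M : R) :
  (forall x, 0 <= x -> is_derive A x (A1 x)) ->
  (forall x, 0 <= x -> is_derive A1 x (dfamp v (r0 x) * A x)) ->
  A1 0 = 0 -> (forall x, 0 <= x -> Rabs (A x) <= M) -> forall x, 0 <= x -> A x = 0 /\ A1 x = 0.
Proof.
  intros H1 H2 H0 HM. destruct dfamp_rho0_bound as [Cd [HCd Hd]]. pose proof vabs_bounds.
  pose (b := A 0 / Rabs v).
  assert (E : forall x, 0 <= x -> A x + b * zu v x = 0 /\ A1 x + b * zu' v x = 0).
  { intros x Hx.
    pose proof (second_order_gronwall (fun x => A x + b * zu v x) (fun x => A1 x + b * zu' v x) (fun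
      x => dfamp v (r0 x) * A x + b * (dfamp v (r0 x) * zu v x)) 0 x Cd 0 Hx ltac:(lra) ltac:(lra))
      as G.
    cbv beta in G. rewrite zu_0, zu'_0, H0 in G.
    replace (A 0 + b * - Rabs v) with 0 in G by (unfold b; field; lra).
    replace ((0 ^ 2 + (0 + b * 0) ^ 2 + 0 ^ 2) * exp ((2 + Cd) * (x - 0))) with 0 in G by ring.
    assert ((A x + b * zu v x) ^ 2 + (A1 x + b * zu' v x) ^ 2 <= 0).
    { apply G.
      - derive.
      - derive.
      - intros y Hy.
        replace (dfamp v (r0 y) * A y + b * (dfamp v (r0 y) * zu v y)) with (dfamp v (r0 y) * (A y +
          b * zu v y)) by ring.
        rewrite Rabs_mult, Rplus_0_r. mono. }
    pose proof (pow2_ge_0 (A x + b * zu v x)). pose proof (pow2_ge_0 (A1 x + b * zu' v x)).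
    split; nra. }
  assert (Hb : b = 0).
  { destruct (Req_dec b 0) as [|Hb]; [easy|exfalso]. apply Rabs_pos_lt in Hb.
    destruct zu_growth as [T [HT Hz]].
    assert (0 <= M) by (specialize (HM 0 (Rle_refl _)); pose proof (Rabs_pos (A 0)); lra).
    pose (x := T + (M + 1) / Rabs b). assert (Hx : T <= x).
    { unfold x. assert (0 < (M + 1) / Rabs b) by pos. lra. }
    assert ((M + 1) / Rabs b <= zu v x).
    { destruct (mvt (zu v) (zu' v) T x Hx) as [c [Hc Ec]]; [intros; apply is_derive_zu|].
      destruct (Hz T (Rle_refl _)) as [Z1 _]. destruct (Hz c ltac:(lra)) as [_ Z2].
      replace (x - T) with ((M + 1) / Rabs b) in Ec by (unfold x; ring).
      assert (0 < (M + 1) / Rabs b) by pos. nra. }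
    destruct (E x ltac:(lra)) as [E1 _]. specialize (HM x ltac:(lra)).
    replace (A x) with (- (b * zu v x)) in HM by lra. rewrite Rabs_Ropp, Rabs_mult in HM.
    assert (zu v x <= Rabs (zu v x)) by bound. assert (M + 1 <= Rabs b * Rabs (zu v x)); [|lra].
    apply Rle_trans with (Rabs b * ((M + 1) / Rabs b)); [right; field; lra|]. mono. }
  intros x Hx. destruct (E x Hx) as [E1 E2]. nra.
Qed.

(** Treat the error in the coefficient [c] as a source [S]. Since [zs' = famp v (r0 0)] and
    [solve' S = 0] at 0, the function [D - al zs - solve S] has zero slope at 0; it is bounded and
    solves the linearized equation, so it vanishes. *)
Lemma mode_approx : exists C, 0 < C /\ forall (D D1 c : R -> R) (eta m : R), cont c -> cont D ->
  (forall x, 0 <= x -> is_derive D x (D1 x)) -> (forall x, 0 <= x -> is_derive D1 x (c x * D x)) ->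
  0 <= eta -> (forall x, Rabs (c x - dfamp v (r0 x)) <= eta) -> (forall x, Rabs (D x) <= m) ->
  forall x, 0 <= x ->
  Rabs (D x - D1 0 / famp v (r0 0) * zs v x) <= C * eta * m /\
  Rabs (D1 x - D1 0 / famp v (r0 0) * famp v (r0 x)) <= C * eta * m.
Proof.
  destruct solve_bound as [C [HC Hs]]. pose proof kap_pos. exists (C / (2 * k)). splits.
  intros D D1 c eta m Hcc HcD HD HD1 Heta Hc Hm x Hx. pose proof famp_rho0_0.
  pose (al := D1 0 / famp v (r0 0)). fold al. pose (S := fun x => (c x - dfamp v (r0 x)) * D x).
  assert (0 <= m) by (specialize (Hm 0); pose proof (Rabs_pos (D 0)); lra). assert (HSc : cont S).
  { apply cont_mult; [|easy]. apply (cont_ext (fun x => c x + -1 * dfamp v (r0 x))); [bound|].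
    apply cont_plus; [easy|]. apply cont_mult; [solve_cont|]. intros y. pose proof (rho0_pos y).
    apply (ex_derive_continuous (fun y => - (v ^ 2 + 2) + 6 * r0 y ^ 2 - 3 * v ^ 2 / r0 y ^ 4)).
    pose proof (is_derive_rho0 y). auto_derive. solve_ex_derive.
    apply Rgt_not_eq, Rmult_lt_0_compat; [easy|]. pos. }
  assert (HSb : forall z, Rabs (S z) <= eta * m) by (intros z; now apply Rabs_mult_le).
  assert (Hem : 0 <= eta * m) by pos.
  assert (Hsol : forall y, 0 <= y -> Rabs (solve S y) <= C / (2 * k) * eta * m /\ Rabs (solve' S y)
    <= C / (2 * k) * eta * m).
  { intros y Hy. pose proof (Hs S (eta * m) 0 0 y HSc (Rle_refl _) ltac:(lra) Hem ltac:(lra)) as G.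
    rewrite Rminus_0_r, (Rabs_right (2 * k)), (Rmin_right (2 * k) 0), Ropp_0, Rmult_0_l, exp_0,
      Rmult_1_r in G by lra.
    rewrite Rmult_assoc. apply G. intros z _. rewrite Rmult_0_l, exp_0, Rmult_1_r. apply HSb. }
  pose proof (solve_derive S 0 (eta * m) HSc (fun z _ => HSb z)) as Hsd.
  destruct modes_bound as [Cm [HCm Hmodes]].
  destruct (bounded_even_mode (fun x => D x - al * zs v x - solve S x) (fun x => D1 x - al * famp v
    (r0 x) - solve' S x) (m + Rabs al * Cm + C / (2 * k) * eta * m)) with (x := x) as [E1 E2].
  - intros y Hy. apply (is_derive_minus (fun x => D x - al * zs v x)); [|apply Hsd]. derive.
  - intros y Hy. evar_last.
    + apply (is_derive_minus (fun x => D1 x - al * famp v (r0 x))); [|apply Hsd].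
      apply (is_derive_minus D1); [now apply HD1|]. apply is_derive_scal.
      apply is_derive_famp; [pose proof (rho0_pos y); lra|apply is_derive_rho0].
    + unfold minus, plus, opp, S; cbn. ring.
  - rewrite solve'_0. unfold al. field. lra.
  - intros y Hy. destruct (Hsol y Hy) as [S1 _]. destruct (Hmodes y) as [Z1 _].
    assert (Rabs (zs v y) <= Cm).
    { eapply Rle_trans; [exact Z1|]. rewrite <- (Rmult_1_r Cm) at 2.
      apply Rmult_le_compat_l; [lra|]. apply exp_ge0_1. assert (0 <= k * Rabs y) by pos. lra. }
    mono.
  - easy.
  - destruct (Hsol x Hx) as [S1 S2]. bound.
Qed.

Section Potential.

Variable V : R -> R.
Hypothesis HV : expdom Kv a V.

Lemma close_derive (z : R) : 0 < z -> exists e1 d, 0 < e1 /\ 0 < d /\ forall e p p1, Rabs e <= e1 ->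
  gm v e V p p1 -> (forall x, Rabs (p x - r0 x) <= d) -> forall x, Rabs (p1 x - zs v x) <= z.
Proof.
  intros Hz. destruct (second_derivative_bound) as [e1 [M [He1 [HM Hb]]]].
  destruct modes_bound as [Cm [HCm Hmodes]]. pose (h := z / (2 * (M + Cm))).
  assert (Hh : 0 < h) by (apply Rdiv_lt_0_compat; lra).
  assert (HMh : (M + Cm) * h = z / 2) by (unfold h; field; lra). exists e1, (z * h / 4). splits.
  intros e p p1 He Hg Hd x.
  pose proof (derive_small (fun y => p y - r0 y) (fun y => p1 y - zs v y) (fun y => (famp v (p y) +
    2 * e * V y * p y) - famp v (r0 y)) x h (M + Cm) (z * h / 4) Hh) as G.
  replace (2 * (z * h / 4) / h + (M + Cm) * h) with z in G by (rewrite HMh; field; lra).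
  apply G; try apply Hd.
  - derive.
  - derive.
  - intros y. destruct (Hb e V p p1 He (proj2 HV) Hg y) as [_ B1].
    destruct (Hmodes y) as [_ [B2 _]]. assert (Rabs (famp v (r0 y)) <= Cm).
    { eapply Rle_trans; [exact B2|]. rewrite <- (Rmult_1_r Cm) at 2.
      apply Rmult_le_compat_l; [lra|]. apply exp_ge0_1. assert (0 <= k * Rabs y) by pos. lra. }
    mono.
Qed.

Lemma cont_gm (e : R) (p p1 : R -> R) : gm v e V p p1 -> cont p /\ cont p1.
Proof.
  intros Hg. split.
  - apply (cont_of_derive _ _ (gm_d Hg)).
  - apply (cont_of_derive _ _ (gm_dd Hg)).
Qed.

Lemma expdom_momentum (e : R) (p p1 : R -> R) : gm v e V p p1 ->
  exists M, expdom M a (fun x => V x * (2 * p x * p1 x)).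
Proof.
  intros Hg. destruct (momentum_bounded e V p p1 Hg (proj2 HV)) as [M HM].
  destruct (cont_gm e p p1 Hg). exists (Kv * M). apply expdom_mult; [easy| |easy]. solve_cont.
Qed.

(** The energy vanishes at both ends and its derivative is [e V (p^2)']; dividing by [e] requires
    [e <> 0]. *)
Lemma momentum_integral (e : R) (p p1 : R -> R) : e <> 0 -> gm v e V p p1 ->
  intR (fun x => V x * (2 * p x * p1 x)) = 0.
Proof.
  intros He Hg. destruct (expdom_momentum e p p1 Hg) as [M HM].
  pose proof (decays_le V (proj2 HV)) as HVb.
  assert (H : intR (fun x => e * V x * (2 * p x * p1 x)) = 0 - 0).
  { apply (intR_derive (M * Rabs e) a (energy p p1)); [easy| | | |].
    - apply (expdom_ext _ _ (fun x => V x * (2 * p x * p1 x) * e)); [bound|].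
      apply expdom_mult; [easy|solve_cont|easy].
    - intros x. now apply energy_derive.
    - now apply (energy_lim Kv e V).
    - pose proof (energy_lim Kv e _ _ _ (gm_opp Hg) (fun x => HVb (- x))) as H.
      apply is_lim_opp_arg in H. eapply is_lim_ext; [|exact H]. intros x. unfold energy.
      rewrite Ropp_involutive. lra. }
  rewrite (intR_ext _ (fun x => 0 * (V x * (2 * p x * p1 x)) + e * (V x * (2 * p x * p1 x)))) in H
    by bound.
  rewrite (intR_lin 0 M a) in H.
  - rewrite (intR_ext _ (fun _ => 0)) in H by bound. replace (intR (fun _ => 0)) with 0 in H.
    + nra.
    + symmetry. apply (intR_unique _ 0 a); [easy| |].
      * split; [solve_cont|]. bound.
      * apply (is_lim_ext (fun _ => 0)); [|apply is_lim_const]. intros T. rewrite RInt_const.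
        eauto with real.
  - easy.
  - split.
    + solve_cont.
    + bound.
  - easy.
Qed.

Hypothesis HMdd : Mdd V <> 0.

(** The difference of two amplitudes is [al zs] up to an error [O(eta |al|)]. Subtracting their
    momentum identities leaves [al Mdd = O(eta |al|)], so [al = 0], and with it the difference. *)
Lemma local_uniqueness : exists e1 d, 0 < e1 /\ 0 < d /\ forall e p p1 q q1, Rabs e <= e1 -> e <> 0 ->
  gm v e V p p1 -> gm v e V q q1 ->
  (forall x, Rabs (p x - r0 x) <= d) -> (forall x, Rabs (q x - r0 x) <= d) -> forall x, p x = q x.
Proof.
  destruct fq_bound as [Cf [HCf Hfq]]. pose proof vabs_bounds.
  destruct mode_approx as [C [HC Hmode]]. destruct modes_bound as [Cm [HCm Hmodes]].
  assert (0 < Rabs (Mdd V)) by pos. assert (0 < 2 * PI / a * Kv) by pos.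
  (* the total error in the integral identity is at most [eta * Ctot * |alpha|] *)
  pose (Ctot := 2 * PI / a * Kv * (2 * (2 * C * Cm * (Cm + 2) + 3 * Cm))). assert (0 < Ctot).
  { apply Rmult_lt_0_compat; [easy|]. pos. }
  pose (eta := Rmin (Rmin 1 (/ (2 * C))) (Rabs (Mdd V) / (2 * Ctot))).
  assert (Heta : 0 < eta /\ eta <= 1 /\ C * eta <= / 2 /\ eta * Ctot <= Rabs (Mdd V) / 2) by bound.
  destruct Heta as [Heta [Heta1 [HetaC HetaM]]]. clearbody eta.
  destruct (close_derive eta Heta) as [e1 [d1 [He1 [Hd1 Hcd]]]].
  destruct (apriori 1 Rlt_0_1) as [e2 [He2 Hap]].
  exists (Rmin (Rmin e1 e2) (eta / (4 * Kv))), (Rmin (Rmin d1 eta) (eta / (4 * Cf))). splits.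
  intros e p p1 q q1 He He0 Hp Hq Hpd Hqd. set (d := Rmin (Rmin d1 eta) (eta / (4 * Cf))) in *.
  assert (Hdd : d <= d1 /\ d <= eta /\ Cf * d <= eta / 4) by bound.
  assert (Hee : Rabs e <= e1 /\ Rabs e <= e2 /\ 2 * Rabs e * Kv <= eta / 2) by bound.
  destruct Hdd as [Hdd1 [Hdd2 Hdd3]]. destruct Hee as [Hee1 [Hee2 Hee3]].
  pose proof (Hcd e p p1 Hee1 Hp (fun x => Rle_trans _ _ _ (Hpd x) Hdd1)) as Hp1.
  pose proof (Hap e V p p1 Hee2 (proj2 HV) Hp) as Hpa.
  pose proof (Hap e V q q1 Hee2 (proj2 HV) Hq) as Hqa. destruct (cont_gm e p p1 Hp) as [Hcp Hcp1].
  destruct (cont_gm e q q1 Hq) as [Hcq Hcq1]. pose (D := fun x => p x - q x).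
  pose (D1 := fun x => p1 x - q1 x). pose (c := fun x => fq v (p x) (q x) + 2 * e * V x).
  assert (forall x, is_derive D x (D1 x)).
  { intros x. apply (is_derive_minus p q); [apply (gm_d Hp)|apply (gm_d Hq)]. }
  assert (HD1 : forall x, is_derive D1 x (c x * D x)).
  { intros x. evar_last.
    - apply (is_derive_minus p1 q1); [apply (gm_dd Hp)|apply (gm_dd Hq)].
    - destruct (Hpa x) as [_ [Hr2 _]]. destruct (Hqa x) as [_ [Hr3 _]].
      pose proof (famp_sub v (p x) (q x) ltac:(lra) ltac:(lra)) as E.
      unfold c, D, minus, plus, opp; cbn. lra. }
  assert (Hc : forall x, Rabs (c x - dfamp v (r0 x)) <= eta).
  { intros x. destruct (Hpa x) as [_ [Hr2 _]]. destruct (Hqa x) as [_ [Hr3 _]].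
    pose proof (rho0_ge x). pose proof (rho0_lt1 x).
    destruct (Hfq (p x) (q x) (r0 x)) as [_ F]; try lra.
    assert (Cf * (Rabs (p x - r0 x) + Rabs (q x - r0 x)) <= Cf * (d + d)) by mono.
    assert (Rabs (2 * e * V x) <= 2 * Rabs e * Kv).
    { apply Rabs_mult_le; [rewrite Rabs_mult, (Rabs_right 2); lra|now apply (decays_le V (proj2
        HV))]. }
    unfold c. bound. }
  assert (cont c).
  { apply cont_plus; [|apply cont_mult; [solve_cont|apply HV]].
    assert (Hinv : forall f, cont f -> (forall x, f x <> 0) -> cont (fun x => / f x)).
    { intros f Hf Hf0 x. apply (continuous_comp f Rinv); [easy|]. now apply continuous_Rinv. }
    assert (cont (fun x => / p x)) by (apply Hinv; [easy|]; intros x; pose proof (gm_pos Hp x);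
      lra).
    assert (cont (fun x => / q x)) by (apply Hinv; [easy|]; intros x; pose proof (gm_pos Hq x);
      lra).
    unfold fq. solve_cont. }
  assert (cont D) by solve_cont. pose (al := D1 0 / famp v (r0 0)).
  assert (Happ : forall m, (forall x, Rabs (D x) <= m) -> forall x, Rabs (D x - al * zs v x) <= C *
    eta * m /\ Rabs (D1 x - al * famp v (r0 x)) <= C * eta * m).
  { intros m Hm x. destruct (Rle_dec 0 x) as [Hx|Hx].
    - eauto with real.
    - destruct (Hmode (fun x => D (- x)) (fun x => - D1 (- x)) (fun x => c (- x)) eta m) with (x :=
        - x) as [M1 M2]; try lra.
      + solve_cont.
      + solve_cont.
      + intros y _. now apply is_derive_opp_arg.
      + intros y _. replace (c (- y) * D (- y)) with (- - (c (- y) * D (- y))) by ring.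
        apply (is_derive_opp (fun y => D1 (- y))), is_derive_opp_arg, HD1.
      + intros y. rewrite <- (rho0_opp y). apply Hc.
      + easy.
      + rewrite !Ropp_involutive, Ropp_0, zs_opp, rho0_opp in *. split.
        * replace (D x - al * zs v x) with (D x - - D1 0 / famp v (r0 0) * - zs v x) by (unfold al,
            Rdiv; ring).
          exact M1.
        * rewrite <- Rabs_Ropp.
          replace (- (D1 x - al * famp v (r0 x))) with (- D1 x - - D1 0 / famp v (r0 0) * famp v (r0
            x)) by (unfold al, Rdiv; ring).
          exact M2. }
  assert (Hz : forall x, Rabs (zs v x) <= Cm /\ Rabs (famp v (r0 x)) <= Cm).
  { intros x. destruct (Hmodes x) as [Z1 [Z2 _]].
    assert (Cm * exp (- (2 * k) * Rabs x) <= Cm); [|lra]. rewrite <- (Rmult_1_r Cm) at 2.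
    apply Rmult_le_compat_l; [lra|]. apply exp_ge0_1. assert (0 <= k * Rabs x) by pos. lra. }
  assert (Hm : forall x, Rabs (D x) <= 2 * Cm * Rabs al).
  { destruct (completeness (fun y => exists x, y = Rabs (D x))) as [m [Hm1 Hm2]].
    - exists 4. intros y [x ->]. destruct (Hpa x) as [_ [Hr2 _]]. destruct (Hqa x) as [_ [Hr3 _]].
      unfold D. mono.
    - exists (Rabs (D 0)). now exists 0.
    - assert (Hmx : forall x, Rabs (D x) <= m) by (intros x; apply Hm1; now exists x).
      assert (Hm0 : 0 <= m) by (specialize (Hmx 0); pose proof (Rabs_pos (D 0)); lra).
      (* The approximation error is itself bounded through the supremum [m] of [|D|]; as
         [C eta <= 1 / 2] it can be absorbed. *)
      assert (m <= Cm * Rabs al + m / 2).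
      { apply Hm2. intros y [x ->]. destruct (Happ m Hmx x) as [A1 _]. destruct (Hz x) as [Z1 _].
        pose proof (Rabs_triang (D x - al * zs v x) (al * zs v x)) as Ht. rewrite Rabs_mult in Ht.
        assert (Rabs al * Rabs (zs v x) <= Rabs al * Cm) by mono.
        assert (C * eta * m <= / 2 * m) by mono. bound. }
      intros x. specialize (Hmx x). lra. }
  set (m := 2 * Cm * Rabs al) in *.
  assert (al * Mdd V + intR (fun x => V x * (2 * (p x * p1 x - q x * q1 x) - al * dr2 (zs v) (fun y
    => famp v (r0 y)) x)) = 0).
  { destruct (expdom_momentum e p p1 Hp) as [Mp HMp].
    destruct (expdom_momentum e q q1 Hq) as [Mq HMq].
    assert (Hdr : expdom (Kv * (2 * (Cm * Cm + Cm))) a (fun x => V x * dr2 (zs v) (fun y => famp v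
      (r0 y)) x)).
    { apply expdom_mult; [easy| |].
      - apply cont_dr2; [apply cont_zs|].
        apply (cont_of_derive _ (fun x => dfamp v (r0 x) * zs v x)). intros x.
        apply is_derive_famp; [pose proof (rho0_pos x); lra|derive].
      - intros x. destruct (Hz x). now apply dr2_bound. }
    pose proof (momentum_integral e p p1 He0 Hp) as I1.
    pose proof (momentum_integral e q q1 He0 Hq) as I2.
    assert (Hpq : expdom (Mp + Mq * Rabs (-1)) a (fun x => V x * (2 * p x * p1 x) + -1 * (V x * (2 *
      q x * q1 x)))).
    { apply expdom_plus; [easy|].
      apply (expdom_ext _ _ (fun x => V x * (2 * q x * q1 x) * -1)); [bound|].
      apply expdom_mult; [easy|solve_cont|easy]. }
    rewrite (intR_ext _ (fun x => (V x * (2 * p x * p1 x) + -1 * (V x * (2 * q x * q1 x))) + - al *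
      (V x * dr2 (zs v) (fun y => famp v (r0 y)) x))) by bound.
    rewrite (intR_lin _ _ a _ _ (- al) Ha Hpq Hdr), (intR_lin Mp Mq a _ _ (-1) Ha HMp HMq), I1, I2.
    fold (Mdd V). ring. }
  assert (Rabs (intR (fun x => V x * (2 * (p x * p1 x - q x * q1 x) - al * dr2 (zs v) (fun y => famp
    v (r0 y)) x))) <= Ctot * eta * Rabs al).
  { eapply Rle_trans.
    - apply (intR_bound (Kv * ((2 * (2 * C * Cm * (Cm + 2) + 3 * Cm)) * eta * Rabs al)) a); [easy|].
      apply expdom_mult; [easy| |].
      + assert (cont (dr2 (zs v) (fun y => famp v (r0 y)))).
        { apply cont_dr2; [apply cont_zs|].
          apply (cont_of_derive _ (fun x => dfamp v (r0 x) * zs v x)). intros x.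
          apply is_derive_famp; [pose proof (rho0_pos x); lra|derive]. }
        solve_cont.
      + intros x. destruct (Happ m Hm x) as [A1 A2]. destruct (Hz x) as [Z1 Z2]. specialize (Hp1 x).
        specialize (Hqd x). pose proof (rho0_pos x). pose proof (rho0_lt1 x).
        pose proof (Rabs_pos al) as Hal.
        assert (Hm0 : C * eta * m = 2 * C * Cm * eta * Rabs al) by (unfold m; ring).
        assert (Rabs (D1 x) <= 2 * Cm * Rabs al).
        { pose proof (Rabs_triang (D1 x - al * famp v (r0 x)) (al * famp v (r0 x))) as Ht.
          rewrite Rabs_mult in Ht. assert (Rabs al * Rabs (famp v (r0 x)) <= Rabs al * Cm) by mono.
          assert (C * eta * m <= / 2 * m) by (apply Rmult_le_compat_r; [unfold m; pose proof
            (Rmult_le_pos Cm (Rabs al)); lra|lra]).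
          unfold m in *. bound. }
        assert (Rabs (p1 x) <= Cm + 1). { bound. }
        replace (2 * (p x * p1 x - q x * q1 x) - al * dr2 (zs v) (fun y => famp v (r0 y)) x) with (2
          * ((D x - al * zs v x) * p1 x + (al * zs v x) * (p1 x - zs v x) + (q x - r0 x) * D1 x + r0
          x * (D1 x - al * famp v (r0 x)))) by (unfold D, D1, dr2; ring).
        replace (2 * (2 * C * Cm * (Cm + 2) + 3 * Cm) * eta * Rabs al) with (2 * ((2 * C * Cm * eta
          * Rabs al) * (Cm + 1) + (Rabs al * Cm) * eta + eta * (2 * Cm * Rabs al) + 1 * (2 * C * Cm
          * eta * Rabs al))) by ring.
        mono.
    - unfold Ctot. lra. }
  assert (Hal : al = 0).
  { destruct (Req_dec al 0) as [|Hn]; [easy|exfalso]. apply Rabs_pos_lt in Hn.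
    assert (E : Rabs (al * Mdd V) <= Ctot * eta * Rabs al) by bound. rewrite Rabs_mult in E. nra. }
  intros x. specialize (Hm x). unfold m in Hm. rewrite Hal, Rabs_R0, Rmult_0_r in Hm.
  unfold D in Hm. bound.
Qed.

End Potential.

(** * Uniqueness of continuous families of amplitudes *)

Lemma rho0_far (h : R) : 0 < h -> exists T, 0 < T /\ forall x, T <= Rabs x -> 1 - h <= r0 x.
Proof.
  intros Hh. pose proof kap_pos as Hk.
  destruct (exp_small (2 * k) (h / 4)) as [T [HT H]]; [lra|lra|]. exists T. splits. intros x Hx.
  specialize (H (Rabs x) Hx). pose proof (rho0_near1 x). lra.
Qed.

(** Close to the soliton every dip lies within [T] of 0 and one lies in [(-1, 1)], whereas distinct
    dips are more than [T + 1] apart. *)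
Lemma single_dip : exists e1 d, 0 < e1 /\ 0 < d /\ forall e V p p1, Rabs e <= e1 -> decays V ->
  gm v e V p p1 -> (forall x, Rabs (p x - r0 x) <= d) ->
  exists X, -1 < X < 1 /\ dip p p1 X /\ forall x, dip p p1 x -> x = X.
Proof.
  pose proof vabs_bounds. assert (Rabs v < r0 (/ 2)).
  { pose proof (rho0_sq (/ 2)) as Hs. pose proof (th_pos (/ 2) ltac:(lra)).
    pose proof (rho0_pos (/ 2)). assert (0 < k * th v (/ 2)) by pos. rewrite <- (pow2_abs v) in Hs.
    nra. }
  pose (d := Rmin ((r0 (/ 2) - Rabs v) / 4) ((1 - Rabs v) / 8)).
  assert (0 < d /\ d <= (r0 (/ 2) - Rabs v) / 4 /\ d <= (1 - Rabs v) / 8) by bound.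
  destruct (rho0_far ((1 - Rabs v) / 8)) as [T [HT Hfar]]; [lra|].
  destruct (dip_spacing (T + 1) ltac:(lra)) as [e1 [He1 Hsp]].
  destruct (dip_between ((1 - Rabs v) / 2) ltac:(lra)) as [e2 [He2 Hbet]]. exists (Rmin e1 e2), d.
  splits. intros e V p p1 He HV Hg Hp. minmax. pose proof (Hp 0) as P0. pose proof (Hp (/ 2)) as P1.
  pose proof (Hp (- / 2)) as P2. rewrite rho0_0 in P0. rewrite rho0_opp in P2.
  apply Rabs_le_between in P0. apply Rabs_le_between in P1. apply Rabs_le_between in P2.
  destruct (Hbet e V p p1 ltac:(lra) HV Hg (- / 2) (/ 2) 0) as [X [HX HdX]]; try lra. exists X.
  splits. intros x Hx. assert (HxT : Rabs x < T).
  { destruct (Rlt_dec (Rabs x) T) as [|Hn]; [easy|exfalso]. specialize (Hfar x ltac:(lra)).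
    destruct Hx as [_ Hx]. specialize (Hp x). bound. }
  apply Rabs_def2 in HxT. destruct (Rtotal_order x X) as [Hlt|[|Hlt]]; [|easy|].
  - pose proof (Hsp e V p p1 ltac:(lra) HV Hg x X Hx HdX Hlt). lra.
  - pose proof (Hsp e V p p1 ltac:(lra) HV Hg X x HdX Hx Hlt). lra.
Qed.

Lemma gfam_opp (lo hi : R) (V : R -> R) (P P1 : R -> R -> R) : gfam lo hi V P P1 ->
  gfam lo hi (fun x => V (- x)) (fun e x => P e (- x)) (fun e x => - P1 e (- x)).
Proof.
  intros [H1 H2]. split.
  - intros e He. now apply gm_opp, H1.
  - auto.
Qed.

(** On a compact interval the convergence is uniform. Outside, [right_bound], used on both sides by
    reflection, excludes new dips, and without dips the amplitude cannot drop away from 1. *)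
Lemma stays_close (V : R -> R) (h : R) : cont V -> decays V -> 0 < h -> exists e1 d, 0 < e1 /\ 0 < d /\
  forall lo hi P P1, - e1 <= lo -> hi <= e1 -> 0 <= lo \/ hi <= 0 -> gfam lo hi V P P1 ->
  forall e, lo < e < hi -> (forall x, Rabs (P e x - r0 x) <= d) ->
  exists t, 0 < t /\ forall e', lo < e' < hi -> Rabs (e' - e) < t -> forall x, Rabs (P e' x - r0 x) <= h.
Proof.
  intros HcV HV Hh. destruct single_dip as [e1 [d1 [He1 [Hd1 Hsd]]]].
  destruct (right_bound V HcV HV) as [e2 [He2 Hr]].
  destruct (right_bound _ (cont_opp_arg V HcV) (decays_opp V HV)) as [e3 [He3 Hl]].
  destruct (family_locally_uniform) as [e4 [He4 Hu]]. pose (h' := h / 2).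
  assert (Hh' : 0 < h') by (unfold h'; lra). destruct (dip_after h' Hh') as [e5 [He5 Haft]].
  destruct (apriori h' Hh') as [e6 [He6 Hap]].
  destruct (rho0_far (h' / 4)) as [T [HT Hfar]]; [lra|].
  pose (ee := Rmin (Rmin (Rmin e1 e2) (Rmin e3 e4)) (Rmin e5 e6)). exists ee, (Rmin d1 (h' / 4)).
  assert (0 < ee /\ ee <= e1 /\ ee <= e2 /\ ee <= e3 /\ ee <= e4 /\ ee <= e5 /\ ee <= e6) by bound.
  splits. intros lo hi P P1 Hlo Hhi H0 Hf e He Hpe. pose proof (gf_gm Hf e He) as Hg.
  destruct (Hsd e V _ _ ltac:(apply Rabs_le; lra) HV Hg) as [X [HX [HdX Hun]]].
  { intros x. specialize (Hpe x). bound. }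
  destruct (Hr lo hi P P1 ltac:(lra) ltac:(lra) H0 Hf e X He HX HdX) as [M1 [t1 [Ht1 HM1]]].
  { intros x Hx Hd. apply Hun in Hd. lra. }
  destruct (Hl lo hi _ _ ltac:(lra) ltac:(lra) H0 (gfam_opp _ _ _ _ _ Hf) e (- X) He ltac:(lra)
    (dip_opp HdX)) as [M2 [t2 [Ht2 HM2]]].
  { intros x Hx Hd. apply dip_opp_inv, Hun in Hd. lra. } pose (L := Rmax T (Rmax M1 M2)).
  assert (T <= L /\ M1 <= L /\ M2 <= L) by bound.
  destruct (Hu V lo hi P P1 ltac:(lra) ltac:(lra) HV Hf e (- L) L (h' / 4) He ltac:(lra)) as [t3
    [Ht3 HM3]].
  exists (Rmin (Rmin t1 t2) t3). split; [pos|]. intros e' He' Het x.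
  pose proof (Rmin_r (Rmin t1 t2) t3).
  assert (Hin : forall y, - L <= y <= L -> Rabs (P e' y - r0 y) <= h' / 2).
  { intros y Hy. pose proof (HM3 e' He' ltac:(lra) y Hy) as B1. specialize (Hpe y). bound. }
  pose proof (gf_gm Hf e' He') as Hg'. assert (Rabs e' <= ee) by mono.
  assert (Hout : forall W p p1, decays W -> gm v e' W p p1 -> Rabs (p L - r0 L) <= h' / 2 -> (forall
    y, L < y -> ~ dip p p1 y) -> forall y, L <= y -> Rabs (p y - r0 y) <= h).
  { intros W p p1 HW Hgp HpL Hno y Hy. destruct (Hap e' W p p1 ltac:(lra) HW Hgp y) as [B1 _].
    pose proof (Hfar y ltac:(rewrite Rabs_right; lra)). pose proof (rho0_lt1 y).
    pose proof (Hfar L ltac:(rewrite Rabs_right; lra)). apply Rabs_le_between in HpL.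
    assert (1 - h' <= p y).
    { destruct (Rle_dec (1 - h') (p y)) as [|Hn]; [easy|exfalso].
      destruct (Req_dec y L) as [->|Hne]; [lra|].
      destruct (Haft e' W p p1 ltac:(lra) HW Hgp L y) as [c [Hc1 Hc2]]; try lra.
      apply (Hno c); [lra|easy]. }
    apply Rabs_le. unfold h' in *. lra. }
  destruct (Rle_dec L x) as [HLx|HLx]; [|destruct (Rle_dec L (- x)) as [HLx'|HLx']].
  - apply (Hout V (P e') (P1 e')); try easy; [apply Hin; lra|]. intros y Hy.
    apply (HM1 e' He'); bound.
  - pose proof (Hout (fun x => V (- x)) (fun x => P e' (- x)) (fun x => - P1 e' (- x)) (decays_opp V
      HV) (gm_opp Hg')) as G.
    assert (Gx : Rabs (P e' (- - x) - r0 (- x)) <= h).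
    { apply G; [rewrite <- (rho0_opp L); apply Hin; lra| |lra]. intros y Hy.
      apply (HM2 e' He'); bound. }
    now rewrite Ropp_involutive, rho0_opp in Gx.
  - specialize (Hin x ltac:(lra)). unfold h' in *. lra.
Qed.

Lemma gfam_sub (lo hi lo' hi' : R) (V : R -> R) (P P1 : R -> R -> R) : lo <= lo' -> hi' <= hi ->
  gfam lo hi V P P1 -> gfam lo' hi' V P P1.
Proof.
  intros Hlo Hhi [H1 H2]. split.
  - intros e He. apply H1. lra.
  - intros x e d He Hd. destruct (H2 x e d ltac:(lra) Hd) as [t [Ht H]]. exists t. splits.
    intros e' He'. apply H. lra.
Qed.

(** On each side of 0 the parameters where both families agree form a nonempty set, closed by
    pointwise continuity and open by [stays_close] followed by [local_uniqueness]. Parameter 0,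
    where the momentum identity says nothing, is reached by continuity. *)
Lemma amplitude_uniqueness (V : R -> R) (e0 : R) (R R1 : R -> R -> R) : expdom Kv a V -> Mdd V <> 0 ->
  0 < e0 -> gfam (- e0) e0 V R R1 ->
  (forall d, 0 < d -> exists t, 0 < t /\ forall e, Rabs e < t -> forall x, Rabs (R e x - r0 x) <= d) ->
  exists eps0, 0 < eps0 <= e0 /\ forall P P1, gfam (- eps0) eps0 V P P1 ->
  (forall d, 0 < d -> exists t, 0 < t /\ forall e, e <> 0 -> Rabs e < t -> forall x, Rabs (P e x - r0 x) <= d) ->
  forall e, - eps0 < e < eps0 -> forall x, P e x = R e x.
Proof.
  intros HV HMdd He0 HR HRlim. destruct (local_uniqueness V HV HMdd) as [e1 [d [He1 [Hd Hloc]]]].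
  destruct (stays_close V d (proj1 HV) (proj2 HV) Hd) as [e2 [d2 [He2 [Hd2 Hst]]]].
  destruct (HRlim (Rmin d d2)) as [t0 [Ht0 HRc]]; [now apply Rmin_glb_lt|].
  pose (eps0 := Rmin (Rmin e0 e1) (Rmin e2 t0)). exists eps0.
  assert (Heps : 0 < eps0 /\ eps0 <= e0 /\ eps0 <= e1 /\ eps0 <= e2 /\ eps0 <= t0) by bound.
  split; [lra|]. intros P P1 HP HPlim. apply (gfam_sub _ _ (- eps0) eps0) in HR; [|lra|lra].
  pose (A := fun e => forall x, P e x = R e x).
  assert (Hnear : forall e, - eps0 < e < eps0 -> e <> 0 -> (forall x, Rabs (P e x - r0 x) <= d) -> A
    e).
  { intros e He Hne Hc x. assert (Ee : Rabs e < eps0) by bound.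
    apply (Hloc e (P e) (P1 e) (R e) (R1 e)); try easy; [lra|now apply HP|now apply HR|]. intros y.
    specialize (HRc e ltac:(lra) y). bound. }
  destruct (HPlim d Hd) as [t [Ht HPt]].
  assert (Hclosed : forall s, - eps0 < s < eps0 -> ~ A s -> exists r, 0 < r /\ forall s', - eps0 <
    s' < eps0 -> Rabs (s' - s) < r -> ~ A s').
  { intros s Hs HnA. assert (Hx : exists x, P s x <> R s x).
    { apply NNPP. intros Hne. apply HnA. intros x. apply NNPP. eauto. }
    destruct Hx as [x Hx]. assert (Hg : 0 < Rabs (P s x - R s x)) by pos.
    destruct (gf_cont HP x s (Rabs (P s x - R s x) / 2) Hs ltac:(lra)) as [r1 [Hr1 C1]].
    destruct (gf_cont HR x s (Rabs (P s x - R s x) / 2) Hs ltac:(lra)) as [r2 [Hr2 C2]].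
    exists (Rmin r1 r2). split; [pos|]. intros s' Hs' Hss HA. pose proof (Rmin_l r1 r2).
    pose proof (Rmin_r r1 r2). specialize (C1 s' Hs' ltac:(lra)). specialize (C2 s' Hs' ltac:(lra)).
    rewrite HA in C1. pose proof (Rabs_triang (- (R s' x - P s x)) (R s' x - R s x)) as Htr.
    rewrite Rabs_Ropp in Htr.
    replace (- (R s' x - P s x) + (R s' x - R s x)) with (P s x - R s x) in Htr by ring. lra. }
  assert (Hopen : forall lo hi, - eps0 <= lo -> hi <= eps0 -> 0 <= lo \/ hi <= 0 -> forall s, lo < s
    < hi -> A s -> exists r, 0 < r /\ forall s', lo < s' < hi -> Rabs (s' - s) < r -> A s').
  { intros lo hi Hlo Hhi H0 s Hs HA.
    destruct (Hst lo hi P P1 ltac:(lra) ltac:(lra) H0 (gfam_sub _ _ _ _ V P P1 Hlo Hhi HP) s Hs) as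
      [r [Hr H]].
    { intros x. rewrite HA. specialize (HRc s ltac:(apply Rabs_def1; lra) x). bound. } exists r.
    splits. intros s' Hs' Hss. apply Hnear; [lra|lra|]. now apply H. }
  assert (Hsmall : forall s, - eps0 < s < eps0 -> s <> 0 -> Rabs s < t -> A s) by auto.
  assert (Hpos : forall e, 0 < e < eps0 -> A e).
  { intros e He.
    destruct (Rlt_dec e t) as [|Hn]; [apply Hsmall; [lra|lra|rewrite Rabs_right; lra]|].
    replace e with (- - e) by ring.
    apply (open_closed (fun s => A (- s)) (- e) (- (t / 2))); [lra| | |].
    - intros s Hs HA.
      destruct (Hopen 0 eps0 ltac:(lra) ltac:(lra) ltac:(lra) (- s) ltac:(lra) HA) as [r [Hr H]].
      exists r. splits. intros s' Hs' Hss. apply H; [lra|]. bound.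
    - intros s Hs HA. destruct (Hclosed (- s) ltac:(lra) HA) as [r [Hr H]]. exists r. splits.
      intros s' Hs' Hss. apply H; [lra|]. bound.
    - apply Hsmall; [lra|lra|bound]. }
  assert (Hneg : forall e, - eps0 < e < 0 -> A e).
  { intros e He.
    destruct (Rlt_dec (- t) e) as [|Hn]; [apply Hsmall; [lra|lra|rewrite Rabs_left; lra]|].
    apply (open_closed A e (- (t / 2))); [lra| | |].
    - intros s Hs HA.
      destruct (Hopen (- eps0) 0 ltac:(lra) ltac:(lra) ltac:(lra) s ltac:(lra) HA) as [r [Hr H]].
      exists r. splits. intros s' Hs' Hss. apply H; [lra|easy].
    - intros s Hs HA. destruct (Hclosed s ltac:(lra) HA) as [r [Hr H]]. exists r. splits.
      intros s' Hs' Hss. apply H; [lra|easy].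
    - apply Hsmall; [lra|lra|bound]. }
  intros e He. destruct (Rtotal_order e 0) as [Hlt|[->|Hgt]]; [now apply Hneg| |apply Hpos; lra].
  apply NNPP. intros HnA. destruct (Hclosed 0 He HnA) as [r [Hr H]].
  pose (s := Rmin (r / 2) (eps0 / 2)). assert (Hs : 0 < s /\ s <= r / 2 /\ s <= eps0 / 2) by bound.
  apply (H s); [lra|bound|apply Hpos; lra].
Qed.

End GrayAmplitudes.

(** * The effective potential *)

Lemma antiderivative_lim (f : R -> R) (K g : R) : 0 < g -> expdom K g f ->
  is_lim (fun x => RInt f 0 x) p_infty (tail f 0) /\
  is_lim (fun x => RInt f 0 x) m_infty (- tail (fun z => f (- z)) 0).
Proof.
  intros Hg Hf. pose proof (expdom_ge0 Hf) as HK. pose proof (expdom_opp _ _ _ Hf) as Hf'. split.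
  - apply (tail_correct f 0 K g 0); [apply Hf|easy|easy|]. intros z _. rewrite Rminus_0_r. apply Hf.
  - assert (H : is_lim (fun x => RInt (fun z => f (- z)) 0 x) p_infty (tail (fun z => f (- z)) 0)).
    { apply (tail_correct _ 0 K g 0); [apply Hf'|easy|easy|]. intros z _. rewrite Rminus_0_r.
      apply Hf'. }
    apply is_lim_opp in H. apply is_lim_opp_arg in H. eapply is_lim_ext; [|exact H]. intros x.
    cbv beta. rewrite RInt_opp_arg by apply Hf. rewrite Ropp_involutive.
    rewrite <- (opp_RInt_swap (V := R_CompleteNormedModule) f x 0) by (apply ex_RInt_cont, Hf).
    reflexivity.
Qed.

Lemma intR_shift (f : R -> R) (K g s : R) : 0 < g -> expdom K g f ->
  intR (fun x => f (x + s)) = intR f.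
Proof.
  intros Hg Hf. destruct (antiderivative_lim f K g Hg Hf) as [H1 H2].
  replace (intR f) with (tail f 0 - - tail (fun z => f (- z)) 0) by (unfold intR; ring).
  pose proof (expdom_ge0 Hf).
  apply (intR_derive (K * exp (g * Rabs s)) g (fun x => RInt f 0 (x + s))); [easy| | | |].
  - split.
    + solve_cont.
    + intros z. eapply Rle_trans; [apply Hf|]. rewrite Rmult_assoc, <- exp_plus.
      apply Rmult_le_compat_l; [easy|]. apply exp_le. pose proof (Rabs_triang (z + s) (- s)) as Ht.
      replace (z + s + - s) with z in Ht by ring. rewrite Rabs_Ropp in Ht. nra.
  - intros x. evar_last.
    + apply (is_derive_comp (fun x => RInt f 0 x) (fun x => x + s)).
      * apply is_derive_RInt_cont, Hf.
      * auto_derive; easy.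
    + eauto with real.
  - apply (is_lim_comp (fun x => RInt f 0 x) (fun x => x + s) p_infty _ p_infty); [easy| |exists 0;
      intros; easy].
    apply (is_lim_plus (fun x => x) (fun _ => s) p_infty p_infty s); [easy|apply is_lim_const|easy].
  - apply (is_lim_comp (fun x => RInt f 0 x) (fun x => x + s) m_infty _ m_infty); [easy| |exists 0;
      intros; easy].
    apply (is_lim_plus (fun x => x) (fun _ => s) m_infty m_infty s); [easy|apply is_lim_const|easy].
Qed.

Section Effective.

Context {sp : speed}.
Notation v := (@vel sp).
Notation k := (kap v).
Notation r0 := (rho0 v).

(** The derivative of the density [|phi_0|^2 = rho0^2]; [dN1] is the second derivative. *)
Definition dN (x : R) : R := 2 * (r0 x * zs v x).
Definition dN1 (x : R) : R := dr2 (zs v) (fun y => famp v (r0 y)) x.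

Lemma Cmod_soliton (x : R) : Cmod (soliton v x) ^ 2 = r0 x ^ 2.
Proof.
  rewrite rho0_sq. unfold soliton, Cmod. cbn [fst snd]. rewrite pow2_sqrt.
  - fold (kap v). unfold th. ring.
  - pos.
Qed.

Lemma is_derive_dN (x : R) : is_derive dN x (dN1 x).
Proof. pose proof (is_derive_rho0 x). pose proof (is_derive_zs x). unfold dN, dN1, dr2. derive. Qed.

Lemma dN_bounds : exists C, 0 < C /\ (forall x, Rabs (dN x) <= C) /\ (forall x, Rabs (dN1 x) <= C) /\
  forall x y, Rabs (dN1 y - dN1 x) <= C * Rabs (y - x).
Proof.
  destruct modes_bound as [Cm [HCm Hmodes]]. destruct dfamp_rho0_bound as [Cd [HCd Hd]].
  assert (Hz : forall x, Rabs (zs v x) <= Cm /\ Rabs (famp v (r0 x)) <= Cm).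
  { intros x. destruct (Hmodes x) as [Z1 [Z2 _]].
    assert (Hle : Cm * exp (- (2 * k) * Rabs x) <= Cm); [|lra]. rewrite <- (Rmult_1_r Cm) at 2.
    apply Rmult_le_compat_l; [lra|]. apply exp_ge0_1. assert (0 <= k * Rabs x) by pos. lra. }
  assert (Hr : forall x, Rabs (r0 x) <= 1). { intros x. pose proof (rho0_lt1 x). mono. }
  pose (C2 := 2 * (3 * (Cm * Cm) + Cd * Cm)). assert (HC2 : 0 < C2). { unfold C2. pos. }
  exists (2 * Cm + 2 * (Cm * Cm + Cm) + C2). assert (HCC : 0 < Cm * Cm) by pos. splits.
  split; [|split].
  - intros x. unfold dN. destruct (Hz x) as [Z1 _].
    assert (Rabs (2 * (r0 x * zs v x)) <= 2 * (1 * Cm)); [|lra]. mono.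
  - intros x. unfold dN1. destruct (Hz x) as [Z1 Z2].
    pose proof (dr2_bound (zs v) (fun y => famp v (r0 y)) Cm Cm x Z1 Z1 Z2). lra.
  - assert (Hd2 : forall z, is_derive dN1 z (2 * (3 * (zs v z * famp v (r0 z)) + r0 z * (dfamp v (r0
      z) * zs v z)))).
    { intros z. pose proof (is_derive_rho0 z) as H1. pose proof (is_derive_zs z).
      pose proof (is_derive_famp r0 z (zs v z) ltac:(pose proof (rho0_pos z); lra) H1) as H3.
      assert (G : forall f l, is_derive f z l -> is_derive (fun x => 2 * (zs v x * zs v x + r0 x * f
        x)) z (2 * (2 * (zs v z * famp v (r0 z)) + zs v z * f z + r0 z * l))) by derive.
      derive. }
    assert (forall z, Rabs (2 * (3 * (zs v z * famp v (r0 z)) + r0 z * (dfamp v (r0 z) * zs v z)))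
      <= C2).
    { intros z. destruct (Hz z) as [Z1 Z2]. apply Rabs_mult_le; [mono|]. triangle.
      apply Rplus_le_compat.
      - mono.
      - rewrite <- (Rmult_1_l (Cd * Cm)). mono. }
    assert (Hle : forall x y, x <= y -> Rabs (dN1 y - dN1 x) <= C2 * (y - x)).
    { intros x y Hxy.
      apply (derive_abs_le dN1 (fun z => 2 * (3 * (zs v z * famp v (r0 z)) + r0 z * (dfamp v (r0 z)
        * zs v z)))); auto. }
    intros x y. assert (0 <= (2 * Cm + 2 * (Cm * Cm + Cm)) * Rabs (y - x)) by pos.
    destruct (Rle_dec x y) as [Hxy|Hxy].
    + specialize (Hle x y Hxy). rewrite (Rabs_right (y - x)) in * by lra. lra.
    + specialize (Hle y x ltac:(lra)). rewrite Rabs_minus_sym.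
      rewrite (Rabs_left (y - x)) in * by lra. lra.
Qed.

Variables (V : R -> R) (s0 a Kv : R).
Hypothesis Ha : 0 < a.
Hypothesis HV : expdom Kv a V.
Hypothesis HVd : forall x, is_derive V x (Derive V x).
Hypothesis HVc : cont (Derive V).

(** Integration by parts: [V (1 - rho0^2)] vanishes at both ends, and moving the derivative to the
    profile leaves an integrand dominated by the decay of [V] itself. *)
Lemma dM_eq (s : R) : dM v V s = intR (fun x => V x * dN (x - s)).
Proof.
  destruct dN_bounds as [C [HC [HN _]]]. assert (HcN : cont (fun x => dN (x - s))).
  { apply (cont_comp dN (fun x => x - s)); [apply (cont_of_derive _ _ is_derive_dN)|]. solve_cont. }
  pose (f := fun x => V x * dN (x - s)).
  assert (Hf : expdom (Kv * C) a f) by (apply expdom_mult; [easy|easy|easy]).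
  pose (n := fun x => 1 - r0 (x - s) ^ 2). assert (Hn : forall x, is_derive n x (- dN (x - s))).
  { intros x. pose proof (is_derive_rho0 (x - s)) as H1. unfold n, dN.
    auto_derive; [solve_ex_derive|]. unfold Rminus in *. rewrite (Derive_eta H1). ring. }
  pose (H := fun x => V x * n x + RInt f 0 x).
  assert (HH : forall x, is_derive H x (Derive V x * n x)).
  { intros x. evar_last.
    - apply (is_derive_plus (fun x => V x * n x)).
      + apply (is_derive_mult V n); [apply HVd|apply Hn|]. eauto with real.
      + apply (is_derive_RInt_cont f), Hf.
    - unfold plus, mult, f; cbn. ring. }
  assert (Hcn : cont n) by solve_cont. destruct (antiderivative_lim f _ a Ha Hf) as [L1 L2].
  assert (is_lim (fun x => V x * n x) p_infty 0 /\ is_lim (fun x => V x * n x) m_infty 0).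
  { apply (exp_decay_lim _ (Kv * 1) a Ha). intros x.
    pose proof (expdom_mult Kv 1 a V n HV Hcn) as [_ Hb]; [|apply Hb]. intros y. unfold n.
    pose proof (rho0_pos (y - s)). pose proof (rho0_lt1 (y - s)). apply Rabs_le. nra. }
  assert (LH1 : is_lim H p_infty (Finite (tail f 0))).
  { rewrite <- (Rplus_0_l (tail f 0)).
    now apply (is_lim_plus (fun x => V x * n x) (fun x => RInt f 0 x) p_infty 0 (tail f 0)). }
  assert (LH2 : is_lim H m_infty (Finite (- tail (fun z => f (- z)) 0))).
  { rewrite <- (Rplus_0_l (- tail (fun z => f (- z)) 0)).
    now apply (is_lim_plus (fun x => V x * n x) (fun x => RInt f 0 x) m_infty 0 (- tail (fun z => f
      (- z)) 0)). }
  unfold dM. apply is_RInt_gen_unique. apply (is_RInt_gen_ext (Derive H)).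
  { apply filter_forall. intros [x y] z _. rewrite (is_derive_unique _ _ _ (HH z)).
    rewrite Cmod_soliton. reflexivity. }
  change (intR (fun x => V x * dN (x - s))) with (tail f 0 + tail (fun z => f (- z)) 0).
  replace (tail f 0 + tail (fun z => f (- z)) 0) with (tail f 0 - - tail (fun z => f (- z)) 0) by
    ring.
  apply is_RInt_gen_Derive.
  - apply filter_forall. intros [x y] z _. eexists. apply HH.
  - apply filter_forall. intros [x y] z _. apply (continuous_ext (fun x => Derive V x * n x)).
    { intros t. symmetry. apply is_derive_unique, HH. }
    apply (cont_mult (Derive V) n HVc Hcn).
  - exact LH2.
  - exact LH1.
Qed.

(** As [dN1] is Lipschitz, the Taylor remainder of [dN] is at most [C h^2] uniformly in [x], and its
    integral against [V] is [O(h^2)]. The sign comes from [s] entering through [x - s]. *)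
Lemma is_derive_dM : is_derive (dM v V) s0 (- Mdd (fun y => V (y + s0))).
Proof.
  destruct dN_bounds as [C [HC [HN [HN1 HNL]]]].
  assert (HcN : forall s, cont (fun x => dN (x - s))).
  { intros s. apply (cont_comp dN (fun x => x - s)); [apply (cont_of_derive _ _ is_derive_dN)|].
    solve_cont. }
  assert (HcN1 : cont (fun x => dN1 (x - s0))).
  { assert (cont dN1).
    { apply cont_dr2; [apply cont_zs|]. apply (cont_of_derive _ (fun x => dfamp v (r0 x) * zs v x)).
      intros x. apply is_derive_famp; [pose proof (rho0_pos x); lra|derive]. }
    apply (cont_comp dN1 (fun x => x - s0)); [easy|]. solve_cont. }
  assert (HF : forall s, expdom (Kv * C) a (fun x => V x * dN (x - s))).
  { intros s. apply expdom_mult; [easy|easy|easy]. }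
  assert (HF1 : expdom (Kv * C) a (fun x => V x * dN1 (x - s0))).
  { apply expdom_mult; [easy|easy|easy]. }
  assert (EM : Mdd (fun y => V (y + s0)) = intR (fun x => V x * dN1 (x - s0))).
  { rewrite <- (intR_shift _ (Kv * C) a s0 Ha HF1). apply intR_ext. intros x.
    now replace (x + s0 - s0) with x by ring. }
  pose proof (expdom_ge0 HV) as HK0. pose (B := 2 * PI / a * (Kv * C)). assert (HB : 0 <= B).
  { unfold B. pos. }
  assert (key : forall h, Rabs (dM v V (s0 + h) - dM v V s0 - h * - Mdd (fun y => V (y + s0))) <= B
    * h ^ 2).
  { intros h. rewrite !dM_eq, EM.
    assert (E : intR (fun x => V x * (dN (x - (s0 + h)) - dN (x - s0) + h * dN1 (x - s0))) = intR
      (fun x => V x * dN (x - (s0 + h))) - intR (fun x => V x * dN (x - s0)) + h * intR (fun x => V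
      x * dN1 (x - s0))).
    { rewrite (intR_ext _ (fun x => (V x * dN (x - (s0 + h)) + -1 * (V x * dN (x - s0))) + h * (V x
        * dN1 (x - s0)))) by bound.
      rewrite (intR_lin (Kv * C + Kv * C * Rabs (-1)) (Kv * C) a); [|easy| |easy].
      - rewrite (intR_lin (Kv * C) (Kv * C) a); [ring|easy|easy|easy].
      - apply expdom_plus; [easy|].
        apply (expdom_ext _ _ (fun x => V x * dN (x - s0) * -1)); [bound|].
        apply expdom_mult; [easy|solve_cont|easy]. }
    replace (intR (fun x => V x * dN (x - (s0 + h))) - intR (fun x => V x * dN (x - s0)) - h * -
      intR (fun x => V x * dN1 (x - s0))) with (intR (fun x => V x * (dN (x - (s0 + h)) - dN (x -
      s0) + h * dN1 (x - s0)))) by lra.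
    replace (B * h ^ 2) with (2 * PI / a * (Kv * (C * h ^ 2))) by (unfold B; field; lra).
    apply (intR_bound _ a); [easy|]. apply expdom_mult; [easy| |].
    - apply (cont_ext (fun x => dN (x - (s0 + h)) + -1 * dN (x - s0) + h * dN1 (x - s0))); [bound|].
      apply cont_plus; [apply cont_plus; [easy|]|]; apply cont_mult; auto using cont_const.
    - intros x. set (y := x - s0). replace (x - (s0 + h)) with (y - h) by (unfold y; ring).
      assert (Hg : forall z, is_derive (fun z => dN (y - z) + z * dN1 y) z (- dN1 (y - z) + dN1 y)).
      { intros z. pose proof (is_derive_dN (y - z)) as H1. unfold Rminus in *.
        auto_derive; [solve_ex_derive|]. rewrite (Derive_eta H1). ring. }
      assert (Hgb : forall z, Rabs (- dN1 (y - z) + dN1 y) <= C * Rabs z).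
      { intros z. replace (- dN1 (y - z) + dN1 y) with (dN1 y - dN1 (y - z)) by ring.
        eapply Rle_trans; [apply HNL|]. now replace (y - (y - z)) with z by ring. }
      replace (dN (y - h) - dN y + h * dN1 y) with ((dN (y - h) + h * dN1 y) - (dN (y - 0) + 0 * dN1
        y)) by (rewrite Rminus_0_r; ring).
      destruct (Rle_dec 0 h) as [Hh|Hh].
      + replace (C * h ^ 2) with (C * h * (h - 0)) by ring.
        apply (derive_abs_le (fun z => dN (y - z) + z * dN1 y) (fun z => - dN1 (y - z) + dN1 y));
          [easy|auto|].
        intros z Hz. eapply Rle_trans; [apply Hgb|]. mono.
      + rewrite Rabs_minus_sym. replace (C * h ^ 2) with (C * - h * (0 - h)) by ring.
        apply (derive_abs_le (fun z => dN (y - z) + z * dN1 y) (fun z => - dN1 (y - z) + dN1 y));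
          [lra|auto|].
        intros z Hz. eapply Rle_trans; [apply Hgb|]. mono. }
  apply is_derive_Reals. intros d Hd. assert (Hd0 : 0 < d / (B + 1)) by pos.
  exists (mkposreal _ Hd0). cbn. intros h Hh Hhd. specialize (key h).
  replace ((dM v V (s0 + h) - dM v V s0) / h - - Mdd (fun y => V (y + s0))) with ((dM v V (s0 + h) -
    dM v V s0 - h * - Mdd (fun y => V (y + s0))) / h) by algebra.
  unfold Rdiv. rewrite Rabs_mult, Rabs_inv. apply Rabs_pos_lt in Hh as Hp.
  apply (Rmult_lt_reg_r (Rabs h)); [easy|]. rewrite Rmult_assoc, Rinv_l by lra. rewrite Rmult_1_r.
  eapply Rle_lt_trans; [exact key|]. rewrite <- pow2_abs.
  apply (Rmult_lt_compat_r (B + 1)) in Hhd; [|lra].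
  replace (d / (B + 1) * (B + 1)) with d in Hhd by algebra. nra.
Qed.

Lemma root_condition : dM v V s0 = 0 -> intR (fun y => V (y + s0) * (2 * (r0 y * zs v y))) = 0.
Proof.
  intros H. rewrite dM_eq in H. destruct dN_bounds as [C [HC [HN _]]].
  rewrite <- (intR_shift _ (Kv * C) a s0 Ha) in H.
  - rewrite <- H. apply intR_ext. intros x. now replace (x + s0 - s0) with x by ring.
  - apply expdom_mult; [easy| |easy].
    apply (cont_comp dN (fun x => x - s0)); [apply (cont_of_derive _ _ is_derive_dN)|]. solve_cont.
Qed.

Lemma simple_condition : Derive (dM v V) s0 <> 0 -> Mdd (fun y => V (y + s0)) <> 0.
Proof. rewrite (is_derive_unique _ _ _ is_derive_dM). lra. Qed.

End Effective.

(** * Amplitude and phase *)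

Lemma is_derive_C_fst (u : R -> C) (x : R) (l : C) :
  is_derive (K := R_AbsRing) (V := C_R_NormedModule) u x l -> is_derive (fun y => fst (u y)) x (fst l).
Proof.
  intros H.
  apply (filterdiff_comp (U := R_NormedModule) (V := C_R_NormedModule) (W := R_NormedModule) u fst
    (fun y => scal y l) fst H).
  apply filterdiff_linear. apply (is_linear_fst (U := R_NormedModule) (V := R_NormedModule)).
Qed.

Lemma is_derive_C_snd (u : R -> C) (x : R) (l : C) :
  is_derive (K := R_AbsRing) (V := C_R_NormedModule) u x l -> is_derive (fun y => snd (u y)) x (snd l).
Proof.
  intros H.
  apply (filterdiff_comp (U := R_NormedModule) (V := C_R_NormedModule) (W := R_NormedModule) u snd
    (fun y => scal y l) snd H).
  apply filterdiff_linear. apply (is_linear_snd (U := R_NormedModule) (V := R_NormedModule)).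
Qed.

Lemma is_derive_C_pair (f g : R -> R) (x f1 g1 : R) : is_derive f x f1 -> is_derive g x g1 ->
  is_derive (K := R_AbsRing) (V := C_R_NormedModule) (fun y => (f y, g y)) x (f1, g1).
Proof.
  intros Hf Hg.
  apply (is_derive_ext (V := C_R_NormedModule) (fun y => plus (scal (f y) ((1, 0) :
    C_R_NormedModule)) (scal (g y) ((0, 1) : C_R_NormedModule)))).
  { intros t. unfold plus, scal; cbn. unfold prod_plus, prod_scal, plus, scal, mult; cbn.
    f_equal; ring. }
  replace ((f1, g1) : C) with (plus (scal f1 ((1, 0) : C_R_NormedModule)) (scal g1 ((0, 1) :
    C_R_NormedModule))).
  - apply (is_derive_plus (V := C_R_NormedModule)); now apply (is_derive_scal_l (V :=
      C_R_NormedModule)).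
  - unfold plus, scal; cbn. unfold prod_plus, prod_scal, plus, scal, mult; cbn. f_equal; ring.
Qed.

Definition polar (r t : R) : C := (r * cos t, r * sin t).

Lemma cis_mult (s t : R) : (cis s * cis t)%C = cis (s + t).
Proof. unfold cis, Cmult. cbn [fst snd]. rewrite cos_plus, sin_plus. f_equal; ring. Qed.

Lemma polar_cis (r s t : R) : (RtoC r * cis s * cis t)%C = polar r (s + t).
Proof.
  rewrite <- Cmult_assoc, cis_mult. unfold polar, cis, Cmult, RtoC. cbn [fst snd]. f_equal; ring.
Qed.

Lemma cos2_sin2 (t : R) : cos t ^ 2 + sin t ^ 2 = 1.
Proof. pose proof (sin2_cos2 t) as H. unfold Rsqr in H. lra. Qed.

Lemma Cmod_polar (r t : R) : 0 <= r -> Cmod (polar r t) = r.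
Proof.
  intros Hr. unfold Cmod, polar. cbn [fst snd].
  replace ((r * cos t) ^ 2 + (r * sin t) ^ 2) with (r ^ 2 * (cos t ^ 2 + sin t ^ 2)) by ring.
  rewrite cos2_sin2, Rmult_1_r. now apply sqrt_pow2.
Qed.

Section Polar.

Variables (e v Vx r r1 r2 t t1 t2 : R).

Definition polar1 : C := (r1 * cos t - r * t1 * sin t, r1 * sin t + r * t1 * cos t).
Definition polar2 : C :=
  (r2 * cos t - (2 * r1 * t1 + r * t2) * sin t - r * t1 ^ 2 * cos t,
   r2 * sin t + (2 * r1 * t1 + r * t2) * cos t - r * t1 ^ 2 * sin t).

(** Up to the rotation by [e^(i t)] the residual has real part [A] and imaginary part [B], so it
    vanishes exactly when both do; [A = 0] governs the amplitude and [B = 0] is the conservation law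
    for the phase. *)
Lemma polar_equation : 0 <= r ->
  (- (RtoC (1 / 2) * polar2) + Ci * RtoC v * polar1 - RtoC (1 - Cmod (polar r t) ^ 2) * polar r t
   + RtoC (e * Vx) * polar r t)%C = RtoC 0 <->
  r2 = r * t1 ^ 2 - 2 * v * r * t1 - 2 * (1 - r ^ 2) * r + 2 * e * Vx * r /\ 2 * r1 * t1 + r * t2 = 2 * v * r1.
Proof.
  intros Hr. rewrite Cmod_polar by easy. pose proof (cos2_sin2 t).
  assert (E : (- (RtoC (1 / 2) * polar2) + Ci * RtoC v * polar1 - RtoC (1 - r ^ 2) * polar r t +
    RtoC (e * Vx) * polar r t)%C = (let A := - (1 / 2) * (r2 - r * t1 ^ 2) - v * r * t1 - (1 - r ^
    2) * r + e * Vx * r in let B := - (1 / 2) * (2 * r1 * t1 + r * t2) + v * r1 in (A * cos t - B *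
    sin t, A * sin t + B * cos t))).
  { unfold polar, polar1, polar2, Cplus, Cminus, Copp, Cmult, RtoC, Ci. unfold Cplus; cbn [fst snd].
    f_equal; field. }
  rewrite E. set (A := - (1 / 2) * (r2 - r * t1 ^ 2) - v * r * t1 - (1 - r ^ 2) * r + e * Vx * r).
  set (B := - (1 / 2) * (2 * r1 * t1 + r * t2) + v * r1).
  assert (HAB : (A = 0 /\ B = 0) <-> (A * cos t - B * sin t, A * sin t + B * cos t) = RtoC 0).
  { split.
    - intros [-> ->]. unfold RtoC. f_equal; ring.
    - intros HE. injection HE as H1 H2. nra. }
  rewrite <- HAB. unfold A, B. lra.
Qed.

End Polar.

Lemma is_derive_polar (r r1 t t1 : R -> R) (x : R) : is_derive r x (r1 x) -> is_derive t x (t1 x) ->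
  is_derive (K := R_AbsRing) (V := C_R_NormedModule) (fun y => polar (r y) (t y)) x
    (polar1 (r x) (r1 x) (t x) (t1 x)).
Proof.
  intros Hr Ht. apply is_derive_C_pair.
  - auto_derive; [solve_ex_derive|]. rewrite (Derive_eta Hr), (Derive_eta Ht). ring.
  - auto_derive; [solve_ex_derive|]. rewrite (Derive_eta Hr), (Derive_eta Ht). ring.
Qed.

Lemma is_derive_polar1 (r r1 r2 t t1 t2 : R -> R) (x : R) : is_derive r x (r1 x) -> is_derive r1 x (r2 x) ->
  is_derive t x (t1 x) -> is_derive t1 x (t2 x) ->
  is_derive (K := R_AbsRing) (V := C_R_NormedModule) (fun y => polar1 (r y) (r1 y) (t y) (t1 y)) x
    (polar2 (r x) (r1 x) (r2 x) (t x) (t1 x) (t2 x)).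
Proof.
  intros Hr Hr1 Ht Ht1. apply is_derive_C_pair.
  - auto_derive; [solve_ex_derive|].
    rewrite (Derive_eta Hr), (Derive_eta Ht), (Derive_eta Hr1), (Derive_eta Ht1). ring.
  - auto_derive; [solve_ex_derive|].
    rewrite (Derive_eta Hr), (Derive_eta Ht), (Derive_eta Hr1), (Derive_eta Ht1). ring.
Qed.

Lemma exp_cvg_pinfty_lim (f : R -> R) (l : R) : exp_cvg_pinfty f l -> is_lim f p_infty l.
Proof.
  intros [K [a [Ha H]]]. apply is_lim_spec. intros [d Hd]. cbn. pose (K' := Rabs K + 1).
  assert (0 < K') by (unfold K'; pose proof (Rabs_pos K); lra).
  destruct (exp_small a (d / (2 * K'))) as [T [HT HE]]; [easy|apply Rdiv_lt_0_compat; lra|].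
  exists T. intros x Hx. specialize (H x ltac:(lra)). specialize (HE x ltac:(lra)).
  pose proof (exp_pos (- a * x)). assert (K * exp (- a * x) <= K' * exp (- a * x)).
  { apply Rmult_le_compat_r; [lra|]. unfold K'. bound. }
  bound.
Qed.

Lemma exp_cvg_minfty_lim (f : R -> R) (l : R) : exp_cvg_minfty f l -> is_lim f m_infty l.
Proof.
  intros H. apply exp_cvg_pinfty_lim in H. apply is_lim_opp_arg in H. eapply is_lim_ext; [|exact H].
  intros x. cbv beta. now rewrite Ropp_involutive.
Qed.

(** The imaginary part of the equation says that [r^2 (t' - v)] is constant. At [+oo] the amplitude
    tends to 1, so [t'] has a limit, which is 0 because [t] itself converges; hence the constant is
    [- v], and the real part becomes the equation with [famp]. *)
Lemma gray_mode_polar (e v : R) (V : R -> R) (u : R -> C) : gray_mode e v V u ->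
  exists r r1 t, gm v e V r r1 /\ (forall x, is_derive t x (v * (1 - / r x ^ 2))) /\
    forall x, u x = polar (r x) (t x).
Proof.
  intros [[[du [ddu [Hdu [Hddu Heq]]]] _] [_ [r [th [tm [tp [ph [Sr [St [Hpos [Rm [Rp [Tm [Tp
    Hu]]]]]]]]]]]]]].
  pose (t := fun x => th x + ph).
  assert (Hut : forall x, u x = polar (r x) (t x)) by (intros x; rewrite Hu; apply polar_cis).
  pose (r1 := Derive r). pose (r2 := Derive r1). pose (t1 := Derive th). pose (t2 := Derive t1).
  assert (Hr : forall x, is_derive r x (r1 x)) by (intros x; apply Derive_correct, (Sr 1%nat)).
  assert (Hr1 : forall x, is_derive r1 x (r2 x)) by (intros x; apply Derive_correct, (Sr 2%nat)).
  assert (Hth : forall x, is_derive th x (t1 x)) by (intros x; apply Derive_correct, (St 1%nat)).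
  assert (Ht1 : forall x, is_derive t1 x (t2 x)) by (intros x; apply Derive_correct, (St 2%nat)).
  assert (Ht : forall x, is_derive t x (t1 x)).
  { intros x.
    evar_last; [apply (is_derive_plus th (fun _ => ph)); [apply Hth|apply (is_derive_const ph)]|].
    eauto with real. }
  assert (Huniq : forall (f g : R -> C) x l l', (forall y, f y = g y) -> is_derive (K := R_AbsRing)
    (V := C_R_NormedModule) f x l -> is_derive (K := R_AbsRing) (V := C_R_NormedModule) g x l' -> l
    = l').
  { intros f g x l l' Hfg Hf Hg. apply (is_derive_ext (V := C_R_NormedModule) f g) in Hf; [|easy].
    apply injective_projections.
    - rewrite <- (is_derive_unique _ _ _ (is_derive_C_fst _ _ _ Hf)).
      now apply is_derive_unique, is_derive_C_fst.
    - rewrite <- (is_derive_unique _ _ _ (is_derive_C_snd _ _ _ Hf)).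
      now apply is_derive_unique, is_derive_C_snd. }
  assert (E1 : forall x, du x = polar1 (r x) (r1 x) (t x) (t1 x)).
  { intros x. apply (Huniq u _ x _ _ Hut (Hdu x)). now apply is_derive_polar. }
  assert (E2 : forall x, ddu x = polar2 (r x) (r1 x) (r2 x) (t x) (t1 x) (t2 x)).
  { intros x. apply (Huniq du _ x _ _ E1 (Hddu x)). now apply is_derive_polar1. }
  assert (HE : forall x, r2 x = r x * t1 x ^ 2 - 2 * v * r x * t1 x - 2 * (1 - r x ^ 2) * r x + 2 *
    e * V x * r x /\ 2 * r1 x * t1 x + r x * t2 x = 2 * v * r1 x).
  { intros x. specialize (Heq x). rewrite E1, E2, Hut in Heq. apply polar_equation in Heq; [easy|].
    pos. }
  apply exp_cvg_pinfty_lim in Rp. apply exp_cvg_minfty_lim in Rm. apply exp_cvg_pinfty_lim in Tp.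
  pose (F := fun x => r x ^ 2 * t1 x - v * r x ^ 2). assert (HF : forall x, is_derive F x 0).
  { intros x. unfold F. specialize (Hr x). specialize (Ht1 x). destruct (HE x) as [_ HE2].
    auto_derive; [solve_ex_derive|]. rewrite (Derive_eta Hr), (Derive_eta Ht1).
    transitivity (r x * (2 * r1 x * t1 x + r x * t2 x - 2 * v * r1 x)); [ring|]. rewrite HE2. ring. }
  assert (HFc : forall x, F x = F 0) by (intros x; now apply derive_0_const).
  assert (Ht1E : forall x, t1 x = v + F 0 * (/ r x * / r x)).
  { intros x. rewrite <- (HFc x). unfold F. specialize (Hpos x). field. lra. }
  assert (Hlim1 : is_lim t1 p_infty (v + F 0)).
  { apply (is_lim_ext (fun x => v + F 0 * (/ r x * / r x))); [easy|].
    assert (is_lim (fun x => / r x) p_infty (Finite 1)).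
    { replace (Finite 1) with (Rbar_inv (Finite 1)) by (cbn; f_equal; field).
      apply is_lim_inv; [easy|]. intros H; injection H; lra. }
    assert (is_lim (fun x => / r x * / r x) p_infty (Finite (1 * 1))).
    { now apply (is_lim_mult (fun x => / r x) (fun x => / r x) p_infty (Finite 1) (Finite 1)). }
    replace (v + F 0) with (v + F 0 * (1 * 1)) by ring.
    apply (is_lim_plus (fun _ => v) (fun x => F 0 * (/ r x * / r x)) p_infty (Finite v) (Finite (F 0
      * (1 * 1)))).
    - apply is_lim_const.
    - now apply (is_lim_mult (fun _ => F 0) (fun x => / r x * / r x) p_infty (Finite (F 0)) (Finite
        (1 * 1))); [apply is_lim_const| |].
    - easy. }
  assert (HF0 : F 0 = - v).
  { destruct (Req_dec (v + F 0) 0) as [|Hn]; [lra|exfalso]. apply Rabs_pos_lt in Hn.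
    set (c := v + F 0) in *. destruct (eventually_lt t1 c (Rabs c / 2) Hlim1) as [M1 HM1]; [lra|].
    destruct (eventually_lt th tp (Rabs c / 8) Tp) as [M2 HM2]; [lra|]. pose (x := Rmax M1 M2 + 1).
    pose proof (Rmax_l M1 M2). pose proof (Rmax_r M1 M2).
    destruct (mvt th t1 x (x + 1)) as [z [Hz Ez]]; [lra|intros; apply Hth|].
    specialize (HM1 z ltac:(unfold x in *; lra)). pose proof (HM2 x ltac:(unfold x; lra)) as A1.
    pose proof (HM2 (x + 1) ltac:(unfold x; lra)) as A2. apply Rabs_def2 in HM1.
    apply Rabs_def2 in A1. apply Rabs_def2 in A2.
    destruct (Rle_dec 0 c); [rewrite (Rabs_right c) in * by lra|rewrite (Rabs_left c) in * by lra];
      lra. }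
  exists r, r1, t. split; [|split].
  - split; try easy. intros x. evar_last; [apply Hr1|]. destruct (HE x) as [HE1 _].
    rewrite HE1, Ht1E, HF0. unfold famp. specialize (Hpos x). field. lra.
  - intros x. evar_last; [apply Ht|]. rewrite Ht1E, HF0. specialize (Hpos x). field. lra.
  - easy.
Qed.

Lemma gm_shift (v e s : R) (V p p1 : R -> R) : gm v e V p p1 ->
  gm v e (fun x => V (x + s)) (fun x => p (x + s)) (fun x => p1 (x + s)).
Proof.
  intros [H1 H2 H3 H4 H5].
  assert (forall (f : R -> R) (x l : R), is_derive f (x + s) l -> is_derive (fun x => f (x + s)) x
    l).
  { intros f x l H. apply (is_derive_ext (fun x => f (s + x))); [eauto with real|].
    apply is_derive_shift. now rewrite Rplus_comm. }
  split.
  - easy.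
  - auto.
  - auto.
  - apply (is_lim_comp p (fun x => x + s) p_infty _ p_infty); [easy| |exists 0; intros; easy].
    apply (is_lim_plus (fun x => x) (fun _ => s) p_infty p_infty s); [easy|apply is_lim_const|easy].
  - apply (is_lim_comp p (fun x => x + s) m_infty _ m_infty); [easy| |exists 0; intros; easy].
    apply (is_lim_plus (fun x => x) (fun _ => s) m_infty m_infty s); [easy|apply is_lim_const|easy].
Qed.

Lemma same_amplitude_phase (v : R) (u w : R -> C) (r t s : R -> R) : (forall x, r x <> 0) ->
  (forall x, u x = polar (r x) (t x)) -> (forall x, w x = polar (r x) (s x)) ->
  (forall x, is_derive t x (v * (1 - / r x ^ 2))) -> (forall x, is_derive s x (v * (1 - / r x ^ 2))) ->
  same_up_to_phase u w.
Proof.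
  intros Hr Hu Hw Ht Hs. exists (s 0 - t 0). intros x. assert (E : s x - t x = s 0 - t 0).
  { apply (derive_0_const (fun y => s y - t y)). derive. }
  rewrite Hu, Hw, <- E. transitivity (polar (r x) ((s x - t x) + t x)); [f_equal; ring|].
  unfold polar, cis, Cmult. cbn [fst snd]. rewrite cos_plus, sin_plus. f_equal; ring.
Qed.

(** * The family of gray modes *)

Lemma expdom_shift (f : R -> R) (K g s : R) : 0 < g -> expdom K g f ->
  expdom (K * exp (g * Rabs s)) g (fun x => f (x + s)).
Proof.
  intros Hg Hf. pose proof (expdom_ge0 Hf). split.
  - solve_cont.
  - intros z. eapply Rle_trans; [apply Hf|]. rewrite Rmult_assoc, <- exp_plus.
    apply Rmult_le_compat_l; [easy|]. apply exp_le. pose proof (Rabs_triang (z + s) (- s)) as Ht.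
    replace (z + s + - s) with z in Ht by ring. rewrite Rabs_Ropp in Ht. nra.
Qed.

Lemma exp_cvg_of_expdom (f : R -> R) (l K g : R) : 0 < g -> expdom K g (fun x => f x - l) ->
  exp_cvg_minfty f l /\ exp_cvg_pinfty f l.
Proof.
  intros Hg [_ Hf]. split; exists K, g; (split; [easy|]); intros x Hx.
  - specialize (Hf (- x)). rewrite Rabs_Ropp, (Rabs_right x) in Hf by lra. exact Hf.
  - specialize (Hf x). rewrite (Rabs_right x) in Hf by lra. exact Hf.
Qed.

Lemma exp_cvg_of_derive (f f' : R -> R) (K g : R) : 0 < g -> (forall x, is_derive f x (f' x)) ->
  expdom K g f' -> exists l, exp_cvg_pinfty f l.
Proof.
  intros Hg Hd Hf. destruct (antiderivative_lim f' K g Hg Hf) as [H1 _].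
  exists (f 0 + tail f' 0), (K / g), g. splits. intros x Hx.
  apply (decay_of_derive (fun x => f x - (f 0 + tail f' 0)) f' 0 K g Hg); [| | |easy].
  - derive.
  - intros y Hy. destruct Hf as [_ Hf]. specialize (Hf y). rewrite (Rabs_right y) in Hf by lra.
    easy.
  - apply (is_lim_ext (fun x => RInt f' 0 x - tail f' 0)).
    + intros y. rewrite (RInt_derive f f' 0 y); [ring|apply Hf|easy].
    + replace (Finite 0) with (Finite (tail f' 0 - tail f' 0)) by (f_equal; ring).
      apply (is_lim_minus (fun x => RInt f' 0 x) (fun _ => tail f' 0) p_infty (Finite (tail f' 0))
        (Finite (tail f' 0))); [easy|apply is_lim_const|easy].
Qed.

Section Construction.

Context {sp : speed}.
Notation v := (@vel sp).
Notation k := (kap v).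
Notation r0 := (rho0 v).

Definition phase0 (y : R) : R := - atan (k * th v y / v).

Lemma is_derive_phase0 (y : R) : is_derive phase0 y (v * (1 - / r0 y ^ 2)).
Proof.
  pose proof vel_neq0. pose proof (is_derive_th y) as Ht. pose proof (rho0_sq y) as Hs.
  pose proof (rho0_sq_sch y) as Hc. pose proof (rho0_pos y). evar_last.
  - apply (is_derive_opp (fun y => atan (k * th v y / v))).
    apply (is_derive_comp atan (fun y => k * th v y / v)); [apply is_derive_atan|].
    auto_derive; [solve_ex_derive|]. rewrite (Derive_eta Ht). reflexivity.
  - unfold opp, scal; cbn -[pow]. unfold Rsqr.
    assert (E : 1 + k * th v y / v * (k * th v y / v) = r0 y ^ 2 / v ^ 2) by (rewrite Hs; field;
      easy).
    rewrite E. replace (v * (1 - / r0 y ^ 2)) with (- (v * (1 - r0 y ^ 2) / r0 y ^ 2)) by algebra.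
    rewrite Hc. field. lra.
Qed.

(** The soliton takes the value [i v] at 0, where [phase0] vanishes. *)
Definition sgn_phase : R := if Rlt_dec 0 v then PI / 2 else - (PI / 2).

Lemma soliton_polar (y : R) : soliton v y = polar (r0 y) (phase0 y + sgn_phase).
Proof.
  pose proof vel_neq0. pose proof (rho0_sq y) as Hs. pose proof (rho0_pos y).
  pose proof vabs_bounds. set (x := k * th v y / v). assert (Hsq : sqrt (1 + x²) = r0 y / Rabs v).
  { apply sqrt_lem_1.
    - pose proof (Rle_0_sqr x). lra.
    - pos.
    - unfold Rsqr, x.
      replace (r0 y / Rabs v * (r0 y / Rabs v)) with (r0 y ^ 2 / Rabs v ^ 2) by algebra.
      rewrite pow2_abs, Hs. field. easy. }
  assert (Hsin : sin (atan x) = x * Rabs v / r0 y) by (rewrite sin_atan, Hsq; field; lra).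
  assert (Hcos : cos (atan x) = Rabs v / r0 y) by (rewrite cos_atan, Hsq; field; lra).
  unfold soliton, polar, phase0, sgn_phase. fold x. change (sqrt (1 - v ^ 2)) with k.
  change (tanh (k * y)) with (th v y). destruct (Rlt_dec 0 v) as [Hlt|Hlt].
  - replace (- atan x + PI / 2) with (PI / 2 - atan x) by ring.
    rewrite cos_shift, sin_shift, Hsin, Hcos, (Rabs_right v) by lra. unfold x. f_equal; field; lra.
  - replace (- atan x + - (PI / 2)) with (- (PI / 2 - - atan x)) by ring.
    rewrite cos_neg, sin_neg, cos_shift, sin_shift, sin_neg, cos_neg, Hsin, Hcos, (Rabs_left v) by
      lra.
    unfold x. f_equal; field; lra.
Qed.

Variables (V : R -> R) (a Kv : R).
Hypothesis Ha : 0 < a.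
Hypothesis Ha2 : a < 2 * k.
Hypothesis HV : expdom Kv a V.
Hypothesis HMdd : Mdd V <> 0.
Hypothesis HM1 : intR (fun x => V x * (2 * (r0 x * zs v x))) = 0.
Hypothesis HVs : forall n, Cn n (fun _ => True) V.

Notation gc := (cg V (kcV V) lamV).
Notation rE := (rhoE V).
Notation rE1 := (rhoE1 V).

(** The coefficients in [e] of the primitive from 0 of [- v / r^2], with order 0 left to [phase0].
    Fixing the phase at [y = 0] is what makes it a power series in [e] at every [y]. *)
Definition tcoef (n : nat) (y : R) : R := match n with
  | O => 0
  | S _ => - v * RInt (fun z => PS_mult (fun i => gc i z) (fun i => gc i z) n) 0 y
  end.

Definition dphase (e y : R) : R := PSeries (fun n => tcoef n y) e.

Definition phaseE (e y : R) : R := phase0 y + dphase e y.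

Definition modeE (e y : R) : C := polar (rE e y) (phaseE e y + sgn_phase).

Lemma dphase_0 (e : R) : dphase e 0 = 0.
Proof.
  unfold dphase. rewrite (PSeries_ext _ (fun _ => 0)); [apply PSeries_const_0|].
  intros [|n]; [easy|]. unfold tcoef. rewrite RInt_point. eauto with real.
Qed.

Lemma dphase_family : exists e0, 0 < e0 /\ forall e, Rabs e < e0 -> forall y,
  is_derive (phaseE e) y (v * (1 - / rE e y ^ 2)) /\
  is_derive (dphase e) y (v * (/ r0 y ^ 2 - / rE e y ^ 2)) /\
  Rbar_lt (Rabs e) (CV_radius (fun n => tcoef n y)) /\
  Rbar_lt (Rabs e) (CV_radius (fun n => ca V (kcV V) lamV n y)).
Proof.
  destruct (family V a Kv Ha Ha2 HV HMdd HM1) as [e0 [K [B [He0 [HK [HB [He0B [Hcg [Hb [_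
    Hfam]]]]]]]]]].
  exists e0. splits. intros e He y. assert (HeB : Rabs e < / (2 * B)).
  { eapply Rlt_le_trans; [exact He|]. eapply Rle_trans; [exact He0B|]. mono. }
  assert (Rabs e < / B) by (eapply Rlt_le_trans; [exact HeB|]; apply Rinv_le_contravar; lra).
  assert (forall z, pbound K B (fun i => gc i z)) by (intros z n; apply Hb).
  pose (gg := fun n z => PS_mult (fun i => gc i z) (fun i => gc i z) n).
  assert (forall n z, Rabs (gg n z) <= K * K * (2 * B) ^ n).
  { intros n z. apply (pbound_mult K K B); [easy|easy|easy]. }
  assert (Hggc : forall n, cont (gg n)).
  { intros n. apply (cont_ext (fun z => sumn (S n) (fun i => gc i z * gc (n - i)%nat z))).
    - intros z. unfold gg, PS_mult. now rewrite sumn_sum_f_R0.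
    - apply (cont_sumn (S n) (fun i z => gc i z * gc (n - i)%nat z)). solve_cont. }
  assert (Rabs (- v) <= 1) by (rewrite Rabs_Ropp; pose proof vabs_bounds; lra).
  assert (forall z, pbound (K * K * Rabs z) (2 * B) (fun n => tcoef n z)).
  { intros z [|n].
    - cbn [tcoef pow]. mono.
    - unfold tcoef. fold (gg (S n)). rewrite <- (Rmult_1_l (_ * (2 * B) ^ S n)).
      replace (K * K * Rabs z * (2 * B) ^ S n) with (K * K * (2 * B) ^ S n * Rabs z) by ring.
      apply Rabs_mult_le; [easy|].
      assert (Hpos : forall z', 0 <= z' -> forall f, cont f -> (forall t, Rabs (f t) <= K * K * (2 *
        B) ^ S n) -> Rabs (RInt f 0 z') <= K * K * (2 * B) ^ S n * z').
      { intros z' Hz' f Hf Hfb. replace z' with (z' - 0) at 2 by ring.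
        apply (RInt_dom f (fun _ => 1) (fun t => t) 0 z'); [easy|easy| |].
        - derive.
        - intros t _. rewrite Rmult_1_r. apply Hfb. }
      destruct (Rle_dec 0 z) as [Hz|Hz].
      + rewrite (Rabs_right z) by lra. auto.
      + assert (E : RInt (gg (S n)) 0 z = - RInt (fun t => gg (S n) (- t)) 0 (- z)).
        { rewrite RInt_opp_arg by easy. rewrite Ropp_involutive.
          rewrite <- (opp_RInt_swap (V := R_CompleteNormedModule) (gg (S n)) z 0) by apply
            ex_RInt_cont, Hggc.
          reflexivity. }
        rewrite (Rabs_left z), E, Rabs_Ropp by lra. apply Hpos; [lra|apply cont_opp_arg, Hggc|easy]. }
  assert (Hd : is_derive (dphase e) y (v * (/ r0 y ^ 2 - / rE e y ^ 2))).
  { evar_last.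
    - apply (is_derive_Series (fun n z => tcoef n z * e ^ n) (fun n z => (match n with O => 0 | S _
        => - v * gg n z end) * e ^ n) (fun n => K * K * (/ 2) ^ n) y (mkposreal 1 Rlt_0_1)).
      + apply (ex_series_scal (V := R_NormedModule) (K * K) (fun n => (/ 2) ^ n)).
        apply ex_series_geom. bound.
      + intros n z _. destruct n as [|n].
        * evar_last; [apply (is_derive_const (V := R_NormedModule) (0 * e ^ 0))|]. eauto with real.
        * unfold tcoef. fold (gg (S n)).
          apply (is_derive_ext (fun z => e ^ S n * (- v * RInt (gg (S n)) 0 z))); [bound|].
          rewrite (Rmult_comm _ (e ^ S n)). apply is_derive_scal, is_derive_scal.
          apply is_derive_RInt_cont, Hggc.
      + intros n z _. destruct n as [|n]. { mono. }
        replace (K * K * (/ 2) ^ S n) with (1 * (K * K * (2 * B) ^ S n) * (/ (4 * B)) ^ S n).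
        2:{ replace ((/ 2) ^ S n) with ((2 * B * / (4 * B)) ^ S n).
          - rewrite (Rpow_mult_distr (2 * B) (/ (4 * B))). lra.
          - f_equal. field. lra. }
        apply Rabs_mult_le.
        * mono.
        * rewrite <- RPow_abs. apply pow_incr. splits. apply Rle_trans with e0; [lra|].
          eapply Rle_trans; [exact He0B|]. mono.
      + intros z _. apply (pbound_ex (K * K * Rabs z) (2 * B)); [lra|easy|easy].
      + cbn. bound.
    - destruct (Hfam e ltac:(lra) y) as [Hr [Hrg _]]. assert (HgE : gE V e y = / rE e y).
      { apply (Rmult_eq_reg_l (rE e y)); [|nra]. rewrite Hrg. field. nra. }
      assert (Eg : PSeries (fun n => gg n y) e = gE V e y * gE V e y).
      { apply (PSeries_mult (fun i => gc i y) (fun i => gc i y) e); now apply (pbound_cv K B). }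
      assert (Hgx : ex_pseries (fun n => gg n y) e).
      { apply (pbound_exp (K * K) (2 * B)); [lra| |easy]. easy. }
      assert (Eser : Series (fun n => (match n with O => 0 | S _ => - v * gg n y end) * e ^ n) = - v
        * (PSeries (fun n => gg n y) e - gg O y)).
      { rewrite (PSeries_decr_1 (fun n => gg n y) e Hgx). rewrite Series_incr_1_aux by lra.
        replace (- v * (gg O y + e * PSeries (PS_decr_1 (fun n => gg n y)) e - gg O y)) with (- v *
          e * PSeries (PS_decr_1 (fun n => gg n y)) e) by ring.
        unfold PSeries, PS_decr_1. rewrite <- Series_scal_l. apply Series_ext. intros n. cbn; lra. }
      rewrite Eser, Eg, HgE. assert (E0 : gg O y = / r0 y * / r0 y) by easy. rewrite E0.
      pose proof (rho0_pos y). pose proof vabs_bounds. algebra. }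
  split; [|split; [easy|split]].
  - evar_last; [apply (is_derive_plus phase0 (dphase e)); [apply is_derive_phase0|exact Hd]|].
    cbn; lra.
  - apply (pbound_cv (K * K * Rabs y) (2 * B)); [lra|easy|easy].
  - apply (pbound_cv K B); [easy| |easy]. intros n. apply Hb.
Qed.

Lemma open_interval (l h : R) : open (fun x => l < x < h).
Proof. apply (open_and (fun x => l < x) (fun x => x < h)); [apply open_gt|apply open_lt]. Qed.

Lemma Cn_PSeries (n : nat) (I : R -> Prop) (c : nat -> R) :
  (forall x, I x -> Rbar_lt (Rabs x) (CV_radius c)) -> Cn n I (PSeries c).
Proof.
  revert c. induction n as [|n IH]; intros c Hc; [easy|]. exists (PSeries (PS_derive c)). split.
  - intros x Hx. apply is_derive_PSeries. auto.
  - apply IH. intros x Hx. rewrite CV_radius_derive. auto.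
Qed.

Lemma derive_dominated (f f' g g' : R -> R) (x y : R) : x <= y ->
  (forall z, is_derive f z (f' z)) -> (forall z, is_derive g z (g' z)) -> (forall z, Rabs (f' z) <= g' z) ->
  Rabs (f y - f x) <= g y - g x.
Proof.
  intros Hxy Hf Hg Hb.
  pose proof (derive_ge0_le (fun z => g z - f z) (fun z => g' z - f' z) x y Hxy) as H1.
  pose proof (derive_ge0_le (fun z => g z + f z) (fun z => g' z + f' z) x y Hxy) as H2.
  apply Rabs_le. split.
  - enough (g x + f x <= g y + f y) by lra. apply H2.
    + derive.
    + intros z _. specialize (Hb z). bound.
  - enough (g x - f x <= g y - f y) by lra. apply H1.
    + derive.
    + intros z _. specialize (Hb z). bound.
Qed.

Lemma Cmod_le_sum (z : C) : Cmod z <= Rabs (fst z) + Rabs (snd z).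
Proof.
  pose proof (Rabs_pos (fst z)). pose proof (Rabs_pos (snd z)).
  rewrite <- (sqrt_pow2 (Rabs (fst z) + Rabs (snd z))) by lra. apply sqrt_le_1_alt.
  rewrite <- (pow2_abs (fst z)), <- (pow2_abs (snd z)). nra.
Qed.

Lemma polar_sub_le (r r' s t : R) : Rabs r' <= 1 ->
  Cmod (polar r s - polar r' t)%C <= 2 * (Rabs (r - r') + Rabs (s - t)).
Proof.
  intros Hr'. eapply Rle_trans; [apply Cmod_le_sum|]. cbn [fst snd polar Cminus Cplus Copp].
  assert (Hlip : forall f f' : R -> R, (forall x, is_derive f x (f' x)) -> (forall x, Rabs (f' x) <=
    1) -> (forall x, Rabs (f x) <= 1) -> Rabs (r * f s + - (r' * f t)) <= Rabs (r - r') + Rabs (s -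
    t)).
  { intros f f' Hf Hf' Hf1.
    replace (r * f s + - (r' * f t)) with ((r - r') * f s + r' * (f s - f t)) by ring. triangle.
    apply Rplus_le_compat.
    - rewrite <- (Rmult_1_r (Rabs (r - r'))). mono.
    - rewrite <- (Rmult_1_l (Rabs (s - t))). apply Rabs_mult_le; [easy|].
      destruct (Rle_dec t s) as [Hts|Hts].
      + rewrite (Rabs_right (s - t)) by lra. rewrite <- (Rmult_1_l (s - t)).
        apply (derive_abs_le f f'); auto.
      + rewrite (Rabs_minus_sym (f s)), (Rabs_left (s - t)) by lra.
        replace (- (s - t)) with (1 * (t - s)) by ring. apply (derive_abs_le f f'); auto. lra. }
  pose proof (Hlip cos (fun x => - sin x)) as Hc. pose proof (Hlip sin cos) as Hs.
  assert (Hb : forall x, Rabs (cos x) <= 1 /\ Rabs (sin x) <= 1).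
  { intros x. pose proof (COS_bound x). pose proof (SIN_bound x). mono. }
  assert (Rabs (r * cos s + - (r' * cos t)) <= Rabs (r - r') + Rabs (s - t)).
  { apply Hc; intros x; [apply is_derive_cos|rewrite Rabs_Ropp|]; apply Hb. }
  assert (Rabs (r * sin s + - (r' * sin t)) <= Rabs (r - r') + Rabs (s - t)).
  { apply Hs; intros x; [apply is_derive_sin| |]; apply Hb. }
  lra.
Qed.

Lemma rE_0 (y : R) : rE 0 y = r0 y.
Proof. unfold rhoE. rewrite PSeries_0, ca_0. reflexivity. Qed.

Lemma modeE_0 (y : R) : modeE 0 y = soliton v y.
Proof.
  rewrite soliton_polar. unfold modeE, phaseE, dphase. rewrite rE_0, PSeries_0. eauto with real.
Qed.

Section Amplitude.

Variable e : R.
Hypothesis Hr : forall y, Rabs v / 2 <= rE e y <= 2.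
Hypothesis Hr1 : forall y, is_derive (rE e) y (rE1 e y).
Hypothesis Hr2 : forall y, is_derive (rE1 e) y (famp v (rE e y) + 2 * e * V y * rE e y).

Lemma rE_pos (y : R) : 0 < rE e y.
Proof. specialize (Hr y). pose proof vabs_bounds. lra. Qed.

Lemma Cn_rE (n : nat) : Cn n (fun _ => True) (rE e) /\ Cn n (fun _ => True) (rE1 e).
Proof.
  induction n as [|n [IH1 IH2]]; [easy|]. split.
  - exists (rE1 e). easy.
  - exists (fun y => - (v ^ 2 + 2) * rE e y + 2 * (rE e y * (rE e y * rE e y)) + v ^ 2 * (/ rE e y *
      (/ rE e y * / rE e y)) + 2 * e * (V y * rE e y)).
    split.
    + intros y _. evar_last; [apply Hr2|]. unfold famp. pose proof (rE_pos y). field. lra.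
    + assert (Cn n (fun _ => True) (fun y => / rE e y)).
      { apply Cn_inv; [|easy]. intros y _. pose proof (rE_pos y). lra. }
      apply Cn_plus; [apply Cn_plus; [apply Cn_plus|]|]; apply Cn_mult; try apply Cn_const; try
        easy; apply Cn_mult; try easy; try (now apply Cn_mult); apply HVs.
Qed.

Hypothesis Hph : forall y, is_derive (phaseE e) y (v * (1 - / rE e y ^ 2)).

Lemma Cn_phaseE (n : nat) : Cn n (fun _ => True) (phaseE e).
Proof.
  destruct n as [|n]; [easy|]. exists (fun y => v * (1 + -1 * (/ rE e y * / rE e y))). split.
  - intros y _. evar_last; [apply Hph|]. pose proof (rE_pos y). field. lra.
  - apply Cn_mult; [apply Cn_const|]. apply Cn_plus; [apply Cn_const|].
    apply Cn_mult; [apply Cn_const|]. assert (Cn n (fun _ => True) (fun y => / rE e y)).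
    { apply Cn_inv; [intros y _; pose proof (rE_pos y); lra|apply Cn_rE]. }
    now apply Cn_mult.
Qed.

Lemma smooth_shift (f : R -> R) (s : R) : (forall n, Cn n (fun _ => True) f) -> smooth (fun x => f (x - s)).
Proof.
  intros H n x. apply (ex_derive_n_comp_trans f n x (- s)).
  apply (ex_derive_n_of_Cn n (fun _ => True)); [apply open_true|apply H|easy].
Qed.

Variables (K1 : R).
Hypothesis Hclose : forall y, Rabs (rE e y - r0 y) <= K1 * exp (- a * Rabs y).

Lemma expdom_rE : expdom (K1 + 4) a (fun y => rE e y - 1).
Proof.
  split.
  - solve_cont.
  - intros y. replace (rE e y - 1) with ((rE e y - r0 y) + - (1 - r0 y)) by ring. triangle.
    rewrite Rabs_Ropp, Rmult_plus_distr_r. apply Rplus_le_compat; [easy|].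
    pose proof (rho0_near1 y) as H. rewrite Rabs_right by lra. eapply Rle_trans; [apply H|]. mono.
Qed.

Lemma expdom_dphase : expdom ((K1 + 4) * (12 / v ^ 2)) a (fun y => v * (1 - / rE e y ^ 2)).
Proof.
  pose proof vabs_bounds. assert (cont (fun y => / rE e y)).
  { intros y. apply (continuous_comp (rE e) Rinv).
    - apply (cont_of_derive _ _ Hr1).
    - apply continuous_Rinv. pose proof (rE_pos y). lra. }
  apply (expdom_ext _ _ (fun y => (rE e y - 1) * (v * ((rE e y + 1) * (/ rE e y * / rE e y))))).
  { intros y. pose proof (rE_pos y). field. lra. }
  apply expdom_mult; [apply expdom_rE| |].
  - solve_cont.
  - intros y. specialize (Hr y). replace (12 / v ^ 2) with (1 * (3 * (2 / Rabs v * (2 / Rabs v)))).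
    2:{ rewrite <- (pow2_abs v). field. lra. }
    assert (Rabs (/ rE e y) <= 2 / Rabs v).
    { replace (2 / Rabs v) with (/ (Rabs v / 2)) by algebra. mono. }
    mono.
Qed.

Lemma modeE_gm : gm v e V (rE e) (rE1 e).
Proof.
  destruct (exp_decay_lim (fun y => rE e y - 1) (K1 + 4) a Ha (proj2 expdom_rE)) as [L1 L2].
  assert (forall p, is_lim (fun y => rE e y - 1) p 0 -> is_lim (rE e) p 1).
  { intros p Hp. apply (is_lim_ext (fun y => (rE e y - 1) + 1)); [bound|].
    replace (Finite 1) with (Finite (0 + 1)) by (f_equal; ring).
    apply (is_lim_plus _ (fun _ => 1) p (Finite 0) (Finite 1)); [easy|apply is_lim_const|easy]. }
  split; [apply rE_pos|easy|easy|auto|auto].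
Qed.

Lemma modeE_gray (s : R) : gray_mode e v (fun x => V (x - s)) (fun x => modeE e (x - s)).
Proof.
  pose proof (gm_shift v e (- s) V (rE e) (rE1 e) modeE_gm) as Hg.
  pose (r := fun x => rE e (x + - s)). pose (r1 := fun x => rE1 e (x + - s)).
  pose (t := fun x => phaseE e (x + - s) + sgn_phase). pose (t1 := fun x => v * (1 - / r x ^ 2)).
  pose (t2 := fun x => v * (2 * r1 x / r x ^ 3)).
  pose (r2 := fun x => famp v (r x) + 2 * e * V (x + - s) * r x).
  assert (Hpos : forall x, 0 < r x) by solve_cont.
  assert (Dr : forall x, is_derive r x (r1 x)) by solve_cont.
  assert (Dr1 : forall x, is_derive r1 x (r2 x)) by solve_cont.
  assert (Dph : forall x, is_derive (fun x => phaseE e (x + - s)) x (t1 x)).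
  { intros x. apply (is_derive_ext (fun x => phaseE e (- s + x))); [eauto with real|].
    apply is_derive_shift. rewrite Rplus_comm. apply Hph. }
  assert (Dt : forall x, is_derive t x (t1 x)).
  { intros x. evar_last.
    - apply (is_derive_plus (fun x => phaseE e (x + - s)) (fun _ => sgn_phase)); [apply Dph|apply
        (is_derive_const sgn_phase)].
    - eauto with real. }
  assert (Dt1 : forall x, is_derive t1 x (t2 x)).
  { intros x. pose proof (Dr x) as H. pose proof (Hpos x) as Hx. unfold t1, t2.
    auto_derive; [solve_ex_derive; apply Rgt_not_eq; repeat apply Rmult_lt_0_compat; lra|].
    rewrite (Derive_eta H). field. lra. }
  split; [split; [|split]|split].
  - exists (fun x => polar1 (r x) (r1 x) (t x) (t1 x)), (fun x => polar2 (r x) (r1 x) (r2 x) (t x)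
      (t1 x) (t2 x)).
    split; [|split].
    + intros x. apply (is_derive_polar r r1 t t1); auto.
    + intros x. apply (is_derive_polar1 r r1 r2 t t1 t2); auto.
    + intros x. apply (polar_equation e v (V (x - s)) (r x) (r1 x) (r2 x) (t x) (t1 x) (t2 x)).
      * pos.
      * specialize (Hpos x). unfold t1, t2, r2, famp. change (V (x - s)) with (V (x + - s)).
        split; field; lra.
  - apply (is_lim_ext (fun x => r x * r x)).
    { intros x. unfold modeE. rewrite Cmod_polar by (left; apply rE_pos). unfold r, Rminus. ring. }
    replace (Finite 1) with (Finite (1 * 1)) by (f_equal; ring).
    apply (is_lim_mult r r p_infty (Finite 1) (Finite 1)); try apply (gm_pinf Hg). easy.
  - apply (is_lim_ext (fun x => r x * r x)).
    { intros x. unfold modeE. rewrite Cmod_polar by (left; apply rE_pos). unfold r, Rminus. ring. }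
    replace (Finite 1) with (Finite (1 * 1)) by (f_equal; ring).
    apply (is_lim_mult r r m_infty (Finite 1) (Finite 1)); try apply (gm_minf Hg). easy.
  - intros x Hx. pose proof (rE_pos (x - s)).
    assert (Hc : Cmod (modeE e (x - s)) = rE e (x - s)) by (apply Cmod_polar; lra).
    rewrite Hx, Cmod_0 in Hc. lra.
  - pose proof (expdom_shift _ _ a (- s) Ha expdom_rE) as Er.
    pose proof (expdom_shift _ _ a (- s) Ha expdom_dphase) as Et.
    destruct (exp_cvg_of_expdom (fun x => rE e (x - s)) 1 _ a Ha Er) as [R1 R2].
    destruct (exp_cvg_of_derive (fun x => phaseE e (x - s)) t1 _ a Ha Dph Et) as [tp Htp].
    destruct (exp_cvg_of_derive (fun x => phaseE e (- x - s)) (fun x => - t1 (- x)) ((K1 + 4) * (12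
      / v ^ 2) * exp (a * Rabs (- s)) * Rabs (-1)) a Ha) as [tm Htm].
    { intros x. apply (is_derive_opp_arg (fun x => phaseE e (x - s))). apply Dph. }
    { apply (expdom_ext _ _ (fun x => t1 (- x) * -1)); [bound|].
      apply expdom_mult; [now apply expdom_opp|solve_cont|easy]. }
    exists (fun x => rE e (x - s)), (fun x => phaseE e (x - s)), tm, tp, sgn_phase.
    split; [apply smooth_shift; intros; apply Cn_rE|].
    split; [apply smooth_shift; intros; apply Cn_phaseE|]. splits. intros x. symmetry.
    apply polar_cis.
Qed.

End Amplitude.

(** At each [y] both the amplitude and the phase are power series in [e] of positive radius, so the
    real and imaginary parts of the mode are smooth in [e]. *)
Lemma mode_family : exists e0 C, 0 < e0 /\ 0 < C /\ forall e, Rabs e < e0 ->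
  gm v e V (rE e) (rE1 e) /\ (forall s, gray_mode e v (fun x => V (x - s)) (fun x => modeE e (x - s))) /\
  (forall y, Rabs (rE e y - r0 y) <= C * Rabs e) /\
  (forall y, Cmod (modeE e y - soliton v y)%C <= C * Rabs e) /\
  (forall y, Rabs (rE e y) = Cmod (modeE e y)) /\
  (forall y, is_derive (phaseE e) y (v * (1 - / rE e y ^ 2))) /\
  (forall y, continuous (fun e => rE e y) e) /\
  (forall y n, ex_derive_n (fun e => fst (modeE e y)) n e /\ ex_derive_n (fun e => snd (modeE e y)) n e).
Proof.
  destruct (family V a Kv Ha Ha2 HV HMdd HM1) as [e1 [K [B [He1 [HK [HB [_ [_ [_ [_ Hfam]]]]]]]]]].
  destruct dphase_family as [e2 [He2 Hdp]]. pose proof vabs_bounds.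
  (* From [1 / rho0^2 - 1 / r^2 = (r - rho0) (r + rho0) / (rho0^2 r^2)] with [r + rho0 <= 4],
     [rho0 >= |v|] and [r >= |v| / 2]. *)
  pose (C1 := 16 * K / Rabs v ^ 4). assert (0 < Rabs v ^ 4) by pos.
  assert (0 < C1) by (apply Rdiv_lt_0_compat; lra). exists (Rmin e1 e2), (2 * (K + C1 * (PI / a))).
  splits. intros e He. assert (Ee1 : Rabs e <= e1) by bound. assert (Rabs e < e2) by bound.
  assert (Hr : forall y, Rabs v / 2 <= rE e y <= 2) by solve_cont.
  assert (Hr1 : forall y, is_derive (rE e) y (rE1 e y)) by (intros y; apply (Hfam e Ee1 y)).
  assert (Hr2 : forall y, is_derive (rE1 e) y (famp v (rE e y) + 2 * e * V y * rE e y)) by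
    solve_cont.
  assert (Hcl : forall y, Rabs (rE e y - r0 y) <= K * Rabs e * exp (- a * Rabs y)) by (intros y;
    apply (Hfam e Ee1 y)).
  assert (Hph : forall y, is_derive (phaseE e) y (v * (1 - / rE e y ^ 2))) by solve_cont.
  assert (Hcle : forall y, Rabs (rE e y - r0 y) <= K * Rabs e).
  { intros y. eapply Rle_trans; [apply Hcl|]. rewrite <- (Rmult_1_r (K * Rabs e)) at 2.
    apply Rmult_le_compat_l; [apply Rmult_le_pos; [lra|pos]|]. apply exp_ge0_1.
    assert (0 <= a * Rabs y) by pos. lra. }
  split; [apply (modeE_gm e Hr Hr1 Hr2 (K * Rabs e) Hcl)|].
  split; [apply (modeE_gray e Hr Hr1 Hr2 Hph (K * Rabs e) Hcl)|]. assert (0 <= K * Rabs e) by pos.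
  assert (0 <= C1 * (PI / a) * Rabs e) by pos. split; [intros y; specialize (Hcle y); lra|].
  assert (Hdph : forall y, Rabs (dphase e y) <= C1 * (PI / a) * Rabs e).
  { assert (Hdom : forall x y, x <= y -> Rabs (dphase e y - dphase e x) <= C1 * Rabs e * bump_int a
      0 y - C1 * Rabs e * bump_int a 0 x).
    { intros x y Hxy.
      apply (derive_dominated (dphase e) (fun y => v * (/ r0 y ^ 2 - / rE e y ^ 2)) (fun y => C1 *
        Rabs e * bump_int a 0 y) (fun y => C1 * Rabs e * bump a 0 y)); [easy| | |].
      - solve_cont.
      - intros z. apply is_derive_scal. now apply is_derive_bump_int.
      - intros z. specialize (Hr z). pose proof (rho0_ge z). pose proof (rho0_lt1 z).
        pose proof (bump_ge a 0 z Ha) as Hb. rewrite Rminus_0_r in Hb.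
        apply Rle_trans with (C1 * Rabs e * exp (- a * Rabs z)). 2:{ mono. }
        replace (v * (/ r0 z ^ 2 - / rE e z ^ 2)) with (v * ((rE e z - r0 z) * ((rE e z + r0 z) * (/
          r0 z * / r0 z * (/ rE e z * / rE e z))))) by algebra.
        replace (C1 * Rabs e * exp (- a * Rabs z)) with (1 * ((K * Rabs e * exp (- a * Rabs z)) * (4
          * (/ Rabs v * / Rabs v * (2 / Rabs v * (2 / Rabs v)))))) by (unfold C1; field; lra).
        assert (Rabs (/ rE e z) <= 2 / Rabs v).
        { replace (2 / Rabs v) with (/ (Rabs v / 2)) by algebra. mono. }
        mono. }
    intros y. pose proof (bump_int_bounds a 0 y Ha). pose proof (bump_int_bounds a 0 0 Ha).
    destruct (Rle_dec 0 y) as [Hy|Hy].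
    - specialize (Hdom 0 y Hy). rewrite dphase_0, Rminus_0_r in Hdom. bound.
    - specialize (Hdom y 0 ltac:(lra)). rewrite dphase_0 in Hdom. unfold Rminus at 1 in Hdom.
      rewrite Rplus_0_l, Rabs_Ropp in Hdom. bound. }
  split.
  { intros y. rewrite soliton_polar.
    eapply Rle_trans; [apply polar_sub_le; pose proof (rho0_pos y); pose proof (rho0_lt1 y); rewrite
      Rabs_right; lra|].
    unfold phaseE.
    replace (phase0 y + dphase e y + sgn_phase - (phase0 y + sgn_phase)) with (dphase e y) by ring.
    specialize (Hcle y). specialize (Hdph y). lra. }
  split.
  { intros y. specialize (Hr y). unfold modeE. rewrite Cmod_polar by lra. apply Rabs_right. lra. }
  split; [easy|].
  assert (Hint : forall y e', - Rmin e1 e2 < e' < Rmin e1 e2 -> Rbar_lt (Rabs e') (CV_radius (fun n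
    => tcoef n y)) /\ Rbar_lt (Rabs e') (CV_radius (fun n => ca V (kcV V) lamV n y))).
  { intros y e' He'. apply (Hdp e'). bound. } assert (- Rmin e1 e2 < e < Rmin e1 e2) by bound.
  assert (HrC : forall y n, Cn n (fun e' => - Rmin e1 e2 < e' < Rmin e1 e2) (fun e => rE e y)).
  { intros y n. apply Cn_PSeries. solve_cont. }
  split.
  { intros y. destruct (HrC y 1%nat) as [f' [Hf' _]].
    apply (ex_derive_continuous (fun e => rE e y)). exists (f' e). auto. }
  intros y n.
  assert (Ht : Cn n (fun e' => - Rmin e1 e2 < e' < Rmin e1 e2) (fun e => phaseE e y + sgn_phase)).
  { apply Cn_plus; [|apply Cn_const]. apply Cn_plus; [apply Cn_const|]. apply Cn_PSeries.
    intros e' He'. apply (proj1 (Hint y e' He')). }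
  destruct (Cn_cos_sin n _ _ Ht) as [Hc Hs].
  split; apply (ex_derive_n_of_Cn n (fun e' => - Rmin e1 e2 < e' < Rmin e1 e2)); try apply
    open_interval; try easy; apply Cn_mult; try easy; apply HrC.
Qed.

End Construction.

Lemma continuous_eps (f : R -> R) (e : R) : continuous f e -> forall d, 0 < d -> exists t, 0 < t /\
  forall e', Rabs (e' - e) < t -> Rabs (f e' - f e) < d.
Proof.
  intros Hf d Hd. apply continuity_pt_filterlim in Hf. destruct (Hf d Hd) as [t [Ht H]]. exists t.
  splits. intros e' He'. destruct (Req_dec e' e) as [->|Hne]; [rewrite Rminus_diag, Rabs_R0; lra|].
  solve_cont.
Qed.

Lemma Linf_norm_le (f : R -> C) (M : R) : (forall x, Cmod (f x) <= M) -> Rbar_le (Linf_norm f) M.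
Proof.
  intros H. apply (proj2 (Lub_Rbar_correct (fun y => exists x : R, y = Cmod (f x)))).
  intros y [x ->]. apply H.
Qed.

Lemma Cmod_le_Linf_norm (f : R -> C) (x : R) : Rbar_le (Cmod (f x)) (Linf_norm f).
Proof. apply (proj1 (Lub_Rbar_correct (fun y => exists x : R, y = Cmod (f x)))). eauto. Qed.

Lemma Linf_norm_plus_lt (f : R -> C) (d eta : R) : 0 <= d ->
  Rbar_lt (Rbar_plus (Linf_norm f) (Finite d)) (Finite eta) -> d < eta /\ forall x, Cmod (f x) <= eta.
Proof.
  intros Hd H. pose proof (Cmod_le_Linf_norm f) as Hx. destruct (Linf_norm f) as [l| |]; [|easy|].
  - cbn in H, Hx. split; [|intros x; specialize (Hx x); lra]. specialize (Hx 0).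
    pose proof (Cmod_ge_0 (f 0)). lra.
  - specialize (Hx 0). easy.
Qed.

Lemma Cmod_triangle_inv (x y : C) : Rabs (Cmod x - Cmod y) <= Cmod (x - y)%C.
Proof.
  pose proof (Cmod_triangle (x - y)%C y) as H1. pose proof (Cmod_triangle (- (x - y))%C x) as H2.
  replace (x - y + y)%C with x in H1 by ring. replace (- (x - y) + x)%C with y in H2 by ring.
  rewrite Cmod_opp in H2. mono.
Qed.

(** * Competing families of gray modes *)

Section Uniqueness.

Context {sp : speed}.
Notation v := (@vel sp).
Notation r0 := (rho0 v).

Lemma rho0_lipschitz (x y : R) : Rabs (r0 x - r0 y) <= / Rabs v * Rabs (x - y).
Proof.
  assert (H : forall x y, y <= x -> Rabs (r0 x - r0 y) <= / Rabs v * (x - y)).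
  { intros x' y' Hxy. apply (derive_abs_le r0 (zs v)); [easy|derive|intros; apply zs_le]. }
  destruct (Rle_dec y x) as [Hxy|Hxy].
  - rewrite (Rabs_right (x - y)) by lra. now apply H.
  - rewrite Rabs_minus_sym, (Rabs_left (x - y)) by lra. replace (- (x - y)) with (y - x) by ring.
    apply H. lra.
Qed.

(** Coordinates are centred at [s0] for every parameter, so that the potential does not move; the
    displacement [t e - s0] is absorbed by the Lipschitz bound on [rho0]. *)
Lemma gray_family_amplitude (V : R -> R) (s0 eps0 : R) (psi : R -> R -> C) (t : R -> R) : 0 < eps0 ->
  gray_family v V s0 eps0 psi t ->
  let P e y := Cmod (psi e (y + s0 - t e)) in
  gfam (- eps0) eps0 (fun y => V (y + s0)) P (fun e => Derive (P e)) /\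
  forall d, 0 < d -> exists h, 0 < h /\ forall e, e <> 0 -> Rabs e < h -> forall y, Rabs (P e y - r0 y) <= d.
Proof.
  intros Heps [Hg [Hlim Hsm]] P. pose proof vabs_bounds as Hv. split; [split|].
  - intros e He. destruct (gray_mode_polar e v V _ (Hg e He)) as [r [r1 [th [Hgm [_ Hu]]]]].
    assert (HP : P e = fun y => r (y + s0)).
    { apply functional_extensionality. intros y. unfold P. rewrite (Hu (y + s0)). apply Cmod_polar.
      left. solve_cont. }
    pose proof (gm_shift _ _ s0 _ _ _ Hgm) as Hs. rewrite HP.
    replace (Derive (fun y => r (y + s0))) with (fun y => r1 (y + s0)); [easy|].
    apply functional_extensionality. intros y. symmetry. apply is_derive_unique, (gm_d Hs).
  - intros y e d He Hd. destruct (Hsm (y + s0) 1%nat e He) as [H1 H2].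
    assert (Hc : continuous (fun e => P e y) e).
    { apply (continuous_comp (fun e => fst (psi e (y + s0 - t e)) ^ 2 + snd (psi e (y + s0 - t e)) ^
        2) sqrt).
      - apply (continuous_plus (fun e => fst (psi e (y + s0 - t e)) ^ 2) (fun e => snd (psi e (y +
          s0 - t e)) ^ 2)); (apply (continuous_comp _ (fun x => x ^ 2)); [now apply
          (ex_derive_continuous (V := R_NormedModule))|]); apply (ex_derive_continuous (fun x => x ^
          2)); auto_derive; easy.
      - apply continuous_sqrt. }
    destruct (continuous_eps (fun e => P e y) e Hc d Hd) as [h [Hh H]]. eauto.
  - intros d Hd. pose (eta := d / (1 + / Rabs v)). assert (Hiv : 0 < / Rabs v) by pos.
    assert (Heta : 0 < eta) by (apply Rdiv_lt_0_compat; lra).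
    assert (Hed : eta + / Rabs v * eta = d) by (unfold eta; field; lra).
    destruct (Hlim eta Heta) as [[h Hh] H]. exists h. splits. intros e Hne He y. specialize (H e).
    assert (Hb : ball (M := R_UniformSpace) 0 h e).
    { unfold ball; cbn. unfold AbsRing_ball, abs, minus, plus, opp; cbn. bound. }
    specialize (H Hb Hne). apply Linf_norm_plus_lt in H; [|pos]. destruct H as [H1 H2].
    set (z := y + s0 - t e). specialize (H2 z). unfold P. fold z.
    pose proof (Cmod_triangle_inv (psi e z) (soliton v z)).
    assert (Cmod (soliton v z) = r0 z) by (rewrite soliton_polar; apply Cmod_polar; left; apply
      rho0_pos).
    pose proof (rho0_lipschitz z y) as H4.
    replace (z - y) with (- (t e - s0)) in H4 by (unfold z; ring). rewrite Rabs_Ropp in H4.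
    assert (/ Rabs v * Rabs (t e - s0) <= / Rabs v * eta) by mono. bound.
Qed.

Lemma gray_family_exists_unique (V : R -> R) (s0 : R) : smooth V -> exp_decay V ->
  dM v V s0 = 0 -> Derive (dM v V) s0 <> 0 ->
  exists eps0 : R, 0 < eps0 /\
  exists (phi : R -> R -> C) (s : R -> R),
    (forall x : R, phi 0 x = soliton v x) /\ s 0 = s0 /\
    gray_family v V s0 eps0 phi s /\
    forall (psi : R -> R -> C) (t : R -> R),
      gray_family v V s0 eps0 psi t ->
      forall eps : R, - eps0 < eps < eps0 ->
        same_up_to_phase (fun x => phi eps (x - s eps)) (fun x => psi eps (x - t eps)).
Proof.
  intros HVs [K [a' [Ha' HVd]]] Hroot Hsimple. pose proof kap_pos as Hk. set (k := kap v) in *.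
  assert (HVder : forall x, is_derive V x (Derive V x)) by (intros x; apply Derive_correct, (HVs
    1%nat)).
  assert (HVc : cont V) by solve_cont. assert (HVc1 : cont (Derive V)).
  { apply (cont_of_derive _ (Derive (Derive V))). intros x. apply Derive_correct, (HVs 2%nat). }
  (* [a] has to divide [2 k] into a half-integer *)
  destruct (nfloor_ex (2 * k / a')) as [n0 [_ Hn0]]. { pos. } pose (N := S (S n0)).
  pose (a := 2 * k / (INR N - / 2)). assert (HN : (2 <= N)%nat) by lia.
  assert (HNr : 2 * k / a' + 3 / 2 <= INR N + 1 /\ 2 <= INR N).
  { unfold N. rewrite !S_INR. pose proof (pos_INR n0). lra. }
  assert (Ha : 0 < a) by (apply Rdiv_lt_0_compat; lra).
  assert (HaN : (INR N - / 2) * a = 2 * k) by (unfold a; field; lra).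
  assert (Ha2 : a < 2 * k) by nra. assert (Haa : a <= a').
  { apply (Rmult_le_reg_l (INR N - / 2)); [lra|]. rewrite HaN.
    apply Rle_trans with (2 * k / a' * a'); [right; field; lra|]. mono. }
  assert (HV0 : expdom (Rabs K + 1) a V).
  { splits. intros z. eapply Rle_trans; [apply HVd|]. pose proof (Rle_abs K).
    apply Rle_trans with ((Rabs K + 1) * exp (- a' * Rabs z)).
    - mono.
    - mono. }
  pose (Vc := fun y => V (y + s0)). pose (Kv := (Rabs K + 1) * exp (a * Rabs s0)).
  assert (HKv : 0 < Kv). { apply Rmult_lt_0_compat; [pose proof (Rabs_pos K); lra|pos]. }
  assert (HV : expdom Kv a Vc) by now apply expdom_shift.
  assert (HM1 : intR (fun x => Vc x * (2 * (r0 x * zs v x))) = 0).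
  { apply (root_condition V s0 a (Rabs K + 1)); easy. }
  assert (HMdd : Mdd Vc <> 0). { apply (simple_condition V s0 a (Rabs K + 1)); easy. }
  assert (HVcs : forall n, Cn n (fun _ => True) Vc).
  { intros n. apply Cn_of_ex_derive_n. intros m x. now apply (ex_derive_n_comp_trans V m x s0). }
  destruct (mode_family Vc a Kv Ha Ha2 HV HMdd HM1 HVcs) as [e0 [C [He0 [HC Hmode]]]].
  assert (Habs : forall e, - e0 < e < e0 -> Rabs e < e0) by bound.
  destruct (amplitude_uniqueness a Kv N Ha HKv HN HaN Vc e0 (rhoE Vc) (rhoE1 Vc) HV HMdd He0) as
    [eps0 [Heps0 Huniq]].
  { split.
    - intros e He. now apply Hmode, Habs.
    - intros y e d He Hd. destruct (Hmode e (Habs e He)) as [_ [_ [_ [_ [_ [_ [Hc _]]]]]]].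
      destruct (continuous_eps (fun e => rhoE Vc e y) e (Hc y) d Hd) as [t [Ht H]]. eauto. }
  { intros d Hd. exists (Rmin e0 (d / C)). split; [apply Rmin_glb_lt; [easy|pos]|]. intros e He x.
    minmax. destruct (Hmode e ltac:(lra)) as [_ [_ [Hc _]]]. eapply Rle_trans; [apply Hc|]. bound. }
  assert (HVV : (fun x => Vc (x - s0)) = V).
  { apply functional_extensionality. intros x. unfold Vc. f_equal. ring. }
  assert (Heps : forall e, - eps0 < e < eps0 -> Rabs e < e0) by bound. exists eps0. splits.
  (* The translation of the mode is already contained in the multiples of [zs] in the coefficients,
     so the shift can be constant. *)
  exists (modeE Vc), (fun _ => s0). split; [apply modeE_0|]. splits. split; [split; [|split]|].
  - intros e He. destruct (Hmode e (Heps e He)) as [_ [Hgray _]]. rewrite <- HVV. apply Hgray.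
  - intros eta Heta. assert (Hd : 0 < Rmin e0 (eta / (2 * C))) by pos. exists (mkposreal _ Hd).
    intros e He _. cbn in He. assert (Rabs e < Rmin e0 (eta / (2 * C))).
    { unfold AbsRing_ball, abs, minus, plus, opp in He; cbn in He. bound. }
    minmax. destruct (Hmode e ltac:(lra)) as [_ [_ [_ [Hc _]]]].
    pose proof (Linf_norm_le (fun x => (modeE Vc e x - soliton v x)%C) (C * Rabs e) Hc) as HL.
    assert (C * Rabs e < eta) by bound. rewrite Rminus_diag, Rabs_R0.
    destruct (Linf_norm (fun x => (modeE Vc e x - soliton v x)%C)) as [l| |]; [cbn in HL |- *;
      lra|easy|easy].
  - intros x n e He. destruct (Hmode e (Heps e He)) as [_ [_ [_ [_ [_ [_ [_ Hs]]]]]]]. apply Hs.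
  - intros psi t Hpsi eps He.
    destruct (gray_family_amplitude V s0 eps0 psi t ltac:(lra) Hpsi) as [HP Hlim].
    pose proof (Huniq _ _ HP Hlim eps He) as HE. destruct Hpsi as [Hg _].
    destruct (gray_mode_polar eps v V _ (Hg eps He)) as [r [r1 [th [Hgm [Hth Hu]]]]].
    assert (Hr : forall x, r x = rhoE Vc eps (x - s0)).
    { intros x. rewrite <- HE. replace (x - s0 + s0 - t eps) with (x - t eps) by ring.
      rewrite (Hu x). symmetry. apply Cmod_polar. left. solve_cont. }
    destruct (Hmode eps (Heps eps He)) as [_ [_ [_ [_ [_ [Hph _]]]]]].
    apply (same_amplitude_phase v _ _ r (fun x => phaseE Vc eps (x - s0) + sgn_phase) th).
    + intros x. pose proof (gm_pos Hgm x). lra.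
    + intros x. rewrite Hr. reflexivity.
    + exact Hu.
    + intros x. rewrite Hr. evar_last.
      * apply (is_derive_plus (fun x => phaseE Vc eps (x - s0)) (fun _ => sgn_phase)); [|apply
          (is_derive_const sgn_phase)].
        apply (is_derive_ext (fun x => phaseE Vc eps (- s0 + x))); [eauto with real|].
        apply is_derive_shift. apply Hph.
      * unfold plus, zero; cbn -[pow]. replace (- s0 + x) with (x - s0) by ring. ring.
    + exact Hth.
Qed.

End Uniqueness.

Theorem proposition1p1 (v : R) (hv : -1 < v < 1) (hv0 : v <> 0)
    (V : R -> R) (hVsmooth : smooth V) (hVdecay : exp_decay V)
    (s0 : R) (hroot : dM v V s0 = 0) (hsimple : Derive (dM v V) s0 <> 0) :
  exists eps0 : R, 0 < eps0 /\
  exists (phi : R -> R -> C) (s : R -> R),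
    (forall x : R, phi 0 x = soliton v x) /\ s 0 = s0 /\
    gray_family v V s0 eps0 phi s /\
    forall (psi : R -> R -> C) (t : R -> R),
      gray_family v V s0 eps0 psi t ->
      forall eps : R, - eps0 < eps < eps0 ->
        same_up_to_phase (fun x => phi eps (x - s eps))
                         (fun x => psi eps (x - t eps)).
Proof.
  exact (gray_family_exists_unique (sp := Speed v hv hv0) V s0 hVsmooth hVdecay hroot hsimple).
Qed.
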